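(* Let $0<p\le\infty$, $0<\alpha<\infty$, and let $(\varphi_t)$ be a non-trivial semigroup of analytic functions with Denjoy–Wolff point $b\in\mathbb{D}$, infinitesimal generator $G$, and associated g-symbol $\gamma(z)=\int_b^z\frac{\zeta-b}{G(\zeta)}\,d\zeta$. Then $$H(p,0,\alpha)=[\varphi_t,H(p,\infty,\alpha)]\iff\gamma\in\mathcal{B}_0.$$ Moreover, if $\gamma\notin\mathcal{B}_0$, then $[\varphi_t,H(p,\infty,\alpha)]$ contains a closed subspace isomorphic to $\ell_\infty$.
   Context: A semigroup of analytic functions is a family $\{\varphi_t:t\ge0\}$ of analytic self-maps of the unit disk $\mathbb{D}$ with $\varphi_0=\mathrm{id}$, $\varphi_{t+s}=\varphi_t\circ\varphi_s$, and $\varphi_t\to\varphi_0$ uniformly on compact sets as $t\to0^+$. Its infinitesimal generator is $G(z)=\lim_{t\to0^+}(\varphi_t(z)-z)/t$, which has the form $G(z)=(\bar bz-1)(z-b)P(z)$ with $P$ analytic, $\mathrm{Re}\,P\ge0$, where $b\in\overline{\mathbb{D}}$ is the common Denjoy–Wolff point of the $\varphi_t$. $M_p(r,f)=\left(\int_0^{2\pi}|f(re^{i\theta})|^p\frac{d\theta}{2\pi}\right)^{1/p}$ ($p<\infty$), $M_\infty(r,f)=\max_\theta|f(re^{i\theta})|$; $H(p,\infty,\alpha)$: analytic $f$ with $\sup_{0\le r<1}(1-r)^\alpha M_p(r,f)<\infty$ (this is the norm); $H(p,0,\alpha)$: its subspace where $(1-r)^\alpha M_p(r,f)\to0$. $[\varphi_t,X]=\{f\in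 X:\|f\circ\varphi_t-f\|_X\to0\text{ as }t\to0^+\}$. $\mathcal{B}_0$ is the little Bloch space: analytic $f$ with $(1-|z|^2)|f'(z)|\to0$ as $|z|\to1$. *)

(* Defs.v *)
From Stdlib Require Import Reals.
From Coquelicot Require Import Coquelicot.
Open Scope R_scope.

Definition inD (z : C) : Prop := Cmod z < 1.

Definition holoD (f : C -> C) : Prop :=
  forall z : C, inD z -> ex_derive (K := C_AbsRing) (V := C_NormedModule) f z.

(* x^y for x >= 0, y > 0, with 0^y = 0 *)
Definition rpow (x y : R) : R := if Rlt_dec 0 x then Rpower x y else 0.

Definition polar (r th : R) : C := (r * cos th, r * sin th).

Definition Mp (p : Rbar) (r : R) (f : C -> C) : R :=
  match p with
  | Finite q =>
      rpow (RInt (fun th => rpow (Cmod (f (polar r th))) q) 0 (2 * PI) / (2 * PI))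
           (/ q)
  | p_infty => real (Lub_Rbar (fun x => exists th, x = Cmod (f (polar r th))))
  | m_infty => 0
  end.

Definition Hnorm (p : Rbar) (alpha : R) (f : C -> C) : Rbar :=
  Lub_Rbar (fun x => exists r, 0 <= r < 1 /\ x = rpow (1 - r) alpha * Mp p r f).

Definition Hinf (p : Rbar) (alpha : R) (f : C -> C) : Prop :=
  holoD f /\ Rbar_lt (Hnorm p alpha f) p_infty.

Definition H0 (p : Rbar) (alpha : R) (f : C -> C) : Prop :=
  Hinf p alpha f /\
  forall eps : R, 0 < eps -> exists r0 : R, 0 <= r0 < 1 /\
    forall r, r0 < r < 1 -> rpow (1 - r) alpha * Mp p r f < eps.

Definition semigroup (phi : R -> C -> C) : Prop :=
  (forall t, 0 <= t -> holoD (phi t)) /\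
  (forall t z, 0 <= t -> inD z -> inD (phi t z)) /\
  (forall z, inD z -> phi 0 z = z) /\
  (forall t s z, 0 <= t -> 0 <= s -> inD z -> phi (t + s) z = phi t (phi s z)) /\
  (forall r, 0 <= r < 1 -> forall eps, 0 < eps -> exists delta, 0 < delta /\
     forall t z, 0 < t < delta -> Cmod z <= r -> Cmod (phi t z - z)%C < eps).

Definition nontrivial (phi : R -> C -> C) : Prop :=
  exists t z, 0 <= t /\ inD z /\ phi t z <> z.

Definition generator (phi : R -> C -> C) (G : C -> C) : Prop :=
  forall z, inD z ->
    forall eps, 0 < eps -> exists delta, 0 < delta /\
      forall t, 0 < t < delta ->
        Cmod ((phi t z - z) / RtoC t - G z)%C < eps.

Definition DW_point_in_D (phi : R -> C -> C) (b : C) : Prop :=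
  inD b /\ forall t, 0 <= t -> phi t b = b.

(* g-symbol gamma(z) = int_b^z (zeta - b)/G(zeta) dzeta, i.e. the primitive on D
   of (zeta-b)/G(zeta) (holomorphic on D) vanishing at b *)
Definition g_symbol (b : C) (G gamma : C -> C) : Prop :=
  holoD gamma /\ gamma b = RtoC 0 /\
  forall z, inD z -> z <> b ->
    is_derive (K := C_AbsRing) (V := C_NormedModule) gamma z ((z - b) / G z)%C.

Definition little_Bloch (g : C -> C) : Prop :=
  holoD g /\
  forall eps, 0 < eps -> exists r0, 0 <= r0 < 1 /\
    forall z l, r0 < Cmod z < 1 ->
      is_derive (K := C_AbsRing) (V := C_NormedModule) g z l ->
      (1 - Cmod z ^ 2) * Cmod l < eps.

Definition strong_cont (p : Rbar) (alpha : R) (phi : R -> C -> C) (f : C -> C) : Prop :=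
  Hinf p alpha f /\
  forall eps, 0 < eps -> exists delta, 0 < delta /\
    forall t, 0 < t < delta ->
      Rbar_le (Hnorm p alpha (fun z => f (phi t z) - f z)%C) (Finite eps).

Definition linf_seq (x : nat -> C) : Prop := exists M, forall n, Cmod (x n) <= M.
Definition linf_norm (x : nat -> C) : Rbar :=
  Lub_Rbar (fun v => exists n, v = Cmod (x n)).

(* S (a set of functions on D) contains a closed subspace of H(p,oo,alpha)
   isomorphic to ell_infty: a linear map T from ell_infty into S, bounded
   above and below, whose range is closed in H(p,oo,alpha). *)
Definition contains_closed_linf (p : Rbar) (alpha : R) (S : (C -> C) -> Prop) : Prop :=
  exists T : (nat -> C) -> (C -> C),
    (forall x y a c, linf_seq x -> linf_seq y -> forall z, inD z ->
       T (fun n => a * x n + c * y n)%C z = (a * T x z + c * T y z)%C) /\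
    (exists m M, 0 < m /\ 0 < M /\ forall x, linf_seq x ->
       Rbar_le (Rbar_mult (Finite m) (linf_norm x)) (Hnorm p alpha (T x)) /\
       Rbar_le (Hnorm p alpha (T x)) (Rbar_mult (Finite M) (linf_norm x))) /\
    (forall x, linf_seq x -> S (T x)) /\
    (forall f, Hinf p alpha f ->
       (forall eps, 0 < eps -> exists x, linf_seq x /\
          Rbar_lt (Hnorm p alpha (fun z => T x z - f z)%C) (Finite eps)) ->
       exists x, linf_seq x /\ forall z, inD z -> f z = T x z).

(* Main.v *)
Require Import Defs.
From Stdlib Require Import Reals Lra Lia Psatz Classical ClassicalEpsilon.
From Coquelicot Require Import Coquelicot.
Open Scope R_scope.

(** The generator satisfies G = (z - b) / gamma', and - (1 - conj b z) gamma' has nonnegative real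
    part, so gamma' obeys a Harnack inequality.

    Functions of H(p,0,alpha) are strongly continuous by Littlewood subordination near the circle and
    uniform convergence on compact sets.  If gamma is little Bloch, the flow moves a point w near the
    circle by a fixed fraction of 1 - |w| within the time x(w) = c (1 - |w|^2) |gamma'(w)|, which tends
    to 0; hence f o phi_t - f controls (1 - |w|^2) f'(w), and a strongly continuous f lies in
    H(p,0,alpha).  For finite p this is averaged over a short time interval: a change of the time
    variable absorbs the dependence of x(w) on w, and the bound on f' is turned into a contraction
    inequality for the means of f o phi_t along the radii 1 - (7/8)^k.

    If gamma is not little Bloch, there are points a with |a| close to 1 and
    (1 - |a|^2) |gamma'(a)| >= eta.  By Harnack |G(w)| <= C |1 - conj a w|^2 / (1 - |w|), so at the
    scale 1 - |a| the flow near a is slow, uniformly in a, and the normalized kernels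
    (1 - |a|)^(- alpha - 1/p) ((1 - |a|) / (1 - conj a z))^N are uniformly strongly continuous.
    Along a sufficiently sparse sequence of such points the kernels are gliding humps, and
    x |-> sum_n x_n f_n embeds ell_infty. *)

(** * Continuity and complex differentiability *)

(** The exponent may be below 1, so neither convexity nor duality of [Mp] is available. What
    survives is that |f|^p is subharmonic: pointwise bounds on f or f' near w are routed through the
    Poisson integral [hm] of |f|^p. It obeys Harnack's inequality, and being the real part of a
    holomorphic function it keeps the mean value property after composition with phi_t, so
    subordination costs only a constant although phi_t need not fix 0. Triangle inequalities hold up
    to the constant [Kp p].

    The generator is given by one-sided pointwise limits only, and continuity in t has to be derived
    from the semigroup law; hence the arguments with right Dini derivatives in [right_dini], [flow]
    and [stay].

    For finite p the contraction is run on time averages of the means of f o phi_t, not on the means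
    of f, because the increment estimate controls f' at the moving points phi_t z. Schwarz-Pick for
    phi_t turns this into control of the derivative of f o phi_t, and strong continuity leads back
    to f at the end. *)

Definition ccont {U : UniformSpace} (f : U -> C) (x : U) : Prop :=
  continuous (U := C_UniformSpace) f x.

Lemma ccont_pair {U : UniformSpace} (f : U -> C) x :
  continuous (fun y => fst (f y)) x -> continuous (fun y => snd (f y)) x -> ccont f x.
Proof.
intros H1 H2; unfold ccont.
apply (continuous_ext (fun y => (fst (f y), snd (f y)))); [intros y; destruct (f y); reflexivity|].
apply (continuous_comp_2 (fun y => fst (f y)) (fun y => snd (f y)) (fun a b => (a, b))); auto.
apply (continuous_ext (fun y => y)); [intros []; reflexivity|apply continuous_id].
Qed.

Lemma ccont_fst {U : UniformSpace} (f : U -> C) x : ccont f x -> continuous (fun y => fst (f y)) x.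
Proof.
intros H; apply (continuous_comp f (fun z : C_UniformSpace => fst z)); [exact H|].
destruct (f x); apply (continuous_fst (U := R_UniformSpace) (V := R_UniformSpace)).
Qed.

Lemma ccont_snd {U : UniformSpace} (f : U -> C) x : ccont f x -> continuous (fun y => snd (f y)) x.
Proof.
intros H; apply (continuous_comp f (fun z : C_UniformSpace => snd z)); [exact H|].
destruct (f x); apply (continuous_snd (U := R_UniformSpace) (V := R_UniformSpace)).
Qed.

Lemma rcont_plus {U : UniformSpace} (f g : U -> R) x :
  continuous f x -> continuous g x -> continuous (fun y => f y + g y) x.
Proof. intros; apply (continuous_plus (V := R_NormedModule) f g); auto. Qed.

Lemma rcont_minus {U : UniformSpace} (f g : U -> R) x :
  continuous f x -> continuous g x -> continuous (fun y => f y - g y) x.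
Proof. intros; apply (continuous_minus (V := R_NormedModule) f g); auto. Qed.

Lemma rcont_opp {U : UniformSpace} (f : U -> R) x :
  continuous f x -> continuous (fun y => - f y) x.
Proof. intros; apply (continuous_opp (V := R_NormedModule) f); auto. Qed.

Lemma rcont_mult {U : UniformSpace} (f g : U -> R) x :
  continuous f x -> continuous g x -> continuous (fun y => f y * g y) x.
Proof. intros; apply (continuous_mult (K := R_AbsRing) f g); auto. Qed.

Lemma rcont_comp {U : UniformSpace} (f : U -> R) (g : R -> R) x :
  continuous f x -> continuity_pt g (f x) -> continuous (fun y => g (f y)) x.
Proof.
intros H1 H2; apply (continuous_comp f g); auto.
apply continuity_pt_filterlim; exact H2.
Qed.

Lemma rcont_inv {U : UniformSpace} (f : U -> R) x :
  continuous f x -> f x <> 0 -> continuous (fun y => / f y) x.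
Proof.
intros H1 H2; apply (rcont_comp f Rinv); auto.
apply (continuity_pt_inv id); [apply derivable_continuous_pt, derivable_pt_id|exact H2].
Qed.

Lemma rcont_div {U : UniformSpace} (f g : U -> R) x :
  continuous f x -> continuous g x -> g x <> 0 -> continuous (fun y => f y / g y) x.
Proof. intros; apply rcont_mult; [|apply rcont_inv]; auto. Qed.

Lemma rcont_pow {U : UniformSpace} (f : U -> R) n x :
  continuous f x -> continuous (fun y => f y ^ n) x.
Proof.
intros H; induction n; simpl; [apply continuous_const|apply rcont_mult; auto].
Qed.

Lemma ccont_const {U : UniformSpace} (c : C) (x : U) : ccont (fun _ => c) x.
Proof. apply continuous_const. Qed.

Lemma ccont_id (z : C) : ccont (U := C_UniformSpace) (fun w => w) z.
Proof. apply continuous_id. Qed.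

Lemma ccont_comp {U V : UniformSpace} (f : U -> V) (g : V -> C) x :
  continuous f x -> ccont g (f x) -> ccont (fun y => g (f y)) x.
Proof. intros; apply (continuous_comp f g); auto. Qed.

Lemma ccont_ext {U : UniformSpace} (f g : U -> C) x :
  (forall y, f y = g y) -> ccont f x -> ccont g x.
Proof. intros H; apply continuous_ext; auto. Qed.

Lemma ccont_plus {U : UniformSpace} (f g : U -> C) x :
  ccont f x -> ccont g x -> ccont (fun y => f y + g y)%C x.
Proof.
intros Hf Hg; apply ccont_pair; simpl; apply rcont_plus;
  try (apply ccont_fst; assumption); apply ccont_snd; assumption.
Qed.

Lemma ccont_opp {U : UniformSpace} (f : U -> C) x :
  ccont f x -> ccont (fun y => - f y)%C x.
Proof.
intros Hf; apply ccont_pair; simpl; apply rcont_opp;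
  try (apply ccont_fst; assumption); apply ccont_snd; assumption.
Qed.

Lemma ccont_minus {U : UniformSpace} (f g : U -> C) x :
  ccont f x -> ccont g x -> ccont (fun y => f y - g y)%C x.
Proof. intros; apply ccont_plus; [|apply ccont_opp]; auto. Qed.

Lemma ccont_mult {U : UniformSpace} (f g : U -> C) x :
  ccont f x -> ccont g x -> ccont (fun y => f y * g y)%C x.
Proof.
intros Hf Hg; pose proof (ccont_fst _ _ Hf); pose proof (ccont_snd _ _ Hf).
pose proof (ccont_fst _ _ Hg); pose proof (ccont_snd _ _ Hg).
apply ccont_pair; simpl; [apply rcont_minus|apply rcont_plus]; apply rcont_mult; auto.
Qed.

Lemma C_norm2_neq_0 (z : C) : z <> 0%C -> fst z ^ 2 + snd z ^ 2 <> 0.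
Proof.
intros Hz H; apply Hz.
assert (fst z = 0 /\ snd z = 0) as [H1 H2] by (split; nra).
destruct z as [x y]; simpl in *; subst; reflexivity.
Qed.

Lemma ccont_inv {U : UniformSpace} (f : U -> C) x :
  ccont f x -> f x <> 0%C -> ccont (fun y => / f y)%C x.
Proof.
intros Hf Hn; pose proof (ccont_fst _ _ Hf); pose proof (ccont_snd _ _ Hf).
pose proof (C_norm2_neq_0 _ Hn).
apply ccont_pair; simpl; (apply rcont_div; [try apply rcont_opp; assumption| |assumption]);
  apply rcont_plus; apply rcont_mult; auto; apply rcont_mult; auto; apply continuous_const.
Qed.

Lemma ccont_div {U : UniformSpace} (f g : U -> C) x :
  ccont f x -> ccont g x -> g x <> 0%C -> ccont (fun y => f y / g y)%C x.
Proof. intros; apply ccont_mult; [|apply ccont_inv]; auto. Qed.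

Lemma ccont_RtoC {U : UniformSpace} (f : U -> R) x :
  continuous f x -> ccont (fun y => RtoC (f y)) x.
Proof. intros; apply ccont_pair; simpl; [auto|apply continuous_const]. Qed.

Lemma rcont_Cmod {U : UniformSpace} (f : U -> C) x :
  ccont f x -> continuous (fun y => Cmod (f y)) x.
Proof.
intros Hf; pose proof (ccont_fst _ _ Hf); pose proof (ccont_snd _ _ Hf).
apply (rcont_comp (fun y => fst (f y) ^ 2 + snd (f y) ^ 2) sqrt).
- apply rcont_plus; apply rcont_pow; auto.
- apply continuity_pt_sqrt; nra.
Qed.

Lemma rcont_sin {U : UniformSpace} (f : U -> R) x : continuous f x -> continuous (fun y => sin (f y)) x.
Proof. intros; apply (rcont_comp f sin); auto; apply continuity_sin. Qed.
Lemma rcont_cos {U : UniformSpace} (f : U -> R) x : continuous f x -> continuous (fun y => cos (f y)) x.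
Proof. intros; apply (rcont_comp f cos); auto; apply continuity_cos. Qed.

Lemma ccont_polar {U : UniformSpace} (r t : U -> R) x :
  continuous r x -> continuous t x -> ccont (fun y => polar (r y) (t y)) x.
Proof.
intros; apply ccont_pair; simpl; apply rcont_mult; auto; [apply rcont_cos|apply rcont_sin]; auto.
Qed.

Lemma continuous_fst' (q : R * R) : continuous (T := prod_UniformSpace R_UniformSpace R_UniformSpace) (fun q : R * R => fst q) q.
Proof. destruct q; apply continuous_fst. Qed.
Lemma continuous_snd' (q : R * R) : continuous (T := prod_UniformSpace R_UniformSpace R_UniformSpace) (fun q : R * R => snd q) q.
Proof. destruct q; apply continuous_snd. Qed.

Lemma Cmod_fst_le (z : C) : Rabs (fst z) <= Cmod z.
Proof. apply re_le_Cmod. Qed.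

Lemma Cmod_snd_le (z : C) : Rabs (snd z) <= Cmod z.
Proof. eapply Rle_trans; [|apply Rmax_Cmod]; apply Rmax_r. Qed.

Lemma Cmod_le_abs (z : C) : Cmod z <= Rabs (fst z) + Rabs (snd z).
Proof.
replace z with (RtoC (fst z) + RtoC (snd z) * Ci)%C at 1.
- eapply Rle_trans; [apply Cmod_triangle|]. rewrite Cmod_mult, Cmod_Ci, !Cmod_R; lra.
- destruct z; unfold RtoC, Ci, Cplus, Cmult; simpl; f_equal; ring.
Qed.

Lemma ccont_eps (f : C -> C) (z : C) :
  ccont (U := C_UniformSpace) f z <->
  forall eps, 0 < eps -> exists d, 0 < d /\ forall w, Cmod (w - z) < d -> Cmod (f w - f z) < eps.
Proof.
split.
- intros H eps He.
  pose proof (rcont_Cmod (fun w => f w - f z)%C z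
     (ccont_minus (U := C_UniformSpace) f (fun _ => f z) z H (ccont_const _ _))) as H1.
  assert (H2 := H1 (fun v => v < eps)).
  destruct H2 as [d Hd].
  { exists (mkposreal _ He); intros y Hy; simpl in Hy.
    unfold ball in Hy; simpl in Hy; unfold AbsRing_ball, abs, minus, plus, opp in Hy; simpl in Hy.
    replace (f z - f z)%C with (RtoC 0) in Hy by ring. rewrite Cmod_0 in Hy.
    apply Rabs_def2 in Hy; lra. }
  exists d; split; [apply cond_pos|]. intros w Hw; apply Hd.
  apply C_NormedModule_mixin_compat1. exact Hw.
- intros H P [eps Hp].
  destruct (H eps (cond_pos eps)) as [d [Hd Hw]].
  (* Half of [d], because the product ball bounds each coordinate separately and the modulus is at
     most their sum. *)
  assert (Hd2 : 0 < d / 2) by lra.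
  exists (mkposreal _ Hd2); intros w Hb; apply Hp.
  apply C_NormedModule_mixin_compat1. apply Hw.
  destruct Hb as [B1 B2]. unfold ball in B1, B2; simpl in B1, B2.
  unfold AbsRing_ball, abs, minus, plus, opp in B1, B2; simpl in B1, B2.
  eapply Rle_lt_trans; [apply Cmod_le_abs|].
  destruct w, z; simpl in *. unfold Rminus. lra.
Qed.

Definition cdiff (f : C -> C) (z l : C) : Prop :=
  is_derive (K := C_AbsRing) (V := C_NormedModule) f z l.

Lemma cdiff_eps (f : C -> C) (z l : C) :
  cdiff f z l <->
  forall eps, 0 < eps -> exists d, 0 < d /\ forall w, Cmod (w - z) < d ->
     Cmod (f w - f z - l * (w - z)) <= eps * Cmod (w - z).
Proof.
assert (E : forall w, @minus C_NormedModule (minus (f w) (f z)) (scal (minus w z) l)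
             = (f w - f z - l * (w - z))%C).
{ intros w. unfold minus, plus, opp, scal, mult; simpl.
  unfold mult; simpl. unfold Cminus. ring. }
split.
- intros [_ H] eps He.
  specialize (H z (fun P HP => HP) (mkposreal _ He)). simpl in H.
  destruct H as [d Hd]. exists d; split; [apply cond_pos|].
  intros w Hw. specialize (Hd w Hw).
  change (Cmod (@minus C_NormedModule (minus (f w) (f z)) (scal (minus w z) l)) <= eps * Cmod (w - z)) in Hd.
  rewrite E in Hd. exact Hd.
- intros H; split.
  + apply (is_linear_scal_l (K := C_AbsRing) (V := C_NormedModule)).
  + intros x Hx. assert (Ex : z = x) by exact (is_filter_lim_locally_unique (V := AbsRing_NormedModule C_AbsRing) z x Hx).
    subst x.
    intros eps. destruct (H eps (cond_pos eps)) as [d [Hd Hw]].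
    exists (mkposreal _ Hd). intros w Hb.
    change (Cmod (@minus C_NormedModule (minus (f w) (f z)) (scal (minus w z) l)) <= eps * Cmod (w - z)).
    rewrite E. apply Hw; exact Hb.
Qed.

Lemma C_dec (z w : C) : {z = w} + {z <> w}.
Proof.
destruct z as [a b], w as [c d].
destruct (Req_EM_T a c); destruct (Req_EM_T b d); subst; auto;
  right; intros H; injection H; intros; contradiction.
Qed.

(* Caratheodory's formulation: the difference quotient extends continuously. *)
Lemma cdiff_carath (f : C -> C) (z l : C) :
  cdiff f z l <-> exists q : C -> C, ccont (U := C_UniformSpace) q z /\ q z = l /\
     forall w, f w = (f z + q w * (w - z))%C.
Proof.
split.
- intros H. rewrite cdiff_eps in H.
  exists (fun w => if C_dec w z then l else (f w - f z) / (w - z))%C.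
  destruct (C_dec z z) as [_|n]; [|congruence]. split; [|split; [reflexivity|]].
  + apply ccont_eps. intros eps He. destruct (H (eps/2)) as [d [Hd Hw]]; [lra|].
    exists d; split; auto. intros w Hwd. specialize (Hw w Hwd).
    destruct (C_dec z z) as [_|n]; [|congruence].
    destruct (C_dec w z) as [->|n].
    * replace (l - l)%C with (RtoC 0) by ring. rewrite Cmod_0; auto.
    * assert (Hn : (w - z)%C <> 0%C).
      { intros K; apply n. replace w with (w - z + z)%C by ring. rewrite K; ring. }
      pose proof (proj1 (Cmod_gt_0 _) Hn).
      replace ((f w - f z) / (w - z) - l)%C with ((f w - f z - l * (w - z)) / (w - z))%C
        by (field; auto).
      rewrite Cmod_div by auto.
      apply Rle_lt_trans with (eps / 2); [|lra].
      apply Rmult_le_reg_r with (Cmod (w - z)); auto.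
      unfold Rdiv at 1. rewrite Rmult_assoc, Rinv_l by lra. lra.
  + intros w. destruct (C_dec w z) as [->|n]; [ring|].
    field. intros K; apply n. replace w with (w - z + z)%C by ring. rewrite K; ring.
- intros [q [Hq [Hl Hf]]]. apply cdiff_eps. intros eps He.
  rewrite ccont_eps in Hq. destruct (Hq eps He) as [d [Hd Hw]].
  exists d; split; auto. intros w Hwd. specialize (Hw w Hwd).
  replace (f w - f z - l * (w - z))%C with ((q w - q z) * (w - z))%C by (rewrite (Hf w), Hl; ring).
  rewrite Cmod_mult. apply Rmult_le_compat_r; [apply Cmod_ge_0|lra].
Qed.

Lemma cdiff_ccont f z l : cdiff f z l -> ccont (U := C_UniformSpace) f z.
Proof.
rewrite cdiff_carath. intros [q [Hq [_ Hf]]].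
apply (ccont_ext (U := C_UniformSpace) (fun w => f z + q w * (w - z))%C); [intros; symmetry; auto|].
apply ccont_plus; [apply ccont_const|]. apply ccont_mult; auto.
apply ccont_minus; [apply ccont_id|apply ccont_const].
Qed.

Lemma cdiff_ext f g z l : (forall w, f w = g w) -> cdiff f z l -> cdiff g z l.
Proof. intros H; apply is_derive_ext; auto. Qed.

Lemma cdiff_ext_loc f g z l d : 0 < d -> (forall w, Cmod (w - z) < d -> f w = g w) ->
  cdiff f z l -> cdiff g z l.
Proof.
intros Hd H; apply is_derive_ext_loc. exists (mkposreal _ Hd). exact H.
Qed.

Lemma cdiff_val f z l l' : l = l' -> cdiff f z l -> cdiff f z l'.
Proof. intros ->; auto. Qed.

Lemma cdiff_const (c z : C) : cdiff (fun _ => c) z 0%C.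
Proof.
apply cdiff_carath. exists (fun _ => 0%C). repeat split; [apply ccont_const|intros; ring].
Qed.

Lemma cdiff_id (z : C) : cdiff (fun w => w) z 1%C.
Proof.
apply cdiff_carath. exists (fun _ => 1%C). repeat split; [apply ccont_const|intros; ring].
Qed.

Lemma cdiff_plus f g z l m : cdiff f z l -> cdiff g z m -> cdiff (fun w => f w + g w)%C z (l + m)%C.
Proof.
rewrite !cdiff_carath. intros [q [Hq [<- Hf]]] [k [Hk [<- Hg]]].
exists (fun w => q w + k w)%C. split; [apply ccont_plus; auto|split; auto].
intros w. rewrite (Hf w), (Hg w). ring.
Qed.

Lemma cdiff_mult f g z l m : cdiff f z l -> cdiff g z m ->
  cdiff (fun w => f w * g w)%C z (l * g z + f z * m)%C.
Proof.
intros H1 H2. pose proof (cdiff_ccont _ _ _ H2) as Hc. revert H1 H2.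
rewrite !cdiff_carath. intros [q [Hq [<- Hf]]] [k [Hk [<- Hg]]].
exists (fun w => q w * g w + f z * k w)%C. split; [|split; auto].
- apply ccont_plus; apply ccont_mult; auto. apply ccont_const.
- intros w. rewrite (Hf w), (Hg w). ring.
Qed.

Lemma cdiff_comp f g z l m : cdiff g z l -> cdiff f (g z) m ->
  cdiff (fun w => f (g w)) z (m * l)%C.
Proof.
intros H1 H2. pose proof (cdiff_ccont _ _ _ H1) as Hc. revert H1 H2.
rewrite !cdiff_carath. intros [q [Hq [<- Hg]]] [k [Hk [<- Hf]]].
exists (fun w => k (g w) * q w)%C. split; [|split; auto].
- apply ccont_mult; auto. apply (ccont_comp (U := C_UniformSpace) (V := C_UniformSpace) g k); auto.
- intros w. rewrite (Hf (g w)), (Hg w). ring.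
Qed.

Lemma cdiff_inv (z : C) : z <> 0%C -> cdiff (fun w => / w)%C z (- / (z * z))%C.
Proof.
intros Hz. assert (H0z := proj1 (Cmod_gt_0 _) Hz).
(* The value at w = 0 is altered so that the Caratheodory identity holds there with an explicit
   quotient. This happens away from z and is undone at the end by locality. *)
assert (Hq : cdiff (fun w => if C_dec w 0%C then / z + - / (z * z) * (w - z) else / w)%C z (- / (z * z))%C).
{ apply cdiff_carath.
  exists (fun w => if C_dec w 0%C then - / (z * z) else - / (w * z))%C. split; [|split].
  - apply (continuous_ext_loc (T := C_UniformSpace) (U := C_UniformSpace) _ (fun w => - / (w * z))%C).
    + assert (Hd : 0 < Cmod z / 2) by lra.
      exists (mkposreal _ Hd). intros w Hw. destruct (C_dec w 0) as [->|]; auto.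
      exfalso. destruct Hw as [B1 B2]. unfold ball in B1, B2; simpl in B1, B2.
      unfold AbsRing_ball, abs, minus, plus, opp in B1, B2; simpl in B1, B2.
      pose proof (Cmod_le_abs z). rewrite Rplus_0_l, Rabs_Ropp in B1, B2. lra.
    + apply (ccont_opp (U := C_UniformSpace)), ccont_inv; [apply ccont_mult; [apply ccont_id|apply ccont_const]|].
      apply Cmult_neq_0; auto.
  - destruct (C_dec z 0); [contradiction|reflexivity].
  - intros w. destruct (C_dec z 0) as [|_]; [contradiction|]. destruct (C_dec w 0) as [->|Hw]; [ring|].
    field; auto. }
refine (cdiff_ext_loc _ _ z _ (Cmod z) H0z _ Hq). intros w Hw.
destruct (C_dec w 0) as [->|]; auto. exfalso.
replace (0 - z)%C with (- z)%C in Hw by ring. rewrite Cmod_opp in Hw. lra.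
Qed.

Lemma cdiff_opp f z l : cdiff f z l -> cdiff (fun w => - f w)%C z (- l)%C.
Proof.
intros H. apply (cdiff_ext (fun w => (- (1)) * f w)%C); [intros; ring|].
eapply cdiff_val; [|apply (cdiff_mult _ _ _ _ _ (cdiff_const (- (1))%C z) H)]. simpl; ring.
Qed.

Lemma cdiff_minus f g z l m : cdiff f z l -> cdiff g z m -> cdiff (fun w => f w - g w)%C z (l - m)%C.
Proof. intros; apply cdiff_plus; [|apply cdiff_opp]; auto. Qed.

Lemma cdiff_scal c f z l : cdiff f z l -> cdiff (fun w => c * f w)%C z (c * l)%C.
Proof.
intros H. eapply cdiff_val; [|apply (cdiff_mult _ _ _ _ _ (cdiff_const c z) H)]. simpl; ring.
Qed.

Lemma cdiff_div f g z l m : cdiff f z l -> cdiff g z m -> g z <> 0%C ->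
  cdiff (fun w => f w / g w)%C z ((l * g z - f z * m) / (g z * g z))%C.
Proof.
intros Hf Hg Hn.
eapply cdiff_val; [|apply (cdiff_mult _ _ _ _ _ Hf (cdiff_comp (fun w => / w)%C g z _ _ Hg (cdiff_inv _ Hn)))].
simpl. field. auto.
Qed.

Lemma cdiff_unique f z l m : cdiff f z l -> cdiff f z m -> l = m.
Proof.
intros H1 H2. apply is_C_derive_unique in H1. apply is_C_derive_unique in H2. congruence.
Qed.

(** Integrals over the unit circle are taken of functions holomorphic on a disc of radius larger
    than 1, which arise by dilation; hence the variable radius. *)
Definition holR (rho : R) (f : C -> C) : Prop :=
  forall z, Cmod z < rho -> exists l, cdiff f z l.

Lemma holR_1 f : holR 1 f <-> holoD f.
Proof. split; intros H z Hz; apply H; auto. Qed.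

Lemma C_derive_cdiff f z l : cdiff f z l -> cdiff f z (C_derive f z).
Proof. intros H. rewrite (is_C_derive_unique _ _ _ H). exact H. Qed.

Lemma holR_derive rho f z : holR rho f -> Cmod z < rho -> cdiff f z (C_derive f z).
Proof. intros H Hz; destruct (H z Hz) as [l Hl]. apply C_derive_cdiff in Hl; auto. Qed.

(** * Goursat's theorem and the mean value property *)

Lemma ex_RInt_cont (f : R -> R) a b : (forall x, continuous f x) -> ex_RInt f a b.
Proof. intros H; apply (ex_RInt_continuous (V := R_CompleteNormedModule)); auto. Qed.

Lemma ex_RInt_cont_seg (f : R -> R) a b : a <= b ->
  (forall x, a <= x <= b -> continuous f x) -> ex_RInt f a b.
Proof.
intros Hab H; apply (ex_RInt_continuous (V := R_CompleteNormedModule)).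
rewrite Rmin_left, Rmax_right by lra. auto.
Qed.

Lemma RInt_Rplus (f g : R -> R) a b : ex_RInt f a b -> ex_RInt g a b ->
  RInt (fun x => f x + g x) a b = RInt f a b + RInt g a b.
Proof. intros; apply (RInt_plus (V := R_CompleteNormedModule)); auto. Qed.

Lemma RInt_Rminus (f g : R -> R) a b : ex_RInt f a b -> ex_RInt g a b ->
  RInt (fun x => f x - g x) a b = RInt f a b - RInt g a b.
Proof. intros; apply (RInt_minus (V := R_CompleteNormedModule)); auto. Qed.

Lemma RInt_Rscal (f : R -> R) c a b : ex_RInt f a b ->
  RInt (fun x => c * f x) a b = c * RInt f a b.
Proof. intros; apply (RInt_scal (V := R_CompleteNormedModule)); auto. Qed.

Lemma RInt_Rext (f g : R -> R) (a b : R) : (forall x, Rmin a b < x < Rmax a b -> f x = g x) ->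
  RInt f a b = RInt g a b.
Proof. apply (RInt_ext (V := R_CompleteNormedModule)). Qed.

Lemma RInt_Rconst (c a b : R) : RInt (fun _ => c) a b = (b - a) * c.
Proof. apply (RInt_const (V := R_CompleteNormedModule)). Qed.

Lemma RInt_Rchasles (f : R -> R) a b c : ex_RInt f a b -> ex_RInt f b c ->
  RInt f a b + RInt f b c = RInt f a c.
Proof. intros; apply (RInt_Chasles (V := R_CompleteNormedModule)); auto. Qed.

Lemma nested_intervals (a b : nat -> R) :
  (forall n, a n <= a (S n)) -> (forall n, b (S n) <= b n) -> (forall n, a n <= b n) ->
  exists x, forall n, a n <= x <= b n.
Proof.
intros Ha Hb Hab.
assert (Ham : forall n m, (n <= m)%nat -> a n <= a m).
{ intros n m H; induction H; [lra|eapply Rle_trans; eauto]. }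
assert (Hbm : forall n m, (n <= m)%nat -> b m <= b n).
{ intros n m H; induction H; [lra|eapply Rle_trans; eauto]. }
assert (Hall : forall n m, a n <= b m).
{ intros n m. eapply Rle_trans; [apply (Ham n (max n m)); lia|].
  eapply Rle_trans; [apply Hab|]. apply Hbm; lia. }
destruct (completeness (fun v => exists n, v = a n)) as [x [Hx1 Hx2]].
- exists (b O). intros v [n ->]; auto.
- exists (a O), O; auto.
- exists x. intros n; split; [apply Hx1; exists n; auto|].
  apply Hx2. intros v [m ->]; auto.
Qed.

Lemma abs_quarter w w1 w2 w3 w4 : w = w1 + w2 + w3 + w4 ->
  Rabs w1 < Rabs w / 4 -> Rabs w2 < Rabs w / 4 -> Rabs w3 < Rabs w / 4 -> Rabs w / 4 <= Rabs w4.
Proof.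
intros ->. pose proof (Rabs_triang (w1 + w2 + w3) w4). pose proof (Rabs_triang (w1 + w2) w3).
pose proof (Rabs_triang w1 w2). lra.
Qed.

Section Goursat.

Variables (f : C -> C).

(** Real part of the integral of f dz along the boundary of [a,b] x [c,d], counterclockwise. *)
Definition rectW (a b c d : R) : R :=
  RInt (fun x => fst (f (x, c))) a b - RInt (fun x => fst (f (x, d))) a b
  - (RInt (fun y => snd (f (b, y))) c d - RInt (fun y => snd (f (a, y))) c d).

Variables (L H A0 B0 : R).
Hypotheses (HL : 0 <= L) (HH : 0 <= H).
Hypothesis Hf : forall x y, A0 <= x <= A0 + L -> B0 <= y <= B0 + H -> exists l, cdiff f (x, y) l.

Let rcx c x : A0 <= x <= A0 + L -> B0 <= c <= B0 + H -> continuous (fun x => fst (f (x, c))) x.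
Proof.
intros Hx Hc. apply ccont_fst. apply (ccont_comp (V := C_UniformSpace) (fun x => (x, c)) f).
- apply ccont_pair; simpl; [apply continuous_id|apply continuous_const].
- destruct (Hf x c Hx Hc) as [l Hl]. eapply cdiff_ccont; eauto.
Qed.

Let rcy a y : A0 <= a <= A0 + L -> B0 <= y <= B0 + H -> continuous (fun y => snd (f (a, y))) y.
Proof.
intros Hx Hc. apply ccont_snd. apply (ccont_comp (V := C_UniformSpace) (fun y => (a, y)) f).
- apply ccont_pair; simpl; [apply continuous_const|apply continuous_id].
- destruct (Hf a y Hx Hc) as [l Hl]. eapply cdiff_ccont; eauto.
Qed.

Let exx a b c : A0 <= a -> a <= b -> b <= A0 + L -> B0 <= c <= B0 + H -> ex_RInt (fun x => fst (f (x, c))) a b.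
Proof. intros; apply ex_RInt_cont_seg; auto. intros x Hx; apply rcx; auto; lra. Qed.

Let exy a c d : B0 <= c -> c <= d -> d <= B0 + H -> A0 <= a <= A0 + L -> ex_RInt (fun y => snd (f (a, y))) c d.
Proof. intros; apply ex_RInt_cont_seg; auto. intros y Hy; apply rcy; auto; lra. Qed.

Let wid n := L / 2 ^ n.
Let hei n := H / 2 ^ n.
Let Wn n (q : R * R) := rectW (fst q) (fst q + wid n) (snd q) (snd q + hei n).

(** Bisection: the chosen quadrant carries at least a quarter of the boundary integral. If the first
    three fail to, [abs_quarter] shows that the fourth does. *)
Let step (n : nat) (q : R * R) : R * R :=
  let l := wid (S n) in let h := hei (S n) in
  let q1 := (fst q, snd q) in let q2 := (fst q + l, snd q) in
  let q3 := (fst q, snd q + h) in let q4 := (fst q + l, snd q + h) in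
  if Rle_dec (Rabs (Wn n q) / 4) (Rabs (Wn (S n) q1)) then q1 else
  if Rle_dec (Rabs (Wn n q) / 4) (Rabs (Wn (S n) q2)) then q2 else
  if Rle_dec (Rabs (Wn n q) / 4) (Rabs (Wn (S n) q3)) then q3 else q4.

Let inQ n (q : R * R) := A0 <= fst q /\ fst q + wid n <= A0 + L /\ B0 <= snd q /\ snd q + hei n <= B0 + H.

Let widS n : wid n = wid (S n) + wid (S n).
Proof. unfold wid; simpl. field. apply pow_nonzero; lra. Qed.
Let heiS n : hei n = hei (S n) + hei (S n).
Proof. unfold hei; simpl. field. apply pow_nonzero; lra. Qed.
Let wid0 n : 0 <= wid n.
Proof. apply Rdiv_le_0_compat; auto. apply pow_lt; lra. Qed.
Let hei0 n : 0 <= hei n.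
Proof. apply Rdiv_le_0_compat; auto. apply pow_lt; lra. Qed.

Let quarter n q : inQ n q ->
  Wn n q = Wn (S n) (fst q, snd q) + Wn (S n) (fst q + wid (S n), snd q)
     + Wn (S n) (fst q, snd q + hei (S n)) + Wn (S n) (fst q + wid (S n), snd q + hei (S n)).
Proof.
intros [I1 [I2 [I3 I4]]]. unfold Wn, rectW; simpl.
pose proof (wid0 (S n)); pose proof (hei0 (S n)).
rewrite (widS n) in *; rewrite (heiS n) in *.
set (l := wid (S n)) in *; set (h := hei (S n)) in *. destruct q as [a c]; simpl in *.
rewrite <- !Rplus_assoc.
rewrite <- (RInt_Rchasles (fun x => fst (f (x, c))) a (a + l) (a + l + l)) by (apply exx; lra).
rewrite <- (RInt_Rchasles (fun x => fst (f (x, c + h + h))) a (a + l) (a + l + l)) by (apply exx; lra).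
rewrite <- (RInt_Rchasles (fun y => snd (f (a, y))) c (c + h) (c + h + h)) by (apply exy; lra).
rewrite <- (RInt_Rchasles (fun y => snd (f (a + l + l, y))) c (c + h) (c + h + h)) by (apply exy; lra).
ring.
Qed.

Let step_spec n q : inQ n q ->
  inQ (S n) (step n q) /\ Rabs (Wn n q) / 4 <= Rabs (Wn (S n) (step n q)) /\
  fst q <= fst (step n q) <= fst q + wid (S n) /\ snd q <= snd (step n q) <= snd q + hei (S n).
Proof.
intros Hq. pose proof (quarter n q Hq) as E.
destruct Hq as [I1 [I2 [I3 I4]]]. unfold step, inQ.
pose proof (wid0 (S n)); pose proof (hei0 (S n)).
rewrite (widS n) in *; rewrite (heiS n) in *.
repeat destruct Rle_dec; simpl; repeat split; try lra.
apply Rnot_le_lt in n0, n1, n2. exact (abs_quarter _ _ _ _ _ E n0 n1 n2).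
Qed.

Let qs := fix qs n := match n with O => (A0, B0) | S n => step n (qs n) end.

Let qs_in n : inQ n (qs n).
Proof.
induction n.
- unfold inQ, wid, hei; simpl. lra.
- simpl. apply step_spec; auto.
Qed.

Let qs_W n : Rabs (rectW A0 (A0 + L) B0 (B0 + H)) / 4 ^ n <= Rabs (Wn n (qs n)).
Proof.
induction n.
- simpl. unfold Wn, wid, hei; simpl. unfold Rdiv. rewrite Rinv_1, !Rmult_1_r. lra.
- destruct (step_spec n (qs n) (qs_in n)) as [_ [HW _]].
  simpl qs. eapply Rle_trans; [|exact HW]. simpl pow.
  replace (Rabs (rectW A0 (A0 + L) B0 (B0 + H)) / (4 * 4 ^ n))
    with (Rabs (rectW A0 (A0 + L) B0 (B0 + H)) / 4 ^ n / 4)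
    by (field; apply pow_nonzero; lra). lra.
Qed.

Lemma goursat_rect : rectW A0 (A0 + L) B0 (B0 + H) = 0.
Proof.
destruct (nested_intervals (fun n => fst (qs n)) (fun n => fst (qs n) + wid n)) as [x Hx].
{ intros n. destruct (step_spec n (qs n) (qs_in n)) as [_ [_ [Hs _]]]. simpl qs; lra. }
{ intros n. destruct (step_spec n (qs n) (qs_in n)) as [_ [_ [Hs _]]]. simpl qs. rewrite (widS n). lra. }
{ intros n. pose proof (wid0 n). lra. }
destruct (nested_intervals (fun n => snd (qs n)) (fun n => snd (qs n) + hei n)) as [y Hy].
{ intros n. destruct (step_spec n (qs n) (qs_in n)) as [_ [_ [_ Hs]]]. simpl qs; lra. }
{ intros n. destruct (step_spec n (qs n) (qs_in n)) as [_ [_ [_ Hs]]]. simpl qs. rewrite (heiS n). lra. }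
{ intros n. pose proof (hei0 n). lra. }
destruct (Hf x y) as [l Hl].
{ specialize (Hx O). unfold wid in Hx; simpl in Hx. lra. }
{ specialize (Hy O). unfold hei in Hy; simpl in Hy. lra. }
rewrite cdiff_eps in Hl.
destruct (Req_dec (rectW A0 (A0 + L) B0 (B0 + H)) 0) as [|Hne]; auto. exfalso.
set (W0 := Rabs (rectW A0 (A0 + L) B0 (B0 + H))).
assert (HW0 : 0 < W0) by (apply Rabs_pos_lt; auto).
(* The estimates below yield W0 <= 2 eps (L + H)^2, and for this [eps] the right-hand side is less
   than W0 / 2. The summand 1 covers degenerate rectangles. *)
set (eps := W0 / (4 * (L + H + 1) ^ 2)).
assert (Heps : 0 < eps) by (apply Rdiv_lt_0_compat; auto; nra).
destruct (Hl eps Heps) as [d [Hd Hw]].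
assert (exists n, (L + H) / 2 ^ n < d) as [n Hn].
{ destruct (pow_lt_1_zero (/ 2)) with (y := d / (L + H + 1)) as [n Hn].
  - rewrite Rabs_pos_eq; lra.
  - apply Rdiv_lt_0_compat; lra.
  - exists n. specialize (Hn n (le_n n)). rewrite Rabs_pos_eq in Hn by (apply pow_le; lra).
    rewrite pow_inv in Hn. unfold Rdiv.
    apply (Rmult_lt_compat_r (L + H + 1)) in Hn; [|lra].
    unfold Rdiv in Hn. rewrite Rmult_assoc, Rinv_l, Rmult_1_r in Hn by lra.
    assert (0 < / 2 ^ n) by (apply Rinv_0_lt_compat, pow_lt; lra). nra. }
pose proof (qs_W n) as HWn. pose proof (qs_in n) as [I1 [I2 [I3 I4]]].
specialize (Hx n); specialize (Hy n). simpl in Hx, Hy.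
unfold Wn in HWn. destruct (qs n) as [a c]; simpl in *.
set (b := a + wid n) in *. set (e := c + hei n) in *.
assert (Hab : a <= b) by (pose proof (wid0 n); unfold b; lra).
assert (Hce : c <= e) by (pose proof (hei0 n); unfold e; lra).
set (s := (L + H) / 2 ^ n) in *.
assert (Hs : wid n + hei n = s) by (unfold wid, hei, s; field; apply pow_nonzero; lra).
assert (HE : forall u v, a <= u <= b -> c <= v <= e ->
    Cmod (f (u, v) - f (x, y) - l * ((u, v) - (x, y)))%C <= eps * s).
{ intros u v Hu Hv.
  assert (Hm : Cmod ((u, v) - (x, y))%C <= s).
  { eapply Rle_trans; [apply Cmod_le_abs|]. simpl.
    assert (Rabs (u + - x) <= wid n) by (apply Rabs_le; unfold b in *; lra).
    assert (Rabs (v + - y) <= hei n) by (apply Rabs_le; unfold e in *; lra). lra. }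
  eapply Rle_trans; [apply Hw; lra|]. apply Rmult_le_compat_l; lra. }
assert (HWf : rectW a b c e = RInt (fun x => fst (f (x, c)) - fst (f (x, e))) a b
             - RInt (fun y => snd (f (b, y)) - snd (f (a, y))) c e).
{ unfold rectW.
  rewrite (RInt_Rminus (fun x => fst (f (x, c))) (fun x => fst (f (x, e)))) by (apply exx; lra).
  rewrite (RInt_Rminus (fun y => snd (f (b, y))) (fun y => snd (f (a, y)))) by (apply exy; lra). ring. }
(* The affine part of f contributes [snd l * (b - a) * (e - c)] to the horizontal and to the
   vertical difference alike, so it cancels in [rectW] and only the o(s) remainder is left. *)
assert (X1 : Rabs (RInt (fun x => fst (f (x, c)) - fst (f (x, e)) - snd l * (e - c)) a b) <= (b - a) * (2 * eps * s)).
{ apply abs_RInt_le_const; auto.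
  - apply ex_RInt_cont_seg; auto. intros t Ht.
    apply rcont_minus; [apply rcont_minus; apply rcx; lra|apply continuous_const].
  - intros t Ht.
    pose proof (HE t c Ht (conj (Rle_refl c) Hce)) as E1.
    pose proof (HE t e Ht (conj Hce (Rle_refl e))) as E2.
    pose proof (Rle_trans _ _ _ (Cmod_fst_le _) E1) as F1.
    pose proof (Rle_trans _ _ _ (Cmod_fst_le _) E2) as F2. simpl in F1, F2.
    replace (fst (f (t, c)) - fst (f (t, e)) - snd l * (e - c)) with
      ((fst (f (t, c)) + - fst (f (x, y)) + - (fst l * (t + - x) - snd l * (c + - y)))
       - (fst (f (t, e)) + - fst (f (x, y)) + - (fst l * (t + - x) - snd l * (e + - y)))) by ring.
    eapply Rle_trans; [apply Rabs_triang|]. rewrite Rabs_Ropp. lra. }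
assert (X2 : Rabs (RInt (fun y => snd (f (b, y)) - snd (f (a, y)) - snd l * (b - a)) c e) <= (e - c) * (2 * eps * s)).
{ apply abs_RInt_le_const; auto.
  - apply ex_RInt_cont_seg; auto. intros t Ht.
    apply rcont_minus; [apply rcont_minus; apply rcy; lra|apply continuous_const].
  - intros t Ht.
    pose proof (HE b t (conj Hab (Rle_refl b)) Ht) as E1.
    pose proof (HE a t (conj (Rle_refl a) Hab) Ht) as E2.
    pose proof (Rle_trans _ _ _ (Cmod_snd_le _) E1) as F1.
    pose proof (Rle_trans _ _ _ (Cmod_snd_le _) E2) as F2. simpl in F1, F2.
    replace (snd (f (b, t)) - snd (f (a, t)) - snd l * (b - a)) with
      ((snd (f (b, t)) + - snd (f (x, y)) + - (fst l * (t + - y) + snd l * (b + - x)))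
       - (snd (f (a, t)) + - snd (f (x, y)) + - (fst l * (t + - y) + snd l * (a + - x)))) by ring.
    eapply Rle_trans; [apply Rabs_triang|]. rewrite Rabs_Ropp. lra. }
rewrite (RInt_Rminus (fun x => fst (f (x, c)) - fst (f (x, e))) (fun _ => snd l * (e - c))), RInt_Rconst in X1; [|apply ex_RInt_cont_seg; auto; intros t Ht; apply rcont_minus; apply rcx; lra|apply ex_RInt_cont; intros; apply continuous_const].
rewrite (RInt_Rminus (fun y => snd (f (b, y)) - snd (f (a, y))) (fun _ => snd l * (b - a))), RInt_Rconst in X2; [|apply ex_RInt_cont_seg; auto; intros t Ht; apply rcont_minus; apply rcy; lra|apply ex_RInt_cont; intros; apply continuous_const].
assert (HB : Rabs (rectW a b c e) <= s * (2 * eps * s)).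
{ rewrite HWf. replace (b - a) with (wid n) in X1 by (unfold b; ring).
  replace (e - c) with (hei n) in X2 by (unfold e; ring).
  replace (b - a) with (wid n) in X2 by (unfold b; ring).
  replace (e - c) with (hei n) in X1 by (unfold e; ring).
  set (I := RInt _ a b) in *. set (J := RInt _ c e) in *.
  replace (I - J) with ((I - wid n * (snd l * hei n)) - (J - hei n * (snd l * wid n))) by ring.
  eapply Rle_trans; [apply Rabs_triang|]. rewrite Rabs_Ropp. rewrite <- Hs at 1. lra. }
fold W0 in HWn.
assert (Hp : 0 < 2 ^ n) by (apply pow_lt; lra).
assert (H4 : 4 ^ n = 2 ^ n * 2 ^ n) by (rewrite <- Rpow_mult_distr; f_equal; lra).
assert (HC : W0 <= 2 * eps * (L + H) ^ 2).
{ apply Rmult_le_reg_r with (/ 4 ^ n); [apply Rinv_0_lt_compat, pow_lt; lra|].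
  eapply Rle_trans; [exact HWn|]. eapply Rle_trans; [exact HB|].
  apply Req_le. unfold s. rewrite H4. field. apply pow_nonzero; lra. }
assert (W0 = eps * (4 * (L + H + 1) ^ 2)) by (unfold eps; field; nra).
nra.
Qed.

End Goursat.

(** In the coordinates z = exp(s + i t) an annulus is a rectangle. This reduces circle means to
    [goursat_rect] and later puts radial and angular derivatives on the same footing. *)
Definition Cexp (w : C) : C := (exp (fst w) * cos (snd w), exp (fst w) * sin (snd w)).

Lemma Cexp_polar s t : Cexp (s, t) = polar (exp s) t.
Proof. reflexivity. Qed.

Lemma sin_abs_le (x : R) : Rabs (sin x) <= Rabs x.
Proof.
destruct (MVT_gen sin 0 x cos) as [c [_ Hc]].
- intros; apply is_derive_sin.
- intros; apply continuity_sin.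
- rewrite sin_0, !Rminus_0_r in Hc. rewrite Hc, Rabs_mult.
  assert (Rabs (cos c) <= 1) by (apply Rabs_le; apply COS_bound).
  pose proof (Rabs_pos x). nra.
Qed.

Lemma cos_m1_le (x : R) : Rabs (cos x - 1) <= x ^ 2.
Proof.
replace (cos x) with (1 - 2 * sin (x / 2) * sin (x / 2)).
2: { rewrite <- cos_2a_sin. f_equal; field. }
pose proof (sin_abs_le (x / 2)) as H. apply Rsqr_le_abs_1 in H. unfold Rsqr in H.
rewrite Rabs_left1; nra.
Qed.

Lemma sin_id_le (x : R) : Rabs x <= 1 -> Rabs (sin x - x) <= x ^ 2.
Proof.
intros Hx.
destruct (MVT_gen (fun x => sin x - x) 0 x (fun x => cos x - 1)) as [c [Hc1 Hc]].
- intros; auto_derive; auto; ring.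
- intros y _. apply continuity_pt_minus; [apply continuity_sin|apply derivable_continuous_pt, derivable_pt_id].
- rewrite sin_0, !Rminus_0_r in Hc. rewrite Hc, Rabs_mult.
  pose proof (cos_m1_le c) as H.
  assert (c ^ 2 <= x ^ 2).
  { destruct (Rle_lt_dec x 0);
    [rewrite Rmin_right, Rmax_left in Hc1 by lra|rewrite Rmin_left, Rmax_right in Hc1 by lra]; nra. }
  pose proof (Rabs_pos x). nra.
Qed.

Lemma exp_id_le (x : R) : Rabs x <= / 2 -> Rabs (exp x - 1 - x) <= 2 * x ^ 2.
Proof.
intros Hx. apply Rabs_le_between in Hx.
assert (E1 : 1 + x <= exp x) by apply exp_ineq1_le.
assert (E2 : 1 - x <= exp (- x)) by (replace (1 - x) with (1 + - x) by ring; apply exp_ineq1_le).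
assert (E3 : exp x * exp (- x) = 1) by (rewrite <- exp_plus, Rplus_opp_r, exp_0; auto).
pose proof (exp_pos x).
rewrite Rabs_pos_eq by lra.
assert (exp x * (1 - x) <= 1) by nra.
nra.
Qed.

Lemma Cexp_plus z w : Cexp (z + w)%C = (Cexp z * Cexp w)%C.
Proof.
unfold Cexp, Cmult, Cplus; simpl. rewrite exp_plus, cos_plus, sin_plus. f_equal; ring.
Qed.

Lemma Cexp_taylor h : Cmod h <= / 2 -> Cmod (Cexp h - 1 - h)%C <= 10 * Cmod h ^ 2.
Proof.
intros Hh. destruct h as [s t].
pose proof (Cmod_fst_le (s, t)) as H1. pose proof (Cmod_snd_le (s, t)) as H2. simpl in H1, H2.
set (m := Cmod (s, t)) in *.
assert (S2 : s ^ 2 <= m ^ 2) by (apply pow_maj_Rabs; auto).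
assert (T2 : t ^ 2 <= m ^ 2) by (apply pow_maj_Rabs; auto).
eapply Rle_trans; [apply Cmod_le_abs|]. unfold Cexp; simpl.
assert (A1 : Rabs (exp s - 1 - s) <= 2 * s ^ 2) by (apply exp_id_le; lra).
pose proof (cos_m1_le t) as A2.
assert (A3 : Rabs (sin t - t) <= t ^ 2) by (apply sin_id_le; lra).
pose proof (sin_abs_le t) as A4.
assert (A5 : Rabs (cos t) <= 1) by (apply Rabs_le; apply COS_bound).
replace (exp s * cos t + - (1) + - s) with ((exp s - 1 - s) * cos t + (1 + s) * (cos t - 1)) by ring.
replace (exp s * sin t + - 0 + - t) with ((exp s - 1 - s) * sin t + s * sin t + (sin t - t)) by ring.
assert (B1 : Rabs ((exp s - 1 - s) * cos t) <= 2 * m ^ 2).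
{ rewrite Rabs_mult. pose proof (Rabs_pos (exp s - 1 - s)). pose proof (Rabs_pos (cos t)). nra. }
assert (B2 : Rabs ((1 + s) * (cos t - 1)) <= 2 * m ^ 2).
{ rewrite Rabs_mult. assert (Rabs (1 + s) <= 2) by (apply Rabs_le; apply Rabs_le_between in H1; lra).
  pose proof (Rabs_pos (1 + s)). pose proof (Rabs_pos (cos t - 1)). nra. }
assert (B3 : Rabs ((exp s - 1 - s) * sin t) <= 2 * m ^ 2).
{ rewrite Rabs_mult. pose proof (Rabs_pos (exp s - 1 - s)). pose proof (Rabs_pos (sin t)). nra. }
assert (B4 : Rabs (s * sin t) <= m ^ 2).
{ rewrite Rabs_mult. pose proof (Rabs_pos s). pose proof (Rabs_pos (sin t)). nra. }
eapply Rle_trans; [apply Rplus_le_compat; [apply Rabs_triang|eapply Rle_trans; [apply Rabs_triang|apply Rplus_le_compat_r, Rabs_triang]]|].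
pose proof (pow2_ge_0 m). simpl in *. lra.
Qed.

Lemma cdiff_Cexp z : cdiff Cexp z (Cexp z).
Proof.
apply cdiff_eps. intros eps He.
set (K := Cmod (Cexp z) * 10 + 1).
assert (HK : 1 <= K) by (unfold K; pose proof (Cmod_ge_0 (Cexp z)); lra).
exists (Rmin (/ 2) (eps / K)). split; [apply Rmin_pos; [lra|apply Rdiv_lt_0_compat; lra]|].
intros w Hw.
pose proof (Rlt_le_trans _ _ _ Hw (Rmin_l _ _)). pose proof (Rlt_le_trans _ _ _ Hw (Rmin_r _ _)) as Hw2.
replace (Cexp w) with (Cexp z * Cexp (w - z))%C by (rewrite <- Cexp_plus; f_equal; ring).
replace (Cexp z * Cexp (w - z) - Cexp z - Cexp z * (w - z))%C
  with (Cexp z * (Cexp (w - z) - 1 - (w - z)))%C by ring.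
rewrite Cmod_mult. pose proof (Cexp_taylor (w - z)%C ltac:(lra)) as T.
pose proof (Cmod_ge_0 (Cexp z)). pose proof (Cmod_ge_0 (w - z)%C).
apply Rle_trans with (Cmod (Cexp z) * (10 * Cmod (w - z) ^ 2)); [apply Rmult_le_compat_l; auto|].
assert (Cmod (w - z) * K <= eps).
{ apply (Rmult_lt_compat_r K) in Hw2; [|lra]. unfold Rdiv in Hw2.
  rewrite Rmult_assoc, Rinv_l, Rmult_1_r in Hw2; lra. }
unfold K in *. nra.
Qed.

Lemma Cmod_polar r t : 0 <= r -> Cmod (polar r t) = r.
Proof.
intros Hr. unfold Cmod, polar; simpl.
replace (r * cos t * (r * cos t * 1) + r * sin t * (r * sin t * 1)) with (r * r * (Rsqr (sin t) + Rsqr (cos t)))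
  by (unfold Rsqr; ring).
rewrite sin2_cos2, Rmult_1_r. apply sqrt_square; auto.
Qed.

Lemma polar_0 t : polar 0 t = 0%C.
Proof. unfold polar. rewrite !Rmult_0_l. reflexivity. Qed.

(** Goursat for f o exp on [ln r', ln r] x [0, 2 pi]: the horizontal sides cancel by periodicity, so
    the mean of Im f does not depend on the radius, and r' tends to 0. The imaginary part comes
    first because it is what [rectW] sees on vertical sides. *)
Lemma mean_value_snd rho f r : holR rho f -> 0 <= r < rho ->
  RInt (fun t => snd (f (polar r t))) 0 (2 * PI) = 2 * PI * snd (f 0%C) :> R.
Proof.
intros Hf [Hr0 Hr]. pose proof PI_RGT_0 as HPI.
destruct (Req_dec r 0) as [->|Hrn].
{ rewrite (RInt_Rext _ (fun _ => snd (f 0%C))) by (intros; rewrite polar_0; auto).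
  rewrite RInt_Rconst; ring. }
assert (Hrp : 0 < r) by lra.
assert (Hcont : forall r', 0 <= r' < rho -> forall t, continuous (fun t => snd (f (polar r' t))) t).
{ intros r' Hr' t. apply ccont_snd. apply (ccont_comp (V := C_UniformSpace) (fun t => polar r' t) f).
  - apply ccont_polar; [apply continuous_const|apply continuous_id].
  - destruct (Hf (polar r' t)) as [l Hl]; [rewrite Cmod_polar; lra|]. eapply cdiff_ccont; eauto. }
assert (Hconst : forall r', 0 < r' <= r ->
   RInt (fun t => snd (f (polar r t))) 0 (2 * PI) = RInt (fun t => snd (f (polar r' t))) 0 (2 * PI)).
{ intros r' Hr'.
  assert (Hln : ln r' <= ln r).
  { destruct (Req_dec r' r) as [->|]; [lra|]. left; apply ln_increasing; lra. }
  pose proof (goursat_rect (fun w => f (Cexp w)) (ln r - ln r') (2 * PI) (ln r') 0) as HG.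
  assert (G0 := HG ltac:(lra) ltac:(lra)). clear HG.
  replace (ln r' + (ln r - ln r')) with (ln r) in G0 by ring. rewrite Rplus_0_l in G0.
  unfold rectW in G0.
  rewrite (RInt_Rext (fun x => fst (f (Cexp (x, 0)))) (fun x => fst (f (Cexp (x, 2 * PI))))) in G0.
  2: { intros x _. unfold Cexp; simpl. rewrite cos_2PI, sin_2PI, cos_0, sin_0; auto. }
  rewrite (RInt_Rext (fun y => snd (f (Cexp (ln r, y)))) (fun t => snd (f (polar r t)))) in G0.
  2: { intros x _. rewrite Cexp_polar, exp_ln by lra; auto. }
  rewrite (RInt_Rext (fun y => snd (f (Cexp (ln r', y)))) (fun t => snd (f (polar r' t)))) in G0.
  2: { intros x _. rewrite Cexp_polar, exp_ln by lra; auto. }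
  enough (Hd : forall x y : R, ln r' <= x <= ln r -> 0 <= y <= 2 * PI ->
     exists l : C, cdiff (fun w : C => f (Cexp w)) (x, y) l) by (specialize (G0 Hd); lra).
  intros x y Hx _. destruct (Hf (Cexp (x, y))) as [l Hl].
  - rewrite Cexp_polar, Cmod_polar by (left; apply exp_pos).
    apply Rle_lt_trans with r; auto. rewrite <- (exp_ln r) by lra.
    destruct (Req_dec x (ln r)) as [->|]; [lra|]. left; apply exp_increasing; lra.
  - eexists. apply (cdiff_comp f Cexp); [apply cdiff_Cexp|apply Hl]. }
apply cond_eq. intros eps He.
destruct (Hf 0%C) as [l Hl]; [rewrite Cmod_0; lra|].
apply cdiff_ccont in Hl. rewrite ccont_eps in Hl.
destruct (Hl (eps / (4 * PI))) as [d [Hd Hw]]; [apply Rdiv_lt_0_compat; lra|].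
set (r' := Rmin r (d / 2)).
assert (Hr' : 0 < r' <= r) by (split; [apply Rmin_pos; lra|apply Rmin_l]).
assert (Hr'd : r' < d) by (pose proof (Rmin_r r (d / 2)); unfold r'; lra).
rewrite (Hconst r' Hr').
assert (Ec : 2 * PI * snd (f 0%C) = RInt (fun _ => snd (f 0%C)) 0 (2 * PI)) by (rewrite RInt_Rconst; ring).
rewrite Ec.
rewrite <- RInt_Rminus; [|apply ex_RInt_cont; apply Hcont; lra|apply ex_RInt_cont; intros; apply continuous_const].
eapply Rle_lt_trans; [apply abs_RInt_le_const with (M := eps / (4 * PI)); [lra| |]|].
- apply ex_RInt_cont; intros t; apply rcont_minus; [apply Hcont; lra|apply continuous_const].
- intros t _. specialize (Hw (polar r' t)).
  replace (polar r' t - 0)%C with (polar r' t) in Hw by ring. rewrite Cmod_polar in Hw by lra.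
  specialize (Hw Hr'd). pose proof (Cmod_snd_le (f (polar r' t) - f 0%C)%C) as H1.
  simpl in H1. unfold Rminus. lra.
- replace ((2 * PI - 0) * (eps / (4 * PI))) with (eps / 2) by (field; lra). lra.
Qed.

Lemma mean_value_fst rho f r : holR rho f -> 0 <= r < rho ->
  RInt (fun t => fst (f (polar r t))) 0 (2 * PI) = 2 * PI * fst (f 0%C) :> R.
Proof.
intros Hf Hr. pose proof (mean_value_snd rho (fun w => Ci * f w)%C r) as H.
assert (HI : holR rho (fun w => Ci * f w)%C).
{ intros z Hz. destruct (Hf z Hz) as [l Hl]. eexists. apply cdiff_scal; eauto. }
specialize (H HI Hr). simpl in H.
rewrite (RInt_Rext _ (fun t => 0 * snd (f (polar r t)) + 1 * fst (f (polar r t)))) by (intros; ring).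
rewrite H; ring.
Qed.

(** * Disc automorphisms and the Poisson kernel *)

Definition rdiff (c : R -> C) (t : R) (l : C) : Prop :=
  is_derive (fun s => fst (c s)) t (fst l) /\ is_derive (fun s => snd (c s)) t (snd l).

Lemma is_derive_Rcont (f : R -> R) (x l : R) : is_derive f x l -> continuous f x.
Proof. intros H; apply (ex_derive_continuous (K := R_AbsRing) (V := R_NormedModule)); exists l; auto. Qed.

Lemma rdiff_ccont c t l : rdiff c t l -> ccont c t.
Proof.
intros [H1 H2]. apply ccont_pair; eapply is_derive_Rcont; eauto.
Qed.

(** The product rule with k merely continuous, at a zero of g. It differentiates the Caratheodory
    form q(c s) (c s - c t), in which q is only known to be continuous. *)
Lemma is_derive_mult_vanish (k g : R -> R) t l :
  continuous k t -> is_derive g t l -> g t = 0 -> is_derive (fun s => k s * g s) t (k t * l).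
Proof.
intros Hk Hg H0. apply is_derive_Reals. apply is_derive_Reals in Hg.
intros eps He.
set (M := Rabs (k t) + Rabs l + 2).
assert (HM : 2 <= M) by (unfold M; pose proof (Rabs_pos (k t)); pose proof (Rabs_pos l); lra).
set (e1 := Rmin 1 (eps / (2 * M))).
assert (He1 : 0 < e1) by (apply Rmin_pos; [lra|apply Rdiv_lt_0_compat; lra]).
assert (He1M : e1 * (2 * M) <= eps).
{ apply Rle_trans with (eps / (2 * M) * (2 * M)); [apply Rmult_le_compat_r; [lra|apply Rmin_r]|].
  apply Req_le; field; lra. }
assert (He11 : e1 <= 1) by apply Rmin_l.
destruct (Hg e1 He1) as [d1 Hd1].
apply continuity_pt_filterlim in Hk.
destruct (Hk e1 He1) as [d2 [Hd2 Hk2]].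
exists (mkposreal _ (Rmin_pos _ _ (cond_pos d1) Hd2)). intros h Hh Hhd. simpl in Hhd.
pose proof (Rlt_le_trans _ _ _ Hhd (Rmin_l _ _)) as Hh1.
pose proof (Rlt_le_trans _ _ _ Hhd (Rmin_r _ _)) as Hh2.
specialize (Hd1 h Hh Hh1).
assert (Hkk : Rabs (k (t + h) - k t) < e1).
{ apply (Hk2 (t + h)). split; [split; [exact I|]|].
  - lra.
  - simpl. unfold Rdist. replace (t + h - t) with h by ring. auto. }
rewrite H0 in *. rewrite Rmult_0_r, !Rminus_0_r in *.
replace (k (t + h) * g (t + h) / h - k t * l)
  with (k (t + h) * (g (t + h) / h - l) + (k (t + h) - k t) * l) by (field; auto).
eapply Rle_lt_trans; [apply Rabs_triang|]. rewrite !Rabs_mult.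
assert (Rabs (k (t + h)) <= Rabs (k t) + 1).
{ replace (k (t + h)) with (k t + (k (t + h) - k t)) by ring.
  eapply Rle_trans; [apply Rabs_triang|]. lra. }
pose proof (Rabs_pos (k (t + h))). pose proof (Rabs_pos l). pose proof (Rabs_pos (k t)).
pose proof (Rabs_pos (g (t + h) / h - l)). pose proof (Rabs_pos (k (t + h) - k t)).
assert (Rabs (k (t + h)) * Rabs (g (t + h) / h - l) <= (Rabs (k t) + 1) * e1) by (apply Rmult_le_compat; lra).
assert (Rabs (k (t + h) - k t) * Rabs l <= e1 * Rabs l) by (apply Rmult_le_compat_r; lra).
unfold M in *. nra.
Qed.

Lemma is_derive_minus_const (f : R -> R) c t l : is_derive f t l -> is_derive (fun s => f s - c) t l.
Proof.
intros H. replace l with (minus l zero) at 1 by (unfold minus, plus, opp, zero; simpl; ring).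
apply (is_derive_minus (K := R_AbsRing) (V := R_NormedModule)); auto.
apply (is_derive_const (K := R_AbsRing) (V := R_NormedModule)).
Qed.

Lemma rdiff_comp F (c : R -> C) t l m : rdiff c t l -> cdiff F (c t) m ->
  rdiff (fun s => F (c s)) t (m * l)%C.
Proof.
intros Hc HF. pose proof (rdiff_ccont _ _ _ Hc) as Hcc. destruct Hc as [Hc1 Hc2].
rewrite cdiff_carath in HF. destruct HF as [q [Hq [<- Hf]]].
assert (Hqc : ccont (fun s => q (c s)) t)
  by (apply (ccont_comp (V := C_UniformSpace) c q); auto).
pose proof (ccont_fst _ _ Hqc) as Q1. pose proof (ccont_snd _ _ Hqc) as Q2. simpl in Q1, Q2.
pose proof (is_derive_minus_const _ (fst (c t)) _ _ Hc1) as D1.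
pose proof (is_derive_minus_const _ (snd (c t)) _ _ Hc2) as D2.
split.
- apply (is_derive_ext (fun s => (fst (q (c s)) * (fst (c s) - fst (c t)) - snd (q (c s)) * (snd (c s) - snd (c t))) - - fst (F (c t)))).
  { intros s. rewrite (Hf (c s)). simpl. unfold minus, plus, opp; simpl. ring. }
  apply is_derive_minus_const.
  apply (is_derive_minus (K := R_AbsRing) (V := R_NormedModule)
    (fun s => fst (q (c s)) * (fst (c s) - fst (c t))) (fun s => snd (q (c s)) * (snd (c s) - snd (c t))));
  apply (is_derive_mult_vanish (fun s => _ (q (c s)))); auto; lra.
- apply (is_derive_ext (fun s => (fst (q (c s)) * (snd (c s) - snd (c t)) + snd (q (c s)) * (fst (c s) - fst (c t))) - - snd (F (c t)))).
  { intros s. rewrite (Hf (c s)). simpl. ring. }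
  apply is_derive_minus_const.
  apply (is_derive_plus (K := R_AbsRing) (V := R_NormedModule)
    (fun s => fst (q (c s)) * (snd (c s) - snd (c t))) (fun s => snd (q (c s)) * (fst (c s) - fst (c t))));
  apply (is_derive_mult_vanish (fun s => _ (q (c s)))); auto; lra.
Qed.

Lemma rdiff_polar r t : rdiff (fun s => polar r s) t (Ci * polar r t)%C.
Proof.
split; simpl; auto_derive; auto; ring.
Qed.

Notation e1 t := (polar 1 t).

Lemma Cmod_e1 t : Cmod (e1 t) = 1.
Proof. apply Cmod_polar; lra. Qed.

Lemma e1_conj t : (e1 t * Cconj (e1 t))%C = 1%C.
Proof. rewrite <- Cmod2_conj, Cmod_e1. f_equal; ring. Qed.

Lemma Cmod_1m_conj a t : Cmod (1 - Cconj a * e1 t)%C = Cmod (e1 t - a)%C.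
Proof.
replace (1 - Cconj a * e1 t)%C with (e1 t * Cconj (e1 t - a))%C.
- rewrite Cmod_mult, Cmod_e1, Cmod_conj. ring.
- rewrite <- (e1_conj t). destruct (e1 t), a; unfold Cconj, Cmult, Cminus, Cplus, Copp; simpl; f_equal; ring.
Qed.

Definition PK (a : C) (t : R) : R := (1 - Cmod a ^ 2) / Cmod (e1 t - a)%C ^ 2.

Lemma Cmod_minus_ge (z w : C) : Cmod z - Cmod w <= Cmod (z - w)%C.
Proof.
replace z with (z - w + w)%C at 1 by ring. pose proof (Cmod_triangle (z - w) w). lra.
Qed.

Lemma Cmod_minus_le (z w : C) : Cmod (z - w)%C <= Cmod z + Cmod w.
Proof. unfold Cminus. eapply Rle_trans; [apply Cmod_triangle|]. rewrite Cmod_opp; lra. Qed.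

Lemma Cmod_minus_sym (z w : C) : Cmod (z - w)%C = Cmod (w - z)%C.
Proof. rewrite <- Cmod_opp. f_equal; ring. Qed.

Lemma Cmod_neq0 (z : C) : 0 < Cmod z -> z <> 0%C.
Proof. intros H; apply Cmod_gt_0; auto. Qed.

Lemma PK_den a t : Cmod a < 1 -> 0 < Cmod (e1 t - a)%C.
Proof. intros H. pose proof (Cmod_minus_ge (e1 t) a). rewrite Cmod_e1 in *; lra. Qed.

Lemma PK_pos a t : Cmod a < 1 -> 0 < PK a t.
Proof.
intros H. unfold PK. pose proof (PK_den a t H). pose proof (Cmod_ge_0 a).
apply Rdiv_lt_0_compat; nra.
Qed.

Lemma PK_cont a t : Cmod a < 1 -> continuous (PK a) t.
Proof.
intros H. unfold PK. pose proof (PK_den a t H).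
apply rcont_div; [apply continuous_const| |nra].
apply rcont_pow, rcont_Cmod, ccont_minus; [|apply ccont_const].
apply ccont_polar; [apply continuous_const|apply continuous_id].
Qed.

Lemma Re_cayley (v : C) : v <> 1%C -> fst ((1 + v) / (1 - v))%C = (1 - Cmod v ^ 2) / Cmod (1 - v)%C ^ 2.
Proof.
intros Hv. rewrite !Cmod2_alt. destruct v as [x y]. simpl.
assert (Hn : (1 - x) ^ 2 + y ^ 2 <> 0).
{ intros E. apply Hv.
  assert (H1 : 1 - x = 0) by nra. assert (H2 : y = 0) by nra.
  replace x with 1 by lra. rewrite H2. reflexivity. }
field. simpl in Hn. nra.
Qed.

Lemma PK_cayley a t : Cmod a < 1 ->
  PK a t = fst ((1 + Cconj a * e1 t) / (1 - Cconj a * e1 t))%C.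
Proof.
intros Ha. rewrite Re_cayley.
- rewrite Cmod_1m_conj, Cmod_mult, Cmod_e1, Cmod_conj, Rmult_1_r. reflexivity.
- intros E. pose proof (f_equal Cmod E) as E'. rewrite Cmod_mult, Cmod_e1, Cmod_conj, Cmod_1 in E'. lra.
Qed.

Lemma C1_minus_neq0 (v : C) : Cmod v < 1 -> (1 - v)%C <> 0%C.
Proof.
intros H. apply Cmod_neq0. pose proof (Cmod_minus_ge 1 v). rewrite Cmod_1 in *; lra.
Qed.
Lemma C1_plus_neq0 (v : C) : Cmod v < 1 -> (1 + v)%C <> 0%C.
Proof.
intros H. replace (1 + v)%C with (1 - (- v))%C by ring. apply C1_minus_neq0. rewrite Cmod_opp; auto.
Qed.

Lemma PK_int a : Cmod a < 1 -> RInt (PK a) 0 (2 * PI) = 2 * PI :> R.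
Proof.
intros Ha. pose proof (Cmod_ge_0 a).
set (F := fun w => ((1 + Cconj a * w) / (1 - Cconj a * w))%C).
rewrite (RInt_Rext _ (fun t => fst (F (polar 1 t)))) by (intros; apply PK_cayley; auto).
(* A radius above 1 whose product with |a| is still below 1; it also serves a = 0. *)
rewrite (mean_value_fst (2 / (1 + Cmod a))).
- unfold F. rewrite !Cmult_0_r. replace ((1 + 0) / (1 - 0))%C with (RtoC 1) by (field; apply C1_nz).
  simpl; ring.
- intros z Hz.
  assert (Hz1 : Cmod (Cconj a * z)%C < 1).
  { rewrite Cmod_mult, Cmod_conj. destruct (Req_dec (Cmod a) 0) as [->|]; [lra|].
    apply Rlt_trans with (Cmod a * (2 / (1 + Cmod a))).
    - apply Rmult_lt_compat_l; lra.
    - apply Rmult_lt_reg_r with (1 + Cmod a); [lra|]. field_simplify; lra. }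
  eexists. apply cdiff_div.
  + apply cdiff_plus; [apply cdiff_const|apply cdiff_scal, cdiff_id].
  + apply cdiff_minus; [apply cdiff_const|apply cdiff_scal, cdiff_id].
  + apply C1_minus_neq0; auto.
- split; [lra|]. apply Rmult_lt_reg_r with (1 + Cmod a); [lra|]. field_simplify; lra.
Qed.

Lemma unit_angle x y : x ^ 2 + y ^ 2 = 1 -> exists s, cos s = x /\ sin s = y.
Proof.
intros H. assert (Hx : -1 <= x <= 1) by (split; nra).
assert (Hs : sqrt (1 - x²) = Rabs y).
{ replace (1 - x²) with (y²) by (unfold Rsqr; lra). apply sqrt_Rsqr_abs. }
destruct (Rle_lt_dec 0 y).
- exists (acos x). rewrite cos_acos, sin_acos by auto. rewrite Hs, Rabs_pos_eq; auto.
- exists (- acos x). rewrite cos_neg, sin_neg, cos_acos, sin_acos by auto. rewrite Hs, Rabs_left; auto.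
  split; auto; ring.
Qed.

Definition tau (a z : C) : C := ((z + a) / (1 + Cconj a * z))%C.

Lemma C_eq (z w : C) : fst z = fst w -> snd z = snd w -> z = w.
Proof. destruct z, w; simpl; intros -> ->; auto. Qed.

Lemma mobius_identity (a z : C) :
  Cmod (z + a)%C ^ 2 - Cmod (1 + Cconj a * z)%C ^ 2 = (Cmod z ^ 2 - 1) * (1 - Cmod a ^ 2).
Proof. rewrite !Cmod2_alt. destruct a, z; simpl. ring. Qed.

Lemma RInt_shift (U : R -> R) a b c : (forall x, continuous U x) ->
  RInt (fun x => U (x + c)) a b = RInt U (a + c) (b + c).
Proof.
intros HU. replace (a + c) with (1 * a + c) by ring. replace (b + c) with (1 * b + c) by ring.
rewrite <- (RInt_comp_lin (V := R_CompleteNormedModule) U 1 c a b) by (apply ex_RInt_cont; auto).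
apply RInt_Rext. intros x _. unfold scal; simpl; unfold mult; simpl. rewrite !Rmult_1_l. auto.
Qed.

Lemma RInt_periodic (U : R -> R) T c : (forall x, continuous U x) -> (forall x, U (x + T) = U x) ->
  RInt U c (c + T) = RInt U 0 T.
Proof.
intros HU HT.
assert (E : RInt U (0 + T) (c + T) = RInt U 0 c).
{ rewrite <- RInt_shift by auto. apply RInt_Rext; intros; auto. }
rewrite Rplus_0_l in E.
pose proof (RInt_Rchasles U 0 c (c + T) ltac:(apply ex_RInt_cont; auto) ltac:(apply ex_RInt_cont; auto)).
pose proof (RInt_Rchasles U 0 T (c + T) ltac:(apply ex_RInt_cont; auto) ltac:(apply ex_RInt_cont; auto)).
lra.
Qed.

Lemma polar_period r t : polar r (t + 2 * PI) = polar r t.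
Proof.
unfold polar. rewrite cos_plus, sin_plus, cos_2PI, sin_2PI. f_equal; ring.
Qed.

(* Under the disc automorphism tau_a the angular measure becomes the Poisson kernel: the angle of
   the inverse automorphism on the circle has derivative PK a. *)
Lemma poisson_change (a : C) (u : C -> R) : Cmod a < 1 ->
  (forall z : C, Cmod z = 1 -> continuous (T := C_UniformSpace) u z) ->
  RInt (fun t => u (tau a (e1 t))) 0 (2 * PI) = RInt (fun t => PK a t * u (e1 t)) 0 (2 * PI) :> R.
Proof.
intros Ha Hu. pose proof (Cmod_ge_0 a) as Ha0.
set (sg := fun w => ((w - a) / (1 - Cconj a * w))%C).
assert (Hden : forall w, Cmod w <= 1 -> (1 - Cconj a * w)%C <> 0%C).
{ intros w Hw. apply C1_minus_neq0. rewrite Cmod_mult, Cmod_conj. pose proof (Cmod_ge_0 w); nra. }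
assert (Hden2 : forall w, Cmod w <= 1 -> (1 + Cconj a * w)%C <> 0%C).
{ intros w Hw. apply C1_plus_neq0. rewrite Cmod_mult, Cmod_conj. pose proof (Cmod_ge_0 w); nra. }
assert (Haa : (1 - Cconj a * a)%C <> 0%C) by (apply Hden; lra).
assert (Hsg1 : forall t, Cmod (sg (e1 t)) = 1).
{ intros t. unfold sg. rewrite Cmod_div by (apply Hden; rewrite Cmod_e1; lra).
  rewrite Cmod_1m_conj. field. pose proof (PK_den a t Ha); lra. }
assert (Hinv : forall t, tau a (sg (e1 t)) = e1 t).
{ intros t. unfold tau, sg.
  assert (Hd := Hden (e1 t) ltac:(rewrite Cmod_e1; lra)).
  field. split; auto.
  replace (1 - Cconj a * e1 t + Cconj a * (e1 t - a))%C with (1 - Cconj a * a)%C by ring. auto. }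
assert (Hder : forall t, rdiff (fun s => sg (e1 s)) t (Ci * (RtoC (PK a t) * sg (e1 t)))%C).
{ intros t. assert (Hd := Hden (e1 t) ltac:(rewrite Cmod_e1; lra)).
  assert (D : cdiff sg (e1 t) ((1 - Cconj a * a) / ((1 - Cconj a * e1 t) * (1 - Cconj a * e1 t)))%C).
  { unfold sg. eapply cdiff_val; [|apply cdiff_div].
    - simpl. 2: apply cdiff_minus; [apply cdiff_id|apply cdiff_const].
      2: apply cdiff_minus; [apply cdiff_const|apply cdiff_scal, cdiff_id]. field; auto.
    - auto. }
  pose proof (rdiff_comp sg (fun s => e1 s) t _ _ (rdiff_polar 1 t) D) as H.
  match type of H with rdiff _ _ ?v => replace (Ci * (RtoC (PK a t) * sg (e1 t)))%C with v; auto end.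
  assert (HPK : RtoC (PK a t) = ((1 - Cconj a * a) / ((1 - Cconj a * e1 t) * Cconj (1 - Cconj a * e1 t)))%C).
  { unfold PK. rewrite <- Cmod_1m_conj, RtoC_div, RtoC_minus, !Cmod2_conj; [rewrite (Cmult_comm a); reflexivity|].
    apply pow_nonzero. apply Cmod_gt_0 in Hd. lra. }
  rewrite HPK. unfold sg.
  assert (Hd' : Cconj (1 - Cconj a * e1 t)%C <> 0%C).
  { apply Cmod_neq0. rewrite Cmod_conj. apply Cmod_gt_0; auto. }
  assert (E : (e1 t - a)%C = (e1 t * Cconj (1 - Cconj a * e1 t))%C).
  { replace (Cconj (1 - Cconj a * e1 t))%C with (1 - a * Cconj (e1 t))%C.
    - transitivity (e1 t - a * (e1 t * Cconj (e1 t)))%C; [rewrite e1_conj; ring|ring].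
    - apply C_eq; destruct a, (e1 t); simpl; ring. }
  rewrite E. field. split; auto. }
destruct (unit_angle (fst (sg (e1 0))) (snd (sg (e1 0)))) as [p0 [Hp1 Hp2]].
{ rewrite <- Cmod2_alt. rewrite Hsg1; ring. }
set (psi := fun t => p0 + RInt (PK a) 0 t).
assert (Hpsi : forall t, is_derive psi t (PK a t)).
{ intros t. unfold psi.
  apply (is_derive_ext (fun s => RInt (PK a) 0 s - - p0)); [intros; simpl; ring|].
  apply is_derive_minus_const. apply (is_derive_RInt (V := R_NormedModule) _ _ 0).
  - exists (mkposreal 1 Rlt_0_1). intros y _. apply (RInt_correct (V := R_CompleteNormedModule)).
    apply ex_RInt_cont. intros; apply PK_cont; auto.
  - apply PK_cont; auto. }
set (X := fun t => fst (sg (e1 t))). set (Y := fun t => snd (sg (e1 t))).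
assert (HX : forall t, is_derive X t (- PK a t * Y t)).
{ intros t. destruct (Hder t) as [H _]. unfold X. evar_last; [exact H|]. unfold Y; simpl. ring. }
assert (HY : forall t, is_derive Y t (PK a t * X t)).
{ intros t. destruct (Hder t) as [_ H]. unfold Y. evar_last; [exact H|]. unfold X; simpl. ring. }
(* [HE1] and [HE2] are the real and imaginary parts of [sg (e1 t)] times the conjugate of
   [e1 (psi t)]. Both points turn with angular velocity [PK a t], so the product is constant; [psi]
   is a continuous argument obtained without a logarithm. *)
assert (HE1 : forall t, 0 <= t -> X t * cos (psi t) + Y t * sin (psi t) = 1).
{ intros t Ht.
  assert (E0 : X 0 * cos (psi 0) + Y 0 * sin (psi 0) = 1).
  { unfold psi. rewrite RInt_point. unfold zero; simpl. rewrite Rplus_0_r, Hp1, Hp2.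
    unfold X, Y. replace (fst (sg (e1 0)) * fst (sg (e1 0)) + snd (sg (e1 0)) * snd (sg (e1 0)))
      with (Cmod (sg (e1 0)) ^ 2) by (rewrite Cmod2_alt; simpl; ring). rewrite Hsg1; ring. }
  destruct Ht as [Ht| <-]; auto. rewrite <- E0. symmetry.
  apply (eq_is_derive (fun t => X t * cos (psi t) + Y t * sin (psi t))); auto.
  intros s _. auto_derive.
  - repeat split; eexists; eauto.
  - change (Derive (fun x => X x) s) with (Derive X s). change (Derive (fun x => Y x) s) with (Derive Y s).
    change (Derive (fun x => psi x) s) with (Derive psi s).
    rewrite (is_derive_unique _ _ _ (HX s)), (is_derive_unique _ _ _ (HY s)), (is_derive_unique _ _ _ (Hpsi s)).
    unfold zero; simpl. ring. }
assert (HE2 : forall t, 0 <= t -> Y t * cos (psi t) - X t * sin (psi t) = 0).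
{ intros t Ht.
  assert (E0 : Y 0 * cos (psi 0) - X 0 * sin (psi 0) = 0).
  { unfold psi. rewrite RInt_point. unfold zero; simpl. rewrite Rplus_0_r, Hp1, Hp2.
    unfold X, Y. ring. }
  destruct Ht as [Ht| <-]; auto. rewrite <- E0. symmetry.
  apply (eq_is_derive (fun t => Y t * cos (psi t) - X t * sin (psi t))); auto.
  intros s _. auto_derive.
  - repeat split; eexists; eauto.
  - change (Derive (fun x => X x) s) with (Derive X s). change (Derive (fun x => Y x) s) with (Derive Y s).
    change (Derive (fun x => psi x) s) with (Derive psi s).
    rewrite (is_derive_unique _ _ _ (HX s)), (is_derive_unique _ _ _ (HY s)), (is_derive_unique _ _ _ (Hpsi s)).
    unfold zero; simpl. ring. }
assert (Hang : forall t, 0 <= t -> e1 (psi t) = sg (e1 t)).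
{ intros t Ht. specialize (HE1 t Ht). specialize (HE2 t Ht).
  pose proof (sin2_cos2 (psi t)) as HS. unfold Rsqr in HS.
  assert (A : X t * (sin (psi t) * sin (psi t) + cos (psi t) * cos (psi t)) =
    (X t * cos (psi t) + Y t * sin (psi t)) * cos (psi t) - (Y t * cos (psi t) - X t * sin (psi t)) * sin (psi t)) by ring.
  assert (B : Y t * (sin (psi t) * sin (psi t) + cos (psi t) * cos (psi t)) =
    (X t * cos (psi t) + Y t * sin (psi t)) * sin (psi t) + (Y t * cos (psi t) - X t * sin (psi t)) * cos (psi t)) by ring.
  rewrite HS, HE1, HE2 in A, B.
  apply C_eq.
  - change (1 * cos (psi t) = X t). lra.
  - change (1 * sin (psi t) = Y t). lra. }
set (U := fun t => u (tau a (e1 t))).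
assert (Htau1 : forall t, Cmod (tau a (e1 t)) = 1).
{ intros t. unfold tau. assert (Hd := Hden2 (e1 t) ltac:(rewrite Cmod_e1; lra)).
  rewrite Cmod_div by auto. pose proof (mobius_identity a (e1 t)) as M. rewrite Cmod_e1 in M.
  apply Cmod_gt_0 in Hd. pose proof (Cmod_ge_0 (e1 t + a)%C).
  replace (Cmod (e1 t + a)) with (Cmod (1 + Cconj a * e1 t)%C) by nra. field; lra. }
assert (HU : forall t, continuous U t).
{ intros t. unfold U. apply (continuous_comp (V := C_UniformSpace) (fun t => tau a (e1 t)) u).
  - assert (Hp : ccont (fun t => e1 t) t) by (apply ccont_polar; [apply continuous_const|apply continuous_id]).
    apply (ccont_div (fun t => (e1 t + a)%C) (fun t => (1 + Cconj a * e1 t)%C)).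
    + apply ccont_plus; auto. apply ccont_const.
    + apply ccont_plus; [apply ccont_const|]. apply ccont_mult; auto. apply ccont_const.
    + apply Hden2; rewrite Cmod_e1; lra.
  - apply Hu; auto. }
assert (Hend : psi (2 * PI) = psi 0 + 2 * PI).
{ unfold psi. rewrite PK_int by auto. rewrite RInt_point. unfold zero; simpl; ring. }
pose proof PI_RGT_0.
fold U.
rewrite <- (RInt_periodic U (2 * PI) (psi 0)); auto.
2: { intros x. unfold U. rewrite polar_period; auto. }
rewrite <- Hend.
rewrite <- (RInt_comp (V := R_CompleteNormedModule) U psi (PK a) 0 (2 * PI)).
- apply RInt_Rext. intros x Hx. rewrite Rmin_left, Rmax_right in Hx by lra.
  unfold scal; simpl; unfold mult; simpl. unfold U. rewrite Hang by lra. rewrite Hinv. auto.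
- intros; apply HU.
- intros x _. split; [apply Hpsi|apply PK_cont; auto].
Qed.

(** * Cauchy's formula and Taylor estimates *)

Lemma ccont_comp_hol {U : UniformSpace} (f : C -> C) (c : U -> C) x l :
  ccont c x -> cdiff f (c x) l -> ccont (fun y => f (c y)) x.
Proof.
intros Hc Hf. apply (ccont_comp (V := C_UniformSpace) c f); auto. eapply cdiff_ccont; eauto.
Qed.

Lemma ccont_e1 r t : ccont (fun s => polar r s) t.
Proof. apply ccont_polar; [apply continuous_const|apply continuous_id]. Qed.

Lemma ccont_circle rho f r t : holR rho f -> 0 <= r < rho -> ccont (fun s => f (polar r s)) t.
Proof.
intros Hf Hr. destruct (Hf (polar r t)) as [l Hl]; [rewrite Cmod_polar; lra|].
apply (ccont_comp_hol f (fun s => polar r s) t l); auto. apply ccont_e1.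
Qed.

Lemma tau_enlarge rho (z : C) : 1 < rho -> Cmod z < 1 ->
  exists rho', 1 < rho' /\ forall w, Cmod w < rho' ->
    (1 + Cconj z * w)%C <> 0%C /\ Cmod (tau z w) < rho.
Proof.
intros Hr Hz. pose proof (Cmod_ge_0 z) as Hz0.
(* The first bound keeps the denominator away from 0, the second gives |w|^2 - 1 < 3 x, and the
   third makes [mobius_identity] yield |tau z w| < rho. *)
set (x := Rmin ((1 - Cmod z) / 2) (Rmin 1 ((rho ^ 2 - 1) * (1 - Cmod z) ^ 2 / 16))).
assert (Hq : 0 < (rho ^ 2 - 1) * (1 - Cmod z) ^ 2 / 16).
{ apply Rdiv_lt_0_compat; [|lra]. apply Rmult_lt_0_compat; [nra|]. apply pow_lt; lra. }
assert (Hx0 : 0 < x) by (repeat apply Rmin_pos; lra).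
assert (Hx1 : x <= (1 - Cmod z) / 2) by apply Rmin_l.
assert (Hx2 : x <= 1) by (eapply Rle_trans; [apply Rmin_r|apply Rmin_l]).
assert (Hx3 : x <= (rho ^ 2 - 1) * (1 - Cmod z) ^ 2 / 16) by (eapply Rle_trans; [apply Rmin_r|apply Rmin_r]).
exists (1 + x). split; [lra|]. intros w Hw. pose proof (Cmod_ge_0 w) as Hw0.
assert (Hzw : Cmod (Cconj z * w)%C <= (1 + Cmod z) / 2).
{ rewrite Cmod_mult, Cmod_conj. nra. }
assert (Hd : (1 - Cmod z) / 2 <= Cmod (1 + Cconj z * w)%C).
{ replace (1 + Cconj z * w)%C with (1 - (- (Cconj z * w)))%C by ring.
  pose proof (Cmod_minus_ge 1 (- (Cconj z * w))%C). rewrite Cmod_1, Cmod_opp in *. lra. }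
assert (Hn : (1 + Cconj z * w)%C <> 0%C) by (apply Cmod_neq0; lra).
split; auto.
unfold tau. rewrite Cmod_div by auto.
set (D := Cmod (1 + Cconj z * w)%C) in *.
apply Rmult_lt_reg_r with D; [lra|]. unfold Rdiv. rewrite Rmult_assoc, Rinv_l, Rmult_1_r by lra.
pose proof (mobius_identity z w) as M. fold D in M.
set (N := Cmod (w + z)%C) in *. assert (0 <= N) by apply Cmod_ge_0.
assert (HD2 : (1 - Cmod z) ^ 2 / 4 <= D ^ 2) by nra.
assert (Hw2 : Cmod w ^ 2 - 1 < 3 * x) by nra.
assert ((Cmod w ^ 2 - 1) * (1 - Cmod z ^ 2) < (rho ^ 2 - 1) * D ^ 2).
{ apply Rlt_le_trans with ((rho ^ 2 - 1) * ((1 - Cmod z) ^ 2 / 4)).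
  - assert (0 < 1 - Cmod z ^ 2 <= 1) by nra.
    apply Rle_lt_trans with (3 * x); [|lra].
    destruct (Rle_lt_dec 0 (Cmod w ^ 2 - 1)); nra.
  - apply Rmult_le_compat_l; [nra|lra]. }
assert (N ^ 2 < (rho * D) ^ 2) by (rewrite Rpow_mult_distr; nra).
apply Rnot_le_lt. intros Hc. assert ((rho * D) ^ 2 <= N ^ 2) by (apply pow_incr; nra). lra.
Qed.

Lemma tau_0 a : tau a 0%C = a.
Proof. unfold tau. field. Qed.

Lemma cdiff_tau a w : (1 + Cconj a * w)%C <> 0%C -> exists l, cdiff (tau a) w l.
Proof.
intros H. eexists. unfold tau. apply cdiff_div; auto.
- apply cdiff_plus; [apply cdiff_id|apply cdiff_const].
- apply cdiff_plus; [apply cdiff_const|apply cdiff_scal, cdiff_id].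
Qed.

Lemma holR_tau rho g z : 1 < rho -> holR rho g -> Cmod z < 1 ->
  exists rho', 1 < rho' /\ holR rho' (fun w => g (tau z w)).
Proof.
intros Hr Hg Hz. destruct (tau_enlarge rho z Hr Hz) as [rho' [H1 H2]].
exists rho'; split; auto. intros w Hw. destruct (H2 w Hw) as [Hn Ht].
destruct (cdiff_tau z w Hn) as [l Hl]. destruct (Hg _ Ht) as [m Hm].
eexists. apply (cdiff_comp g (tau z)); eauto.
Qed.

(** The mean value property of g o tau_z at 0, read through [poisson_change]. *)
Lemma poisson_formula rho g z : 1 < rho -> holR rho g -> Cmod z < 1 ->
  RInt (fun t => PK z t * fst (g (e1 t))) 0 (2 * PI) = 2 * PI * fst (g z) :> R.
Proof.
intros Hr Hg Hz. rewrite <- (poisson_change z (fun w => fst (g w))); auto.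
- destruct (holR_tau rho g z Hr Hg Hz) as [rho' [H1 H2]].
  rewrite (mean_value_fst rho' (fun w => g (tau z w)) 1 H2) by lra. rewrite tau_0. auto.
- intros w Hw. apply ccont_fst. destruct (Hg w) as [l Hl]; [lra|]. eapply cdiff_ccont; eauto.
Qed.

Definition CI (c : R -> C) : C :=
  (RInt (fun t => fst (c t)) 0 (2 * PI), RInt (fun t => snd (c t)) 0 (2 * PI)).

Lemma CI_ext c d : (forall t, c t = d t) -> CI c = CI d.
Proof. intros H. unfold CI. f_equal; apply RInt_Rext; intros; rewrite H; auto. Qed.

Lemma ex_fst c a b : (forall t, ccont c t) -> ex_RInt (fun t => fst (c t)) a b.
Proof. intros H; apply ex_RInt_cont. intros; apply ccont_fst; auto. Qed.
Lemma ex_snd c a b : (forall t, ccont c t) -> ex_RInt (fun t => snd (c t)) a b.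
Proof. intros H; apply ex_RInt_cont. intros; apply ccont_snd; auto. Qed.

Lemma CI_plus c d : (forall t, ccont c t) -> (forall t, ccont d t) ->
  CI (fun t => c t + d t)%C = (CI c + CI d)%C.
Proof.
intros Hc Hd. unfold CI. apply C_eq; simpl; rewrite RInt_Rplus; auto using ex_fst, ex_snd.
Qed.

Lemma CI_scal k c : (forall t, ccont c t) -> CI (fun t => k * c t)%C = (k * CI c)%C.
Proof.
intros Hc. unfold CI. pose proof (ex_fst c 0 (2 * PI) Hc) as H1. pose proof (ex_snd c 0 (2 * PI) Hc) as H2.
apply C_eq; simpl; [rewrite RInt_Rminus|rewrite RInt_Rplus];
  try rewrite !RInt_Rscal; auto; apply (ex_RInt_scal (V := R_NormedModule)); auto.
Qed.

Lemma CI_minus c d : (forall t, ccont c t) -> (forall t, ccont d t) ->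
  CI (fun t => c t - d t)%C = (CI c - CI d)%C.
Proof.
intros Hc Hd. rewrite (CI_ext _ (fun t => c t + (- (1)) * d t)%C) by (intros; ring).
rewrite CI_plus, CI_scal; auto; [ring|]. intros; apply ccont_mult; auto; apply ccont_const.
Qed.

Lemma CI_bound c M : (forall t, ccont c t) -> (forall t, Cmod (c t) <= M) -> Cmod (CI c) <= 4 * PI * M.
Proof.
intros Hc HM. pose proof PI_RGT_0. eapply Rle_trans; [apply Cmod_le_abs|]. unfold CI; simpl.
assert (Rabs (RInt (fun t => fst (c t)) 0 (2 * PI)) <= (2 * PI - 0) * M).
{ apply abs_RInt_le_const; [lra|apply ex_fst; auto|]. intros t _. eapply Rle_trans; [apply Cmod_fst_le|auto]. }
assert (Rabs (RInt (fun t => snd (c t)) 0 (2 * PI)) <= (2 * PI - 0) * M).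
{ apply abs_RInt_le_const; [lra|apply ex_snd; auto|]. intros t _. eapply Rle_trans; [apply Cmod_snd_le|auto]. }
lra.
Qed.

Lemma e1_minus_ge z t : 1 - Cmod z <= Cmod (e1 t - z)%C.
Proof. pose proof (Cmod_minus_ge (e1 t) z). rewrite Cmod_e1 in *; auto. Qed.

Lemma e1_minus_neq0 z t : Cmod z < 1 -> (e1 t - z)%C <> 0%C.
Proof. intros H. apply Cmod_neq0. pose proof (e1_minus_ge z t); lra. Qed.

(** On the circle e/(e - z) equals the Poisson kernel times (1 - conj z e)/(1 - |z|^2). The Cauchy
    integral of g is thus the Poisson integral of a function G that is again holomorphic and
    satisfies G(z) = g(z). *)
Lemma cauchy_formula rho g z : 1 < rho -> holR rho g -> Cmod z < 1 ->
  CI (fun t => g (e1 t) * (e1 t / (e1 t - z)))%C = (RtoC (2 * PI) * g z)%C.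
Proof.
intros Hr Hg Hz.
set (k := (/ (1 - Cconj z * z))%C).
assert (Hk : (1 - Cconj z * z)%C <> 0%C).
{ apply C1_minus_neq0. rewrite Cmod_mult, Cmod_conj. pose proof (Cmod_ge_0 z); nra. }
set (G := fun w => (g w * (1 - Cconj z * w) * k)%C).
assert (HG : holR rho G).
{ intros w Hw. destruct (Hg w Hw) as [l Hl]. eexists. unfold G.
  apply cdiff_mult; [apply cdiff_mult; [exact Hl|]|apply cdiff_const].
  apply cdiff_minus; [apply cdiff_const|apply cdiff_scal, cdiff_id]. }
assert (HGz : G z = g z) by (unfold G, k; field; auto).
assert (E : forall t, (g (e1 t) * (e1 t / (e1 t - z)))%C = (RtoC (PK z t) * G (e1 t))%C).
{ intros t. unfold G, k, PK.
  pose proof (PK_den z t Hz) as Hd.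
  rewrite RtoC_div, RtoC_minus, !Cmod2_conj by (apply pow_nonzero; lra).
  pose proof (e1_minus_neq0 z t Hz) as Hn.
  assert (Hc : Cconj (e1 t - z)%C <> 0%C).
  { apply Cmod_neq0. rewrite Cmod_conj. auto. }
  assert (E1 : (1 - Cconj z * e1 t)%C = (e1 t * Cconj (e1 t - z))%C).
  { transitivity (e1 t * Cconj (e1 t) - Cconj z * e1 t)%C; [rewrite e1_conj; auto|].
    apply C_eq; destruct z, (e1 t); simpl; ring. }
  rewrite E1. rewrite (Cmult_comm z). field. auto. }
(* The Poisson formula is about real parts; multiplication by -i gives the imaginary part. *)
assert (HIG : holR rho (fun w => - Ci * G w)%C).
{ intros w Hw. destruct (HG w Hw) as [l Hl]. eexists. apply cdiff_scal; eauto. }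
assert (HiG : forall w : C, fst (- Ci * w)%C = snd w) by (intros []; simpl; ring).
assert (Hrs : forall (x : R) (w : C), fst (RtoC x * w)%C = x * fst w /\ snd (RtoC x * w)%C = x * snd w)
  by (intros x []; simpl; split; ring).
rewrite <- HGz. rewrite (CI_ext _ _ E). unfold CI. apply C_eq; cbn [fst snd];
  [rewrite (proj1 (Hrs (2 * PI) (G z)))|rewrite (proj2 (Hrs (2 * PI) (G z)))].
- rewrite (RInt_Rext _ (fun t => PK z t * fst (G (e1 t)))) by (intros; apply Hrs).
  apply (poisson_formula rho G z); auto.
- rewrite (RInt_Rext _ (fun t => PK z t * fst ((fun w => - Ci * G w)%C (e1 t)))).
  + rewrite (poisson_formula rho (fun w => - Ci * G w)%C z); auto. rewrite HiG. auto.
  + intros; rewrite HiG. apply Hrs.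
Qed.

Section Kernel.

Variables (c : R -> C) (M : R).
Hypothesis Hc : forall t, ccont c t.
Hypothesis HM : forall t, Cmod (c t) <= M.

(** Cauchy-type integral of a continuous density. Its derivative is n times [CK (S n)]; this is
    needed only for n = 1 and n = 2, which suffices to differentiate f twice. *)
Definition CK (n : nat) (z : C) : C := CI (fun t => c t / (e1 t - z) ^ n)%C.

Lemma Cpow_neq0 (z : C) n : z <> 0%C -> (z ^ n)%C <> 0%C.
Proof.
intros H. apply Cmod_neq0. rewrite Cmod_pow. apply pow_lt. apply Cmod_gt_0; auto.
Qed.

Lemma ccont_pow {U : UniformSpace} (f : U -> C) n x : ccont f x -> ccont (fun y => f y ^ n)%C x.
Proof. intros H; induction n; simpl; [apply ccont_const|apply ccont_mult; auto]. Qed.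

Lemma ccont_e1m z t : ccont (fun t => e1 t - z)%C t.
Proof. apply ccont_minus; [apply ccont_e1|apply ccont_const]. Qed.

Lemma CK_cont n z t : Cmod z < 1 -> ccont (fun t => c t / (e1 t - z) ^ n)%C t.
Proof.
intros Hz. apply ccont_div; auto.
- apply ccont_pow, ccont_minus; [apply ccont_e1|apply ccont_const].
- apply Cpow_neq0, e1_minus_neq0; auto.
Qed.

Lemma Cmod_div_le a b A B : 0 < B -> Cmod a <= A -> B <= Cmod b -> Cmod (a / b)%C <= A / B.
Proof.
intros HB Ha Hb. rewrite Cmod_div by (apply Cmod_neq0; lra). unfold Rdiv.
pose proof (Cmod_ge_0 a).
apply Rmult_le_compat; auto; [left; apply Rinv_0_lt_compat; lra|apply Rinv_le_contravar; auto].
Qed.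

Lemma M_ge0 : 0 <= M.
Proof. eapply Rle_trans; [apply Cmod_ge_0|apply (HM 0)]. Qed.

Lemma CK1_taylor z h eta : 0 < eta -> Cmod z + 2 * eta <= 1 -> Cmod h <= eta ->
  Cmod (CK 1 (z + h)%C - CK 1 z - h * CK 2 z)%C <= 4 * PI * M / (4 * eta ^ 3) * Cmod h ^ 2.
Proof.
intros He Hz Hh. pose proof PI_RGT_0. pose proof M_ge0. pose proof (Cmod_ge_0 h).
assert (Hz1 : Cmod z < 1) by lra.
assert (Hzh : Cmod (z + h)%C < 1) by (pose proof (Cmod_triangle z h); lra).
(* Partial fractions give the second-order remainder exactly; it is then bounded by means of |e1 t -
   z| >= 2 eta and |e1 t - z - h| >= eta. *)
assert (E : (CK 1 (z + h) - CK 1 z - h * CK 2 z)%C =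
   (h * h * CI (fun t => c t / ((e1 t - (z + h)) * (e1 t - z) ^ 2)))%C).
{ unfold CK. rewrite <- CI_scal by (intros; apply CK_cont; auto).
  rewrite <- CI_minus; try (intros; apply CK_cont; auto).
  rewrite <- CI_minus.
  - rewrite <- CI_scal.
    + apply CI_ext. intros t. pose proof (e1_minus_neq0 _ t Hz1). pose proof (e1_minus_neq0 _ t Hzh).
      simpl. field. split; auto.
    + intros t. apply ccont_div; auto.
      * apply ccont_mult; [apply ccont_e1m|apply ccont_pow, ccont_e1m].
      * apply Cmult_neq_0; [|apply Cpow_neq0]; apply e1_minus_neq0; auto.
  - intros t. apply ccont_minus; apply CK_cont; auto.
  - intros t. apply ccont_mult; [apply ccont_const|apply CK_cont; auto]. }
rewrite E, !Cmod_mult.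
assert (B : Cmod (CI (fun t => c t / ((e1 t - (z + h)) * (e1 t - z) ^ 2))%C) <= 4 * PI * (M / (4 * eta ^ 3))).
{ apply CI_bound.
  - intros t. apply ccont_div; auto.
    + apply ccont_mult; [apply ccont_e1m|apply ccont_pow, ccont_e1m].
    + apply Cmult_neq_0; [|apply Cpow_neq0]; apply e1_minus_neq0; auto.
  - intros t. apply Cmod_div_le; auto.
    + apply Rmult_lt_0_compat; [lra|apply pow_lt; auto].
    + rewrite Cmod_mult, Cmod_pow. pose proof (e1_minus_ge z t). pose proof (e1_minus_ge (z + h) t).
      pose proof (Cmod_triangle z h).
      replace (4 * eta ^ 3) with (eta * (2 * eta) ^ 2) by ring.
      apply Rmult_le_compat; try lra; [apply pow_le; lra|apply pow_incr; lra]. }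
apply Rle_trans with (Cmod h * Cmod h * (4 * PI * (M / (4 * eta ^ 3)))).
- apply Rmult_le_compat_l; auto. nra.
- apply Req_le. field. lra.
Qed.

Lemma CK2_taylor z h eta : 0 < eta -> Cmod z + 2 * eta <= 1 -> Cmod h <= eta ->
  Cmod (CK 2 (z + h)%C - CK 2 z - h * (2 * CK 3 z))%C <= 4 * PI * (8 * M / (8 * eta ^ 5)) * Cmod h ^ 2.
Proof.
intros He Hz Hh. pose proof PI_RGT_0. pose proof M_ge0. pose proof (Cmod_ge_0 h).
assert (Hz1 : Cmod z < 1) by lra. pose proof (Cmod_ge_0 z).
assert (Hzh : Cmod (z + h)%C < 1) by (pose proof (Cmod_triangle z h); lra).
assert (Hcc : forall t, ccont (fun t => c t * (3 * (e1 t - z) - 2 * h) / ((e1 t - (z + h)) ^ 2 * (e1 t - z) ^ 3))%C t).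
{ intros t. apply ccont_div.
  - apply ccont_mult; auto. apply ccont_minus; [apply ccont_mult; [apply ccont_const|]|apply ccont_const].
    apply ccont_minus; [apply ccont_e1|apply ccont_const].
  - apply ccont_mult; apply ccont_pow, ccont_e1m.
  - apply Cmult_neq_0; apply Cpow_neq0; apply e1_minus_neq0; auto. }
assert (E : (CK 2 (z + h) - CK 2 z - h * (2 * CK 3 z))%C =
   (h * h * CI (fun t => c t * (3 * (e1 t - z) - 2 * h) / ((e1 t - (z + h)) ^ 2 * (e1 t - z) ^ 3)))%C).
{ replace (h * (2 * CK 3 z))%C with (h * 2 * CK 3 z)%C by ring. unfold CK.
  rewrite <- CI_scal by (intros; apply CK_cont; auto).
  rewrite <- CI_minus; try (intros; apply CK_cont; auto).
  rewrite <- CI_minus.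
  - rewrite <- CI_scal by auto.
    apply CI_ext. intros t. pose proof (e1_minus_neq0 _ t Hz1). pose proof (e1_minus_neq0 _ t Hzh).
    simpl. field. split; auto.
  - intros t. apply ccont_minus; apply CK_cont; auto.
  - intros t. apply ccont_mult; [apply ccont_const|apply CK_cont; auto]. }
rewrite E, !Cmod_mult.
assert (B : Cmod (CI (fun t => c t * (3 * (e1 t - z) - 2 * h) / ((e1 t - (z + h)) ^ 2 * (e1 t - z) ^ 3))%C)
    <= 4 * PI * (8 * M / (8 * eta ^ 5))).
{ apply CI_bound; auto.
  intros t. apply Cmod_div_le; auto.
    + apply Rmult_lt_0_compat; [lra|apply pow_lt; auto].
    + rewrite Cmod_mult.
      assert (Cmod (3 * (e1 t - z) - 2 * h)%C <= 8).
      { eapply Rle_trans; [apply Cmod_minus_le|]. rewrite !Cmod_mult, !Cmod_R.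
        rewrite !Rabs_pos_eq by lra. pose proof (Cmod_minus_le (e1 t) z). rewrite Cmod_e1 in *. lra. }
      rewrite (Rmult_comm 8). apply Rmult_le_compat; auto using Cmod_ge_0.
    + rewrite Cmod_mult, !Cmod_pow. pose proof (e1_minus_ge z t). pose proof (e1_minus_ge (z + h) t).
      pose proof (Cmod_triangle z h).
      replace (8 * eta ^ 5) with (eta ^ 2 * (2 * eta) ^ 3) by ring.
      apply Rmult_le_compat; try (apply pow_le; lra); apply pow_incr; lra. }
apply Rle_trans with (Cmod h * Cmod h * (4 * PI * (8 * M / (8 * eta ^ 5)))).
- apply Rmult_le_compat_l; auto. nra.
- apply Req_le. ring.
Qed.

End Kernel.

Lemma cdiff_of_taylor f z l K d : 0 < d -> 0 <= K ->
  (forall h, Cmod h <= d -> Cmod (f (z + h)%C - f z - h * l)%C <= K * Cmod h ^ 2) -> cdiff f z l.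
Proof.
intros Hd HK H. apply cdiff_eps. intros eps He.
exists (Rmin d (eps / (K + 1))). split; [apply Rmin_pos; auto; apply Rdiv_lt_0_compat; lra|].
intros w Hw. pose proof (Rlt_le_trans _ _ _ Hw (Rmin_l _ _)). pose proof (Rlt_le_trans _ _ _ Hw (Rmin_r _ _)) as H2.
specialize (H (w - z)%C ltac:(lra)). replace (z + (w - z))%C with w in H by ring.
rewrite (Cmult_comm l). eapply Rle_trans; [exact H|]. pose proof (Cmod_ge_0 (w - z)%C).
assert (Cmod (w - z) * (K + 1) <= eps).
{ apply (Rmult_lt_compat_r (K + 1)) in H2; [|lra]. unfold Rdiv in H2.
  rewrite Rmult_assoc, Rinv_l in H2; lra. }
nra.
Qed.

Lemma continuous_bounded_circle (u : R -> R) : (forall t, continuous u t) -> (forall t, u (t + 2 * PI) = u t) ->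
  exists M, forall t, u t <= M.
Proof.
intros Hu Hp. pose proof PI_RGT_0.
destruct (continuity_ab_maj u 0 (2 * PI)) as [m [Hm _]]; [lra| |].
{ intros; apply continuity_pt_filterlim; apply Hu. }
assert (HpZ : forall n t, u (t + INR n * (2 * PI)) = u t).
{ induction n; intros t; [simpl; f_equal; ring|]. rewrite S_INR.
  replace (t + (INR n + 1) * (2 * PI)) with (t + INR n * (2 * PI) + 2 * PI) by ring. rewrite Hp; auto. }
assert (Hpos : forall t, 0 <= t -> u t <= u m).
{ intros t Ht. destruct (nfloor_ex (t / (2 * PI))) as [n Hn]; [apply Rdiv_le_0_compat; lra|].
  assert (E : t = t / (2 * PI) * (2 * PI)) by (field; lra).
  replace t with (t - INR n * (2 * PI) + INR n * (2 * PI)) by ring. rewrite HpZ. apply Hm.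
  split; nra. }
exists (u m). intros t. destruct (Rle_lt_dec 0 t); auto.
destruct (nfloor_ex (- t / (2 * PI))) as [n Hn]; [apply Rdiv_le_0_compat; lra|].
assert (E : - t = - t / (2 * PI) * (2 * PI)) by (field; lra).
rewrite <- (HpZ (S n)). apply Hpos. rewrite S_INR. nra.
Qed.

Lemma circle_bound rho g r : holR rho g -> 0 <= r < rho -> exists M, forall t, Cmod (g (polar r t)) <= M.
Proof.
intros Hg Hr. apply (continuous_bounded_circle (fun t => Cmod (g (polar r t)))).
- intros t. apply rcont_Cmod. eapply ccont_circle; eauto.
- intros t. rewrite polar_period; auto.
Qed.

Section CauchyDer.

Variables (rho : R) (g : C -> C) (M : R).
Hypothesis Hrho : 1 < rho.
Hypothesis Hg : holR rho g.
Hypothesis HM : forall t, Cmod (g (e1 t)) <= M.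

Definition cker (t : R) : C := (g (e1 t) * e1 t / RtoC (2 * PI))%C.

Lemma twopi_neq0 : RtoC (2 * PI) <> 0%C.
Proof. intros E. apply RtoC_inj in E. pose proof PI_RGT_0; lra. Qed.

Lemma cker_cont t : ccont cker t.
Proof.
apply ccont_div; [|apply ccont_const|apply twopi_neq0]. apply ccont_mult; [|apply ccont_e1].
apply (ccont_circle rho); auto; lra.
Qed.

Lemma cker_bound t : Cmod (cker t) <= M / (2 * PI).
Proof.
pose proof PI_RGT_0. unfold cker. rewrite Cmod_div by apply twopi_neq0. rewrite Cmod_mult, Cmod_e1, Rmult_1_r.
rewrite Cmod_R, Rabs_pos_eq by lra. apply Rmult_le_compat_r; auto. left; apply Rinv_0_lt_compat; lra.
Qed.

Lemma CK1_eq z : Cmod z < 1 -> CK cker 1 z = g z.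
Proof.
intros Hz. pose proof (cauchy_formula rho g z Hrho Hg Hz) as H.
unfold CK, cker.
rewrite (CI_ext _ (fun t => / RtoC (2 * PI) * (g (e1 t) * (e1 t / (e1 t - z))))%C).
- rewrite CI_scal.
  + rewrite H. field. apply twopi_neq0.
  + intros t. apply ccont_mult; [apply (ccont_circle rho); auto; lra|].
    apply ccont_div; [apply ccont_e1| |apply e1_minus_neq0; auto].
    apply ccont_minus; [apply ccont_e1|apply ccont_const].
- intros t. pose proof (e1_minus_neq0 z t Hz). pose proof twopi_neq0. simpl. field. auto.
Qed.

Lemma hol_taylor z h eta : 0 < eta -> Cmod z + 2 * eta <= 1 -> Cmod h <= eta ->
  Cmod (g (z + h)%C - g z - h * CK cker 2 z)%C <= M / (2 * eta ^ 3) * Cmod h ^ 2.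
Proof.
intros He Hz Hh. pose proof PI_RGT_0.
assert (Cmod (z + h)%C < 1) by (pose proof (Cmod_triangle z h); lra).
rewrite <- (CK1_eq z), <- (CK1_eq (z + h)%C) by lra.
eapply Rle_trans; [apply (CK1_taylor cker (M / (2 * PI)) cker_cont cker_bound z h eta); auto|].
apply Req_le. field. lra.
Qed.

Lemma hol_der z : Cmod z < 1 -> cdiff g z (CK cker 2 z).
Proof.
intros Hz. assert (HM0 : 0 <= M) by (eapply Rle_trans; [apply Cmod_ge_0|apply (HM 0)]).
set (eta := (1 - Cmod z) / 2). assert (0 < eta) by (unfold eta; lra).
apply (cdiff_of_taylor g z _ (M / (2 * eta ^ 3)) eta); auto.
- apply Rdiv_le_0_compat; auto. apply Rmult_lt_0_compat; [lra|apply pow_lt; auto].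
- intros h Hh. apply hol_taylor; auto. unfold eta; lra.
Qed.

Lemma hol_der2 z : Cmod z < 1 -> exists l, cdiff (CK cker 2) z l.
Proof.
intros Hz. pose proof PI_RGT_0. assert (HM0 : 0 <= M) by (eapply Rle_trans; [apply Cmod_ge_0|apply (HM 0)]).
set (eta := (1 - Cmod z) / 2). assert (0 < eta) by (unfold eta; lra).
exists (2 * CK cker 3 z)%C.
apply (cdiff_of_taylor _ z _ (4 * PI * (8 * (M / (2 * PI)) / (8 * eta ^ 5))) eta); auto.
- assert (0 <= M / (2 * PI)) by (apply Rdiv_le_0_compat; lra).
  apply Rmult_le_pos; [lra|]. apply Rdiv_le_0_compat; [lra|]. apply Rmult_lt_0_compat; [lra|apply pow_lt; auto].
- intros h Hh. apply (CK2_taylor cker (M / (2 * PI)) cker_cont cker_bound z h eta); auto. unfold eta; lra.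
Qed.

(* (g(z) - g(0)) / z is the Cauchy integral of g(e)/e, hence holomorphic. *)
Lemma hol_quotient z : Cmod z < 1 -> g z = (g 0%C + z * CK (fun t => g (e1 t) / RtoC (2 * PI))%C 1 z)%C.
Proof.
intros Hz. rewrite <- (CK1_eq z), <- (CK1_eq 0%C) by (auto; rewrite Cmod_0; lra).
assert (Hz0 : Cmod 0 < 1) by (rewrite Cmod_0; lra).
assert (Hcc : forall t, ccont (fun t => g (e1 t) / RtoC (2 * PI))%C t).
{ intros t. apply ccont_div; [|apply ccont_const|apply twopi_neq0]. apply (ccont_circle rho); auto; lra. }
unfold CK. rewrite <- CI_scal.
- rewrite <- CI_plus.
  + apply CI_ext. intros t. unfold cker. pose proof (e1_minus_neq0 z t Hz). pose proof (e1_minus_neq0 0 t Hz0) as He.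
    pose proof twopi_neq0. replace (e1 t - 0)%C with (e1 t) in * by ring. simpl. field. auto.
  + intros t. apply CK_cont; auto. apply cker_cont.
  + intros t. apply ccont_mult; [apply ccont_const|]. apply CK_cont; auto.
- intros t. apply CK_cont; auto.
Qed.

End CauchyDer.

Lemma holR_dilate rho f z0 r : 0 < r -> holR 1 f -> Cmod z0 + r * rho <= 1 ->
  holR rho (fun w => f (z0 + RtoC r * w)%C).
Proof.
intros Hr Hf H w Hw.
destruct (Hf (z0 + RtoC r * w)%C) as [l Hl].
{ eapply Rle_lt_trans; [apply Cmod_triangle|]. rewrite Cmod_mult, Cmod_R, Rabs_pos_eq by lra. nra. }
eexists. apply (cdiff_comp f (fun w => z0 + RtoC r * w)%C); [|exact Hl].
apply cdiff_plus; [apply cdiff_const|apply cdiff_scal, cdiff_id].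
Qed.

(** After dilation by a radius r between |z| and 1 the function is holomorphic beyond the unit
    circle, so f' is near z a rescaled [CK 2], and Cauchy integrals are differentiable. *)
Lemma holoD_derive f : holoD f -> holoD (C_derive f).
Proof.
intros Hf. apply holR_1 in Hf. change (holR 1 (C_derive f)). intros z Hz.
pose proof (Cmod_ge_0 z).
set (r := (1 + Cmod z) / 2). assert (Hr : 0 < r) by (unfold r; lra).
assert (Hr1 : r < 1) by (unfold r; lra). assert (Hzr : Cmod z < r) by (unfold r; lra).
set (g := fun w => f (0 + RtoC r * w)%C).
assert (Hg : holR (/ r) g).
{ apply holR_dilate; auto. rewrite Cmod_0, Rinv_r; lra. }
assert (Hir : 1 < / r) by (rewrite <- Rinv_1 at 1; apply Rinv_lt_contravar; lra).
destruct (circle_bound (/ r) g 1 Hg ltac:(lra)) as [M HM].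
assert (Hrc : RtoC r <> 0%C) by (intros E; apply RtoC_inj in E; lra).
assert (Hmr : forall w, Cmod (w / RtoC r)%C = Cmod w / r).
{ intros w. rewrite Cmod_div, Cmod_R, Rabs_pos_eq by (auto; lra). auto. }
assert (Hlt : forall w, Cmod w < r -> Cmod (w / RtoC r)%C < 1).
{ intros w Hw. rewrite Hmr. apply Rmult_lt_reg_r with r; auto. unfold Rdiv. rewrite Rmult_assoc, Rinv_l; lra. }
assert (Hder : forall w, Cmod w < r -> (CK (cker g) 2 (w / RtoC r) / RtoC r)%C = C_derive f w).
{ intros w Hw. symmetry. apply is_C_derive_unique.
  pose proof (hol_der (/ r) g M Hir Hg HM (w / RtoC r)%C (Hlt w Hw)) as Hd.
  apply (cdiff_ext (fun v => g (v / RtoC r)%C)).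
  { intros v. unfold g. f_equal. field; auto. }
  eapply cdiff_val; [|apply (cdiff_comp g (fun v => v / RtoC r)%C); [|exact Hd]].
  2: apply (cdiff_ext (fun v => / RtoC r * v)%C); [intros; unfold Cdiv; ring|apply cdiff_scal, cdiff_id].
  field; auto. }
destruct (hol_der2 (/ r) g M Hir Hg HM (z / RtoC r)%C (Hlt z Hzr)) as [l Hl].
eexists. apply (cdiff_ext_loc (fun w => / RtoC r * CK (cker g) 2 (w / RtoC r))%C _ z _ (r - Cmod z)); [lra| |].
- intros w Hw. rewrite <- Hder; [unfold Cdiv; ring|].
  replace w with (z + (w - z))%C by ring. pose proof (Cmod_triangle z (w - z)). lra.
- apply cdiff_scal. apply (cdiff_comp (CK (cker g) 2) (fun w => w / RtoC r)%C).
  + apply (cdiff_ext (fun v => / RtoC r * v)%C); [intros; unfold Cdiv; ring|apply cdiff_scal, cdiff_id].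
  + exact Hl.
Qed.

Lemma holoD_cdiff f z : holoD f -> Cmod z < 1 -> cdiff f z (C_derive f z).
Proof. intros Hf Hz. apply holR_1 in Hf. apply (holR_derive 1); auto. Qed.

(** Cauchy estimates on the disc of radius r. They are twice the sharp ones because [CI_bound]
    treats real and imaginary parts separately. The centre stays fixed and only the sup bound B
    enters, so they apply uniformly to families. *)
Lemma taylor_bounds f z0 r B : holoD f -> 0 < r -> Cmod z0 + r < 1 ->
  (forall w, Cmod (w - z0)%C <= r -> Cmod (f w) <= B) ->
  Cmod (C_derive f z0) <= 2 * B / r /\
  forall h, Cmod h <= r / 2 -> Cmod (f (z0 + h)%C - f z0 - h * C_derive f z0)%C <= 4 * B * (Cmod h / r) ^ 2 /\
     Cmod (f (z0 + h)%C - f z0)%C <= 6 * B * (Cmod h / r).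
Proof.
intros Hf Hr Hzr HB. pose proof PI_RGT_0. pose proof (Cmod_ge_0 z0).
pose proof (proj2 (holR_1 f) Hf) as Hf'.
set (g := fun w => f (z0 + RtoC r * w)%C).
set (rho := (1 - Cmod z0) / r).
assert (Hrr : rho * r = 1 - Cmod z0) by (unfold rho; field; lra).
assert (Hrho : 1 < rho) by (apply Rmult_lt_reg_r with r; lra).
assert (Hg : holR rho g) by (apply holR_dilate; auto; lra).
assert (HM : forall t, Cmod (g (e1 t)) <= B).
{ intros t. apply HB. replace (z0 + RtoC r * e1 t - z0)%C with (RtoC r * e1 t)%C by ring.
  rewrite Cmod_mult, Cmod_e1, Cmod_R, Rabs_pos_eq; lra. }
assert (HB0 : 0 <= B) by (eapply Rle_trans; [apply Cmod_ge_0|apply (HM 0)]).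
assert (Hrc : RtoC r <> 0%C) by (intros E; apply RtoC_inj in E; lra).
assert (Hz00 : Cmod 0 < 1) by (rewrite Cmod_0; lra).
assert (Hder : CK (cker g) 2 0 = (RtoC r * C_derive f z0)%C).
{ apply (cdiff_unique g 0%C); [apply (hol_der rho g B); auto|].
  unfold g. eapply cdiff_val; [|apply (cdiff_comp f (fun w => z0 + RtoC r * w)%C)].
  2: apply cdiff_plus; [apply cdiff_const|apply cdiff_scal, cdiff_id].
  2: replace (z0 + RtoC r * 0)%C with z0 by ring; apply holoD_cdiff; auto; lra. ring. }
assert (D1 : Cmod (C_derive f z0) <= 2 * B / r).
{ assert (H2 : Cmod (CK (cker g) 2 0) <= 4 * PI * (B / (2 * PI))).
  { unfold CK. apply CI_bound.
    - intros; apply CK_cont; auto. intros; apply (cker_cont rho); auto.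
    - intros t. replace (B / (2 * PI)) with (B / (2 * PI) / 1) by (field; lra).
      apply Cmod_div_le; [lra|apply cker_bound; auto|].
      replace (e1 t - 0)%C with (e1 t) by ring. rewrite Cmod_pow, Cmod_e1. lra. }
  rewrite Hder, Cmod_mult, Cmod_R, Rabs_pos_eq in H2 by lra.
  apply Rmult_le_reg_l with r; auto. eapply Rle_trans; [exact H2|]. apply Req_le; field. lra. }
split; auto. intros h Hh.
set (k := (h / RtoC r)%C).
assert (Hk : Cmod k = Cmod h / r) by (unfold k; rewrite Cmod_div, Cmod_R, Rabs_pos_eq by (auto; lra); auto).
assert (Hk2 : Cmod k <= / 2).
{ rewrite Hk. apply Rmult_le_reg_r with r; auto. unfold Rdiv. rewrite Rmult_assoc, Rinv_l; lra. }
assert (HT : Cmod (f (z0 + h)%C - f z0 - h * C_derive f z0)%C <= 4 * B * (Cmod h / r) ^ 2).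
{ pose proof (hol_taylor rho g B Hrho Hg HM 0%C k (/ 2) ltac:(lra) ltac:(rewrite Cmod_0; lra) Hk2) as T.
  rewrite Hder in T. unfold g in T. rewrite Hk in T.
  replace (z0 + RtoC r * (0 + k))%C with (z0 + h)%C in T by (unfold k; field; auto).
  replace (z0 + RtoC r * 0)%C with z0 in T by ring.
  replace (k * (RtoC r * C_derive f z0))%C with (h * C_derive f z0)%C in T by (unfold k; field; auto).
  eapply Rle_trans; [exact T|]. apply Req_le. field. lra. }
split; auto.
replace (f (z0 + h) - f z0)%C with ((f (z0 + h) - f z0 - h * C_derive f z0) + h * C_derive f z0)%C by ring.
eapply Rle_trans; [apply Cmod_triangle|]. rewrite Cmod_mult.
rewrite <- Hk in HT |- *. pose proof (Cmod_ge_0 k).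
assert (Eh : Cmod h = Cmod k * r) by (rewrite Hk; field; lra).
assert (Cmod h * Cmod (C_derive f z0) <= 2 * B * Cmod k).
{ rewrite Eh. replace (2 * B * Cmod k) with (Cmod k * r * (2 * B / r)) by (field; lra).
  apply Rmult_le_compat_l; auto. nra. }
assert (0 <= B * Cmod k * (/ 2 - Cmod k)) by (repeat apply Rmult_le_pos; lra).
nra.
Qed.

(** * Real powers and integrals with a parameter *)

Lemma Rpower_pos x y : 0 < Rpower x y.
Proof. apply exp_pos. Qed.

Lemma rpow_ge0 x q : 0 <= rpow x q.
Proof. unfold rpow. destruct Rlt_dec; [left; apply Rpower_pos|lra]. Qed.

Lemma rpow_pos x q : 0 < x -> rpow x q = Rpower x q.
Proof. intros H. unfold rpow. destruct Rlt_dec; auto; lra. Qed.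

Lemma rpow_gt0 x q : 0 < x -> 0 < rpow x q.
Proof. intros H. rewrite rpow_pos by auto. apply Rpower_pos. Qed.

Lemma rpow_0 q : rpow 0 q = 0.
Proof. unfold rpow. destruct Rlt_dec; auto; lra. Qed.

Lemma rpow_neg x q : x <= 0 -> rpow x q = 0.
Proof. intros. unfold rpow. destruct Rlt_dec; auto; lra. Qed.

Lemma rpow_le x y q : 0 < q -> x <= y -> rpow x q <= rpow y q.
Proof.
intros Hq H. destruct (Rlt_dec 0 x) as [Hx|Hx].
- rewrite !rpow_pos by lra. apply Rle_Rpower_l; lra.
- rewrite (rpow_neg x) by lra. apply rpow_ge0.
Qed.

Lemma rpow_lt x y q : 0 < q -> 0 <= x -> x < y -> rpow x q < rpow y q.
Proof.
intros Hq Hx H. destruct (Rlt_dec 0 x) as [Hx'|Hx'].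
- rewrite !rpow_pos by lra. apply Rlt_Rpower_l; lra.
- rewrite (rpow_neg x) by lra. apply rpow_gt0; lra.
Qed.

Lemma rpow_mult x y q : 0 <= x -> 0 <= y -> rpow (x * y) q = rpow x q * rpow y q.
Proof.
intros [Hx| <-] [Hy| <-]; rewrite ?Rmult_0_l, ?Rmult_0_r, ?rpow_0, ?Rmult_0_l, ?Rmult_0_r; auto.
rewrite !rpow_pos by (auto; apply Rmult_lt_0_compat; auto). symmetry; apply Rpower_mult_distr; auto.
Qed.

Lemma rpow_rpow x q s : 0 <= x -> rpow (rpow x q) s = rpow x (q * s).
Proof.
intros [Hx| <-]; [|rewrite !rpow_0; auto].
rewrite (rpow_pos (rpow x q)) by (apply rpow_gt0; auto). rewrite !rpow_pos by auto. apply Rpower_mult.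
Qed.

Lemma rpow_1 x : 0 <= x -> rpow x 1 = x.
Proof. intros [Hx| <-]; [|apply rpow_0]. rewrite rpow_pos by auto. apply Rpower_1; auto. Qed.

Lemma rpow_inv_l x q : 0 < q -> 0 <= x -> rpow (rpow x q) (/ q) = x.
Proof. intros Hq Hx. rewrite rpow_rpow by auto. rewrite Rinv_r by lra. apply rpow_1; auto. Qed.

Lemma rpow_inv_r x q : 0 < q -> 0 <= x -> rpow (rpow x (/ q)) q = x.
Proof. intros Hq Hx. rewrite rpow_rpow by auto. rewrite Rinv_l by lra. apply rpow_1; auto. Qed.

Lemma rpow_one q : rpow 1 q = 1.
Proof. rewrite rpow_pos by lra. unfold Rpower. rewrite ln_1, Rmult_0_r, exp_0; auto. Qed.

Lemma rpow_plus x q s : 0 < x -> rpow x (q + s) = rpow x q * rpow x s.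
Proof. intros; rewrite !rpow_pos by auto. apply Rpower_plus. Qed.

Lemma rpow_inv x q : 0 < x -> rpow (/ x) q = / rpow x q.
Proof.
intros Hx. pose proof (rpow_gt0 x q Hx). pose proof (Rinv_0_lt_compat _ Hx).
apply Rmult_eq_reg_l with (rpow x q); [|lra].
rewrite <- rpow_mult, Rinv_r, Rinv_r, rpow_one by lra. auto.
Qed.

Lemma rpow_le_1 x q : 0 < q -> x <= 1 -> rpow x q <= 1.
Proof. intros. rewrite <- (rpow_one q). apply rpow_le; auto. Qed.

(* Compare y with mu x, where (1 + mu)^q = 1 + lam. *)
Lemma rpow_add_lam q lam : 0 < q -> 0 < lam ->
  exists K, 0 < K /\ forall x y, 0 <= x -> 0 <= y -> rpow (x + y) q <= (1 + lam) * rpow x q + K * rpow y q.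
Proof.
intros Hq Hl. set (mu := rpow (1 + lam) (/ q) - 1).
assert (Hmu : 0 < mu).
{ unfold mu. assert (rpow 1 (/ q) < rpow (1 + lam) (/ q)); [|rewrite rpow_one in *; lra].
  apply rpow_lt; try lra. apply Rinv_0_lt_compat; auto. }
assert (Hmu2 : rpow (1 + mu) q = 1 + lam).
{ unfold mu. replace (1 + (rpow (1 + lam) (/ q) - 1)) with (rpow (1 + lam) (/ q)) by ring.
  apply rpow_inv_r; lra. }
pose proof (Rinv_0_lt_compat _ Hmu) as Hi.
exists (rpow (/ mu + 1) q). split; [apply rpow_gt0; lra|]. intros x y Hx Hy.
pose proof (rpow_ge0 x q). pose proof (rpow_ge0 y q).
assert (0 < rpow (/ mu + 1) q) by (apply rpow_gt0; lra).
destruct (Rle_lt_dec y (mu * x)).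
- apply Rle_trans with (rpow ((1 + mu) * x) q); [apply rpow_le; auto; nra|].
  rewrite rpow_mult, Hmu2 by lra. nra.
- apply Rle_trans with (rpow ((/ mu + 1) * y) q).
  + apply rpow_le; auto. assert (x = / mu * (mu * x)) by (field; lra).
    assert (/ mu * (mu * x) <= / mu * y) by (apply Rmult_le_compat_l; lra). lra.
  + rewrite rpow_mult by lra. nra.
Qed.

Lemma rpow_add q x y : 0 < q -> 0 <= x -> 0 <= y -> rpow (x + y) q <= rpow 2 q * (rpow x q + rpow y q).
Proof.
intros Hq Hx Hy. pose proof (rpow_ge0 x q). pose proof (rpow_ge0 y q).
pose proof (rpow_gt0 2 q ltac:(lra)).
destruct (Rle_lt_dec x y).
- apply Rle_trans with (rpow (2 * y) q); [apply rpow_le; lra|]. rewrite rpow_mult by lra. nra.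
- apply Rle_trans with (rpow (2 * x) q); [apply rpow_le; lra|]. rewrite rpow_mult by lra. nra.
Qed.

Lemma continuity_pt_eps (f : R -> R) x : continuity_pt f x <->
  forall eps, 0 < eps -> exists d, 0 < d /\ forall y, Rabs (y - x) < d -> Rabs (f y - f x) < eps.
Proof.
split.
- intros H eps He. destruct (H eps He) as [d [Hd Hy]]. exists d; split; auto.
  intros y Hyd. destruct (Req_dec x y) as [->|]; [rewrite Rminus_diag, Rabs_R0; auto|].
  apply Hy. split; [split; [exact I|auto]|exact Hyd].
- intros H eps He. destruct (H eps He) as [d [Hd Hy]]. exists d; split; auto.
  intros y [_ Hyd]. apply Hy. exact Hyd.
Qed.

Lemma continuity_pt_Rpower x q : 0 < x -> continuity_pt (fun y => Rpower y q) x.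
Proof.
intros Hx. apply derivable_continuous_pt. exists (q * Rpower x (q - 1)).
apply derivable_pt_lim_power; auto.
Qed.

Lemma continuity_pt_rpow x q : 0 < q -> continuity_pt (fun y => rpow y q) x.
Proof.
intros Hq. destruct (Rtotal_order x 0) as [H|[->|H]].
- apply continuity_pt_eps. intros eps He. exists (- x). split; [lra|]. intros y Hy.
  apply Rabs_def2 in Hy. rewrite !rpow_neg by lra. rewrite Rminus_diag, Rabs_R0; auto.
- apply continuity_pt_eps. intros eps He. exists (rpow eps (/ q)). split; [apply rpow_gt0; auto|].
  intros y Hy. rewrite rpow_0, !Rminus_0_r in *. rewrite Rabs_pos_eq by apply rpow_ge0.
  destruct (Rle_lt_dec y 0); [rewrite rpow_neg; auto|].
  rewrite Rabs_pos_eq in Hy by lra.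
  rewrite <- (rpow_inv_r eps q) by lra. apply rpow_lt; lra.
- apply (continuity_pt_ext_loc (fun y => Rpower y q)).
  + exists (mkposreal x H). intros y Hy. apply Rabs_def2 in Hy.
    unfold minus, plus, opp in Hy; simpl in Hy. rewrite rpow_pos; auto. lra.
  + apply continuity_pt_Rpower; auto.
Qed.

Lemma rcont_rpow {U : UniformSpace} (f : U -> R) q x : 0 < q -> continuous f x ->
  continuous (fun y => rpow (f y) q) x.
Proof. intros Hq Hf. apply (rcont_comp f (fun y => rpow y q)); auto. apply continuity_pt_rpow; auto. Qed.

Lemma rcont_Rpower {U : UniformSpace} (f : U -> R) q x : 0 < f x -> continuous f x ->
  continuous (fun y => Rpower (f y) q) x.
Proof. intros Hq Hf. apply (rcont_comp f (fun y => Rpower y q)); auto. apply continuity_pt_Rpower; auto. Qed.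

(** * Integrals depending on a parameter *)

Lemma cont2_of_continuous (K : R -> R -> R) x y :
  continuous (T := prod_UniformSpace R_UniformSpace R_UniformSpace) (fun q : R * R => K (fst q) (snd q)) (x, y) ->
  continuity_2d_pt K x y.
Proof. intros H. apply continuity_2d_pt_filterlim. exact H. Qed.

Lemma cont2_section (K : R -> R -> R) x y : continuity_2d_pt K x y -> continuous (fun t => K x t) y.
Proof.
intros H. apply continuity_2d_pt_filterlim in H.
apply (continuous_comp (V := prod_UniformSpace R_UniformSpace R_UniformSpace)
   (fun t => (x, t)) (fun q : R * R => K (fst q) (snd q))); auto.
apply ccont_pair; simpl; [apply continuous_const|apply continuous_id].
Qed.

Lemma cont2_section_l (K : R -> R -> R) x y : continuity_2d_pt K x y -> continuous (fun t => K t y) x.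
Proof.
intros H. apply continuity_2d_pt_filterlim in H.
apply (continuous_comp (V := prod_UniformSpace R_UniformSpace R_UniformSpace)
   (fun t => (t, y)) (fun q : R * R => K (fst q) (snd q))); auto.
apply ccont_pair; simpl; [apply continuous_id|apply continuous_const].
Qed.

Lemma RInt_param_cont (K : R -> R -> R) a b x : a <= b ->
  (forall t, a <= t <= b -> continuity_2d_pt K x t) ->
  (forall y t, continuous (K y) t) ->
  continuous (fun y => RInt (K y) a b) x.
Proof.
intros Hab HK HKc. apply continuity_pt_filterlim. apply continuity_pt_eps. intros eps He.
assert (He2 : 0 < eps / (2 * (b - a + 1))) by (apply Rdiv_lt_0_compat; lra).
destruct (uniform_continuity_2d_1d' K a b x HK (mkposreal _ He2)) as [d Hd]. simpl in Hd.
exists d. split; [apply cond_pos|]. intros y Hy. apply Rabs_def2 in Hy. pose proof (cond_pos d).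
rewrite <- RInt_Rminus by (apply ex_RInt_cont; auto).
eapply Rle_lt_trans; [apply abs_RInt_le_const with (M := eps / (2 * (b - a + 1))); auto|].
- apply ex_RInt_cont. intros; apply rcont_minus; auto.
- intros t Ht. left. apply Hd; try lra. rewrite Rminus_diag, Rabs_R0; auto.
- apply Rle_lt_trans with (eps / 2); [|lra].
  apply Rle_trans with ((b - a + 1) * (eps / (2 * (b - a + 1)))); [apply Rmult_le_compat_r; lra|].
  apply Req_le. field. lra.
Qed.

Lemma is_derive_RInt_gen (f f' : R -> R -> R) a b s d : 0 < d ->
  (forall x t, Rabs (x - s) < d -> is_derive (fun u => f u t) x (f' x t)) ->
  (forall t, continuity_2d_pt f' s t) ->
  (forall x t, Rabs (x - s) < d -> continuous (f x) t) ->
  is_derive (fun x => RInt (f x) a b) s (RInt (f' s) a b).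
Proof.
intros Hd Hder Hc Hfc.
assert (Hloc : forall P : R -> Prop, (forall x, Rabs (x - s) < d -> P x) -> locally s P).
{ intros P HP. exists (mkposreal _ Hd). intros y Hy. apply HP. exact Hy. }
replace (RInt (f' s) a b) with (RInt (fun t => Derive (fun u => f u t) s) a b).
- apply is_derive_RInt_param.
  + apply Hloc. intros x Hx t _. exists (f' x t). apply Hder; auto.
  + intros t _. apply (continuity_2d_pt_ext_loc f').
    * exists (mkposreal _ Hd). intros u v Hu _. symmetry. apply is_derive_unique. apply Hder; auto.
    * apply Hc.
  + apply Hloc. intros x Hx. apply ex_RInt_cont. intros; apply Hfc; auto.
- apply RInt_Rext. intros t _. apply is_derive_unique. apply Hder. rewrite Rminus_diag, Rabs_R0; auto.
Qed.

(** As functions of the upper limit of the outer integral both sides vanish at a and have the same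
    derivative. *)
Lemma RInt_fubini (K : R -> R -> R) a b c d : a <= b -> c <= d ->
  (forall x y, continuity_2d_pt K x y) ->
  RInt (fun x => RInt (K x) c d) a b = RInt (fun y => RInt (fun x => K x y) a b) c d :> R.
Proof.
intros Hab Hcd HK.
assert (Hr : forall x y, continuous (K x) y) by (intros; apply cont2_section; auto).
assert (Hl : forall x y, continuous (fun x => K x y) x) by (intros; apply cont2_section_l; auto).
assert (Hk : forall x, continuous (fun x => RInt (K x) c d) x) by (intros; apply RInt_param_cont; auto).
set (J := (fun x => RInt (fun y => RInt (fun u => K u y) a x) c d) : R -> R).
assert (HJ : forall x, is_derive J x (RInt (K x) c d)).
{ intros x. unfold J. apply (is_derive_RInt_gen (fun x y => RInt (fun u => K u y) a x) K c d x 1); [lra| |auto|].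
  - intros x' t _. apply (is_derive_RInt (V := R_NormedModule) (fun u => K u t) (fun x => RInt (fun u => K u t) a x) a x'); [|apply Hl].
    exists (mkposreal 1 Rlt_0_1). intros y _. apply (RInt_correct (V := R_CompleteNormedModule)), ex_RInt_cont.
    intros; apply Hl.
  - intros x' t _. destruct (Rle_dec a x') as [H|H].
    + apply (RInt_param_cont (fun y u => K u y) a x' t); auto.
      intros u _. apply cont2_of_continuous. specialize (HK u t). apply continuity_2d_pt_filterlim in HK.
      apply (continuous_comp (V := prod_UniformSpace R_UniformSpace R_UniformSpace) (fun q : R * R => (snd q, fst q)) (fun q : R * R => K (fst q) (snd q))); auto.
      apply ccont_pair; simpl; [apply continuous_snd'|apply continuous_fst'].
    + apply (continuous_ext (fun y => - RInt (fun u => K u y) x' a)).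
      { intros y. apply (opp_RInt_swap (V := R_CompleteNormedModule)). apply ex_RInt_cont; auto. }
      apply rcont_opp. apply (RInt_param_cont (fun y u => K u y) x' a t); auto; [lra|].
      intros u _. apply cont2_of_continuous. specialize (HK u t). apply continuity_2d_pt_filterlim in HK.
      apply (continuous_comp (V := prod_UniformSpace R_UniformSpace R_UniformSpace) (fun q : R * R => (snd q, fst q)) (fun q : R * R => K (fst q) (snd q))); auto.
      apply ccont_pair; simpl; [apply continuous_snd'|apply continuous_fst']. }
assert (E : RInt (fun x => RInt (K x) c d) a b = J b - J a).
{ apply is_RInt_unique. apply (is_RInt_derive (V := R_CompleteNormedModule) J); intros; auto. }
rewrite E. unfold J.
rewrite (RInt_Rext (fun y => RInt (fun u => K u y) a a) (fun _ => 0)).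
- rewrite RInt_Rconst. ring.
- intros; apply (RInt_point (V := R_CompleteNormedModule)).
Qed.

(** * Subharmonicity of powers of the modulus *)

Lemma is_derive_Rmult (f g : R -> R) (x a b : R) : is_derive f x a -> is_derive g x b ->
  is_derive (fun t => f t * g t) x (a * g x + f x * b).
Proof. intros Hf Hg. apply (is_derive_mult (K := R_AbsRing) f g x a b); auto. intros; apply Rmult_comm. Qed.

Lemma is_derive_Rplus (f g : R -> R) (x a b : R) : is_derive f x a -> is_derive g x b ->
  is_derive (fun t => f t + g t) x (a + b).
Proof. intros. apply (is_derive_plus (K := R_AbsRing) (V := R_NormedModule) f g); auto. Qed.

Lemma is_derive_Rval (f : R -> R) (x a b : R) : a = b -> is_derive f x a -> is_derive f x b.
Proof. intros ->; auto. Qed.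

Section LogPolar.

Variables (A B X Y : R -> R) (eps q t a' b' x' y' : R).
Hypothesis He : 0 < eps.
Hypotheses (HA : is_derive A t a') (HB : is_derive B t b') (HX : is_derive X t x') (HY : is_derive Y t y').

Let N s := A s ^ 2 + B s ^ 2 + eps.

Lemma norm2_pos (u v : R) : 0 < u ^ 2 + v ^ 2 + eps.
Proof. pose proof (pow2_ge_0 u). pose proof (pow2_ge_0 v). lra. Qed.

Lemma is_derive_power_norm (r : R) :
  is_derive (fun s => Rpower (A s ^ 2 + B s ^ 2 + eps) r) t
    (2 * r * Rpower (A t ^ 2 + B t ^ 2 + eps) (r - 1) * (A t * a' + B t * b')).
Proof.
assert (HN : is_derive (fun s => A s ^ 2 + B s ^ 2 + eps) t (2 * (A t * a' + B t * b'))).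
{ apply (is_derive_ext (fun s => A s * A s + B s * B s - - eps)); [intros; simpl; ring|].
  apply is_derive_minus_const. eapply is_derive_Rval; [|apply is_derive_Rplus; apply is_derive_Rmult; eauto]. ring. }
assert (HP : is_derive (fun y => Rpower y r) (A t ^ 2 + B t ^ 2 + eps) (r * Rpower (A t ^ 2 + B t ^ 2 + eps) (r - 1))).
{ apply is_derive_Reals. apply derivable_pt_lim_power. apply norm2_pos. }
eapply is_derive_Rval; [|apply (is_derive_comp (fun y => Rpower y r) (fun s => A s ^ 2 + B s ^ 2 + eps) t _ _ HP HN)].
unfold scal; simpl; unfold mult; simpl. ring.
Qed.

(** The direction (X, Y) is kept separate from (A, B), so that the formula gives the second
    derivative both along s and along t. *)
Lemma is_derive_power_norm2 :
  is_derive (fun s => 2 * q * Rpower (A s ^ 2 + B s ^ 2 + eps) (q - 1) * (A s * X s + B s * Y s)) t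
    (4 * q * (q - 1) * Rpower (A t ^ 2 + B t ^ 2 + eps) (q - 2) * (A t * a' + B t * b') * (A t * X t + B t * Y t)
     + 2 * q * Rpower (A t ^ 2 + B t ^ 2 + eps) (q - 1) * (a' * X t + A t * x' + b' * Y t + B t * y')).
Proof.
pose proof (is_derive_power_norm (q - 1)) as HP.
eapply is_derive_Rval; [|apply is_derive_Rmult; [apply (is_derive_Rmult (fun _ => 2 * q)); [apply (is_derive_const (K := R_AbsRing) (V := R_NormedModule))|exact HP]|
   apply is_derive_Rplus; apply is_derive_Rmult; eauto]].
unfold zero; simpl. replace (q - 1 - 1) with (q - 2) by ring. ring.
Qed.

End LogPolar.

(** A smooth substitute for |z|^(2q): without [eps] the power need not be twice differentiable at
    the zeros of f. *)
Definition Phi (eps q : R) (z : C) : R := Rpower (fst z ^ 2 + snd z ^ 2 + eps) q.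

Section Submean.

Variables (f : C -> C) (eps q : R).
Hypothesis Hf : holoD f.
Hypothesis He : 0 < eps.
Hypothesis Hq : 0 < q.

Let D1 := C_derive f.
Let D2 := C_derive (C_derive f).
Let F (w : C) : C := f (Cexp w).
Let F1 (w : C) : C := (D1 (Cexp w) * Cexp w)%C.
Let F2 (w : C) : C := (D2 (Cexp w) * Cexp w * Cexp w + D1 (Cexp w) * Cexp w)%C.

Let Cexp_in w : fst w < 0 -> Cmod (Cexp w) < 1.
Proof.
intros H. destruct w as [s t]. rewrite Cexp_polar, Cmod_polar by (left; apply exp_pos).
rewrite <- exp_0. apply exp_increasing; auto.
Qed.

Let dF w : fst w < 0 -> cdiff F w (F1 w).
Proof.
intros H. apply (cdiff_comp f Cexp); [apply cdiff_Cexp|]. apply holoD_cdiff; auto.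
Qed.

Let dF1 w : fst w < 0 -> cdiff F1 w (F2 w).
Proof.
intros H. unfold F1, F2.
eapply cdiff_val; [|apply cdiff_mult; [apply (cdiff_comp D1 Cexp); [apply cdiff_Cexp|]|apply cdiff_Cexp]].
2: apply holoD_cdiff; auto; apply holoD_derive; auto. unfold D2, D1. ring.
Qed.

Let cF2 w : fst w < 0 -> ccont (U := C_UniformSpace) F2 w.
Proof.
intros H. assert (HD2 : holoD D2) by (apply holoD_derive, holoD_derive; auto).
assert (HD1 : holoD D1) by (apply holoD_derive; auto).
assert (HE : ccont (U := C_UniformSpace) Cexp w) by (eapply cdiff_ccont; apply cdiff_Cexp).
assert (ccont (U := C_UniformSpace) (fun w => D1 (Cexp w)) w)
  by (apply (ccont_comp_hol D1 Cexp w (C_derive D1 (Cexp w))); auto; apply holoD_cdiff; auto).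
assert (ccont (U := C_UniformSpace) (fun w => D2 (Cexp w)) w)
  by (apply (ccont_comp_hol D2 Cexp w (C_derive D2 (Cexp w))); auto; apply holoD_cdiff; auto).
unfold F2. apply ccont_plus; [apply ccont_mult; [apply ccont_mult|]|apply ccont_mult]; assumption.
Qed.

Let along_s (H : C -> C) s t l : cdiff H (s, t) l -> rdiff (fun x => H (x, t)) s l.
Proof.
intros Hd. replace l with (l * 1)%C by ring.
apply (rdiff_comp H (fun x => (x, t))); auto.
split; simpl; [apply (is_derive_id (K := R_AbsRing))|apply (is_derive_const (K := R_AbsRing) (V := R_NormedModule))].
Qed.

Let along_t (H : C -> C) s t l : cdiff H (s, t) l -> rdiff (fun x => H (s, x)) t (l * Ci)%C.
Proof.
intros Hd. apply (rdiff_comp H (fun x => (s, x))); auto.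
split; simpl; [apply (is_derive_const (K := R_AbsRing) (V := R_NormedModule))|apply (is_derive_id (K := R_AbsRing))].
Qed.

Let u s t := Phi eps q (F (s, t)).
Let us s t := 2 * q * Rpower (fst (F (s, t)) ^ 2 + snd (F (s, t)) ^ 2 + eps) (q - 1)
   * (fst (F (s, t)) * fst (F1 (s, t)) + snd (F (s, t)) * snd (F1 (s, t))).
Let uss s t := 4 * q * (q - 1) * Rpower (fst (F (s, t)) ^ 2 + snd (F (s, t)) ^ 2 + eps) (q - 2)
   * (fst (F (s, t)) * fst (F1 (s, t)) + snd (F (s, t)) * snd (F1 (s, t)))
   * (fst (F (s, t)) * fst (F1 (s, t)) + snd (F (s, t)) * snd (F1 (s, t)))
   + 2 * q * Rpower (fst (F (s, t)) ^ 2 + snd (F (s, t)) ^ 2 + eps) (q - 1)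
   * (fst (F1 (s, t)) * fst (F1 (s, t)) + fst (F (s, t)) * fst (F2 (s, t))
      + snd (F1 (s, t)) * snd (F1 (s, t)) + snd (F (s, t)) * snd (F2 (s, t))).
(** The t-derivative of [F] is i times [F1], whence - snd and fst of [F1] in the places of fst and
    snd. *)
Let ut s t := 2 * q * Rpower (fst (F (s, t)) ^ 2 + snd (F (s, t)) ^ 2 + eps) (q - 1)
   * (fst (F (s, t)) * - snd (F1 (s, t)) + snd (F (s, t)) * fst (F1 (s, t))).
Let utt s t := 4 * q * (q - 1) * Rpower (fst (F (s, t)) ^ 2 + snd (F (s, t)) ^ 2 + eps) (q - 2)
   * (fst (F (s, t)) * - snd (F1 (s, t)) + snd (F (s, t)) * fst (F1 (s, t)))
   * (fst (F (s, t)) * - snd (F1 (s, t)) + snd (F (s, t)) * fst (F1 (s, t)))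
   + 2 * q * Rpower (fst (F (s, t)) ^ 2 + snd (F (s, t)) ^ 2 + eps) (q - 1)
   * (- snd (F1 (s, t)) * - snd (F1 (s, t)) + fst (F (s, t)) * - fst (F2 (s, t))
      + fst (F1 (s, t)) * fst (F1 (s, t)) + snd (F (s, t)) * - snd (F2 (s, t))).

Let d_u s t : s < 0 -> is_derive (fun x => u x t) s (us s t).
Proof.
intros Hs. destruct (along_s F s t _ (dF (s, t) Hs)) as [H1 H2].
apply (is_derive_power_norm (fun x => fst (F (x, t))) (fun x => snd (F (x, t))) eps s _ _ He H1 H2 q).
Qed.

Let d_us s t : s < 0 -> is_derive (fun x => us x t) s (uss s t).
Proof.
intros Hs. destruct (along_s F s t _ (dF (s, t) Hs)) as [H1 H2].
destruct (along_s F1 s t _ (dF1 (s, t) Hs)) as [H3 H4].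
apply (is_derive_power_norm2 (fun x => fst (F (x, t))) (fun x => snd (F (x, t)))
  (fun x => fst (F1 (x, t))) (fun x => snd (F1 (x, t))) eps q s _ _ _ _ He H1 H2 H3 H4).
Qed.

Let d_ut s t : s < 0 -> is_derive (fun x => ut s x) t (utt s t).
Proof.
intros Hs. destruct (along_t F s t _ (dF (s, t) Hs)) as [H1 H2].
destruct (along_t F1 s t _ (dF1 (s, t) Hs)) as [H3 H4].
assert (H4' : is_derive (fun x => - snd (F1 (s, x))) t (- fst (F2 (s, t)))).
{ eapply is_derive_Rval; [|apply (is_derive_opp (K := R_AbsRing) (V := R_NormedModule) (fun x => snd (F1 (s, x)))); exact H4].
  unfold opp; simpl; ring. }
assert (E1 : fst (F1 (s, t) * Ci)%C = - snd (F1 (s, t))) by (simpl; ring).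
assert (E2 : snd (F1 (s, t) * Ci)%C = fst (F1 (s, t))) by (simpl; ring).
assert (E3 : fst (F2 (s, t) * Ci)%C = - snd (F2 (s, t))) by (simpl; ring).
rewrite E1 in H1. rewrite E2 in H2. rewrite E3 in H3.
apply (is_derive_power_norm2 (fun x => fst (F (s, x))) (fun x => snd (F (s, x)))
  (fun x => - snd (F1 (s, x))) (fun x => fst (F1 (s, x))) eps q t _ _ _ _ He H1 H2 H4' H3).
Qed.

(** With N = |F|^2 + eps the mixed terms cancel and the Laplacian is 4 q N^(q-2) |F1|^2 (q |F|^2 +
    eps), nonnegative for every q > 0. *)
Let laplace s t : s < 0 -> 0 <= uss s t + utt s t.
Proof.
intros Hs. unfold uss, utt.
set (a := fst (F (s, t))). set (b := snd (F (s, t))). set (x := fst (F1 (s, t))). set (y := snd (F1 (s, t))).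
set (N := a ^ 2 + b ^ 2 + eps).
assert (HN : 0 < N) by (unfold N; pose proof (pow2_ge_0 a); pose proof (pow2_ge_0 b); lra).
assert (E : Rpower N (q - 1) = Rpower N (q - 2) * N).
{ rewrite <- (Rpower_1 N) at 3 by auto. rewrite <- Rpower_plus. f_equal; ring. }
rewrite E. pose proof (Rpower_pos N (q - 2)).
match goal with |- 0 <= ?e => replace e with
  (4 * q * Rpower N (q - 2) * (x ^ 2 + y ^ 2) * (q * (a ^ 2 + b ^ 2) + eps)) by (unfold N; ring) end.
pose proof (pow2_ge_0 a); pose proof (pow2_ge_0 b); pose proof (pow2_ge_0 x); pose proof (pow2_ge_0 y).
apply Rmult_le_pos; [apply Rmult_le_pos; [apply Rmult_le_pos; [lra|]|]|]; try lra.
assert (0 <= q * (a ^ 2 + b ^ 2)) by (apply Rmult_le_pos; lra). lra.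
Qed.

Let c_F (w : C) : fst w < 0 -> continuous (T := C_UniformSpace) (fun w => fst (F w)) w
  /\ continuous (T := C_UniformSpace) (fun w => snd (F w)) w.
Proof. intros H; split; [apply ccont_fst|apply ccont_snd]; eapply cdiff_ccont; apply dF; auto. Qed.
Let c_F1 (w : C) : fst w < 0 -> continuous (T := C_UniformSpace) (fun w => fst (F1 w)) w
  /\ continuous (T := C_UniformSpace) (fun w => snd (F1 w)) w.
Proof. intros H; split; [apply ccont_fst|apply ccont_snd]; eapply cdiff_ccont; apply dF1; auto. Qed.
Let c_F2 (w : C) : fst w < 0 -> continuous (T := C_UniformSpace) (fun w => fst (F2 w)) w
  /\ continuous (T := C_UniformSpace) (fun w => snd (F2 w)) w.
Proof. intros H; split; [apply ccont_fst|apply ccont_snd]; apply cF2; auto. Qed.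

Let c_N (w : C) r : fst w < 0 ->
  continuous (T := C_UniformSpace) (fun w => Rpower (fst (F w) ^ 2 + snd (F w) ^ 2 + eps) r) w.
Proof.
intros H. destruct (c_F w H). apply rcont_Rpower; [apply norm2_pos; auto|].
apply rcont_plus; [|apply continuous_const]. apply rcont_plus; apply rcont_pow; auto.
Qed.

Let cont2_us s t : s < 0 -> continuity_2d_pt us s t.
Proof.
intros Hs. apply cont2_of_continuous.
apply (continuous_ext (fun w : C => 2 * q * Rpower (fst (F w) ^ 2 + snd (F w) ^ 2 + eps) (q - 1)
   * (fst (F w) * fst (F1 w) + snd (F w) * snd (F1 w)))); [intros []; reflexivity|].
destruct (c_F (s, t) Hs). destruct (c_F1 (s, t) Hs).
apply (rcont_mult (U := C_UniformSpace)); [apply (rcont_mult (U := C_UniformSpace)); [apply continuous_const|apply c_N; auto]|].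
apply (rcont_plus (U := C_UniformSpace)); apply (rcont_mult (U := C_UniformSpace)); auto.
Qed.

Let cont2_u s t : s < 0 -> continuity_2d_pt u s t.
Proof.
intros Hs. apply cont2_of_continuous.
apply (continuous_ext (fun w : C => Rpower (fst (F w) ^ 2 + snd (F w) ^ 2 + eps) q)); [intros []; reflexivity|].
apply c_N; auto.
Qed.

Let cont2_uss s t : s < 0 -> continuity_2d_pt uss s t.
Proof.
intros Hs. apply cont2_of_continuous. destruct (c_F (s, t) Hs). destruct (c_F1 (s, t) Hs). destruct (c_F2 (s, t) Hs).
apply (continuous_ext (fun w : C => 4 * q * (q - 1) * Rpower (fst (F w) ^ 2 + snd (F w) ^ 2 + eps) (q - 2)
   * (fst (F w) * fst (F1 w) + snd (F w) * snd (F1 w)) * (fst (F w) * fst (F1 w) + snd (F w) * snd (F1 w))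
   + 2 * q * Rpower (fst (F w) ^ 2 + snd (F w) ^ 2 + eps) (q - 1)
   * (fst (F1 w) * fst (F1 w) + fst (F w) * fst (F2 w) + snd (F1 w) * snd (F1 w) + snd (F w) * snd (F2 w))));
  [intros []; reflexivity|].
assert (continuous (T := C_UniformSpace) (fun w : C => fst (F w) * fst (F1 w) + snd (F w) * snd (F1 w)) (s, t))
  by (apply (rcont_plus (U := C_UniformSpace)); apply (rcont_mult (U := C_UniformSpace)); auto).
apply (rcont_plus (U := C_UniformSpace)).
- apply (rcont_mult (U := C_UniformSpace)); [|assumption]. apply (rcont_mult (U := C_UniformSpace)); [|assumption].
  apply (rcont_mult (U := C_UniformSpace)); [apply continuous_const|apply c_N; auto].
- apply (rcont_mult (U := C_UniformSpace)); [apply (rcont_mult (U := C_UniformSpace)); [apply continuous_const|apply c_N; auto]|].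
  do 3 (apply (rcont_plus (U := C_UniformSpace)); [|apply (rcont_mult (U := C_UniformSpace)); assumption]).
  apply (rcont_mult (U := C_UniformSpace)); assumption.
Qed.

Let cont_utt s t : s < 0 -> continuous (utt s) t.
Proof.
intros Hs.
assert (Hsec : forall g : C -> R, continuous (T := C_UniformSpace) g (s, t) -> continuous (fun x => g (s, x)) t).
{ intros g Hg. apply (continuous_comp (V := C_UniformSpace) (fun x => (s, x)) g); auto.
  apply ccont_pair; simpl; [apply continuous_const|apply continuous_id]. }
destruct (c_F (s, t) Hs). destruct (c_F1 (s, t) Hs). destruct (c_F2 (s, t) Hs).
apply Hsec in H, H0, H1, H2, H3, H4.
assert (HN : forall r, continuous (fun x => Rpower (fst (F (s, x)) ^ 2 + snd (F (s, x)) ^ 2 + eps) r) t).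
{ intros r. apply (Hsec (fun w => Rpower (fst (F w) ^ 2 + snd (F w) ^ 2 + eps) r)). apply c_N; auto. }
assert (continuous (fun x => - snd (F1 (s, x))) t) by (apply rcont_opp; auto).
assert (continuous (fun x => - fst (F2 (s, x))) t) by (apply rcont_opp; auto).
assert (continuous (fun x => - snd (F2 (s, x))) t) by (apply rcont_opp; auto).
assert (continuous (fun x => fst (F (s, x)) * - snd (F1 (s, x)) + snd (F (s, x)) * fst (F1 (s, x))) t)
  by (apply rcont_plus; apply rcont_mult; auto).
unfold utt. apply rcont_plus.
- apply rcont_mult; [|assumption]. apply rcont_mult; [|assumption].
  apply rcont_mult; [apply continuous_const|apply HN].
- apply rcont_mult; [apply rcont_mult; [apply continuous_const|apply HN]|].
  do 3 (apply rcont_plus; [|apply rcont_mult; assumption]).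
  apply rcont_mult; assumption.
Qed.

Let I s := RInt (u s) 0 (2 * PI).
Let I1 s := RInt (us s) 0 (2 * PI).

Let dI s : s < 0 -> is_derive I s (I1 s).
Proof.
intros Hs. apply (is_derive_RInt_gen u us 0 (2 * PI) s (- s)); [lra| | |].
- intros x t Hx. apply Rabs_def2 in Hx. apply d_u; lra.
- intros; apply cont2_us; auto.
- intros x t Hx. apply Rabs_def2 in Hx. apply cont2_section. apply cont2_u; lra.
Qed.

Let dI1 s : s < 0 -> is_derive I1 s (RInt (uss s) 0 (2 * PI)).
Proof.
intros Hs. apply (is_derive_RInt_gen us uss 0 (2 * PI) s (- s)); [lra| | |].
- intros x t Hx. apply Rabs_def2 in Hx. apply d_us; lra.
- intros; apply cont2_uss; auto.
- intros x t Hx. apply Rabs_def2 in Hx. apply cont2_section. apply cont2_us; lra.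
Qed.

(** The second t-derivative integrates to 0 over a period, so [uss] may be replaced by the
    Laplacian. *)
Let I2_pos s : s < 0 -> 0 <= RInt (uss s) 0 (2 * PI).
Proof.
intros Hs. pose proof PI_RGT_0.
assert (E : RInt (utt s) 0 (2 * PI) = ut s (2 * PI) - ut s 0).
{ apply is_RInt_unique. apply (is_RInt_derive (V := R_CompleteNormedModule) (ut s)); intros; [apply d_ut; auto|apply cont_utt; auto]. }
assert (E2 : ut s (2 * PI) = ut s 0).
{ assert (EE : Cexp (s, 2 * PI) = Cexp (s, 0)).
  { rewrite !Cexp_polar. rewrite <- (polar_period _ 0). f_equal; ring. }
  unfold ut, F, F1. rewrite EE. auto. }
assert (Hex : ex_RInt (uss s) 0 (2 * PI)) by (apply ex_RInt_cont; intros; apply cont2_section; apply cont2_uss; auto).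
assert (Hex2 : ex_RInt (utt s) 0 (2 * PI)) by (apply ex_RInt_cont; intros; apply cont_utt; auto).
assert (0 <= RInt (fun t => uss s t + utt s t) 0 (2 * PI)).
{ apply RInt_ge_0; [lra| |intros; apply laplace; auto]. apply (ex_RInt_plus (V := R_NormedModule)); auto. }
rewrite RInt_Rplus in H0 by auto. rewrite E, E2 in H0. lra.
Qed.

Let I1_mono s s' : s <= s' -> s' < 0 -> I1 s <= I1 s'.
Proof.
intros H Hs. destruct H as [H| ->]; [|lra].
destruct (MVT_gen I1 s s' (fun s => RInt (uss s) 0 (2 * PI))) as [c [Hc1 Hc2]].
- rewrite Rmin_left, Rmax_right by lra. intros; apply dI1; lra.
- rewrite Rmin_left, Rmax_right by lra. intros. apply continuity_pt_filterlim.
  eapply is_derive_Rcont. apply dI1; lra.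
- rewrite Rmin_left, Rmax_right in Hc1 by lra.
  assert (0 <= RInt (uss c) 0 (2 * PI)) by (apply I2_pos; lra). nra.
Qed.

(* The mean over |z| = e^s is convex in s; being bounded as s -> -oo, it is nondecreasing. *)
Lemma submean_Phi r : 0 <= r < 1 ->
  2 * PI * Phi eps q (f 0%C) <= RInt (fun t => Phi eps q (f (polar r t))) 0 (2 * PI).
Proof.
intros [Hr0 Hr1]. pose proof PI_RGT_0.
destruct Hr0 as [Hr0| <-].
2: { rewrite (RInt_Rext _ (fun _ => Phi eps q (f 0%C))) by (intros; rewrite polar_0; auto).
  rewrite RInt_Rconst. lra. }
assert (Hln : ln r < 0) by (rewrite <- ln_1; apply ln_increasing; auto).
assert (HIr : RInt (fun t => Phi eps q (f (polar r t))) 0 (2 * PI) = I (ln r)).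
{ apply RInt_Rext. intros t _. unfold u, F. rewrite Cexp_polar, exp_ln; auto. }
rewrite HIr.
assert (Hlim : forall e, 0 < e -> exists s0, s0 < 0 /\ forall s, s <= s0 -> Rabs (I s - 2 * PI * Phi eps q (f 0%C)) <= e).
{ intros e Hep.
  assert (Hc : continuous (T := C_UniformSpace) (fun z => Phi eps q (f z)) (RtoC 0)).
  { assert (ccont (U := C_UniformSpace) f (RtoC 0)).
    { eapply cdiff_ccont. apply holoD_cdiff; auto. rewrite Cmod_0; lra. }
    unfold Phi. apply rcont_Rpower; [apply norm2_pos; auto|].
    apply rcont_plus; [|apply continuous_const]. apply rcont_plus; apply rcont_pow; [apply ccont_fst|apply ccont_snd]; auto. }
  assert (Hc' : ccont (U := C_UniformSpace) (fun z => RtoC (Phi eps q (f z))) (RtoC 0)) by (apply ccont_RtoC; auto).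
  rewrite ccont_eps in Hc'. destruct (Hc' (e / (2 * PI))) as [d [Hd Hw]]; [apply Rdiv_lt_0_compat; lra|].
  exists (Rmin (-1) (ln (d / 2))). split; [pose proof (Rmin_l (-1) (ln (d / 2))); lra|].
  intros s Hs.
  assert (Hs0 : s < 0) by (pose proof (Rmin_l (-1) (ln (d / 2))); lra).
  assert (Hsd : exp s < d).
  { apply Rle_lt_trans with (d / 2); [|lra]. rewrite <- (exp_ln (d / 2)) by lra.
    pose proof (Rmin_r (-1) (ln (d / 2))). destruct (Rle_lt_or_eq_dec s (ln (d / 2))); [lra|left; apply exp_increasing; auto|subst; lra]. }
  assert (Ec : 2 * PI * Phi eps q (f 0%C) = RInt (fun _ => Phi eps q (f 0%C)) 0 (2 * PI)) by (rewrite RInt_Rconst; ring).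
  rewrite Ec. unfold I.
  assert (Hcu : forall t, continuous (u s) t) by (intros; apply cont2_section; apply cont2_u; auto).
  rewrite <- RInt_Rminus; [|apply ex_RInt_cont; auto|apply ex_RInt_cont; intros; apply continuous_const].
  eapply Rle_trans; [apply abs_RInt_le_const with (M := e / (2 * PI)); [lra| |]|].
  - apply ex_RInt_cont. intros; apply rcont_minus; auto. apply continuous_const.
  - intros t _. unfold u, F. rewrite Cexp_polar.
    specialize (Hw (polar (exp s) t)). rewrite <- RtoC_minus, Cmod_R in Hw. left; apply Hw.
    replace (polar (exp s) t - 0)%C with (polar (exp s) t) by ring.
    rewrite Cmod_polar; auto. left; apply exp_pos.
  - apply Req_le. field. lra. }
(* A negative slope at s would persist to the left by convexity. Over a length 3 / (- I1 s) it would
   change [I] by at least 3, while near -oo values of [I] differ by at most 2. *)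
assert (HI1 : forall s, s < 0 -> 0 <= I1 s).
{ intros s Hs. apply Rnot_lt_le. intros Hneg.
  destruct (Hlim 1 Rlt_0_1) as [s0 [Hs0 Hb]].
  set (sa := Rmin s s0). assert (sa <= s) by apply Rmin_l. assert (sa <= s0) by apply Rmin_r.
  set (sb := sa - 3 / (- I1 s)).
  assert (0 < 3 / (- I1 s)) by (apply Rdiv_lt_0_compat; lra).
  destruct (MVT_gen I sb sa I1) as [c [Hc1 Hc2]].
  - rewrite Rmin_left, Rmax_right by (unfold sb; lra). intros; apply dI; lra.
  - rewrite Rmin_left, Rmax_right by (unfold sb; lra). intros. apply continuity_pt_filterlim.
    eapply is_derive_Rcont. apply dI; lra.
  - rewrite Rmin_left, Rmax_right in Hc1 by (unfold sb; lra).
    assert (I1 c <= I1 s) by (apply I1_mono; lra).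
    assert (E3 : (sa - sb) * - I1 s = 3) by (unfold sb; field; lra).
    assert (Hsab : 0 < sa - sb) by (unfold sb; lra).
    pose proof (Hb sa ltac:(lra)) as B1. pose proof (Hb sb ltac:(unfold sb; lra)) as B2.
    apply Rabs_le_between in B1. apply Rabs_le_between in B2. nra. }
apply Rnot_lt_le. intros Hlt.
destruct (Hlim ((2 * PI * Phi eps q (f 0%C) - I (ln r)) / 2)) as [s0 [Hs0 Hb]]; [lra|].
set (sa := Rmin s0 (ln r)). assert (sa <= ln r) by apply Rmin_r. assert (Hsa : sa <= s0) by apply Rmin_l.
specialize (Hb sa Hsa). apply Rabs_le_between in Hb.
assert (I sa <= I (ln r)).
{ destruct (Req_dec sa (ln r)) as [->|]; [lra|].
  destruct (MVT_gen I sa (ln r) I1) as [c [Hc1 Hc2]].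
  - rewrite Rmin_left, Rmax_right by lra. intros; apply dI; lra.
  - rewrite Rmin_left, Rmax_right by lra. intros. apply continuity_pt_filterlim.
    eapply is_derive_Rcont. apply dI; lra.
  - rewrite Rmin_left, Rmax_right in Hc1 by lra. assert (0 <= I1 c) by (apply HI1; lra). nra. }
lra.
Qed.

End Submean.

(** * Poisson majorant, Schwarz-Pick and Harnack inequalities *)

(** The regularisation is written x^2 because |z|^2 + x^2 <= (|z| + x)^2 gives the upper bound at
    once. *)
Lemma Phi_bounds x p z : 0 < x -> 0 < p ->
  rpow (Cmod z) p <= Phi (x ^ 2) (p / 2) z <= rpow (Cmod z + x) p.
Proof.
intros Hx Hp. unfold Phi. pose proof (Cmod_ge_0 z) as Hz.
replace (fst z ^ 2 + snd z ^ 2) with (Cmod z ^ 2) by (rewrite Cmod2_alt; reflexivity).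
assert (E : forall y, 0 < y -> Rpower (y ^ 2) (p / 2) = Rpower y p).
{ intros y Hy. rewrite <- Rpower_pow by auto. rewrite Rpower_mult. f_equal. simpl. field. }
split.
- destruct Hz as [Hz|<-]; [|rewrite rpow_0; left; apply Rpower_pos].
  rewrite rpow_pos by auto. rewrite <- E by auto. apply Rle_Rpower_l; [lra|]. pose proof (pow2_ge_0 x).
  split; [apply pow_lt; auto|lra].
- rewrite rpow_pos by lra. rewrite <- E by lra. apply Rle_Rpower_l; [lra|]. split; nra.
Qed.

Lemma polar_e1 ra t : polar ra t = (RtoC ra * e1 t)%C.
Proof. unfold polar, RtoC, Cmult; simpl. f_equal; ring. Qed.

Lemma Cmod_div_R (w : C) ra : 0 < ra -> Cmod (w / RtoC ra)%C = Cmod w / ra.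
Proof.
intros HR. rewrite Cmod_div, Cmod_R, Rabs_pos_eq; auto; [lra|].
intros E; apply RtoC_inj in E; lra.
Qed.

Lemma Rdiv_lt_1 x y : 0 < y -> x < y -> x / y < 1.
Proof. intros. apply Rmult_lt_reg_r with y; auto. unfold Rdiv. rewrite Rmult_assoc, Rinv_l; lra. Qed.

Lemma Cmod_div_lt (w : C) ra : 0 < ra -> Cmod w < ra -> Cmod (w / RtoC ra)%C < 1.
Proof. intros. rewrite Cmod_div_R by lra. apply Rdiv_lt_1; auto. Qed.

Lemma le_div_2PI X Y : 2 * PI * X <= Y -> X <= Y / (2 * PI).
Proof.
intros H. pose proof PI_RGT_0. apply Rmult_le_reg_l with (2 * PI); [lra|]. eapply Rle_trans; [exact H|].
apply Req_le; field; lra.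
Qed.

Definition mn (u : R -> R) : R := RInt u 0 (2 * PI) / (2 * PI).
(** Poisson integral on the disc |w| < ra of the values of |f|^p on the circle |z| = ra: a harmonic
    majorant of |f|^p that carries all pointwise estimates. *)
Definition hm (p ra : R) (f : C -> C) (w : C) : R :=
  mn (fun t => PK (w / RtoC ra)%C t * rpow (Cmod (f (polar ra t))) p).

Lemma mn_le u v : (forall t, continuous u t) -> (forall t, continuous v t) ->
  (forall t, u t <= v t) -> mn u <= mn v.
Proof.
intros Hu Hv H. pose proof PI_RGT_0. unfold mn. apply Rmult_le_compat_r; [left; apply Rinv_0_lt_compat; lra|].
apply RInt_le; auto; try lra; apply ex_RInt_cont; auto.
Qed.

Lemma mn_plus u v : (forall t, continuous u t) -> (forall t, continuous v t) ->
  mn (fun t => u t + v t) = mn u + mn v.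
Proof.
intros Hu Hv. pose proof PI_RGT_0. unfold mn. rewrite RInt_Rplus by (apply ex_RInt_cont; auto). field. lra.
Qed.

Lemma mn_scal c u : (forall t, continuous u t) -> mn (fun t => c * u t) = c * mn u.
Proof.
intros Hu. pose proof PI_RGT_0. unfold mn. rewrite RInt_Rscal by (apply ex_RInt_cont; auto). field. lra.
Qed.

Lemma mn_const c : mn (fun _ => c) = c.
Proof. pose proof PI_RGT_0. unfold mn. rewrite RInt_Rconst. field. lra. Qed.

Lemma mn_ext u v : (forall t, u t = v t) -> mn u = mn v.
Proof. intros H. unfold mn. f_equal. apply RInt_Rext; auto. Qed.

Lemma mn_ge0 u : (forall t, continuous u t) -> (forall t, 0 <= u t) -> 0 <= mn u.
Proof.
intros Hu H. rewrite <- (mn_const 0). apply mn_le; auto. intros; apply continuous_const.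
Qed.

Lemma mn_PK a : Cmod a < 1 -> mn (PK a) = 1.
Proof. intros H. unfold mn. rewrite PK_int by auto. pose proof PI_RGT_0. field. lra. Qed.

Lemma cont_circle_pow f r p : holoD f -> 0 <= r < 1 -> 0 < p ->
  forall t, continuous (fun t => rpow (Cmod (f (polar r t))) p) t.
Proof.
intros Hf Hr Hp t. apply rcont_rpow; auto. apply rcont_Cmod. apply (ccont_circle 1); auto.
Qed.

Lemma hm_cont f ra p w : holoD f -> 0 < ra < 1 -> 0 < p -> Cmod w < ra ->
  forall t, continuous (fun t => PK (w / RtoC ra)%C t * rpow (Cmod (f (polar ra t))) p) t.
Proof.
intros Hf HR Hp Hw t. apply rcont_mult.
- apply PK_cont. rewrite Cmod_div_R by lra. apply Rdiv_lt_1; lra.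
- apply cont_circle_pow; auto; lra.
Qed.

Lemma le_of_le_lam X Y : 0 <= Y -> (forall lam, 0 < lam -> X <= (1 + lam) * Y) -> X <= Y.
Proof.
intros HY H. apply Rnot_lt_le. intros Hlt.
specialize (H ((X - Y) / (2 * (Y + 1))) ltac:(apply Rdiv_lt_0_compat; lra)).
assert ((X - Y) / (2 * (Y + 1)) * Y <= (X - Y) / 2); [|lra].
apply Rle_trans with ((X - Y) / (2 * (Y + 1)) * (Y + 1)); [|apply Req_le; field; lra].
apply Rmult_le_compat_l; [|lra]. left; apply Rdiv_lt_0_compat; lra.
Qed.

(** The submean inequality at 0 for f precomposed with the automorphism sending 0 to w / ra;
    [poisson_change] converts the circle mean into the kernel. The regularisation is removed
    last. *)
Lemma poisson_majorant p f ra w : 0 < p -> holoD f -> 0 < ra < 1 -> Cmod w < ra ->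
  rpow (Cmod (f w)) p <= hm p ra f w.
Proof.
intros Hp Hf HR Hw. pose proof PI_RGT_0. pose proof (proj2 (holR_1 f) Hf) as Hf'.
set (g := fun z => f (0 + RtoC ra * z)%C).
assert (Hg : holR (/ ra) g).
{ apply holR_dilate; try lra; auto. rewrite Cmod_0, Rinv_r; lra. }
assert (Hir : 1 < / ra) by (rewrite <- Rinv_1 at 1; apply Rinv_lt_contravar; lra).
set (a := (w / RtoC ra)%C).
assert (Ha : Cmod a < 1) by (apply Cmod_div_lt; lra).
assert (HRc : RtoC ra <> 0%C) by (intros E; apply RtoC_inj in E; lra).
assert (Hgt : forall t, g (e1 t) = f (polar ra t)) by (intros t; unfold g; rewrite (polar_e1 ra), Cplus_0_l; auto).
destruct (holR_tau (/ ra) g a Hir Hg Ha) as [rho [Hrho Hgt2]].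
assert (Hrc : RtoC rho <> 0%C) by (intros E; apply RtoC_inj in E; lra).
(* The extra dilation by [rho] makes k holomorphic on the whole unit disc, and the circle of radius
   1/rho goes to the unit circle under it. *)
set (k := fun z => g (tau a (RtoC rho * z)%C)).
assert (Hk : holoD k).
{ apply holR_1; intros z Hz; unfold inD in Hz. destruct (Hgt2 (RtoC rho * z)%C) as [l Hl].
  - rewrite Cmod_mult, Cmod_R, Rabs_pos_eq by lra. nra.
  - eexists. apply (cdiff_comp (fun z => g (tau a z)) (fun z => RtoC rho * z)%C); [apply cdiff_scal, cdiff_id|exact Hl]. }
assert (Hk0 : k 0%C = f w).
{ unfold k. rewrite Cmult_0_r, tau_0. unfold g, a. f_equal. field. auto. }
assert (Hkt : forall t, k (polar (/ rho) t) = g (tau a (e1 t))).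
{ intros t. unfold k. f_equal. f_equal. rewrite (polar_e1 (/ rho)), Cmult_assoc, <- RtoC_mult, Rinv_r by lra. ring. }
assert (Hcont : forall eps q z, 0 < eps -> Cmod z = 1 -> continuous (T := C_UniformSpace) (fun z => Phi eps q (g z)) z).
{ intros eps q z He Hz. destruct (Hg z) as [l Hl]; [lra|]. apply cdiff_ccont in Hl.
  unfold Phi. apply rcont_Rpower; [apply norm2_pos; auto|].
  apply rcont_plus; [|apply continuous_const]. apply rcont_plus; apply rcont_pow; [apply ccont_fst|apply ccont_snd]; auto. }
set (v := fun t => rpow (Cmod (f (polar ra t))) p).
assert (Hv : forall t, continuous v t) by (apply cont_circle_pow; auto; lra).
assert (HPv : forall t, continuous (fun t => PK a t * v t) t) by (intros; apply rcont_mult; auto; apply PK_cont; auto).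
unfold hm. fold a. change (rpow (Cmod (f w)) p <= mn (fun t => PK a t * v t)).
assert (Hm0 : 0 <= mn (fun t => PK a t * v t)).
{ apply mn_ge0; auto. intros t. apply Rmult_le_pos; [left; apply PK_pos; auto|apply rpow_ge0]. }
apply le_of_le_lam; auto. intros lam Hlam.
destruct (rpow_add_lam p lam Hp Hlam) as [K [HK Hadd]].
apply le_epsilon. intros e Hep.
(* Chosen so that K x^p = e: by [rpow_add_lam] the regularisation costs a factor 1 + lam and an
   additive e. *)
set (x := rpow (e / K) (/ p)).
assert (HeK : 0 < e / K) by (apply Rdiv_lt_0_compat; auto).
assert (Hx : 0 < x) by (apply rpow_gt0; auto).
assert (Hxp : rpow x p = e / K) by (apply rpow_inv_r; lra).
apply Rle_trans with (Phi (x ^ 2) (p / 2) (f w)); [apply Phi_bounds; auto|].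
assert (Hx2 : 0 < x ^ 2) by (apply pow_lt; auto).
pose proof (submean_Phi k (x ^ 2) (p / 2) Hk Hx2 ltac:(lra) (/ rho)) as S.
assert (Hirho : 0 <= / rho < 1).
{ split; [left; apply Rinv_0_lt_compat; lra|]. rewrite <- Rinv_1. apply Rinv_lt_contravar; lra. }
specialize (S Hirho). rewrite Hk0 in S.
rewrite (RInt_Rext _ (fun t => (fun z => Phi (x ^ 2) (p / 2) (g z)) (tau a (e1 t)))) in S by (intros; rewrite Hkt; auto).
rewrite (poisson_change a (fun z => Phi (x ^ 2) (p / 2) (g z))) in S; auto.
assert (S2 : Phi (x ^ 2) (p / 2) (f w) <= mn (fun t => PK a t * Phi (x ^ 2) (p / 2) (g (e1 t)))).
{ apply le_div_2PI. exact S. }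
eapply Rle_trans; [exact S2|].
apply Rle_trans with (mn (fun t => (1 + lam) * (PK a t * v t) + e * PK a t)).
- apply mn_le.
  + intros t. apply rcont_mult; [apply PK_cont; auto|].
    apply (continuous_comp (V := C_UniformSpace) (fun t => e1 t) (fun z => Phi (x ^ 2) (p / 2) (g z))).
    * apply ccont_e1.
    * apply Hcont; auto. apply Cmod_e1.
  + intros t. apply rcont_plus; (apply rcont_mult; [apply continuous_const|]); auto. apply PK_cont; auto.
  + intros t. pose proof (PK_pos a t Ha) as HP.
    replace ((1 + lam) * (PK a t * v t) + e * PK a t) with (PK a t * ((1 + lam) * v t + e)) by ring.
    apply Rmult_le_compat_l; [lra|]. eapply Rle_trans; [apply Phi_bounds; auto|].
    rewrite Hgt. eapply Rle_trans; [apply Hadd; [apply Cmod_ge_0|lra]|].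
    rewrite Hxp. unfold v. apply Req_le. field. lra.
- rewrite mn_plus, !mn_scal, mn_PK; auto; try (intros; apply PK_cont; auto); try lra;
  intros; apply rcont_mult; auto; try apply continuous_const. apply PK_cont; auto.
Qed.

(** The Poisson majorant for p = 1, the kernel having mean 1. *)
Lemma max_modulus f ra w B : holoD f -> 0 < ra < 1 -> Cmod w < ra ->
  (forall t, Cmod (f (polar ra t)) <= B) -> Cmod (f w) <= B.
Proof.
intros Hf HR Hw HB.
assert (Ha : Cmod (w / RtoC ra)%C < 1) by (apply Cmod_div_lt; lra).
pose proof (poisson_majorant 1 f ra w Rlt_0_1 Hf HR Hw) as H. rewrite rpow_1 in H by apply Cmod_ge_0.
eapply Rle_trans; [exact H|]. unfold hm.
apply Rle_trans with (mn (fun t => B * PK (w / RtoC ra)%C t)).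
- apply mn_le.
  + apply hm_cont; auto; lra.
  + intros; apply rcont_mult; [apply continuous_const|apply PK_cont; auto].
  + intros t. rewrite rpow_1 by apply Cmod_ge_0. pose proof (PK_pos _ t Ha). rewrite Rmult_comm.
    apply Rmult_le_compat_r; auto; lra.
- rewrite mn_scal, mn_PK by (auto; intros; apply PK_cont; auto). lra.
Qed.

Lemma disc_bound f ra : holoD f -> 0 <= ra < 1 -> exists B, 0 <= B /\ forall w, Cmod w <= ra -> Cmod (f w) <= B.
Proof.
intros Hf HR. set (ra' := (1 + ra) / 2). assert (HR' : 0 < ra' < 1) by (unfold ra'; lra).
destruct (circle_bound 1 f ra' Hf ltac:(lra)) as [B HB]. exists B.
split; [eapply Rle_trans; [apply Cmod_ge_0|apply (HB 0)]|].
intros w Hw. apply (max_modulus f ra'); auto. unfold ra'; lra.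
Qed.

(** The quotient g(z)/z has to be differentiable at 0 itself. Near 0 it is a Cauchy integral formed
    with the dilation h(z) = g(z/2); elsewhere it is a quotient of holomorphic functions. *)
Lemma removable_zero g : holoD g -> g 0%C = 0%C ->
  exists k, holoD k /\ forall z, Cmod z < 1 -> g z = (z * k z)%C.
Proof.
intros Hg Hg0. pose proof (proj2 (holR_1 g) Hg) as Hg'.
set (h := fun z => g (0 + RtoC (/ 2) * z)%C).
assert (Hh : holR 2 h) by (apply holR_dilate; auto; try lra; rewrite Cmod_0; lra).
destruct (circle_bound 2 h 1 Hh ltac:(lra)) as [M HM]. pose proof PI_RGT_0.
set (c := fun t => (h (e1 t) / RtoC (2 * PI))%C).
assert (Hc : forall t, ccont c t).
{ intros t. apply ccont_div; [|apply ccont_const|apply twopi_neq0]. apply (ccont_circle 2); auto; lra. }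
assert (HcM : forall t, Cmod (c t) <= M / (2 * PI)).
{ intros t. unfold c. rewrite Cmod_div_R by lra. apply Rmult_le_compat_r; auto. left; apply Rinv_0_lt_compat; lra. }
assert (Hh0 : h 0%C = 0%C) by (unfold h; rewrite Cmult_0_r, Cplus_0_l; auto).
assert (Hq : forall z, Cmod z < 1 -> h z = (z * CK c 1 z)%C).
{ intros z Hz. rewrite (hol_quotient 2 h ltac:(lra) Hh z Hz), Hh0. unfold c. ring. }
exists (fun z => if C_dec z 0 then (2 * CK c 1 0)%C else (g z / z)%C). split.
- apply holR_1; intros z Hz; unfold inD in Hz. destruct (C_dec z 0) as [->|Hz0].
  + assert (HM0 : 0 <= M / (2 * PI)) by (eapply Rle_trans; [apply Cmod_ge_0|apply (HcM 0)]).
    assert (HCK : cdiff (CK c 1) (2 * 0)%C (CK c 2 0)).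
    { rewrite Cmult_0_r. apply (cdiff_of_taylor _ _ _ (4 * PI * (M / (2 * PI)) / (4 * (/ 2) ^ 3)) (/ 2)); [lra| |].
      - apply Rdiv_le_0_compat; [|lra]. apply Rmult_le_pos; lra.
      - intros k Hk. apply (CK1_taylor c (M / (2 * PI)) Hc HcM 0%C k (/ 2)); auto; try lra. rewrite Cmod_0; lra. }
    eexists. apply (cdiff_ext_loc (fun z => 2 * CK c 1 (2 * z))%C _ 0%C _ (/ 2)); [lra| |].
    * intros w Hw. replace (w - 0)%C with w in Hw by ring.
      destruct (C_dec w 0) as [->|Hw0]; [rewrite Cmult_0_r; auto|].
      assert (Hw2 : Cmod (2 * w)%C < 1) by (rewrite Cmod_mult, Cmod_R, Rabs_pos_eq; lra).
      pose proof (Hq (2 * w)%C Hw2) as E. unfold h in E.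
      replace (0 + RtoC (/ 2) * (2 * w))%C with w in E.
      { rewrite E. field. auto. }
      rewrite Cmult_assoc, <- RtoC_mult, Rinv_l by lra. ring.
    * apply cdiff_scal. apply (cdiff_comp (CK c 1) (fun z => 2 * z)%C); [apply cdiff_scal, cdiff_id|exact HCK].
  + destruct (Hg' z Hz) as [l Hl].
    eexists. apply (cdiff_ext_loc (fun z => g z / z)%C _ z _ (Cmod z)); [apply Cmod_gt_0; auto| |].
    * intros w Hw. destruct (C_dec w 0) as [->|]; auto. exfalso.
      replace (0 - z)%C with (- z)%C in Hw by ring. rewrite Cmod_opp in Hw. lra.
    * apply cdiff_div; [exact Hl|apply cdiff_id|auto].
- intros z Hz. destruct (C_dec z 0) as [->|Hz0]; [rewrite Hg0; ring|]. field; auto.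
Qed.

Lemma schwarz g z : holoD g -> (forall w, Cmod w < 1 -> Cmod (g w) <= 1) -> g 0%C = 0%C ->
  Cmod z < 1 -> Cmod (g z) <= Cmod z.
Proof.
intros Hg Hb H0 Hz. destruct (removable_zero g Hg H0) as [k [Hk E]].
rewrite E by auto. rewrite Cmod_mult. pose proof (Cmod_ge_0 z).
rewrite <- (Rmult_1_r (Cmod z)) at 2. apply Rmult_le_compat_l; auto.
apply le_of_le_lam; [lra|]. intros lam Hl. rewrite Rmult_1_r.
(* The circle must enclose z and satisfy 1/ra <= 1 + lam, since |k| <= 1/ra on it. *)
set (ra := Rmax ((1 + Cmod z) / 2) (/ (1 + lam))).
assert (HR1 : ra < 1).
{ unfold ra. apply Rmax_lub_lt; [lra|]. rewrite <- Rinv_1. apply Rinv_lt_contravar; lra. }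
assert (HR2 : Cmod z < ra) by (unfold ra; pose proof (Rmax_l ((1 + Cmod z) / 2) (/ (1 + lam))); lra).
assert (HR3 : / (1 + lam) <= ra) by apply Rmax_r.
apply (max_modulus k ra z); auto; [lra|]. intros t.
pose proof (Cmod_polar ra t ltac:(lra)) as Hp.
assert (Hpl : Cmod (polar ra t) < 1) by lra.
pose proof (Hb _ Hpl) as Hb'. rewrite E in Hb' by auto. rewrite Cmod_mult, Hp in Hb'.
pose proof (Cmod_ge_0 (k (polar ra t))).
assert (/ (1 + lam) * Cmod (k (polar ra t)) <= 1) by nra.
apply Rmult_le_reg_l with (/ (1 + lam)); [apply Rinv_0_lt_compat; lra|]. rewrite Rinv_l; lra.
Qed.

Lemma tau_in a z : Cmod a < 1 -> Cmod z < 1 -> (1 + Cconj a * z)%C <> 0%C /\ Cmod (tau a z) < 1.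
Proof.
intros Ha Hz. pose proof (Cmod_ge_0 a). pose proof (Cmod_ge_0 z).
assert (Hn : (1 + Cconj a * z)%C <> 0%C).
{ apply C1_plus_neq0. rewrite Cmod_mult, Cmod_conj. nra. }
split; auto. unfold tau. rewrite Cmod_div by auto.
pose proof (mobius_identity a z) as M. apply Cmod_gt_0 in Hn. pose proof (Cmod_ge_0 (z + a)%C).
apply Rdiv_lt_1; auto.
assert ((Cmod z ^ 2 - 1) * (1 - Cmod a ^ 2) < 0).
{ assert (0 < 1 - Cmod z ^ 2) by nra. assert (0 < 1 - Cmod a ^ 2) by nra. nra. }
nra.
Qed.

Lemma holoD_tau a : Cmod a < 1 -> holoD (tau a).
Proof. intros Ha. apply holR_1; intros z Hz; unfold inD in Hz. apply cdiff_tau. apply tau_in; auto. Qed.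

Lemma holoD_comp f g : holoD f -> holoD g -> (forall z, Cmod z < 1 -> Cmod (g z) < 1) -> holoD (fun z => f (g z)).
Proof.
intros Hf Hg Hs. apply holR_1; intros z Hz; unfold inD in Hz.
eexists. apply (cdiff_comp f g); [apply holoD_cdiff; auto|apply holoD_cdiff; auto].
Qed.

Lemma tau_inv a z : Cmod a < 1 -> Cmod z < 1 -> tau a (tau (- a)%C z) = z.
Proof.
intros Ha Hz. unfold tau.
replace (Cconj (- a)) with (- Cconj a)%C by (apply C_eq; destruct a; simpl; ring).
assert (H1 : (1 + - Cconj a * z)%C <> 0%C).
{ replace (1 + - Cconj a * z)%C with (1 - Cconj a * z)%C by ring. apply C1_minus_neq0.
  rewrite Cmod_mult, Cmod_conj. pose proof (Cmod_ge_0 a). pose proof (Cmod_ge_0 z). nra. }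
assert (H2 : (1 - Cconj a * a)%C <> 0%C).
{ apply C1_minus_neq0. rewrite Cmod_mult, Cmod_conj. pose proof (Cmod_ge_0 a). nra. }
field. split; auto. replace (1 + - Cconj a * z + Cconj a * (z + - a))%C with (1 - Cconj a * a)%C by ring. auto.
Qed.

Lemma tau_neg_mod a z : Cmod a < 1 -> Cmod z < 1 ->
  Cmod (tau (- a)%C z) * Cmod (1 - Cconj a * z)%C = Cmod (z - a)%C.
Proof.
intros Ha Hz. unfold tau.
replace (Cconj (- a)) with (- Cconj a)%C by (apply C_eq; destruct a; simpl; ring).
replace (1 + - Cconj a * z)%C with (1 - Cconj a * z)%C by ring.
replace (z + - a)%C with (z - a)%C by ring.
rewrite <- Cmod_mult. f_equal. field. apply C1_minus_neq0.
rewrite Cmod_mult, Cmod_conj. pose proof (Cmod_ge_0 a). pose proof (Cmod_ge_0 z). nra.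
Qed.

(** Schwarz's lemma between automorphisms that move a and g a to 0, with denominators cleared. *)
Lemma schwarz_pick g a z : holoD g -> (forall w, Cmod w < 1 -> Cmod (g w) < 1) ->
  Cmod a < 1 -> Cmod z < 1 ->
  Cmod (g z - g a)%C * Cmod (1 - Cconj a * z)%C <= Cmod (z - a)%C * Cmod (1 - Cconj (g a) * g z)%C.
Proof.
intros Hg Hb Ha Hz.
set (h := fun w => tau (- g a)%C (g (tau a w))).
assert (Hna : Cmod (- a)%C < 1) by (rewrite Cmod_opp; auto).
assert (Hnga : Cmod (- g a)%C < 1) by (rewrite Cmod_opp; auto).
assert (Hh : holoD h).
{ unfold h. apply (holoD_comp (tau (- g a)%C) (fun w => g (tau a w))); [apply holoD_tau; auto| |].
  - apply (holoD_comp g (tau a)); auto; [apply holoD_tau; auto|]. intros; apply tau_in; auto.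
  - intros w Hw. apply Hb. apply tau_in; auto. }
pose proof (schwarz h (tau (- a)%C z) Hh) as S.
assert (S1 : Cmod (h (tau (- a)%C z)) <= Cmod (tau (- a)%C z)).
{ apply S.
  - intros w Hw. left. apply tau_in; auto. apply Hb. apply tau_in; auto.
  - unfold h. rewrite tau_0. unfold tau. replace (g a + - g a)%C with (RtoC 0) by ring. unfold Cdiv. ring.
  - apply tau_in; auto. }
unfold h in S1. rewrite tau_inv in S1 by auto.
rewrite <- (tau_neg_mod a z), <- (tau_neg_mod (g a) (g z)) by auto.
pose proof (Cmod_ge_0 (1 - Cconj a * z)%C). pose proof (Cmod_ge_0 (1 - Cconj (g a) * g z)%C).
assert (0 <= Cmod (1 - Cconj (g a) * g z) * Cmod (1 - Cconj a * z)) by nra. nra.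
Qed.

Lemma schwarz_pick_der g z : holoD g -> (forall w, Cmod w < 1 -> Cmod (g w) < 1) -> Cmod z < 1 ->
  Cmod (C_derive g z) * (1 - Cmod z ^ 2) <= 1 - Cmod (g z) ^ 2.
Proof.
intros Hg Hb Hz.
assert (Hself : forall w, Cmod w < 1 -> Cmod (1 - Cconj w * w)%C = 1 - Cmod w ^ 2).
{ intros w Hw. replace (Cconj w * w)%C with (RtoC (Cmod w ^ 2)) by (rewrite Cmod2_conj; ring).
  rewrite <- RtoC_minus, Cmod_R, Rabs_pos_eq; auto. pose proof (Cmod_ge_0 w). nra. }
pose proof (holoD_cdiff g z Hg Hz) as Hd.
set (l := C_derive g z) in *.
rewrite <- !Hself by auto. pose proof (Cmod_ge_0 l).
set (A := Cmod (1 - Cconj z * z)%C). assert (HA0 : 0 <= A) by apply Cmod_ge_0.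
apply le_epsilon. intros e He.
pose proof (proj1 (cdiff_eps g z l) Hd) as Hd1.
assert (C1 : ccont (U := C_UniformSpace) (fun w => (1 - Cconj z * w)%C) z).
{ apply ccont_minus; [apply ccont_const|apply ccont_mult; [apply ccont_const|apply ccont_id]]. }
assert (C2 : ccont (U := C_UniformSpace) (fun w => (1 - Cconj (g z) * g w)%C) z).
{ apply ccont_minus; [apply ccont_const|apply ccont_mult; [apply ccont_const|]]. eapply cdiff_ccont; eauto. }
rewrite ccont_eps in C1, C2.
set (e' := Rmin 1 (e / (4 * (Cmod l + 3)))).
assert (He' : 0 < e') by (apply Rmin_pos; [lra|apply Rdiv_lt_0_compat; lra]).
assert (He'1 : e' <= 1) by apply Rmin_l.
assert (He'2 : e' * (4 * (Cmod l + 3)) <= e).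
{ apply Rle_trans with (e / (4 * (Cmod l + 3)) * (4 * (Cmod l + 3))); [apply Rmult_le_compat_r; [lra|apply Rmin_r]|].
  apply Req_le; field; lra. }
destruct (Hd1 e' He') as [d1 [Hd1p D1]]. destruct (C1 e' He') as [d2 [Hd2p D2]]. destruct (C2 e' He') as [d3 [Hd3p D3]].
(* One real increment w = z + x suffices: the modulus of the derivative can be read along any
   direction, and Schwarz-Pick becomes a two-point inequality with errors of order e'. *)
set (x := Rmin (Rmin (d1 / 2) (d2 / 2)) (Rmin (d3 / 2) ((1 - Cmod z) / 2))).
assert (Hx : 0 < x) by (unfold x; repeat apply Rmin_pos; lra).
assert (Hx1 : x < d1) by (apply Rle_lt_trans with (d1 / 2); [|lra]; eapply Rle_trans; [apply Rmin_l|apply Rmin_l]).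
assert (Hx2 : x < d2) by (apply Rle_lt_trans with (d2 / 2); [|lra]; eapply Rle_trans; [apply Rmin_l|apply Rmin_r]).
assert (Hx3 : x < d3) by (apply Rle_lt_trans with (d3 / 2); [|lra]; eapply Rle_trans; [apply Rmin_r|apply Rmin_l]).
assert (Hx4 : x < 1 - Cmod z) by (apply Rle_lt_trans with ((1 - Cmod z) / 2); [|lra]; eapply Rle_trans; [apply Rmin_r|apply Rmin_r]).
set (w := (z + RtoC x)%C).
assert (Hwz : (w - z)%C = RtoC x) by (unfold w; ring).
assert (Hwm : Cmod (w - z)%C = x) by (rewrite Hwz, Cmod_R, Rabs_pos_eq; lra).
assert (Hw1 : Cmod w < 1).
{ unfold w. eapply Rle_lt_trans; [apply Cmod_triangle|]. rewrite Cmod_R, Rabs_pos_eq; lra. }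
specialize (D1 w ltac:(lra)). specialize (D2 w ltac:(lra)). specialize (D3 w ltac:(lra)).
pose proof (schwarz_pick g z w Hg Hb Hz Hw1) as SP. rewrite Hwm in *.
set (B := Cmod (1 - Cconj (g z) * g z)%C) in *.
assert (E1 : Cmod l * x - e' * x <= Cmod (g w - g z)%C).
{ replace (Cmod l * x) with (Cmod (l * (w - z))%C) by (rewrite Cmod_mult, Hwm; auto).
  pose proof (Cmod_minus_ge (l * (w - z))%C (- (g w - g z - l * (w - z)))%C) as T.
  rewrite Cmod_opp in T. replace (l * (w - z) - - (g w - g z - l * (w - z)))%C with (g w - g z)%C in T by ring. lra. }
assert (E2 : A - e' <= Cmod (1 - Cconj z * w)%C).
{ pose proof (Cmod_minus_ge (1 - Cconj z * z)%C (- ((1 - Cconj z * w) - (1 - Cconj z * z)))%C) as T.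
  rewrite Cmod_opp in T. replace (1 - Cconj z * z - - (1 - Cconj z * w - (1 - Cconj z * z)))%C with (1 - Cconj z * w)%C in T by ring.
  fold A in T. lra. }
assert (E3 : Cmod (1 - Cconj (g z) * g w)%C <= B + e').
{ replace (1 - Cconj (g z) * g w)%C with ((1 - Cconj (g z) * g z) + ((1 - Cconj (g z) * g w) - (1 - Cconj (g z) * g z)))%C by ring.
  eapply Rle_trans; [apply Cmod_triangle|]. fold B. lra. }
assert (HA2 : A <= 2).
{ unfold A. rewrite Hself by auto. pose proof (pow2_ge_0 (Cmod z)). lra. }
assert (F : (Cmod l - e') * (A - e') <= B + e').
{ destruct (Rle_lt_dec (Cmod l - e') 0).
  - destruct (Rle_lt_dec (A - e') 0).
    + assert (0 <= B) by apply Cmod_ge_0. nra.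
    + assert (0 <= B) by apply Cmod_ge_0. nra.
  - destruct (Rle_lt_dec (A - e') 0); [assert (0 <= B) by apply Cmod_ge_0; nra|].
    apply Rmult_le_reg_l with x; auto.
    apply Rle_trans with (Cmod (g w - g z) * Cmod (1 - Cconj z * w)).
    + replace (x * ((Cmod l - e') * (A - e'))) with ((Cmod l * x - e' * x) * (A - e')) by ring.
      apply Rmult_le_compat; try lra. nra.
    + eapply Rle_trans; [exact SP|]. apply Rmult_le_compat_l; lra. }
nra.
Qed.

(** Schwarz's lemma for the Cayley transform (Q - Q a)/(Q + conj(Q a)) o tau_a gives (1 - rh) |Q w|
    <= (1 + rh) |Q a|, where rh is the pseudohyperbolic distance. Multiplying by 1 + rh <= 2 yields
    the 4, and 1 - rh^2 is rewritten by the Moebius identity. The bound is on |Q|, not only on its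
    real part. *)
Lemma half_plane_harnack Q a w : holoD Q -> (forall z, Cmod z < 1 -> 0 <= fst (Q z)) ->
  Cmod a < 1 -> Cmod w < 1 ->
  (1 - Cmod a ^ 2) * (1 - Cmod w ^ 2) * Cmod (Q w) <= 4 * Cmod (1 - Cconj a * w)%C ^ 2 * Cmod (Q a).
Proof.
intros HQ Hre Ha Hw.
assert (Hna : Cmod (- a)%C < 1) by (rewrite Cmod_opp; auto).
set (rh := Cmod (tau (- a)%C w)).
assert (Hrh : rh < 1) by (apply tau_in; auto). assert (Hrh0 : 0 <= rh) by apply Cmod_ge_0.
assert (Hmain : Cmod (Q w - Q a)%C <= rh * Cmod (Q w + Cconj (Q a))%C).
{ apply le_epsilon. intros e He.
  (* The shift by x makes the real part strictly positive, so the denominator of the Cayley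
     transform does not vanish. *)
  set (x := e / 2). assert (Hx : 0 < x) by (unfold x; lra).
  set (P := fun z => (Q z + RtoC x)%C).
  set (h := fun z => ((P (tau a z) - P a) / (P (tau a z) + Cconj (P a)))%C).
  assert (HPr : forall z, Cmod z < 1 -> 0 < fst (P z)) by (intros z Hz; specialize (Hre z Hz); unfold P; simpl; lra).
  assert (Hden : forall z, Cmod z < 1 -> (P z + Cconj (P a))%C <> 0%C).
  { intros z Hz E. apply (f_equal fst) in E. simpl in E. pose proof (HPr z Hz). pose proof (HPr a Ha). simpl in *. lra. }
  assert (HP : holoD P).
  { apply holR_1; intros z Hz; unfold inD in Hz. eexists. apply cdiff_plus; [apply holoD_cdiff; auto|apply cdiff_const]. }
  assert (HPt : holoD (fun z => P (tau a z))).
  { apply (holoD_comp P (tau a)); auto; [apply holoD_tau; auto|intros; apply tau_in; auto]. }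
  assert (Hh : holoD h).
  { apply holR_1; intros z Hz; unfold inD in Hz. eexists. apply cdiff_div.
    - apply cdiff_minus; [apply (holoD_cdiff (fun z => P (tau a z))); auto|apply cdiff_const].
    - apply cdiff_plus; [apply (holoD_cdiff (fun z => P (tau a z))); auto|apply cdiff_const].
    - apply Hden. apply tau_in; auto. }
  assert (S : Cmod (h (tau (- a)%C w)) <= rh).
  { apply schwarz; auto.
    - intros z Hz. unfold h. assert (Hz' : Cmod (tau a z) < 1) by (apply tau_in; auto).
      pose proof (Hden _ Hz') as Hn. rewrite Cmod_div by auto. apply Cmod_gt_0 in Hn.
      apply Rmult_le_reg_r with (Cmod (P (tau a z) + Cconj (P a))%C); auto.
      unfold Rdiv. rewrite Rmult_assoc, Rinv_l, Rmult_1_r, Rmult_1_l by lra.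
      pose proof (HPr _ Hz'). pose proof (HPr a Ha).
      apply Rsqr_incr_0; [|apply Cmod_ge_0|lra]. rewrite !Rsqr_pow2, !Cmod2_alt.
      destruct (P (tau a z)), (P a); simpl in *. nra.
    - unfold h. rewrite tau_0. replace (P a - P a)%C with (RtoC 0) by ring. unfold Cdiv. ring. }
  unfold h in S. rewrite tau_inv in S by auto.
  pose proof (Hden w Hw) as Hn. rewrite Cmod_div in S by auto. apply Cmod_gt_0 in Hn.
  assert (S2 : Cmod (P w - P a)%C <= rh * Cmod (P w + Cconj (P a))%C).
  { apply (Rmult_le_compat_r (Cmod (P w + Cconj (P a)))) in S; [|lra].
    unfold Rdiv in S. rewrite Rmult_assoc, Rinv_l, Rmult_1_r in S by lra. auto. }
  replace (P w - P a)%C with (Q w - Q a)%C in S2 by (unfold P; ring).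
  assert (E : (P w + Cconj (P a))%C = ((Q w + Cconj (Q a)) + RtoC (2 * x))%C).
  { unfold P. apply C_eq; simpl; ring. }
  rewrite E in S2. pose proof (Cmod_triangle (Q w + Cconj (Q a)) (RtoC (2 * x))) as T.
  rewrite Cmod_R, Rabs_pos_eq in T by lra.
  assert (rh * Cmod (Q w + Cconj (Q a) + RtoC (2 * x)) <= rh * (Cmod (Q w + Cconj (Q a)) + 2 * x))
    by (apply Rmult_le_compat_l; auto).
  unfold x in *. nra. }
pose proof (Cmod_ge_0 (Q w)). pose proof (Cmod_ge_0 (Q a)).
assert (H1 : (1 - rh) * Cmod (Q w) <= (1 + rh) * Cmod (Q a)).
{ pose proof (Cmod_triangle (Q w) (Cconj (Q a))) as T. rewrite Cmod_conj in T.
  pose proof (Cmod_minus_ge (Q w) (Q a)). nra. }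
assert (H2 : (1 - rh ^ 2) * Cmod (Q w) <= 4 * Cmod (Q a)).
{ apply (Rmult_le_compat_l (1 + rh)) in H1; [|lra].
  assert ((1 + rh) * (1 + rh) <= 4) by nra.
  assert ((1 + rh) * (1 + rh) * Cmod (Q a) <= 4 * Cmod (Q a)) by (apply Rmult_le_compat_r; auto). nra. }
pose proof (tau_neg_mod a w Ha Hw) as T. fold rh in T.
pose proof (mobius_identity (- a)%C w) as M.
replace (Cconj (- a)) with (- Cconj a)%C in M by (apply C_eq; destruct a; simpl; ring).
replace (1 + - Cconj a * w)%C with (1 - Cconj a * w)%C in M by ring.
replace (w + - a)%C with (w - a)%C in M by ring. rewrite Cmod_opp in M.
set (d := Cmod (1 - Cconj a * w)%C) in *. assert (0 <= d) by apply Cmod_ge_0.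
replace ((1 - Cmod a ^ 2) * (1 - Cmod w ^ 2)) with (d ^ 2 * (1 - rh ^ 2)).
- pose proof (pow2_ge_0 d). nra.
- rewrite <- T in M. rewrite Rpow_mult_distr in M. nra.
Qed.

(** * Littlewood subordination *)

(** Unlike [PK_cayley], this exhibits the kernel as the real part of a function holomorphic in the
    parameter a. *)
Lemma PK_cayley2 a t : Cmod a < 1 -> PK a t = fst ((e1 t + a) / (e1 t - a))%C.
Proof.
intros Ha. rewrite PK_cayley by auto.
assert (Hn := e1_minus_neq0 a t Ha).
assert (Hv : (1 - a * Cconj (e1 t))%C <> 0%C).
{ apply C1_minus_neq0. rewrite Cmod_mult, Cmod_conj, Cmod_e1. lra. }
assert (E1 : ((e1 t + a) / (e1 t - a))%C = ((1 + a * Cconj (e1 t)) / (1 - a * Cconj (e1 t)))%C).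
{ assert (EE := e1_conj t).
  assert (Hp : (e1 t + a)%C = (e1 t * (1 + a * Cconj (e1 t)))%C).
  { transitivity (e1 t + a * (e1 t * Cconj (e1 t)))%C; [rewrite EE; ring|ring]. }
  assert (Hm : (e1 t - a)%C = (e1 t * (1 - a * Cconj (e1 t)))%C).
  { transitivity (e1 t - a * (e1 t * Cconj (e1 t)))%C; [rewrite EE; ring|ring]. }
  rewrite Hp, Hm. field. split; auto. apply Cmod_neq0. rewrite Cmod_e1; lra. }
rewrite E1. rewrite !Re_cayley.
- assert (Ec : (Cconj a * e1 t)%C = Cconj (a * Cconj (e1 t))).
  { apply C_eq; destruct a, (e1 t); simpl; ring. }
  rewrite Ec. f_equal; [rewrite Cmod_conj; auto|]. f_equal.
  rewrite <- (Cmod_conj (1 - a * Cconj (e1 t))). f_equal.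
  apply C_eq; destruct a, (e1 t); simpl; ring.
- intros E. apply Hv. rewrite E. ring.
- intros E. pose proof (f_equal Cmod E) as E'. rewrite Cmod_mult, Cmod_e1, Cmod_conj, Cmod_1 in E'. lra.
Qed.

(** The Herglotz integral: (e + a)/(e - a) = 2 e/(e - a) - 1, so a Cauchy integral minus the mean
    has [hm] as real part. *)
Lemma hm_re p ra f : 0 < p -> holoD f -> 0 < ra < 1 ->
  exists A, holR ra A /\ forall w, Cmod w < ra -> hm p ra f w = fst (A w).
Proof.
intros Hp Hf Hra. pose proof PI_RGT_0.
set (U := fun t => rpow (Cmod (f (polar ra t))) p).
assert (HU : forall t, continuous U t) by (apply cont_circle_pow; auto; lra).
set (c := fun t => (RtoC (U t / PI) * e1 t)%C).
assert (HUP : forall t, continuous (fun t => U t / PI) t).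
{ intros t. apply rcont_mult; auto. apply continuous_const. }
assert (Hc : forall t, ccont c t).
{ intros t. apply ccont_mult; [apply ccont_RtoC; auto|apply ccont_e1]. }
destruct (continuous_bounded_circle (fun t => Cmod (c t))) as [M HM].
{ intros t. apply rcont_Cmod; auto. }
{ intros t. unfold c, U. rewrite !polar_period. auto. }
assert (HM0 : 0 <= M) by (eapply Rle_trans; [apply Cmod_ge_0|apply (HM 0)]).
exists (fun w => CK c 1 (w / RtoC ra) - RtoC (mn U))%C. split.
- intros w Hw.
  assert (Ha : Cmod (w / RtoC ra)%C < 1) by (apply Cmod_div_lt; lra).
  set (eta := (1 - Cmod (w / RtoC ra)%C) / 2). assert (0 < eta) by (unfold eta; lra).
  assert (Hd : cdiff (CK c 1) (w / RtoC ra)%C (CK c 2 (w / RtoC ra)%C)).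
  { apply (cdiff_of_taylor _ _ _ (4 * PI * M / (4 * eta ^ 3)) eta); auto.
    - apply Rdiv_le_0_compat; [apply Rmult_le_pos; lra|]. apply Rmult_lt_0_compat; [lra|apply pow_lt; auto].
    - intros h Hh. apply (CK1_taylor c M Hc HM); auto. unfold eta; lra. }
  eexists. apply cdiff_minus; [|apply cdiff_const].
  apply (cdiff_comp (CK c 1) (fun w => w / RtoC ra)%C); [|exact Hd].
  apply (cdiff_ext (fun v => / RtoC ra * v)%C); [intros; unfold Cdiv; ring|apply cdiff_scal, cdiff_id].
- intros w Hw.
  assert (Ha : Cmod (w / RtoC ra)%C < 1) by (apply Cmod_div_lt; lra).
  set (a := (w / RtoC ra)%C) in *.
  assert (HPU : forall t, continuous (fun t => PK a t * U t) t) by (intros; apply rcont_mult; auto; apply PK_cont; auto).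
  assert (E : fst (CK c 1 a) = RInt (fun t => / (2 * PI) * (PK a t * U t) + / (2 * PI) * U t) 0 (2 * PI)).
  { unfold CK, CI. apply RInt_Rext. intros t _. rewrite PK_cayley2 by auto.
    pose proof (e1_minus_neq0 a t Ha) as Hn.
    assert (Ez : (c t / (e1 t - a) ^ 1)%C = (RtoC (U t / (2 * PI)) * ((e1 t + a) / (e1 t - a) + 1))%C).
    { unfold c. replace (U t / PI) with (2 * (U t / (2 * PI))) by (field; lra). rewrite RtoC_mult.
      simpl. field. auto. }
    rewrite Ez. set (v := ((e1 t + a) / (e1 t - a))%C). destruct v; simpl. field. lra. }
  change (fst (CK c 1 a - RtoC (mn U))%C) with (fst (CK c 1 a) + - mn U). rewrite E. rewrite RInt_Rplus, !RInt_Rscal; try (apply ex_RInt_cont; intros; auto; apply rcont_mult; auto; apply continuous_const).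
  unfold hm, mn. fold a. change (fun t => PK a t * rpow (Cmod (f (polar ra t))) p) with (fun t => PK a t * U t).
  unfold Rdiv. set (x := RInt (fun t => PK a t * U t) 0 (2 * PI)). set (y := RInt U 0 (2 * PI)).
  assert (forall x y : R, x * / (2 * PI) = / (2 * PI) * x + / (2 * PI) * y + - (y * / (2 * PI))) as EE by (intros; ring).
  apply EE.
Qed.

(** Composition with phi keeps the real part of a holomorphic function, so the mean is computed
    exactly. This is why the majorant, and not |f|^p, is carried along the flow. The radius r' > r
    leaves room around the circle of integration. *)
Lemma hm_mean p ra f phi r r' : 0 < p -> holoD f -> 0 < ra < 1 -> holoD phi -> 0 <= r < r' -> r' <= 1 ->
  (forall z, Cmod z < r' -> Cmod (phi z) < ra) ->
  (forall t, continuous (fun t => hm p ra f (phi (polar r t))) t) /\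
  mn (fun t => hm p ra f (phi (polar r t))) = hm p ra f (phi 0%C).
Proof.
intros Hp Hf Hra Hphi Hr Hr' Hs. pose proof PI_RGT_0.
destruct (hm_re p ra f Hp Hf Hra) as [A [HA E]].
assert (HAp : holR r' (fun z => A (phi z))).
{ intros z Hz. destruct (HA (phi z) (Hs z Hz)) as [l Hl]. eexists.
  apply (cdiff_comp A phi); [apply holoD_cdiff; auto; lra|exact Hl]. }
assert (Hpt : forall t, hm p ra f (phi (polar r t)) = fst (A (phi (polar r t)))).
{ intros t. apply E. apply Hs. rewrite Cmod_polar; lra. }
split.
- intros t. apply (continuous_ext (fun t => fst (A (phi (polar r t))))); [intros; symmetry; auto|].
  apply ccont_fst. apply (ccont_circle r' (fun z => A (phi z))); auto.
- rewrite (mn_ext _ (fun t => fst (A (phi (polar r t))))) by auto.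
  unfold mn. rewrite (mean_value_fst r' (fun z => A (phi z)) r) by auto.
  rewrite E by (apply Hs; rewrite Cmod_0; lra). field. lra.
Qed.

Lemma PK_le a t s : Cmod a <= s -> s < 1 -> PK a t <= 2 / (1 - s).
Proof.
intros Ha Hs. pose proof (Cmod_ge_0 a). pose proof (e1_minus_ge a t) as Hd. unfold PK.
apply Rle_trans with ((1 - Cmod a ^ 2) / (1 - Cmod a) ^ 2).
- apply Rmult_le_compat_l; [nra|]. apply Rinv_le_contravar; [apply pow_lt; lra|]. apply pow_incr; lra.
- replace ((1 - Cmod a ^ 2) / (1 - Cmod a) ^ 2) with ((1 + Cmod a) / (1 - Cmod a)) by (field; lra).
  apply Rmult_le_compat; try lra; [left; apply Rinv_0_lt_compat; lra|]. apply Rinv_le_contravar; lra.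
Qed.

Lemma hm_le p ra f w s : 0 < p -> holoD f -> 0 < ra < 1 -> Cmod w <= s * ra -> s < 1 ->
  hm p ra f w <= 2 / (1 - s) * mn (fun t => rpow (Cmod (f (polar ra t))) p).
Proof.
intros Hp Hf Hra Hw Hs.
assert (Ha : Cmod (w / RtoC ra)%C <= s).
{ rewrite Cmod_div_R by lra. apply Rmult_le_reg_r with ra; [lra|]. unfold Rdiv. rewrite Rmult_assoc, Rinv_l; lra. }
rewrite <- mn_scal by (apply cont_circle_pow; auto; lra). unfold hm. apply mn_le.
- apply hm_cont; auto. nra.
- intros. apply rcont_mult; [apply continuous_const|apply cont_circle_pow; auto; lra].
- intros t. apply Rmult_le_compat_r; [apply rpow_ge0|apply PK_le; auto].
Qed.

Lemma hm_0 p ra f : 0 < ra < 1 -> hm p ra f 0%C = mn (fun t => rpow (Cmod (f (polar ra t))) p).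
Proof.
intros Hra. apply mn_ext. intros t.
replace (0 / RtoC ra)%C with (RtoC 0) by (unfold Cdiv; ring).
unfold PK. rewrite Cmod_0. replace (e1 t - 0)%C with (e1 t) by ring. rewrite Cmod_e1. field.
Qed.

Lemma hm_ge0 p ra f w : 0 < p -> holoD f -> 0 < ra < 1 -> Cmod w < ra -> 0 <= hm p ra f w.
Proof.
intros. apply mn_ge0; [apply hm_cont; auto|]. intros t.
apply Rmult_le_pos; [left; apply PK_pos, Cmod_div_lt; lra|apply rpow_ge0].
Qed.

(** The numerator grows at most by 5/2 and the distance shrinks at most by 3/4; 40/9 is rounded up
    to 5. *)
Lemma PK_harnack a b t : Cmod a < 1 -> Cmod (b - a)%C <= (1 - Cmod a) / 4 -> PK b t <= 5 * PK a t.
Proof.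
intros Ha Hb. pose proof (Cmod_ge_0 a). pose proof (Cmod_ge_0 b).
assert (Hb1 : Cmod b <= Cmod a + (1 - Cmod a) / 4).
{ replace b with (a + (b - a))%C by ring. pose proof (Cmod_triangle a (b - a)). lra. }
assert (Hb2 : Cmod a - (1 - Cmod a) / 4 <= Cmod b).
{ pose proof (Cmod_minus_ge a (a - b)). rewrite (Cmod_minus_sym a b) in *.
  replace (a - (a - b))%C with b in * by ring. lra. }
pose proof (e1_minus_ge a t) as Hd.
assert (Hd2 : 3 / 4 * Cmod (e1 t - a)%C <= Cmod (e1 t - b)%C).
{ pose proof (Cmod_minus_ge (e1 t - a)%C (b - a)%C). replace (e1 t - a - (b - a))%C with (e1 t - b)%C in * by ring. lra. }
unfold PK. set (d := Cmod (e1 t - a)%C) in *. set (d' := Cmod (e1 t - b)%C) in *.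
assert (0 < d) by lra.
apply Rle_trans with ((5 / 2 * (1 - Cmod a ^ 2)) / (3 / 4 * d) ^ 2).
- apply Rmult_le_compat; [nra|left; apply Rinv_0_lt_compat, pow_lt; lra|nra|].
  apply Rinv_le_contravar; [apply pow_lt; lra|apply pow_incr; lra].
- replace ((5 / 2 * (1 - Cmod a ^ 2)) / (3 / 4 * d) ^ 2) with (40 / 9 * ((1 - Cmod a ^ 2) / d ^ 2)) by (field; lra).
  apply Rmult_le_compat_r; [|lra]. apply Rdiv_le_0_compat; [nra|apply pow_lt; lra].
Qed.

Lemma hm_harnack p ra f w w' : 0 < p -> holoD f -> 0 < ra < 1 -> Cmod w < ra ->
  Cmod (w' - w)%C <= (ra - Cmod w) / 4 -> hm p ra f w' <= 5 * hm p ra f w.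
Proof.
intros Hp Hf Hra Hw Hw'.
assert (Hw1 : Cmod w' < ra).
{ replace w' with (w + (w' - w))%C by ring. pose proof (Cmod_triangle w (w' - w)). lra. }
unfold hm. rewrite <- mn_scal by (apply hm_cont; auto). apply mn_le.
- apply hm_cont; auto.
- intros; apply rcont_mult; [apply continuous_const|apply hm_cont; auto].
- intros t. rewrite <- Rmult_assoc. apply Rmult_le_compat_r; [apply rpow_ge0|].
  apply PK_harnack; [apply Cmod_div_lt; lra|].
  assert (HRc : RtoC ra <> 0%C) by (intros E; apply RtoC_inj in E; lra).
  replace (w' / RtoC ra - w / RtoC ra)%C with ((w' - w) / RtoC ra)%C by (field; auto).
  rewrite !Cmod_div_R by lra.
  replace ((1 - Cmod w / ra) / 4) with ((ra - Cmod w) / 4 / ra) by (field; lra).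
  apply Rmult_le_compat_r; auto. left; apply Rinv_0_lt_compat; lra.
Qed.

Definition pm (p r : R) (f : C -> C) : R := mn (fun t => rpow (Cmod (f (polar r t))) p).

(** Since phi 0 may differ from 0, the mean of the majorant is its value at phi 0; |phi 0| <= s ra
    bounds the Poisson kernel there. *)
Lemma littlewood p ra f phi r r' s : 0 < p -> holoD f -> 0 < ra < 1 -> holoD phi -> 0 <= r < r' -> r' <= 1 ->
  (forall z, Cmod z < r' -> Cmod (phi z) < ra) -> Cmod (phi 0%C) <= s * ra -> s < 1 ->
  pm p r (fun z => f (phi z)) <= mn (fun t => hm p ra f (phi (polar r t)))
  /\ mn (fun t => hm p ra f (phi (polar r t))) <= 2 / (1 - s) * pm p ra f.
Proof.
intros Hp Hf Hra Hphi Hr Hr' Hs H0 Hs1.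
destruct (hm_mean p ra f phi r r' Hp Hf Hra Hphi Hr Hr' Hs) as [Hc E]. split.
- apply mn_le; auto.
  + intros t. apply rcont_rpow; auto. apply rcont_Cmod. apply (ccont_circle r' (fun z => f (phi z))); auto.
    intros z Hz. eexists. apply (cdiff_comp f phi); apply holoD_cdiff; auto; try lra.
    specialize (Hs z Hz). lra.
  + intros t. apply poisson_majorant; auto. apply Hs. rewrite Cmod_polar; lra.
- rewrite E. apply hm_le; auto.
Qed.

(** The majorant composed with the identity: its mean on |z| = r is its value at 0, which is the
    mean on |z| = ra. *)
Lemma pm_mono p f r ra : 0 < p -> holoD f -> 0 <= r < ra -> ra < 1 -> pm p r f <= pm p ra f.
Proof.
intros Hp Hf Hr Hra.
destruct (hm_mean p ra f (fun z => z) r ra) as [Hc E]; auto; try lra.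
{ intros z _. eexists. apply cdiff_id. }
rewrite hm_0 in E by lra. unfold pm. rewrite <- E. apply mn_le; auto.
- apply cont_circle_pow; auto; lra.
- intros t. apply poisson_majorant; auto; [lra|]. rewrite Cmod_polar; lra.
Qed.

(** * Integral means *)

Definition circ (u : R -> R) : Prop :=
  (forall t, continuous u t) /\ (forall t, u (t + 2 * PI) = u t) /\ (forall t, 0 <= u t).

(** [Mp] on general nonnegative functions of the angle, so that sums and constants, which are not
    moduli of holomorphic functions, can be compared. *)
Definition Lp (p : Rbar) (u : R -> R) : R :=
  match p with
  | Finite q => rpow (mn (fun t => rpow (u t) q)) (/ q)
  | p_infty => real (Lub_Rbar (fun x => exists t, x = u t))
  | m_infty => 0
  end.

Lemma Mp_Lp p r f : Mp p r f = Lp p (fun t => Cmod (f (polar r t))).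
Proof. destruct p; reflexivity. Qed.

Lemma circ_hol f r : holoD f -> 0 <= r < 1 -> circ (fun t => Cmod (f (polar r t))).
Proof.
intros Hf Hr. repeat split.
- intros t. apply rcont_Cmod. apply (ccont_circle 1); auto.
- intros t. rewrite polar_period; auto.
- intros t. apply Cmod_ge_0.
Qed.

Lemma circ_plus u v : circ u -> circ v -> circ (fun t => u t + v t).
Proof.
intros [U1 [U2 U3]] [V1 [V2 V3]]. repeat split.
- intros t. apply rcont_plus; auto.
- intros t. rewrite U2, V2; auto.
- intros t. specialize (U3 t); specialize (V3 t); lra.
Qed.

Lemma circ_scal c u : 0 <= c -> circ u -> circ (fun t => c * u t).
Proof.
intros Hc [U1 [U2 U3]]. repeat split.
- intros t. apply rcont_mult; auto. apply continuous_const.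
- intros t. rewrite U2; auto.
- intros t. specialize (U3 t). nra.
Qed.

Lemma circ_const c : 0 <= c -> circ (fun _ => c).
Proof. intros Hc. repeat split; auto. intros; apply continuous_const. Qed.

Lemma circ_bounded u : circ u -> exists M, forall t, u t <= M.
Proof. intros [U1 [U2 U3]]. apply continuous_bounded_circle; auto. Qed.

Lemma Lp_inf_lub u : circ u -> (forall t, u t <= Lp p_infty u) /\ forall M, (forall t, u t <= M) -> Lp p_infty u <= M.
Proof.
intros Hu. destruct (circ_bounded u Hu) as [M0 HM0].
set (E := fun x => exists t, x = u t).
destruct (Lub_Rbar_correct E) as [H1 H2].
assert (Hfin : is_finite (Lub_Rbar E)).
{ assert (B1 : Rbar_le (u 0) (Lub_Rbar E)) by (apply H1; exists 0; auto).
  assert (B2 : Rbar_le (Lub_Rbar E) M0) by (apply H2; intros x [t ->]; simpl; auto).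
  destruct (Lub_Rbar E); simpl in *; try contradiction. reflexivity. }
unfold Lp. fold E. rewrite <- Hfin in H1, H2. split.
- intros t. apply (H1 (u t)). exists t; auto.
- intros M HM. apply (H2 M). intros x [t ->]. simpl. auto.
Qed.

Lemma circ_rpow_cont q u : 0 < q -> circ u -> forall t, continuous (fun t => rpow (u t) q) t.
Proof. intros Hq [U1 _] t. apply rcont_rpow; auto. Qed.

Lemma Lp_ge0 p u : circ u -> 0 <= Lp p u.
Proof.
intros Hu. destruct p; simpl; [apply rpow_ge0| |lra].
destruct (Lp_inf_lub u Hu) as [H _]. eapply Rle_trans; [|apply (H 0)]. apply Hu.
Qed.

Lemma Lp_mono p u v : Rbar_lt 0 p -> circ u -> circ v -> (forall t, u t <= v t) -> Lp p u <= Lp p v.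
Proof.
intros Hp Hu Hv H. destruct p as [q| |]; simpl in Hp; [| |contradiction].
- apply rpow_le; [apply Rinv_0_lt_compat; auto|]. apply mn_le; try (apply circ_rpow_cont; auto).
  intros t. apply rpow_le; auto.
- apply Lp_inf_lub; auto. intros t. eapply Rle_trans; [apply H|]. apply Lp_inf_lub; auto.
Qed.

Lemma Lp_const p c : Rbar_lt 0 p -> 0 <= c -> Lp p (fun _ => c) = c.
Proof.
intros Hp Hc. destruct p as [q| |]; simpl in Hp; [| |contradiction].
- simpl. rewrite mn_const. apply rpow_inv_l; auto.
- destruct (Lp_inf_lub (fun _ => c) (circ_const c Hc)) as [H1 H2]. apply Rle_antisym.
  + apply H2. intros; lra.
  + apply (H1 0).
Qed.

Lemma Lp_le_const p u c : Rbar_lt 0 p -> circ u -> (forall t, u t <= c) -> Lp p u <= c.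
Proof.
intros Hp Hu H. assert (0 <= c) by (eapply Rle_trans; [|apply (H 0)]; apply Hu).
rewrite <- (Lp_const p c) by auto. apply Lp_mono; auto. apply circ_const; auto.
Qed.

Lemma Lp_scal p c u : Rbar_lt 0 p -> 0 <= c -> circ u -> Lp p (fun t => c * u t) = c * Lp p u.
Proof.
intros Hp Hc Hu. destruct p as [q| |]; simpl in Hp; [| |contradiction].
- simpl. rewrite (mn_ext _ (fun t => rpow c q * rpow (u t) q)) by (intros; apply rpow_mult; auto; apply Hu).
  rewrite mn_scal by (apply circ_rpow_cont; auto).
  rewrite rpow_mult; [|apply rpow_ge0|apply mn_ge0; [apply circ_rpow_cont; auto|intros; apply rpow_ge0]].
  rewrite rpow_inv_l; auto.
- destruct (Lp_inf_lub u Hu) as [H1 H2]. destruct (Lp_inf_lub _ (circ_scal c u Hc Hu)) as [H3 H4].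
  apply Rle_antisym.
  + apply H4. intros t. apply Rmult_le_compat_l; auto.
  + destruct Hc as [Hc| <-].
    * apply Rmult_le_reg_l with (/ c); [apply Rinv_0_lt_compat; auto|].
      rewrite <- Rmult_assoc, Rinv_l, Rmult_1_l by lra. apply H2. intros t.
      apply Rmult_le_reg_l with c; auto. rewrite <- Rmult_assoc, Rinv_r, Rmult_1_l by lra. apply H3.
    * rewrite Rmult_0_l. eapply Rle_trans; [|apply (H3 0)]. lra.
Qed.

(** A quasi-triangle constant valid for all exponents, also below 1: a factor 2 inside the mean and
    one for the outer power 1/q. *)
Definition Kp (p : Rbar) : R := match p with Finite q => 2 * rpow 2 (/ q) | _ => 1 end.

Lemma Kp_ge1 p : Rbar_lt 0 p -> 1 <= Kp p.
Proof.
intros Hp. destruct p as [q| |]; simpl in *; try lra.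
assert (rpow 1 (/ q) <= rpow 2 (/ q)) by (apply rpow_le; [apply Rinv_0_lt_compat; auto|lra]).
rewrite rpow_one in *. lra.
Qed.

Lemma Lp_plus p u v : Rbar_lt 0 p -> circ u -> circ v -> Lp p (fun t => u t + v t) <= Kp p * (Lp p u + Lp p v).
Proof.
intros Hp Hu Hv. destruct p as [q| |]; simpl in Hp; [| |contradiction].
- simpl. pose proof (Rinv_0_lt_compat _ Hp) as Hi.
  set (A := mn (fun t => rpow (u t) q)). set (B := mn (fun t => rpow (v t) q)).
  assert (HA : 0 <= A) by (apply mn_ge0; [apply circ_rpow_cont; auto|intros; apply rpow_ge0]).
  assert (HB : 0 <= B) by (apply mn_ge0; [apply circ_rpow_cont; auto|intros; apply rpow_ge0]).
  apply Rle_trans with (rpow (rpow 2 q * (A + B)) (/ q)).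
  + apply rpow_le; auto. unfold A, B. rewrite <- mn_plus, <- mn_scal; try (apply circ_rpow_cont; auto).
    2: { intros t. apply rcont_plus; apply circ_rpow_cont; auto. }
    apply mn_le.
    * apply (circ_rpow_cont q (fun t => u t + v t)); auto. apply circ_plus; auto.
    * intros t. apply rcont_mult; [apply continuous_const|]. apply rcont_plus; apply circ_rpow_cont; auto.
    * intros t. apply rpow_add; auto; [apply Hu|apply Hv].
  + rewrite rpow_mult, rpow_inv_l; try lra; [|apply rpow_ge0].
    rewrite (Rmult_assoc 2). apply Rmult_le_compat_l; [lra|]. apply rpow_add; auto.
- simpl. rewrite Rmult_1_l. apply Lp_inf_lub; [apply circ_plus; auto|]. intros t.
  apply Rplus_le_compat; apply Lp_inf_lub; auto.
Qed.

Lemma Lp_plus_le p u v w : Rbar_lt 0 p -> circ u -> circ v -> circ w -> (forall t, w t <= u t + v t) ->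
  Lp p w <= Kp p * (Lp p u + Lp p v).
Proof.
intros Hp Hu Hv Hw H. eapply Rle_trans; [|apply Lp_plus; auto]. apply Lp_mono; auto. apply circ_plus; auto.
Qed.

Lemma Mp_ge0 p r f : holoD f -> 0 <= r < 1 -> 0 <= Mp p r f.
Proof. intros. rewrite Mp_Lp. apply Lp_ge0, circ_hol; auto. Qed.

Lemma Mp_fin q r f : Mp (Finite q) r f = rpow (pm q r f) (/ q).
Proof. reflexivity. Qed.

Lemma pm_ge0 q r f : 0 < q -> holoD f -> 0 <= r < 1 -> 0 <= pm q r f.
Proof. intros. apply mn_ge0; [apply cont_circle_pow; auto|intros; apply rpow_ge0]. Qed.

Lemma holoD_minus f g : holoD f -> holoD g -> holoD (fun z => f z - g z)%C.
Proof. intros Hf Hg z Hz. eexists. apply cdiff_minus; apply holoD_cdiff; auto. Qed.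

Lemma Mp_minus p r f g : Rbar_lt 0 p -> holoD f -> holoD g -> 0 <= r < 1 ->
  Mp p r (fun z => f z - g z)%C <= Kp p * (Mp p r f + Mp p r g).
Proof.
intros Hp Hf Hg Hr. rewrite !Mp_Lp. apply Lp_plus_le; auto; try (apply circ_hol; auto; fail).
- apply (circ_hol (fun z => f z - g z)%C); auto. apply holoD_minus; auto.
- intros t. apply Cmod_minus_le.
Qed.

Lemma Mp_mono p f r ra : Rbar_lt 0 p -> holoD f -> 0 <= r < ra -> ra < 1 -> Mp p r f <= Mp p ra f.
Proof.
intros Hp Hf Hr Hra. destruct p as [q| |]; simpl in Hp; [| |contradiction].
- rewrite !Mp_fin. apply rpow_le; [apply Rinv_0_lt_compat; auto|]. apply pm_mono; auto.
- rewrite !Mp_Lp. pose proof (circ_hol f ra Hf ltac:(lra)) as Hc.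
  apply Lp_inf_lub; [apply circ_hol; auto; lra|]. intros t.
  apply (max_modulus f ra); auto; [lra|rewrite Cmod_polar; lra|]. intros s.
  apply (proj1 (Lp_inf_lub _ Hc) s).
Qed.

Lemma Hnorm_le p al f e : Rbar_le (Hnorm p al f) (Finite e) <->
  forall r, 0 <= r < 1 -> rpow (1 - r) al * Mp p r f <= e.
Proof.
unfold Hnorm. match goal with |- Rbar_le (Lub_Rbar ?E) _ <-> _ => destruct (Lub_Rbar_correct E) as [H1 H2] end.
split.
- intros H r Hr.
  match goal with |- ?x <= e => assert (B : Rbar_le (Finite x) (Finite e)) by
    (eapply Rbar_le_trans; [apply H1; exists r; auto|exact H]); exact B end.
- intros H. apply H2. intros x [r [Hr ->]]. simpl. auto.
Qed.

Lemma Hnorm_fin p al f : Rbar_lt (Hnorm p al f) p_infty <->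
  exists S, forall r, 0 <= r < 1 -> rpow (1 - r) al * Mp p r f <= S.
Proof.
split.
- intros H. exists (real (Hnorm p al f)). apply Hnorm_le.
  destruct (Hnorm p al f) eqn:E; simpl in *; try contradiction; [lra|auto].
- intros [S HS]. apply Hnorm_le in HS. eapply Rbar_le_lt_trans; [exact HS|exact I].
Qed.

(** * Time change and radial comparison of means *)

(** The generator gives derivatives from the right only. The supremum of the times up to which D s
    >= D 0 - e s holds is reached by continuity and can be passed unless it is T. *)
Lemma right_dini (D : R -> R) T : 0 <= T ->
  (forall t, 0 <= t <= T -> forall e, 0 < e -> exists d, 0 < d /\ forall s, 0 <= s <= T -> Rabs (s - t) < d -> Rabs (D s - D t) < e) ->
  (forall t, 0 <= t < T -> forall e, 0 < e -> exists h0, 0 < h0 /\ forall h, 0 < h < h0 -> - e * h <= D (t + h) - D t) ->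
  D 0 <= D T.
Proof.
intros HT Hc Hd.
enough (Hk : forall e, 0 < e -> D 0 - e * T <= D T).
{ apply le_epsilon. intros e He. specialize (Hk (e / (T + 1)) ltac:(apply Rdiv_lt_0_compat; lra)).
  assert (e / (T + 1) * T <= e); [|lra].
  apply Rle_trans with (e / (T + 1) * (T + 1)); [|apply Req_le; field; lra].
  apply Rmult_le_compat_l; [|lra]. left; apply Rdiv_lt_0_compat; lra. }
intros e He.
set (E := fun t => 0 <= t <= T /\ forall s, 0 <= s <= t -> D 0 - e * s <= D s).
destruct (completeness E) as [m [Hm1 Hm2]].
- exists T. intros t [Ht _]; lra.
- exists 0. split; [lra|]. intros s Hs. replace s with 0 by lra. lra.
- assert (Hm0 : 0 <= m).
  { apply Hm1. split; [lra|]. intros s Hs. replace s with 0 by lra. lra. }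
  assert (HmT : m <= T) by (apply Hm2; intros t [Ht _]; lra).
  assert (Hlt : forall s, 0 <= s < m -> D 0 - e * s <= D s).
  { intros s Hs. apply Rnot_lt_le. intros Hbad.
    assert (m <= s); [|lra]. apply Hm2. intros t [Ht Ht2]. apply Rnot_lt_le. intros Hst.
    specialize (Ht2 s ltac:(lra)). lra. }
  assert (Hm : D 0 - e * m <= D m).
  { apply le_epsilon. intros x Hx. destruct (Hc m ltac:(lra) x Hx) as [d [Hd0 Hd1]].
    destruct Hm0 as [Hm0| <-]; [|lra].
    set (s := Rmax (m / 2) (m - d / 2)).
    assert (Hs : 0 <= s < m) by (unfold s; split; [eapply Rle_trans; [|apply Rmax_l]; lra|apply Rmax_lub_lt; lra]).
    assert (Hs2 : m - d / 2 <= s) by apply Rmax_r.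
    specialize (Hd1 s ltac:(lra) ltac:(rewrite Rabs_left; lra)). specialize (Hlt s Hs).
    apply Rabs_def2 in Hd1. nra. }
  destruct HmT as [HmT| ->]; auto. exfalso.
  destruct (Hd m ltac:(lra) e He) as [h0 [Hh0 Hh]].
  set (h := Rmin (h0 / 2) (T - m)).
  assert (Hhp : 0 < h) by (apply Rmin_pos; lra).
  assert (Hh1 : h <= h0 / 2) by apply Rmin_l. assert (Hh2 : h <= T - m) by apply Rmin_r.
  assert (m + h <= m); [|lra]. apply Hm1. split; [lra|]. intros s Hs.
  destruct (Rlt_le_dec s m); [apply Hlt; lra|].
  destruct (Req_dec s m) as [->|]; auto.
  specialize (Hh (s - m) ltac:(lra)). replace (m + (s - m)) with s in Hh by ring. nra.
Qed.

Lemma mobius_identity_neg (a z : C) :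
  Cmod (1 - Cconj a * z)%C ^ 2 - Cmod (z - a)%C ^ 2 = (1 - Cmod z ^ 2) * (1 - Cmod a ^ 2).
Proof. rewrite !Cmod2_alt. destruct a, z; simpl. ring. Qed.

Lemma Cinv_0 : (/ 0)%C = 0%C.
Proof. apply C_eq; simpl; unfold Rdiv; ring. Qed.

Lemma Re_conj_self (v : C) : fst (Cconj v * v)%C = Cmod v ^ 2.
Proof. rewrite Cmod2_alt. destruct v; simpl. ring. Qed.

Lemma RInt_ub (f : R -> R) a b M : a <= b -> ex_RInt f a b -> (forall x, a < x < b -> f x <= M) ->
  RInt f a b <= (b - a) * M.
Proof.
intros Hab Hf H. rewrite <- RInt_Rconst. apply RInt_le; auto.
apply ex_RInt_cont; intros; apply continuous_const.
Qed.

Lemma RInt_lb (f : R -> R) a b M : a <= b -> ex_RInt f a b -> (forall x, a < x < b -> M <= f x) ->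
  (b - a) * M <= RInt f a b.
Proof.
intros Hab Hf H. rewrite <- RInt_Rconst. apply RInt_le; auto.
apply ex_RInt_cont; intros; apply continuous_const.
Qed.

(** The map t + s t grows at rate at least 1/2 and ends below 2 de, so substitution costs a factor
    2. As s need not be differentiable, [right_dini] is applied to the difference of the two
    integrals as functions of the upper limit. *)
Lemma time_change (psi s : R -> R) de : 0 < de -> (forall t, continuous psi t) -> (forall t, 0 <= psi t) ->
  (forall t, continuous s t) -> (forall t, 0 <= t <= de -> 0 <= s t <= de) ->
  (forall t, 0 <= t < de -> exists h0, 0 < h0 /\ forall h, 0 < h < h0 -> s t - h / 2 <= s (t + h)) ->
  RInt (fun t => psi (t + s t)) 0 de <= 2 * RInt psi 0 (2 * de).
Proof.
intros Hde Hpsi Hpos Hs Hsb Hl.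
set (sg := fun t => t + s t).
assert (Hsg : forall t, continuous sg t) by (intros; apply rcont_plus; auto; apply continuous_id).
assert (Hpsg : forall t, continuous (fun t => psi (sg t)) t).
{ intros t. apply (continuous_comp sg psi); auto. }
assert (Hex : forall a c, ex_RInt psi a c) by (intros; apply ex_RInt_cont; auto).
assert (Hex2 : forall a c, ex_RInt (fun t => psi (sg t)) a c) by (intros; apply ex_RInt_cont; auto).
set (D := fun t => 2 * RInt psi 0 (sg t) - RInt (fun t => psi (sg t)) 0 t).
assert (HDc : forall t, continuous D t).
{ intros t. apply rcont_minus.
  - apply rcont_mult; [apply continuous_const|].
    apply (continuous_comp sg (fun y => RInt psi 0 y)); auto.
    eapply is_derive_Rcont. apply (is_derive_RInt (V := R_NormedModule) psi (fun y => RInt psi 0 y) 0); auto.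
    exists (mkposreal 1 Rlt_0_1). intros y _. apply (RInt_correct (V := R_CompleteNormedModule)); auto.
  - eapply is_derive_Rcont. apply (is_derive_RInt (V := R_NormedModule) (fun t => psi (sg t)) (fun y => RInt (fun t => psi (sg t)) 0 y) 0); auto.
    exists (mkposreal 1 Rlt_0_1). intros y _. apply (RInt_correct (V := R_CompleteNormedModule)); auto. }
assert (HD : D 0 <= D de).
{ apply right_dini; [lra| |].
  - intros t Ht e He. pose proof (HDc t) as Hc. apply continuity_pt_filterlim in Hc.
    rewrite continuity_pt_eps in Hc. destruct (Hc e He) as [d [Hd Hd2]]. exists d; split; auto.
  - intros t Ht e He.
    pose proof (Hpsi (sg t)) as Hc. apply continuity_pt_filterlim in Hc. rewrite continuity_pt_eps in Hc.
    destruct (Hc (e / 2) ltac:(lra)) as [d1 [Hd1 Hc1]].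
    pose proof (Hsg t) as Hc'. apply continuity_pt_filterlim in Hc'. rewrite continuity_pt_eps in Hc'.
    destruct (Hc' d1 Hd1) as [d2 [Hd2 Hc2]].
    destruct (Hl t Ht) as [h0 [Hh0 Hh]].
    exists (Rmin h0 d2). split; [apply Rmin_pos; auto|]. intros h Hhh.
    assert (h < h0) by (pose proof (Rmin_l h0 d2); lra). assert (h < d2) by (pose proof (Rmin_r h0 d2); lra).
    specialize (Hh h ltac:(lra)).
    assert (Hsig : h / 2 <= sg (t + h) - sg t) by (unfold sg; lra).
    assert (Hsd : Rabs (sg (t + h) - sg t) < d1) by (apply Hc2; rewrite Rabs_pos_eq; lra).
    apply Rabs_def2 in Hsd.
    set (v := psi (sg t)) in *.
    unfold D.
    rewrite <- (RInt_Rchasles psi 0 (sg t) (sg (t + h))) by auto.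
    rewrite <- (RInt_Rchasles (fun t => psi (sg t)) 0 t (t + h)) by auto.
    assert (I2 : RInt (fun t => psi (sg t)) t (t + h) <= h * (v + e / 2)).
    { replace (h * (v + e / 2)) with ((t + h - t) * (v + e / 2)) by ring.
      apply RInt_ub; auto; [lra|].
      intros y Hy. assert (Hy2 : Rabs (sg y - sg t) < d1) by (apply Hc2; rewrite Rabs_pos_eq; lra).
      specialize (Hc1 _ Hy2). apply Rabs_def2 in Hc1. fold v in Hc1. lra. }
    assert (I1 : h / 2 * (v - e / 2) <= RInt psi (sg t) (sg (t + h))).
    (* The increment of [sg] is only bounded below by h / 2, so the lower bound for psi has to be
       cut off at 0. *)
    { set (m := Rmax 0 (v - e / 2)).
      apply Rle_trans with ((sg (t + h) - sg t) * m).
      - assert (v - e / 2 <= m) by apply Rmax_r. assert (0 <= m) by apply Rmax_l. nra.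
      - apply RInt_lb; auto; [lra|].
        intros y Hy. apply Rmax_lub; auto.
        assert (Hy2 : Rabs (y - sg t) < d1) by (rewrite Rabs_pos_eq; lra).
        specialize (Hc1 _ Hy2). apply Rabs_def2 in Hc1. fold v in Hc1. lra. }
    nra. }
unfold D in HD. rewrite (RInt_point (V := R_CompleteNormedModule)) in HD. unfold zero in HD; simpl in HD.
assert (H1 : 0 <= RInt psi 0 (sg 0)).
{ apply RInt_ge_0; auto. unfold sg. specialize (Hsb 0 ltac:(lra)). lra. }
assert (H2 : RInt psi 0 (sg de) <= RInt psi 0 (2 * de)).
{ rewrite <- (RInt_Rchasles psi 0 (sg de) (2 * de)) by auto.
  assert (0 <= RInt psi (sg de) (2 * de)); [|lra].
  apply RInt_ge_0; auto. unfold sg. specialize (Hsb de ltac:(lra)). lra. }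
change (fun t => psi (t + s t)) with (fun t => psi (sg t)). lra.
Qed.

(** The recursion tends to E / (1 - q); the factor 2 absorbs the transient. *)
Lemma seq_contract (v : nat -> R) q E k0 : 0 <= q < 1 -> 0 < E ->
  (forall k, (k0 <= k)%nat -> v (S k) <= q * v k + E) ->
  exists k1, (k0 <= k1)%nat /\ forall k, (k1 <= k)%nat -> v k <= 2 * E / (1 - q).
Proof.
intros Hq HE H.
set (w := E / (1 - q)). assert (Hw : 0 < w) by (apply Rdiv_lt_0_compat; lra).
assert (Ew : q * w + E = w) by (unfold w; field; lra).
assert (Hind : forall n, v (n + k0)%nat <= q ^ n * Rabs (v k0) + w).
{ induction n; simpl.
  - pose proof (Rle_abs (v k0)). lra.
  - eapply Rle_trans; [apply H; lia|].
    apply Rle_trans with (q * (q ^ n * Rabs (v k0) + w) + E); [|lra].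
    apply Rplus_le_compat_r. apply Rmult_le_compat_l; lra. }
destruct (pow_lt_1_zero q) with (y := w / (Rabs (v k0) + 1)) as [n Hn].
{ rewrite Rabs_pos_eq; lra. }
{ apply Rdiv_lt_0_compat; auto. pose proof (Rabs_pos (v k0)); lra. }
exists (n + k0)%nat. split; [lia|]. intros k Hk.
replace k with ((k - k0) + k0)%nat by lia. eapply Rle_trans; [apply Hind|].
specialize (Hn (k - k0)%nat ltac:(lia)). rewrite Rabs_pos_eq in Hn by (apply pow_le; lra).
pose proof (Rabs_pos (v k0)).
assert (q ^ (k - k0) * Rabs (v k0) <= w).
{ apply Rle_trans with (w / (Rabs (v k0) + 1) * (Rabs (v k0) + 1)); [|apply Req_le; field; lra].
  apply Rmult_le_compat; try lra. apply pow_le; lra. }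
replace (2 * E / (1 - q)) with (w + w) by (unfold w; field; lra). lra.
Qed.

(** With this ratio the step from 1 - d to 1 - th d has length d/8, a quarter of the distance from 1
    - d to the radius 1 - d/2, which is the reach of [hm_harnack]. *)
Definition th : R := 7 / 8.
Definition rk (k : nat) : R := 1 - th ^ k.

Lemma th_pow k : 0 < th ^ k <= 1.
Proof.
unfold th. split; [apply pow_lt; lra|]. induction k; simpl; [lra|]. pose proof (pow_lt (7 / 8) k ltac:(lra)). lra.
Qed.

Lemma rk_bounds k : 0 <= rk k < 1.
Proof. unfold rk. pose proof (th_pow k). lra. Qed.

Lemma rk_lim r : r < 1 -> exists k, r < rk k.
Proof.
intros Hr. destruct (pow_lt_1_zero th) with (y := 1 - r) as [n Hn].
- unfold th; rewrite Rabs_pos_eq; lra.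
- lra.
- exists n. specialize (Hn n (le_n n)). pose proof (th_pow n). rewrite Rabs_pos_eq in Hn by lra. unfold rk. lra.
Qed.

Lemma rk_incr k m : (k <= m)%nat -> rk k <= rk m.
Proof.
intros H. induction H; [lra|]. unfold rk in *. pose proof (th_pow m). simpl. unfold th in *. lra.
Qed.

Lemma rk_find k1 r : rk k1 <= r < 1 -> exists k, (k1 <= k)%nat /\ rk k <= r < rk (S k).
Proof.
intros [H1 H2]. destruct (rk_lim r H2) as [n Hn].
assert (Hi : forall n, r < rk (n + k1) -> exists k, (k1 <= k)%nat /\ rk k <= r < rk (S k)).
{ induction n0; simpl; intros Hlt; [lra|].
  destruct (Rlt_le_dec r (rk (n0 + k1))); auto. exists (n0 + k1)%nat. repeat split; auto; lia. }
apply (Hi n). eapply Rlt_le_trans; [exact Hn|]. apply rk_incr; lia.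
Qed.

(** The real mean value theorem for Re (conj v f) along the radius, v being the total increment. *)
Lemma radial_mvi f r r' B t : holoD f -> 0 <= r < r' -> r' < 1 ->
  (forall s, r <= s <= r' -> Cmod (C_derive f (polar s t)) <= B) ->
  Cmod (f (polar r' t) - f (polar r t))%C <= B * (r' - r).
Proof.
intros Hf Hr Hr' HB. set (v := (f (polar r' t) - f (polar r t))%C).
set (F := fun s => fst (Cconj v * f (polar s t))%C).
set (F' := fun s => fst (Cconj v * (C_derive f (polar s t) * e1 t))%C).
assert (HF : forall s, 0 <= s < 1 -> is_derive F s (F' s)).
{ intros s Hs.
  assert (Hp : rdiff (fun s => polar s t) s (e1 t)).
  { split; simpl; auto_derive; auto; ring. }
  assert (Hd : cdiff (fun z => Cconj v * f z)%C (polar s t) (Cconj v * C_derive f (polar s t))%C).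
  { apply cdiff_scal. apply holoD_cdiff; auto. rewrite Cmod_polar; lra. }
  destruct (rdiff_comp _ _ _ _ _ Hp Hd) as [H1 _]. unfold F, F'. rewrite Cmult_assoc. exact H1. }
destruct (MVT_gen F r r' F') as [c [Hc1 Hc2]].
- rewrite Rmin_left, Rmax_right by lra. intros; apply HF; lra.
- rewrite Rmin_left, Rmax_right by lra. intros. apply continuity_pt_filterlim. eapply is_derive_Rcont. apply HF; lra.
- rewrite Rmin_left, Rmax_right in Hc1 by lra.
  assert (E : F r' - F r = Cmod v ^ 2).
  { rewrite <- (Re_conj_self v). unfold F. unfold v at 3. simpl. ring. }
  rewrite E in Hc2.
  assert (F' c <= Cmod v * B).
  { eapply Rle_trans; [apply Rle_abs|]. eapply Rle_trans; [apply Cmod_fst_le|].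
    rewrite !Cmod_mult, Cmod_conj, Cmod_e1, Rmult_1_r. apply Rmult_le_compat_l; [apply Cmod_ge_0|auto]. }
  pose proof (Cmod_ge_0 v) as Hv. destruct Hv as [Hv|Hv].
  + apply Rmult_le_reg_l with (Cmod v); auto. nra.
  + rewrite <- Hv. assert (0 <= B) by (eapply Rle_trans; [apply Cmod_ge_0|apply (HB r); lra]). nra.
Qed.

(* Harnack for the Poisson majorant of |g'|^q controls |g'| along the radial step from r_k to r_{k+1}. *)
Lemma radial_step q lam : 0 < q -> 0 < lam -> exists K, 0 < K /\ forall g d, holoD g -> 0 < d <= 1 ->
  pm q (1 - th * d) g <= (1 + lam) * pm q (1 - d) g + K * (rpow d q * pm q (1 - d / 2) (C_derive g)).
Proof.
intros Hq Hlam. destruct (rpow_add_lam q lam Hq Hlam) as [K [HK Hadd]].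
exists (5 * K). split; [lra|]. intros g d Hg Hd.
assert (Hg' : holoD (C_derive g)) by (apply holoD_derive; auto).
set (ra := 1 - d / 2). assert (Hra : 0 < ra < 1) by (unfold ra; lra).
set (u := fun t => hm q ra (C_derive g) (polar (1 - d) t)).
destruct (hm_mean q ra (C_derive g) (fun z => z) (1 - d) ra) as [Hc E]; auto; try (unfold ra; lra).
{ intros z _. eexists. apply cdiff_id. }
rewrite hm_0 in E by auto. fold u in Hc.
assert (Hu0 : forall t, 0 <= u t).
{ intros t. unfold u. apply hm_ge0; auto. rewrite Cmod_polar; unfold ra; lra. }
assert (Hstep : forall t, Cmod (g (polar (1 - th * d) t)) <= Cmod (g (polar (1 - d) t)) + d * rpow (5 * u t) (/ q)).
{ intros t.
  assert (M : Cmod (g (polar (1 - th * d) t) - g (polar (1 - d) t))%C <= rpow (5 * u t) (/ q) * ((1 - th * d) - (1 - d))).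
  { apply radial_mvi; auto; try (unfold th; lra). intros s Hs.
    rewrite <- (rpow_inv_l (Cmod (C_derive g (polar s t))) q) by (auto using Cmod_ge_0).
    apply rpow_le; [apply Rinv_0_lt_compat; auto|].
    eapply Rle_trans; [apply (poisson_majorant q (C_derive g) ra); auto|].
    - rewrite Cmod_polar; unfold ra, th in *; lra.
    - unfold u. apply hm_harnack; auto; rewrite ?Cmod_polar; try (unfold ra; lra).
      replace (polar s t - polar (1 - d) t)%C with (polar (s - (1 - d)) t)
        by (unfold polar, Cminus, Cplus, Copp; simpl; f_equal; ring).
      rewrite Cmod_polar by lra. unfold ra, th in *. lra. }
  pose proof (Cmod_triangle (g (polar (1 - d) t)) (g (polar (1 - th * d) t) - g (polar (1 - d) t))) as T.
  replace (g (polar (1 - d) t) + (g (polar (1 - th * d) t) - g (polar (1 - d) t)))%C with (g (polar (1 - th * d) t)) in T by ring.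
  pose proof (rpow_ge0 (5 * u t) (/ q)). unfold th in *. nra. }
unfold pm at 3. fold ra. rewrite <- E. fold u. unfold pm.
apply Rle_trans with (mn (fun t => (1 + lam) * rpow (Cmod (g (polar (1 - d) t))) q + (5 * K * rpow d q) * u t)).
- apply mn_le.
  + apply cont_circle_pow; auto. unfold th; lra.
  + intros t. apply rcont_plus; (apply rcont_mult; [apply continuous_const|]); auto. apply cont_circle_pow; auto; lra.
  + intros t. eapply Rle_trans; [apply rpow_le; [auto|apply Hstep]|].
    eapply Rle_trans; [apply Hadd; [apply Cmod_ge_0|apply Rmult_le_pos; [lra|apply rpow_ge0]]|].
    apply Rplus_le_compat_l. rewrite rpow_mult by (try lra; apply rpow_ge0).
    specialize (Hu0 t). rewrite rpow_inv_r by lra. apply Req_le; ring.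
- rewrite mn_plus, !mn_scal; auto; try (apply cont_circle_pow; auto; lra);
  try (intros; apply rcont_mult; auto; try apply continuous_const; apply cont_circle_pow; auto; lra).
  apply Req_le. ring.
Qed.

(** * Complex series and kernel functions *)

Definition csum (u : nat -> C) : C := (Series (fun n => fst (u n)), Series (fun n => snd (u n))).
Definition absum (u : nat -> C) : Prop := ex_series (fun n => Cmod (u n)).

Lemma absum_le u (a : nat -> R) : (forall n, Cmod (u n) <= a n) -> ex_series a -> absum u.
Proof.
intros H Ha. apply (ex_series_le (K := R_AbsRing) (V := R_CompleteNormedModule) _ a); auto.
intros n. change (Rabs (Cmod (u n)) <= a n). rewrite Rabs_pos_eq; auto using Cmod_ge_0.
Qed.

Lemma absum_parts u : absum u -> ex_series (fun n => Rabs (fst (u n))) /\ ex_series (fun n => Rabs (snd (u n))).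
Proof.
intros H. split; apply (ex_series_le (K := R_AbsRing) (V := R_CompleteNormedModule) _ (fun n => Cmod (u n))); auto;
  intros n; change (Rabs (Rabs (fst (u n))) <= Cmod (u n)) || change (Rabs (Rabs (snd (u n))) <= Cmod (u n));
  rewrite Rabs_Rabsolu; [apply Cmod_fst_le|apply Cmod_snd_le].
Qed.

Lemma absum_ex u : absum u -> ex_series (fun n => fst (u n)) /\ ex_series (fun n => snd (u n)).
Proof. intros H. destruct (absum_parts u H). split; apply ex_series_Rabs; auto. Qed.

Lemma csum_ext u v : (forall n, u n = v n) -> csum u = csum v.
Proof. intros H. unfold csum. f_equal; apply Series_ext; intros n; rewrite H; auto. Qed.

Lemma csum_lin u v a c : absum u -> absum v -> csum (fun n => a * u n + c * v n)%C = (a * csum u + c * csum v)%C.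
Proof.
intros Hu Hv. destruct (absum_ex u Hu) as [U1 U2]. destruct (absum_ex v Hv) as [V1 V2].
assert (S : forall (x : R) w, ex_series w -> ex_series (fun n => x * w n))
  by (intros x w Hw; apply (ex_series_scal (K := R_AbsRing) (V := R_NormedModule) x w Hw)).
assert (L : forall (x y x' y' : R) u1 u2 v1 v2, ex_series u1 -> ex_series u2 -> ex_series v1 -> ex_series v2 ->
  Series (fun n => (x * u1 n + y * u2 n) + (x' * v1 n + y' * v2 n))
  = (x * Series u1 + y * Series u2) + (x' * Series v1 + y' * Series v2)).
{ intros x y x' y' u1 u2 v1 v2 E1 E2 E3 E4.
  rewrite (Series_plus (fun n => x * u1 n + y * u2 n)) by (apply (ex_series_plus (K := R_AbsRing) (V := R_NormedModule)); auto).
  rewrite (Series_plus (fun n => x * u1 n)), (Series_plus (fun n => x' * v1 n)) by auto.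
  rewrite !Series_scal_l. reflexivity. }
apply C_eq; unfold csum; cbn [fst snd].
- rewrite (Series_ext _ (fun n => (fst a * fst (u n) + - snd a * snd (u n)) + (fst c * fst (v n) + - snd c * snd (v n)))).
  + rewrite L by auto. simpl. ring.
  + intros n. simpl. ring.
- rewrite (Series_ext _ (fun n => (fst a * snd (u n) + snd a * fst (u n)) + (fst c * snd (v n) + snd c * fst (v n)))).
  + rewrite L by auto. simpl. ring.
  + intros n. simpl. ring.
Qed.

(* The factor 2 comes from bounding the real and imaginary parts separately. *)
Lemma csum_bound u (a : nat -> R) : (forall n, Cmod (u n) <= a n) -> ex_series a -> Cmod (csum u) <= 2 * Series a.
Proof.
intros H Ha. pose proof (absum_le u a H Ha) as Hu. destruct (absum_parts u Hu) as [U1 U2].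
eapply Rle_trans; [apply Cmod_le_abs|]. simpl.
assert (B1 : Rabs (Series (fun n => fst (u n))) <= Series a).
{ eapply Rle_trans; [apply Series_Rabs; auto|]. apply Series_le; auto. intros n. split; [apply Rabs_pos|].
  eapply Rle_trans; [apply Cmod_fst_le|auto]. }
assert (B2 : Rabs (Series (fun n => snd (u n))) <= Series a).
{ eapply Rle_trans; [apply Series_Rabs; auto|]. apply Series_le; auto. intros n. split; [apply Rabs_pos|].
  eapply Rle_trans; [apply Cmod_snd_le|auto]. }
lra.
Qed.

Lemma is_series_single (c : R) m : is_series (fun n => if Nat.eqb n m then c else 0) c.
Proof.
assert (E : forall n, sum_n (fun n => if Nat.eqb n m then c else 0) n = if Nat.leb m n then c else 0).
{ induction n.
  - rewrite sum_O. destruct m; simpl; auto.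
  - rewrite sum_Sn, IHn. change plus with Rplus. destruct (Nat.eqb_spec (S n) m) as [<-|D].
    + replace (Nat.leb (S n) n) with false by (symmetry; apply Nat.leb_gt; lia). rewrite Nat.leb_refl. apply Rplus_0_l.
    + destruct (Nat.leb_spec m n).
      * replace (Nat.leb m (S n)) with true by (symmetry; apply Nat.leb_le; lia). apply Rplus_0_r.
      * replace (Nat.leb m (S n)) with false by (symmetry; apply Nat.leb_gt; lia). apply Rplus_0_l. }
change (is_lim_seq (sum_n (fun n => if Nat.eqb n m then c else 0)) c).
apply (is_lim_seq_ext_loc (fun _ => c)); [|apply is_lim_seq_const].
exists m. intros n Hn. rewrite E. apply Nat.leb_le in Hn. rewrite Hn. auto.
Qed.

Lemma csum_split u m : absum u -> csum u = (u m + csum (fun n => if Nat.eqb n m then RtoC 0 else u n))%C.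
Proof.
intros Hu. set (w := fun n => if Nat.eqb n m then u m else RtoC 0). set (v := fun n => if Nat.eqb n m then RtoC 0 else u n).
assert (Hw : absum w).
{ apply (absum_le w (fun n => if Nat.eqb n m then Cmod (u m) else 0)).
  - intros n. unfold w. destruct (Nat.eqb n m); [lra|rewrite Cmod_0; lra].
  - exists (Cmod (u m)). apply is_series_single. }
assert (Hv : absum v).
{ apply (absum_le v (fun n => Cmod (u n))); auto.
  intros n. unfold v. destruct (Nat.eqb n m); [rewrite Cmod_0; apply Cmod_ge_0|lra]. }
assert (Ew : csum w = u m).
{ apply C_eq; unfold csum; cbn [fst snd].
  - rewrite (Series_ext _ (fun n => if Nat.eqb n m then fst (u m) else 0)).
    + apply is_series_unique, is_series_single.
    + intros n. unfold w. destruct (Nat.eqb n m); auto.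
  - rewrite (Series_ext _ (fun n => if Nat.eqb n m then snd (u m) else 0)).
    + apply is_series_unique, is_series_single.
    + intros n. unfold w. destruct (Nat.eqb n m); auto. }
rewrite <- Ew. fold v.
rewrite (csum_ext u (fun n => 1 * w n + 1 * v n)%C).
- rewrite csum_lin by auto. ring.
- intros n. unfold w, v. destruct (Nat.eqb_spec n m) as [->|]; ring.
Qed.

Lemma geom_half : is_series (fun n => (/ 2) ^ n) 2.
Proof.
assert (H : Rabs (/ 2) < 1) by (rewrite Rabs_pos_eq; lra).
pose proof (is_series_geom (/ 2) H) as S. assert (E : / (1 - / 2) = 2) by field. rewrite E in S. exact S.
Qed.

Lemma half_pow_bounds n : 0 < (/ 2) ^ n <= 1.
Proof. split; [apply pow_lt; lra|]. induction n; simpl; [lra|]. assert (0 < (/ 2) ^ n) by (apply pow_lt; lra). lra. Qed.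

Lemma half_pow_decr m n : (m <= n)%nat -> (/ 2) ^ n <= (/ 2) ^ m.
Proof.
intros H. induction H; [lra|]. simpl. pose proof (half_pow_bounds m0). lra.
Qed.

Lemma half_pow_lim e : 0 < e -> exists m, (/ 2) ^ m < e.
Proof.
intros He. destruct (pow_lt_1_zero (/ 2) ltac:(rewrite Rabs_pos_eq; lra) e He) as [m Hm]. exists m.
specialize (Hm m (Nat.le_refl m)). rewrite Rabs_pos_eq in Hm; auto. pose proof (half_pow_bounds m); lra.
Qed.

(** Cauchy estimates bound the second-order Taylor remainder of each term by its majorant a n, so
    the remainders sum to O(|h|^2). *)
Lemma holoD_csum (u : nat -> C -> C) : (forall n, holoD (u n)) ->
  (forall s, 0 <= s < 1 -> exists a : nat -> R, ex_series a /\ forall n z, Cmod z <= s -> Cmod (u n z) <= a n) ->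
  holoD (fun z => csum (fun n => u n z)).
Proof.
intros Hu H z0 Hz0. unfold inD in Hz0. pose proof (Cmod_ge_0 z0).
set (r := (1 - Cmod z0) / 2). assert (Hr : 0 < r) by (unfold r; lra).
destruct (H (Cmod z0 + r) ltac:(unfold r; lra)) as [a [Ha Hb]].
assert (Hball : forall n w, Cmod (w - z0)%C <= r -> Cmod (u n w) <= a n).
{ intros n w Hw. apply Hb. replace w with (z0 + (w - z0))%C by ring. pose proof (Cmod_triangle z0 (w - z0)). lra. }
assert (TB := fun n => taylor_bounds (u n) z0 r (a n) (Hu n) Hr ltac:(unfold r; lra) (Hball n)).
assert (S : forall (x : R) w, ex_series w -> ex_series (fun n => x * w n))
  by (intros x w Hw; apply (ex_series_scal (K := R_AbsRing) (V := R_NormedModule) x w Hw)).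
assert (A1 : absum (fun n => C_derive (u n) z0)).
{ apply (absum_le _ (fun n => 2 / r * a n)); auto. intros n. destruct (TB n) as [T1 _]. eapply Rle_trans; [exact T1|].
  apply Req_le; field; lra. }
exists (csum (fun n => C_derive (u n) z0)).
assert (Ha0 : forall n, 0 <= a n).
{ intros n. eapply Rle_trans; [apply Cmod_ge_0|apply (Hb n z0); lra]. }
assert (Hs0 : 0 <= Series a).
{ replace 0 with (Series (fun n => 0 * a n)) by (rewrite Series_scal_l; ring). apply Series_le; auto. intros n.
  specialize (Ha0 n). lra. }
apply (cdiff_of_taylor _ _ _ (8 / r ^ 2 * Series a) (r / 2)); [lra| |].
{ apply Rmult_le_pos; auto. apply Rdiv_le_0_compat; [lra|apply pow_lt; auto]. }
intros h Hh.
assert (A2 : absum (fun n => u n (z0 + h)%C)).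
{ apply (absum_le _ a); auto. intros n. apply Hball. replace (z0 + h - z0)%C with h by ring. lra. }
assert (A3 : absum (fun n => u n z0)).
{ apply (absum_le _ a); auto. intros n. apply Hb. lra. }
assert (A4 : absum (fun n => 1 * u n (z0 + h) + (- (1)) * u n z0)%C).
{ apply (absum_le _ (fun n => 2 * a n)); auto. intros n.
  replace (1 * u n (z0 + h) + (- (1)) * u n z0)%C with (u n (z0 + h) - u n z0)%C by ring.
  eapply Rle_trans; [apply Cmod_minus_le|].
  assert (Cmod (u n (z0 + h)%C) <= a n) by (apply Hball; replace (z0 + h - z0)%C with h by ring; lra).
  assert (Cmod (u n z0) <= a n) by (apply Hb; lra). lra. }
pose proof (csum_lin _ _ 1%C (- (1))%C A2 A3) as E1.
pose proof (csum_lin _ _ 1%C (- h)%C A4 A1) as E2. rewrite E1 in E2.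
match goal with |- Cmod ?x <= _ => replace x with (csum (fun n => 1 * (1 * u n (z0 + h) + (- (1)) * u n z0) + (- h) * C_derive (u n) z0)%C) end.
2: { rewrite E2. ring. }
eapply Rle_trans; [apply (csum_bound _ (fun n => 4 * (Cmod h / r) ^ 2 * a n)); auto|].
- intros n. destruct (TB n) as [_ T2]. destruct (T2 h Hh) as [T3 _].
  replace (1 * (1 * u n (z0 + h) + (- (1)) * u n z0) + (- h) * C_derive (u n) z0)%C
    with (u n (z0 + h) - u n z0 - h * C_derive (u n) z0)%C by ring.
  eapply Rle_trans; [exact T3|]. apply Req_le; ring.
- rewrite Series_scal_l. apply Req_le. field. lra.
Qed.

(** The invariant P may depend on the stage, and Q links consecutive states. *)
Lemma dependent_choice {A : Type} (P : nat -> A -> Prop) (Q : nat -> A -> A -> Prop) :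
  (exists s, P 0%nat s) -> (forall n s, P n s -> exists s', P (S n) s' /\ Q n s s') ->
  exists f : nat -> A, forall n, P n (f n) /\ Q n (f n) (f (S n)).
Proof.
intros H0 HS. apply constructive_indefinite_description in H0.
set (step := fun n (s : {s | P n s}) => let (s0, Hs) := s in
   let (s', Hs') := constructive_indefinite_description _ (HS n s0 Hs) in
   exist (P (S n)) s' (proj1 Hs')).
set (g := nat_rect (fun n => {s | P n s}) H0 step).
exists (fun n => proj1_sig (g n)). intros n. split; [apply proj2_sig|].
simpl. unfold step at 1. destruct (g n) as [s0 Hs]. simpl.
destruct (constructive_indefinite_description _ (HS n s0 Hs)) as [s' Hs']. simpl. tauto.
Qed.

(* x^(1/p), with 1/p read as 0 when p is infinite. *)
Definition dp (p : Rbar) (x : R) : R := match p with Finite q => rpow x (/ q) | _ => 1 end.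

Lemma dp_pos p x : 0 < x -> 0 < dp p x.
Proof. intros Hx. destruct p; simpl; try lra. apply rpow_gt0; auto. Qed.

Lemma dp_mult p x y : 0 <= x -> 0 <= y -> dp p (x * y) = dp p x * dp p y.
Proof. intros Hx Hy. destruct p; simpl; try lra. apply rpow_mult; auto. Qed.

Lemma point_bound p f a : Rbar_lt 0 p -> holoD f -> Cmod a < 1 ->
  dp p ((1 - Cmod a) / 4) * Cmod (f a) <= Mp p ((1 + Cmod a) / 2) f.
Proof.
intros Hp Hf Ha. pose proof (Cmod_ge_0 a). set (ra := (1 + Cmod a) / 2). assert (Hra : 0 < ra < 1) by (unfold ra; lra).
destruct p as [q| |]; simpl in Hp; [| |contradiction]; simpl dp.
- rewrite Mp_fin. pose proof (Rinv_0_lt_compat _ Hp).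
  rewrite <- (rpow_inv_l (Cmod (f a)) q) by (auto using Cmod_ge_0).
  rewrite <- rpow_mult by (try apply rpow_ge0; lra). apply rpow_le; auto.
  pose proof (poisson_majorant q f ra a Hp Hf Hra ltac:(unfold ra; lra)) as P1.
  assert (E : Cmod a / ra * ra = Cmod a) by (field; lra).
  pose proof (hm_le q ra f a (Cmod a / ra) Hp Hf Hra ltac:(lra) ltac:(apply Rdiv_lt_1; unfold ra; lra)) as P2.
  fold (pm q ra f) in P2. pose proof (pm_ge0 q ra f Hp Hf ltac:(lra)) as P3.
  (* [hm_le] with s = |a|/ra; since ra is the midpoint of |a| and 1, the kernel bound is 4 ra/(1 -
     |a|). *)
  replace (2 / (1 - Cmod a / ra)) with (4 * ra / (1 - Cmod a)) in P2 by (unfold ra; field; lra).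
  apply Rle_trans with ((1 - Cmod a) / 4 * (4 * ra / (1 - Cmod a) * pm q ra f)).
  + apply Rmult_le_compat_l; lra.
  + replace ((1 - Cmod a) / 4 * (4 * ra / (1 - Cmod a) * pm q ra f)) with (ra * pm q ra f) by (field; lra). nra.
- rewrite Rmult_1_l, Mp_Lp. pose proof (circ_hol f ra Hf ltac:(lra)) as Hc.
  apply (max_modulus f ra); auto; [unfold ra; lra|]. apply (Lp_inf_lub _ Hc).
Qed.

(** Szego-type kernel scaled to modulus at most 1: it is of order 1 within distance of order 1 - |a|
    of a and small elsewhere. *)
Definition kf (a z : C) : C := (RtoC (1 - Cmod a) / (1 - Cconj a * z))%C.

Lemma conj_mult_mod a z : Cmod (Cconj a * z)%C = Cmod a * Cmod z.
Proof. rewrite Cmod_mult, Cmod_conj. auto. Qed.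

Lemma kden_ge a z : Cmod a < 1 -> Cmod z < 1 ->
  1 - Cmod a <= Cmod (1 - Cconj a * z)%C /\ 1 - Cmod z <= Cmod (1 - Cconj a * z)%C.
Proof.
intros Ha Hz. pose proof (Cmod_minus_ge 1 (Cconj a * z)) as M. rewrite conj_mult_mod, Cmod_1 in M.
pose proof (Cmod_ge_0 a). pose proof (Cmod_ge_0 z). split; nra.
Qed.

Lemma kden_neq0 a z : Cmod a < 1 -> Cmod z < 1 -> (1 - Cconj a * z)%C <> 0%C.
Proof. intros Ha Hz. apply Cmod_gt_0. pose proof (kden_ge a z Ha Hz). lra. Qed.

Lemma kf_mod a z : Cmod a < 1 -> Cmod z < 1 -> Cmod (kf a z) = (1 - Cmod a) / Cmod (1 - Cconj a * z)%C.
Proof.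
intros Ha Hz. unfold kf. rewrite Cmod_div by (apply kden_neq0; auto). rewrite Cmod_R, Rabs_pos_eq; auto. lra.
Qed.

Lemma kf_bounds a z : Cmod a < 1 -> Cmod z < 1 ->
  Cmod (kf a z) <= 1 /\ Cmod (kf a z) * (1 - Cmod z) <= 1 - Cmod a.
Proof.
intros Ha Hz. rewrite kf_mod by auto. destruct (kden_ge a z Ha Hz) as [H1 H2].
set (D := Cmod (1 - Cconj a * z)%C) in *. assert (HD : 0 < D) by lra.
assert (E : (1 - Cmod a) / D * D = 1 - Cmod a) by (field; lra).
assert (0 < (1 - Cmod a) / D) by (apply Rdiv_lt_0_compat; lra). split.
- apply Rmult_le_reg_r with D; lra.
- rewrite <- E at 2. apply Rmult_le_compat_l; lra.
Qed.

Lemma holoD_kf a : Cmod a < 1 -> holoD (kf a).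
Proof.
intros Ha z Hz. unfold inD in Hz. eexists. apply (cdiff_div (fun _ => RtoC (1 - Cmod a)) (fun z => 1 - Cconj a * z)%C).
- apply cdiff_const.
- apply cdiff_minus; [apply cdiff_const|]. apply cdiff_scal, cdiff_id.
- apply kden_neq0; auto.
Qed.

Lemma holoD_pow f n : holoD f -> holoD (fun z => Cpow (f z) n).
Proof.
intros Hf. induction n; intros z Hz.
- simpl. eexists. apply cdiff_const.
- simpl. unfold inD in Hz. eexists. apply (cdiff_mult f (fun z => Cpow (f z) n)); apply holoD_cdiff; auto.
Qed.

(** On |z| = r the square |kf a|^2 is a multiple c of the Poisson kernel of r a, with c <= 1 - |a|.
    For n q > 2 the larger exponent only helps, since |kf a| <= 1. *)
Lemma Mp_kernel p a n r : Rbar_lt 0 p -> match p with Finite q => 2 < INR n * q | _ => True end -> Cmod a < 1 -> 0 <= r < 1 ->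
  Mp p r (fun z => Cpow (kf a z) n) <= dp p (1 - Cmod a).
Proof.
intros Hp Hn Ha Hr. pose proof (holoD_pow _ n (holoD_kf a Ha)) as Hh. pose proof (Cmod_ge_0 a).
assert (Hk : forall t, 0 <= Cmod (kf a (polar r t)) <= 1).
{ intros t. split; [apply Cmod_ge_0|]. apply kf_bounds; auto. rewrite Cmod_polar; lra. }
destruct p as [q| |]; simpl in Hp; [| |contradiction]; simpl dp.
- rewrite Mp_fin. apply rpow_le; [apply Rinv_0_lt_compat; auto|]. unfold pm.
  set (a' := (RtoC r * a)%C). assert (Ea : Cmod a' = r * Cmod a) by (unfold a'; rewrite Cmod_mult, Cmod_R, Rabs_pos_eq; lra).
  assert (Ha' : Cmod a' < 1) by (rewrite Ea; nra).
  assert (Hra : 0 <= r * Cmod a <= Cmod a) by nra.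
  assert (Hq1 : 1 - Cmod a <= 1 - Cmod a' ^ 2) by (rewrite Ea; simpl; nra).
  set (c := (1 - Cmod a) ^ 2 / (1 - Cmod a' ^ 2)).
  apply Rle_trans with (mn (fun t => c * PK a' t)).
  + apply mn_le.
    * apply (cont_circle_pow _ r q Hh Hr Hp).
    * intros t. apply rcont_mult; [apply continuous_const|]. apply PK_cont; auto.
    * intros t. rewrite Cmod_pow. set (x := Cmod (kf a (polar r t))).
      assert (Hx : 0 < x).
      { unfold x. rewrite kf_mod by (auto; rewrite Cmod_polar; lra). apply Rdiv_lt_0_compat; [lra|].
        apply Cmod_gt_0, kden_neq0; auto. rewrite Cmod_polar; lra. }
      assert (E1 : c * PK a' t = x ^ 2).
      { unfold x. rewrite kf_mod by (auto; rewrite Cmod_polar; lra). unfold c, PK.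
        rewrite <- Cmod_1m_conj.
        replace (Cconj a' * e1 t)%C with (Cconj a * polar r t)%C
          by (rewrite (polar_e1 r); unfold a'; apply C_eq; destruct a; simpl; ring).
        assert (0 < Cmod (1 - Cconj a * polar r t)%C) by (apply Cmod_gt_0, kden_neq0; auto; rewrite Cmod_polar; lra).
        field. lra. }
      rewrite E1.
      assert (E2 : x ^ n = rpow x (INR n)) by (rewrite rpow_pos by auto; rewrite Rpower_pow; auto).
      rewrite E2, rpow_rpow by lra.
      replace (INR n * q) with (INR 2 + (INR n * q - 2)) by (simpl; ring).
      rewrite rpow_plus by auto. rewrite (rpow_pos x (INR 2)), Rpower_pow by auto.
      assert (rpow x (INR n * q - 2) <= 1) by (apply rpow_le_1; [lra|]; apply Hk).
      pose proof (pow2_ge_0 x). nra.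
  + rewrite mn_scal, mn_PK by (auto; intros t; apply PK_cont; auto). rewrite Rmult_1_r. unfold c.
    apply Rmult_le_reg_r with (1 - Cmod a' ^ 2); [lra|]. unfold Rdiv. rewrite Rmult_assoc, Rinv_l by lra. nra.
- rewrite Mp_Lp. apply Lp_le_const; [exact I|apply (circ_hol (fun z => Cpow (kf a z) n)); auto|]. intros t. rewrite Cmod_pow.
  destruct (Hk t) as [K1 K2]. rewrite <- (pow1 n). apply pow_incr. lra.
Qed.

(** * Semigroups with an interior fixed point *)
Section Semigroup.

Variables (phi : R -> C -> C) (b : C) (G gamma : C -> C).
Hypothesis phi_semigroup : semigroup phi.
Hypothesis phi_nontrivial : nontrivial phi.
Hypothesis b_DW : DW_point_in_D phi b.
Hypothesis phi_generator : generator phi G.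
Hypothesis gamma_symbol : g_symbol b G gamma.

Lemma phi_hol t : 0 <= t -> holoD (phi t).
Proof. apply phi_semigroup. Qed.
Lemma phi_in t z : 0 <= t -> Cmod z < 1 -> Cmod (phi t z) < 1.
Proof. apply phi_semigroup. Qed.
Lemma phi_0 z : Cmod z < 1 -> phi 0 z = z.
Proof. apply phi_semigroup. Qed.
Lemma phi_plus t s z : 0 <= t -> 0 <= s -> Cmod z < 1 -> phi (t + s) z = phi t (phi s z).
Proof. apply phi_semigroup. Qed.
Lemma b_in : Cmod b < 1.
Proof. apply b_DW. Qed.
Lemma phi_b t : 0 <= t -> phi t b = b.
Proof. apply b_DW. Qed.

(** Lower bound, uniform in t, for (1 - |phi_t z|)/(1 - |z|). The square comes from Schwarz-Pick at
    b, the last 2 from passing from 1 - |w|^2 to 1 - |w|. *)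
Definition cb : R := ((1 - Cmod b) / 2) ^ 2 / 2.

Lemma cb_pos : 0 < cb.
Proof. unfold cb. pose proof b_in. apply Rdiv_lt_0_compat; [apply pow_lt|]; lra. Qed.
Lemma cb_le : cb <= / 2.
Proof. unfold cb. pose proof b_in. pose proof (Cmod_ge_0 b). nra. Qed.

Lemma den_b_bounds z : Cmod z < 1 -> 1 - Cmod b <= Cmod (1 - Cconj b * z)%C <= 2.
Proof.
intros Hz. pose proof b_in. pose proof (Cmod_ge_0 b). pose proof (Cmod_ge_0 z).
assert (Cmod (Cconj b * z)%C <= Cmod b) by (rewrite Cmod_mult, Cmod_conj; nra).
pose proof (Cmod_minus_ge 1 (Cconj b * z)%C). pose proof (Cmod_minus_le 1 (Cconj b * z)%C).
rewrite Cmod_1 in *. lra.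
Qed.

Lemma phi_contract t z : 0 <= t -> Cmod z < 1 ->
  Cmod (phi t z - b)%C * Cmod (1 - Cconj b * z)%C <= Cmod (z - b)%C * Cmod (1 - Cconj b * phi t z)%C.
Proof.
intros Ht Hz. pose proof (schwarz_pick (phi t) b z (phi_hol t Ht) (fun w => phi_in t w Ht) b_in Hz) as H.
rewrite phi_b in H by auto. exact H.
Qed.

(** The pseudohyperbolic distance to the fixed point b does not increase. By the Moebius identity
    this compares 1 - |z|^2 with 1 - |phi_t z|^2, up to |1 - conj b z|, which lies between 1 - |b|
    and 2. *)
Lemma phi_boundary t z : 0 <= t -> Cmod z < 1 -> cb * (1 - Cmod z) <= 1 - Cmod (phi t z).
Proof.
intros Ht Hz. pose proof (phi_contract t z Ht Hz) as H. pose proof (phi_in t z Ht Hz) as Hp.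
pose proof (mobius_identity_neg b z) as M1. pose proof (mobius_identity_neg b (phi t z)) as M2.
pose proof (den_b_bounds z Hz) as D1. pose proof (den_b_bounds _ Hp) as D2. pose proof b_in as Hb.
set (A := Cmod (1 - Cconj b * z)%C) in *. set (B := Cmod (1 - Cconj b * phi t z)%C) in *.
set (x := Cmod (z - b)%C) in *. set (y := Cmod (phi t z - b)%C) in *.
assert (0 <= x) by apply Cmod_ge_0. assert (0 <= y) by apply Cmod_ge_0.
pose proof (Cmod_ge_0 b). pose proof (Cmod_ge_0 z). pose proof (Cmod_ge_0 (phi t z)).
assert (HH2 : y ^ 2 * A ^ 2 <= x ^ 2 * B ^ 2).
{ rewrite <- !Rpow_mult_distr. apply pow_incr. split; auto. apply Rmult_le_pos; lra. }
assert (K1 : B ^ 2 * ((1 - Cmod z ^ 2) * (1 - Cmod b ^ 2)) <= A ^ 2 * ((1 - Cmod (phi t z) ^ 2) * (1 - Cmod b ^ 2))).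
{ rewrite <- M1, <- M2. nra. }
assert (Hbb : 0 < 1 - Cmod b ^ 2) by nra.
assert (K2 : B ^ 2 * (1 - Cmod z ^ 2) <= A ^ 2 * (1 - Cmod (phi t z) ^ 2)).
{ apply Rmult_le_reg_r with (1 - Cmod b ^ 2); auto. lra. }
assert (A ^ 2 <= 4) by nra. assert ((1 - Cmod b) ^ 2 <= B ^ 2) by (apply pow_incr; lra).
assert (0 <= 1 - Cmod (phi t z) ^ 2) by nra. assert (0 <= 1 - Cmod z ^ 2) by nra.
assert ((1 - Cmod b) ^ 2 * (1 - Cmod z ^ 2) <= 4 * (1 - Cmod (phi t z) ^ 2)) by nra.
assert (1 - Cmod z <= 1 - Cmod z ^ 2) by nra.
assert (1 - Cmod (phi t z) ^ 2 <= 2 * (1 - Cmod (phi t z))) by nra.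
assert ((1 - Cmod b) ^ 2 * (1 - Cmod z) <= (1 - Cmod b) ^ 2 * (1 - Cmod z ^ 2)).
{ apply Rmult_le_compat_l; [apply pow2_ge_0|auto]. }
unfold cb. lra.
Qed.

(** All phi_t map |z| <= r into one compact disc, so continuity at time 0 is uniform over the
    starting time t. *)
Lemma phi_unif r : 0 <= r < 1 -> forall e, 0 < e -> exists d, 0 < d /\
  forall t h z, 0 <= t -> 0 <= h < d -> Cmod z <= r -> Cmod (phi (h + t) z - phi t z)%C < e.
Proof.
intros Hr e He. pose proof cb_pos. pose proof cb_le.
destruct phi_semigroup as [_ [_ [_ [_ Hu]]]].
destruct (Hu (1 - cb * (1 - r)) ltac:(nra) e He) as [d [Hd Hd2]].
exists d; split; auto. intros t h z Ht Hh Hz.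
destruct (Req_dec h 0) as [->|].
{ rewrite Rplus_0_l. replace (phi t z - phi t z)%C with (RtoC 0) by ring. rewrite Cmod_0; auto. }
rewrite phi_plus by lra. apply Hd2; [lra|].
pose proof (phi_boundary t z Ht ltac:(lra)). nra.
Qed.

Lemma phi_tcont r : 0 <= r < 1 -> forall e, 0 < e -> exists d, 0 < d /\
  forall t s z, 0 <= t -> 0 <= s -> Rabs (s - t) < d -> Cmod z <= r -> Cmod (phi s z - phi t z)%C < e.
Proof.
intros Hr e He. destruct (phi_unif r Hr e He) as [d [Hd Hd2]]. exists d; split; auto.
intros t s z Ht Hs Hst Hz. destruct (Rle_lt_dec t s).
- replace s with ((s - t) + t) by ring. apply Hd2; auto. rewrite Rabs_pos_eq in Hst; lra.
- rewrite Cmod_minus_sym. replace t with ((t - s) + s) by ring. apply Hd2; auto. rewrite Rabs_left in Hst; lra.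
Qed.

(** Integrated form of the generator equation, with no regularity of G: the deviation v from
    straight motion is paired with its own conjugate, and [right_dini] compares B |v| t with the
    real part. *)
Lemma flow z T g0 B : Cmod z < 1 -> 0 <= T ->
  (forall u, 0 <= u < T -> Cmod (G (phi u z) - g0)%C <= B) ->
  Cmod (phi T z - z - RtoC T * g0)%C <= B * T.
Proof.
intros Hz HT HB. set (v := (phi T z - z - RtoC T * g0)%C).
assert (Hv0 := Cmod_ge_0 v).
assert (Hfst : forall w : C, fst (Cconj v * w)%C <= Cmod v * Cmod w).
{ intros w. eapply Rle_trans; [apply Rle_abs|]. eapply Rle_trans; [apply Cmod_fst_le|].
  rewrite Cmod_mult, Cmod_conj. lra. }
assert (Hlin : forall w w' : C, fst (Cconj v * w)%C - fst (Cconj v * w')%C = fst (Cconj v * (w - w'))%C)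
  by (intros; simpl; ring).
set (D := fun t => B * Cmod v * t - fst (Cconj v * (phi t z - z - RtoC t * g0))%C).
assert (HD : D 0 <= D T).
{ apply right_dini; auto.
  - intros t Ht e He.
    set (K := Rabs (B * Cmod v) + Cmod v * (1 + Cmod g0) + 1).
    assert (HK : 1 <= K).
    { unfold K. pose proof (Rabs_pos (B * Cmod v)). pose proof (Cmod_ge_0 g0). nra. }
    assert (HeK : 0 < e / K) by (apply Rdiv_lt_0_compat; lra).
    destruct (phi_tcont (Cmod z) (conj (Cmod_ge_0 z) Hz) (e / K) HeK) as [d [Hd Hd2]].
    exists (Rmin d (e / K)). split; [apply Rmin_pos; auto|]. intros s Hs Hst.
    pose proof (Rlt_le_trans _ _ _ Hst (Rmin_l _ _)) as S1. pose proof (Rlt_le_trans _ _ _ Hst (Rmin_r _ _)) as S2.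
    specialize (Hd2 t s z ltac:(lra) ltac:(lra) S1 ltac:(lra)).
    unfold D.
    replace (B * Cmod v * s - fst (Cconj v * (phi s z - z - RtoC s * g0))%C -
       (B * Cmod v * t - fst (Cconj v * (phi t z - z - RtoC t * g0))%C))
     with (B * Cmod v * (s - t) - (fst (Cconj v * (phi s z - z - RtoC s * g0))%C - fst (Cconj v * (phi t z - z - RtoC t * g0))%C)) by ring.
    rewrite Hlin.
    replace (phi s z - z - RtoC s * g0 - (phi t z - z - RtoC t * g0))%C with ((phi s z - phi t z) - RtoC (s - t) * g0)%C
      by (rewrite RtoC_minus; ring).
    eapply Rle_lt_trans; [apply Rabs_triang|]. rewrite Rabs_Ropp, Rabs_mult.
    assert (X : Rabs (fst (Cconj v * (phi s z - phi t z - RtoC (s - t) * g0))%C) <= Cmod v * (e / K + e / K * Cmod g0)).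
    { eapply Rle_trans; [apply Cmod_fst_le|]. rewrite Cmod_mult, Cmod_conj. apply Rmult_le_compat_l; auto.
      eapply Rle_trans; [apply Cmod_minus_le|]. rewrite Cmod_mult, Cmod_R. pose proof (Cmod_ge_0 g0). nra. }
    assert (Y : Rabs (B * Cmod v) * Rabs (s - t) <= Rabs (B * Cmod v) * (e / K)).
    { apply Rmult_le_compat_l; [apply Rabs_pos|lra]. }
    apply Rle_lt_trans with ((K - 1) * (e / K)); [unfold K at 1; lra|].
    replace e with (K * (e / K)) at 2 by (field; lra). nra.
  - intros t Ht e He.
    assert (Hw : Cmod (phi t z) < 1) by (apply phi_in; auto; lra).
    destruct (phi_generator (phi t z) Hw (e / (Cmod v + 1)) ltac:(apply Rdiv_lt_0_compat; lra)) as [d [Hd Hd2]].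
    exists d; split; auto. intros h Hh. specialize (Hd2 h Hh). specialize (HB t Ht).
    assert (Hhc : RtoC h <> 0%C) by (intros E; apply RtoC_inj in E; lra).
    rewrite (Rplus_comm t h). unfold D. rewrite phi_plus by lra. set (w := phi t z) in *.
    replace (B * Cmod v * (h + t) - fst (Cconj v * (phi h w - z - RtoC (h + t) * g0))%C -
       (B * Cmod v * t - fst (Cconj v * (w - z - RtoC t * g0))%C))
     with (B * Cmod v * h - (fst (Cconj v * (phi h w - z - RtoC (h + t) * g0))%C - fst (Cconj v * (w - z - RtoC t * g0))%C)) by ring.
    rewrite Hlin.
    replace (phi h w - z - RtoC (h + t) * g0 - (w - z - RtoC t * g0))%C
      with (RtoC h * (((phi h w - w) / RtoC h - G w) + (G w - g0)))%C by (rewrite RtoC_plus; field; auto).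
    assert (Hsc : forall u : C, fst (Cconj v * (RtoC h * u))%C = h * fst (Cconj v * u)%C) by (intros; simpl; ring).
    rewrite Hsc.
    pose proof (Hfst ((phi h w - w) / RtoC h - G w + (G w - g0))%C) as F.
    pose proof (Cmod_triangle ((phi h w - w) / RtoC h - G w) (G w - g0)) as TT.
    assert (Cmod v * Cmod ((phi h w - w) / RtoC h - G w + (G w - g0))%C <= Cmod v * (e / (Cmod v + 1) + B)).
    { apply Rmult_le_compat_l; auto. lra. }
    assert (Cmod v * (e / (Cmod v + 1)) <= e).
    { apply Rle_trans with ((Cmod v + 1) * (e / (Cmod v + 1))); [|apply Req_le; field; lra].
      apply Rmult_le_compat_r; [left; apply Rdiv_lt_0_compat; lra|lra]. }
    nra. }
unfold D in HD. rewrite phi_0 in HD by auto.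
replace (z - z - RtoC 0 * g0)%C with (RtoC 0) in HD by ring. fold v in HD. rewrite Re_conj_self in HD.
replace (fst (Cconj v * RtoC 0)%C) with 0 in HD by (simpl; ring).
destruct Hv0 as [Hv0|Hv0]; [|rewrite <- Hv0 in *].
- apply Rmult_le_reg_l with (Cmod v); auto. nra.
- destruct HT as [HT| <-]; [|lra]. specialize (HB 0 ltac:(lra)). pose proof (Cmod_ge_0 (G (phi 0 z) - g0)%C). nra.
Qed.

(** * Sign condition on the generator and Harnack inequality for the derivative of gamma *)

Lemma generator_sign z : Cmod z < 1 -> fst (G z * Cconj ((z - b) * (1 - Cconj b * z)))%C <= 0.
Proof.
intros Hz. set (W := ((z - b) * (1 - Cconj b * z))%C). set (L := fst (G z * Cconj W)%C).
apply Rnot_lt_le. intros HL. pose proof b_in as Hb. pose proof (Cmod_ge_0 b).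
set (A := Cmod (1 - Cconj b * z)%C ^ 2). set (B := Cmod (z - b)%C ^ 2).
assert (HA : 0 <= A) by apply pow2_ge_0. assert (HBp : 0 <= B) by apply pow2_ge_0.
(* Schwarz-Pick at the fixed point b, expanded in the displacement: the linear term is bounded by a
   quadratic one, so after division by t its limit has the right sign. *)
assert (Key : forall t, 0 <= t -> 2 * (1 - Cmod b ^ 2) * fst ((phi t z - z) * Cconj W)%C <= B * Cmod (phi t z - z)%C ^ 2).
{ intros t Ht. pose proof (phi_contract t z Ht Hz) as Hc.
  assert (H2 : Cmod (phi t z - b)%C ^ 2 * A <= B * Cmod (1 - Cconj b * phi t z)%C ^ 2).
  { unfold A, B. rewrite <- !Rpow_mult_distr. apply pow_incr. split; auto. apply Rmult_le_pos; apply Cmod_ge_0. }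
  set (hh := (phi t z - z)%C) in *.
  replace (phi t z) with (z + hh)%C in H2 by (unfold hh; ring).
  assert (Id : Cmod (z + hh - b)%C ^ 2 * A - B * Cmod (1 - Cconj b * (z + hh))%C ^ 2
     = 2 * (1 - Cmod b ^ 2) * fst (hh * Cconj W)%C + Cmod hh ^ 2 * (A - B * Cmod b ^ 2)).
  { unfold A, B, W. rewrite !Cmod2_alt. destruct z, b, hh; simpl. ring. }
  assert (Cmod hh ^ 2 * (B * Cmod b ^ 2) <= Cmod hh ^ 2 * B).
  { apply Rmult_le_compat_l; [apply pow2_ge_0|]. rewrite <- (Rmult_1_r B) at 2.
    apply Rmult_le_compat_l; auto. nra. }
  pose proof (pow2_ge_0 (Cmod hh)). assert (0 <= Cmod hh ^ 2 * A) by (apply Rmult_le_pos; auto). nra. }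
set (x := L / (2 * (Cmod W + 1))).
assert (HW := Cmod_ge_0 W).
assert (Hx : 0 < x) by (apply Rdiv_lt_0_compat; lra).
destruct (phi_generator z Hz x Hx) as [d [Hd Hd2]].
set (K := (Cmod (G z) + x) ^ 2 * B + 1).
assert (HK : 1 <= K) by (unfold K; pose proof (pow2_ge_0 (Cmod (G z) + x)); nra).
set (q := 1 - Cmod b ^ 2). assert (Hq : 0 < q) by (unfold q; nra).
(* Below this time the quadratic term t^2 K is less than the linear term q t L. *)
set (t := Rmin (d / 2) (q * L / (2 * K))).
assert (Ht : 0 < t) by (apply Rmin_pos; [lra|apply Rdiv_lt_0_compat; nra]).
assert (Ht1 : t <= d / 2) by apply Rmin_l. assert (Ht2 : t <= q * L / (2 * K)) by apply Rmin_r.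
specialize (Hd2 t ltac:(lra)). specialize (Key t ltac:(lra)).
assert (Htc : RtoC t <> 0%C) by (intros E; apply RtoC_inj in E; lra).
set (hh := (phi t z - z)%C) in *.
set (y := (hh / RtoC t - G z)%C) in *.
assert (Eh : hh = (RtoC t * (G z + y))%C) by (unfold y; field; auto).
assert (F1 : fst (hh * Cconj W)%C = t * (L + fst (y * Cconj W)%C)) by (rewrite Eh; unfold L; simpl; ring).
assert (F2 : Rabs (fst (y * Cconj W)%C) <= x * Cmod W).
{ eapply Rle_trans; [apply Cmod_fst_le|]. rewrite Cmod_mult, Cmod_conj. apply Rmult_le_compat_r; lra. }
assert (F3 : x * Cmod W <= L / 2).
{ apply Rle_trans with (x * (Cmod W + 1)); [nra|]. apply Req_le. unfold x. field. lra. }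
assert (F4 : Cmod hh <= t * (Cmod (G z) + x)).
{ rewrite Eh, Cmod_mult, Cmod_R, Rabs_pos_eq by lra. apply Rmult_le_compat_l; [lra|].
  eapply Rle_trans; [apply Cmod_triangle|]. lra. }
apply Rabs_le_between in F2.
assert (F5 : B * Cmod hh ^ 2 <= t ^ 2 * K).
{ apply Rle_trans with (B * (t * (Cmod (G z) + x)) ^ 2).
  - apply Rmult_le_compat_l; auto. apply pow_incr. split; [apply Cmod_ge_0|auto].
  - rewrite Rpow_mult_distr. unfold K. pose proof (pow2_ge_0 t). nra. }
assert (F6 : q * (t * L) <= t ^ 2 * K).
{ fold q in Key. rewrite F1 in Key. assert (q * (t * L) <= 2 * q * (t * (L + fst (y * Cconj W)%C))); [|lra].
  assert (0 < q * t) by nra. nra. }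
assert (F7 : t * K <= q * L / 2).
{ apply Rle_trans with (q * L / (2 * K) * K); [apply Rmult_le_compat_r; lra|]. apply Req_le; field; lra. }
assert (0 < q * L) by nra.
nra.
Qed.

Definition dg : C -> C := C_derive gamma.
(** In terms of the Berkson-Porta form G(z) = (conj b z - 1)(z - b) P(z) this is 1/P, hence of
    nonnegative real part. *)
Definition Qf (z : C) : C := (- ((1 - Cconj b * z) * dg z))%C.

Lemma gamma_hol : holoD gamma.
Proof. apply gamma_symbol. Qed.
Lemma dg_hol : holoD dg.
Proof. apply holoD_derive, gamma_hol. Qed.
Lemma dg_eq z : Cmod z < 1 -> z <> b -> dg z = ((z - b) / G z)%C.
Proof. intros Hz Hzb. apply is_C_derive_unique. apply gamma_symbol; auto. Qed.

Lemma Qf_hol : holoD Qf.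
Proof.
intros z Hz. unfold Qf. eexists. apply cdiff_opp, cdiff_mult.
- apply cdiff_minus; [apply cdiff_const|apply cdiff_scal, cdiff_id].
- apply holoD_cdiff; [apply dg_hol|auto].
Qed.

Lemma C_minus_neq0 (z w : C) : z <> w -> (z - w)%C <> 0%C.
Proof. intros H E. apply H. replace z with (z - w + w)%C by ring. rewrite E. ring. Qed.

Lemma Qf_re z : Cmod z < 1 -> 0 <= fst (Qf z).
Proof.
assert (Hne : forall z, Cmod z < 1 -> z <> b -> 0 <= fst (Qf z)).
{ intros w Hw Hwb. unfold Qf. rewrite dg_eq by auto.
  (* At a zero of G the quotient is 0 by the convention for division; zeros other than b are ruled
     out only after [Qf_neq0]. The point b itself is reached by continuity. *)
  destruct (C_dec (G w) 0) as [E|E].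
  - rewrite E. unfold Cdiv. rewrite Cinv_0. simpl. lra.
  - pose proof (generator_sign w Hw) as S.
    set (W := ((w - b) * (1 - Cconj b * w))%C) in *.
    replace (- ((1 - Cconj b * w) * ((w - b) / G w)))%C with (- (W / G w))%C by (unfold W; field; auto).
    apply C_norm2_neq_0 in E. destruct (G w) as [g1 g2], W as [w1 w2]. simpl in *.
    match goal with |- 0 <= ?e => replace e with (- (g1 * w1 - g2 * - w2) / (g1 ^ 2 + g2 ^ 2)) by (field; simpl; lra) end.
    apply Rdiv_le_0_compat; [lra|]. assert (0 <= g1 ^ 2 + g2 ^ 2) by nra. simpl in *. lra. }
intros Hz. destruct (C_dec z b) as [->|]; auto.
pose proof b_in as Hb.
assert (Hc : ccont (U := C_UniformSpace) Qf b) by (eapply cdiff_ccont; apply (holoD_cdiff Qf b Qf_hol Hb)).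
apply Rnot_lt_le. intros Hneg. rewrite ccont_eps in Hc.
destruct (Hc (- fst (Qf b)) ltac:(lra)) as [d [Hd Hd2]].
set (x := Rmin (d / 2) ((1 - Cmod b) / 2)).
assert (Hx : 0 < x) by (apply Rmin_pos; lra). assert (x <= d / 2) by apply Rmin_l. assert (x <= (1 - Cmod b) / 2) by apply Rmin_r.
set (w := (b + RtoC x)%C).
assert (Hwb : Cmod (w - b)%C = x).
{ replace (w - b)%C with (RtoC x) by (unfold w; ring). rewrite Cmod_R, Rabs_pos_eq; lra. }
specialize (Hd2 w ltac:(lra)).
assert (Hw : Cmod w < 1).
{ unfold w. eapply Rle_lt_trans; [apply Cmod_triangle|]. rewrite Cmod_R, Rabs_pos_eq; lra. }
assert (Hw2 : w <> b).
{ intros E. rewrite E in Hwb. replace (b - b)%C with (RtoC 0) in Hwb by ring. rewrite Cmod_0 in Hwb. lra. }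
pose proof (Hne w Hw Hw2). pose proof (Cmod_fst_le (Qf w - Qf b)%C) as T.
replace (fst (Qf w - Qf b)%C) with (fst (Qf w) - fst (Qf b)) in T by (unfold Cminus; simpl; ring).
rewrite Rabs_pos_eq in T; lra.
Qed.

Lemma G_b : G b = 0%C.
Proof.
apply Cmod_eq_0. apply cond_eq. intros e He. rewrite Rminus_0_r, Rabs_pos_eq by apply Cmod_ge_0.
destruct (phi_generator b b_in e He) as [d [Hd Hd2]]. specialize (Hd2 (d / 2) ltac:(lra)).
rewrite phi_b in Hd2 by lra. replace ((b - b) / RtoC (d / 2) - G b)%C with (- G b)%C in Hd2 by (unfold Cdiv; ring).
rewrite Cmod_opp in Hd2. auto.
Qed.

(** By Harnack one zero makes [Qf] vanish identically. Then G vanishes as well and [flow] shows that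
    every orbit stands still. *)
Lemma Qf_neq0 z : Cmod z < 1 -> Qf z <> 0%C.
Proof.
intros Hz E.
assert (HQ : forall w, Cmod w < 1 -> Qf w = 0%C).
{ intros w Hw. pose proof (half_plane_harnack Qf z w Qf_hol Qf_re Hz Hw) as H.
  rewrite E, Cmod_0, Rmult_0_r in H. apply Cmod_eq_0.
  pose proof (Cmod_ge_0 z). pose proof (Cmod_ge_0 w). pose proof (Cmod_ge_0 (Qf w)).
  assert (0 < (1 - Cmod z ^ 2) * (1 - Cmod w ^ 2)) by (apply Rmult_lt_0_compat; nra). nra. }
assert (HG : forall w, Cmod w < 1 -> G w = 0%C).
{ intros w Hw. destruct (C_dec w b) as [->|Hwb]; [apply G_b|].
  destruct (C_dec (G w) 0) as [|Hg]; auto. exfalso.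
  specialize (HQ w Hw). unfold Qf in HQ. rewrite dg_eq in HQ by auto.
  assert (N : ((1 - Cconj b * w) * ((w - b) / G w))%C <> 0%C).
  { apply Cmult_neq_0.
    - apply Cmod_neq0. pose proof (den_b_bounds w Hw). pose proof b_in. lra.
    - apply Cmult_neq_0; [apply C_minus_neq0; auto|]. apply Cmod_neq0. rewrite Cmod_inv by auto.
      apply Rinv_0_lt_compat, Cmod_gt_0; auto. }
  apply N. replace ((1 - Cconj b * w) * ((w - b) / G w))%C with (- - ((1 - Cconj b * w) * ((w - b) / G w)))%C by ring.
  rewrite HQ. ring. }
destruct phi_nontrivial as [t [w [Ht [Hw Hn]]]]. apply Hn.
pose proof (flow w t 0%C 0 Hw Ht) as F.
assert (F1 : Cmod (phi t w - w - RtoC t * 0)%C <= 0 * t).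
{ apply F. intros u Hu. rewrite HG by (apply phi_in; auto; lra).
  replace (0 - 0)%C with (RtoC 0) by ring. rewrite Cmod_0; lra. }
rewrite Rmult_0_l in F1. replace (phi t w - w - RtoC t * 0)%C with (phi t w - w)%C in F1 by ring.
pose proof (Cmod_ge_0 (phi t w - w)%C). assert (Z : (phi t w - w)%C = 0%C) by (apply Cmod_eq_0; lra).
replace (phi t w) with (phi t w - w + w)%C by ring. rewrite Z. ring.
Qed.

Lemma dg_neq0 z : Cmod z < 1 -> dg z <> 0%C.
Proof. intros Hz E. apply (Qf_neq0 z Hz). unfold Qf. rewrite E. ring. Qed.

Lemma G_eq z : Cmod z < 1 -> G z = ((z - b) / dg z)%C.
Proof.
intros Hz. pose proof (dg_neq0 z Hz) as Hn. destruct (C_dec z b) as [->|Hzb].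
- rewrite G_b. unfold Cdiv. ring.
- rewrite dg_eq in * by auto. destruct (C_dec (G z) 0) as [E|E].
  + exfalso. apply Hn. rewrite E. unfold Cdiv. rewrite Cinv_0. ring.
  + field. split; auto. apply C_minus_neq0; auto.
Qed.

Lemma Qf_mod z : Cmod (Qf z) = Cmod (1 - Cconj b * z)%C * Cmod (dg z).
Proof. unfold Qf. rewrite Cmod_opp, Cmod_mult. auto. Qed.

(** Harnack for [Qf], the factor |1 - conj b z| being absorbed through its bounds 1 - |b| and 2. *)
Lemma dg_harnack a w : Cmod a < 1 -> Cmod w < 1 ->
  (1 - Cmod b) * ((1 - Cmod a) * (1 - Cmod w) * Cmod (dg w)) <= 8 * Cmod (1 - Cconj a * w)%C ^ 2 * Cmod (dg a).
Proof.
intros Ha Hw. pose proof (half_plane_harnack Qf a w Qf_hol Qf_re Ha Hw) as H.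
rewrite !Qf_mod in H. pose proof (den_b_bounds a Ha). pose proof (den_b_bounds w Hw). pose proof b_in.
pose proof (Cmod_ge_0 a). pose proof (Cmod_ge_0 w). pose proof (Cmod_ge_0 (dg a)). pose proof (Cmod_ge_0 (dg w)).
set (A := Cmod (1 - Cconj b * a)%C) in *. set (B := Cmod (1 - Cconj b * w)%C) in *.
assert (L : (1 - Cmod b) * ((1 - Cmod a) * (1 - Cmod w) * Cmod (dg w)) <= (1 - Cmod a ^ 2) * (1 - Cmod w ^ 2) * (B * Cmod (dg w))).
{ replace ((1 - Cmod b) * ((1 - Cmod a) * (1 - Cmod w) * Cmod (dg w))) with ((1 - Cmod a) * (1 - Cmod w) * ((1 - Cmod b) * Cmod (dg w))) by ring.
  apply Rmult_le_compat.
  - apply Rmult_le_pos; lra.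
  - apply Rmult_le_pos; lra.
  - apply Rmult_le_compat; nra.
  - apply Rmult_le_compat_r; lra. }
assert (U : 4 * Cmod (1 - Cconj a * w)%C ^ 2 * (A * Cmod (dg a)) <= 8 * Cmod (1 - Cconj a * w)%C ^ 2 * Cmod (dg a)).
{ pose proof (pow2_ge_0 (Cmod (1 - Cconj a * w)%C)).
  assert (A * Cmod (dg a) <= 2 * Cmod (dg a)) by (apply Rmult_le_compat_r; lra). nra. }
lra.
Qed.

#[local] Hint Resolve phi_hol phi_in phi_0 phi_plus b_in cb_pos cb_le phi_boundary dg_hol dg_neq0 : core.

(** * Strong continuity on H(p,0,alpha) *)

(** The 8 gives room: for w = phi_t z with |z| = r one has rad r - |w| >= 7/8 (1 - |w|), so the ball
    of radius (1 - |w|)/8 about w is within reach of [hm_harnack] on the disc of radius [rad r]. *)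
Definition k0 : R := cb / 8.
Definition rad (r : R) : R := 1 - k0 * (1 - r).

Lemma rad_bounds r : 0 <= r < 1 -> 0 < rad r < 1 /\ r < rad r /\ 1 - rad r = k0 * (1 - r) /\ 1 - cb / 8 <= rad r.
Proof.
intros Hr. unfold rad, k0. pose proof cb_pos. pose proof cb_le. assert (0 < cb / 8 * (1 - r) <= cb / 8) by nra.
repeat split; nra.
Qed.

Lemma phi_rad t r z : 0 <= t -> 0 <= r < 1 -> Cmod z < (1 + r) / 2 -> Cmod (phi t z) < rad r.
Proof.
intros Ht Hr Hz. pose proof (phi_boundary t z Ht ltac:(lra)). unfold rad, k0. pose proof cb_pos. nra.
Qed.

Lemma phi_littlewood q f t r : 0 < q -> holoD f -> 0 <= t -> 0 <= r < 1 ->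
  (forall s, continuous (fun s => hm q (rad r) f (phi t (polar r s))) s) /\
  pm q r (fun z => f (phi t z)) <= mn (fun s => hm q (rad r) f (phi t (polar r s))) /\
  mn (fun s => hm q (rad r) f (phi t (polar r s))) <= 4 / cb * pm q (rad r) f.
Proof.
intros Hq Hf Ht Hr. destruct (rad_bounds r Hr) as [R1 [R2 [R3 R4]]].
pose proof cb_pos. pose proof cb_le.
assert (Hs : forall z, Cmod z < (1 + r) / 2 -> Cmod (phi t z) < rad r) by (intros; apply phi_rad; auto).
split.
- apply (hm_mean q (rad r) f (phi t) r ((1 + r) / 2)); auto; lra.
(* The contraction parameter of [littlewood] is 1 - cb/2: |phi_t 0| <= 1 - cb, while rad r >= 1 -
   cb/8. *)
- replace (4 / cb) with (2 / (1 - (1 - cb / 2))) by (field; lra).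
  apply (littlewood q (rad r) f (phi t) r ((1 + r) / 2)); auto; try lra.
  pose proof (phi_boundary t 0%C Ht ltac:(rewrite Cmod_0; lra)) as P. rewrite Cmod_0 in P. nra.
Qed.

Definition CL (p : Rbar) : R := match p with Finite q => rpow (4 / cb) (/ q) | _ => 1 end.

Lemma CL_pos p : 0 < CL p.
Proof. pose proof cb_pos. destruct p; simpl; try lra. apply rpow_gt0. apply Rdiv_lt_0_compat; lra. Qed.

Lemma holoD_phi f t : holoD f -> 0 <= t -> holoD (fun z => f (phi t z)).
Proof. intros Hf Ht. apply (holoD_comp f (phi t)); auto. Qed.

Lemma Mp_phi p f t r : Rbar_lt 0 p -> holoD f -> 0 <= t -> 0 <= r < 1 ->
  Mp p r (fun z => f (phi t z)) <= CL p * Mp p (rad r) f.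
Proof.
intros Hp Hf Ht Hr. destruct (rad_bounds r Hr) as [R1 [R2 [R3 R4]]]. pose proof cb_pos.
destruct p as [q| |]; simpl in Hp; [| |contradiction].
- rewrite !Mp_fin. simpl CL. pose proof (Rinv_0_lt_compat _ Hp).
  rewrite <- rpow_mult; [|left; apply Rdiv_lt_0_compat; lra|apply pm_ge0; auto; lra].
  apply rpow_le; auto. destruct (phi_littlewood q f t r) as [_ [L1 L2]]; auto. lra.
- simpl CL. rewrite Rmult_1_l, !Mp_Lp. pose proof (circ_hol f (rad r) Hf ltac:(lra)) as Hc.
  apply Lp_inf_lub; [apply (circ_hol (fun z => f (phi t z))); auto; apply holoD_phi; auto|].
  intros s. apply (max_modulus f (rad r)); auto.
  + apply phi_rad; auto. rewrite Cmod_polar; lra.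
  + intros s'. apply (proj1 (Lp_inf_lub _ Hc) s').
Qed.

Lemma uniform_small f r0 : holoD f -> 0 <= r0 < 1 -> forall e, 0 < e -> exists d, 0 < d /\
  forall t z, 0 < t < d -> Cmod z <= r0 -> Cmod (f (phi t z) - f z)%C <= e.
Proof.
intros Hf Hr0 e He.
set (r := (1 - r0) / 2). destruct (disc_bound f ((1 + r0) / 2) Hf ltac:(lra)) as [B [HB0 HB]].
set (x := Rmin (r / 2) (e * r / (6 * (B + 1)))).
assert (Hr : 0 < r) by (unfold r; lra).
assert (Hx : 0 < x) by (apply Rmin_pos; [lra|apply Rdiv_lt_0_compat; nra]).
destruct (phi_unif r0 Hr0 x Hx) as [d [Hd Hd2]]. exists d; split; auto. intros t z Ht Hz.
specialize (Hd2 0 t z (Rle_refl 0) ltac:(lra) Hz). rewrite Rplus_0_r, phi_0 in Hd2 by lra.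
set (h := (phi t z - z)%C) in *.
destruct (taylor_bounds f z r B Hf Hr) as [_ T]; [unfold r; lra| |].
{ intros w Hw. apply HB. replace w with (z + (w - z))%C by ring. pose proof (Cmod_triangle z (w - z)). unfold r in *; lra. }
replace (phi t z) with (z + h)%C by (unfold h; ring).
assert (Hx1 : x <= r / 2) by apply Rmin_l. assert (Hx2 : x <= e * r / (6 * (B + 1))) by apply Rmin_r.
destruct (T h ltac:(lra)) as [_ T2]. eapply Rle_trans; [exact T2|].
pose proof (Cmod_ge_0 h).
assert (Hh : Cmod h / r <= e / (6 * (B + 1))).
{ apply Rmult_le_reg_r with r; auto. unfold Rdiv at 1. rewrite Rmult_assoc, Rinv_l, Rmult_1_r by lra.
  eapply Rle_trans; [left; exact Hd2|]. eapply Rle_trans; [exact Hx2|]. apply Req_le; field. lra. }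
apply Rle_trans with (6 * (B + 1) * (e / (6 * (B + 1)))); [|apply Req_le; field; lra].
apply Rmult_le_compat; try lra. apply Rdiv_le_0_compat; lra.
Qed.

Lemma H0_strong_cont p al f : Rbar_lt 0 p -> 0 < al -> H0 p al f -> strong_cont p al phi f.
Proof.
intros Hp Hal [Hinf Hlim]. split; auto. destruct Hinf as [Hf _].
intros eps He. pose proof (Kp_ge1 p Hp) as HK. pose proof (CL_pos p) as HC. pose proof cb_pos. pose proof cb_le.
assert (Hk0 : 0 < k0) by (unfold k0; lra).
assert (Hka : 0 < rpow k0 al) by (apply rpow_gt0; auto).
(* Total cost of the quasi-triangle inequality, of subordination and of the weight ratio between r
   and [rad r]. Beyond r0 both radii lie where f has small weighted means. *)
set (c := Kp p * (CL p / rpow k0 al + 1)).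
assert (Hc0 : 0 < CL p / rpow k0 al) by (apply Rdiv_lt_0_compat; auto).
assert (Hc : 0 < c) by (unfold c; apply Rmult_lt_0_compat; lra).
destruct (Hlim (eps / c)) as [r0 [Hr0 Hr]]; [apply Rdiv_lt_0_compat; auto|].
destruct (uniform_small f r0 Hf Hr0 eps He) as [d [Hd Hd2]].
exists d; split; auto. intros t Ht. apply Hnorm_le. intros r Hr1.
assert (Hfp : holoD (fun z => f (phi t z))) by (apply holoD_phi; auto; lra).
destruct (Rle_lt_dec r r0) as [Hrr|Hrr].
- rewrite Mp_Lp.
  assert (Hle : Lp p (fun s => Cmod (f (phi t (polar r s)) - f (polar r s))%C) <= eps).
  { apply Lp_le_const; auto.
    - apply (circ_hol (fun z => f (phi t z) - f z)%C); auto. apply holoD_minus; auto.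
    - intros s. apply Hd2; auto. rewrite Cmod_polar; lra. }
  pose proof (rpow_le_1 (1 - r) al Hal ltac:(lra)). pose proof (rpow_ge0 (1 - r) al). nra.
- destruct (rad_bounds r Hr1) as [R1 [R2 [R3 R4]]].
  pose proof (Hr r ltac:(lra)) as B1. pose proof (Hr (rad r) ltac:(lra)) as B2.
  pose proof (Mp_minus p r (fun z => f (phi t z)) f Hp Hfp Hf Hr1) as M1.
  pose proof (Mp_phi p f t r Hp Hf ltac:(lra) Hr1) as M2.
  rewrite R3, rpow_mult in B2 by lra.
  set (w := rpow (1 - r) al) in *. assert (Hw : 0 <= w) by apply rpow_ge0.
  set (m := Mp p (rad r) f) in *. set (m1 := Mp p r f) in *.
  set (x := eps / c) in *.
  assert (B3 : w * m <= x / rpow k0 al).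
  { apply Rmult_le_reg_l with (rpow k0 al); auto.
    replace (rpow k0 al * (x / rpow k0 al)) with x by (field; lra). lra. }
  apply Rle_trans with (w * (Kp p * (CL p * m + m1))).
  + apply Rmult_le_compat_l; auto. eapply Rle_trans; [exact M1|]. apply Rmult_le_compat_l; lra.
  + replace (w * (Kp p * (CL p * m + m1))) with (Kp p * (CL p * (w * m) + w * m1)) by ring.
    replace eps with (Kp p * (CL p * (x / rpow k0 al) + x)) by (unfold x, c; field; split; lra).
    apply Rmult_le_compat_l; [lra|]. apply Rplus_le_compat; [|lra]. apply Rmult_le_compat_l; lra.
Qed.

(** * Strong continuity when gamma is little Bloch *)

(** A continuity argument: G is bounded by B only near z, but until it leaves the ball the orbit has
    covered at most B T < rho. *)
Lemma stay z rho B T : Cmod z < 1 -> 0 <= T -> 0 <= B -> B * T < rho ->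
  (forall w, Cmod w < 1 -> Cmod (w - z)%C < rho -> Cmod (G w) <= B) ->
  forall u, 0 <= u <= T -> Cmod (phi u z - z)%C <= B * u.
Proof.
intros Hz HT HB HBT HG.
assert (Hflow : forall t, 0 <= t -> (forall u, 0 <= u < t -> Cmod (phi u z - z)%C < rho) -> Cmod (phi t z - z)%C <= B * t).
{ intros t Ht H. pose proof (flow z t 0%C B Hz Ht) as F.
  replace (phi t z - z - RtoC t * 0)%C with (phi t z - z)%C in F by ring. apply F.
  intros u Hu. replace (G (phi u z) - 0)%C with (G (phi u z)) by ring. apply HG; [apply phi_in; auto; lra|auto]. }
set (E := fun t => 0 <= t <= T /\ forall u, 0 <= u < t -> Cmod (phi u z - z)%C < rho).
assert (HE0 : E 0) by (split; [lra|intros; lra]).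
destruct (completeness E) as [m [Hm1 Hm2]].
- exists T. intros t [Ht _]; lra.
- exists 0; auto.
- assert (Hm0 : 0 <= m) by (apply Hm1; auto).
  assert (HmT : m <= T) by (apply Hm2; intros t [Ht _]; lra).
  assert (Hlt : forall u, 0 <= u < m -> Cmod (phi u z - z)%C < rho).
  { intros u Hu. apply Rnot_le_lt. intros Hbad. assert (m <= u); [|lra].
    apply Hm2. intros t [Ht Ht2]. apply Rnot_lt_le. intros Hut. specialize (Ht2 u ltac:(lra)). lra. }
  assert (HmE : m = T).
  { apply Rle_antisym; auto. apply Rnot_lt_le. intros Hmt.
    pose proof (Hflow m Hm0 Hlt) as Fm.
    assert (HBm : B * m <= B * T) by (apply Rmult_le_compat_l; lra).
    destruct (phi_tcont (Cmod z) (conj (Cmod_ge_0 z) Hz) (rho - B * T) ltac:(lra)) as [d [Hd Hd2]].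
    set (h := Rmin (d / 2) (T - m)). assert (0 < h) by (apply Rmin_pos; lra).
    assert (h <= d / 2) by apply Rmin_l. assert (h <= T - m) by apply Rmin_r.
    assert (m + h <= m); [|lra]. apply Hm1. split; [lra|]. intros u Hu.
    destruct (Rlt_le_dec u m); [apply Hlt; lra|].
    specialize (Hd2 m u z Hm0 ltac:(lra) ltac:(rewrite Rabs_pos_eq; lra) (Rle_refl _)).
    replace (phi u z - z)%C with ((phi u z - phi m z) + (phi m z - z))%C by ring.
    eapply Rle_lt_trans; [apply Cmod_triangle|]. lra. }
  subst m. intros u Hu. apply Hflow; [lra|]. intros v Hv. apply Hlt. lra.
Qed.

(** From [dg_harnack]: 8 (9/4)^2 / (3/4), since |1 - conj w w'| <= 9/4 (1 - |w|) and 1 - |w'| >= 3/4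
    (1 - |w|) on the ball. *)
Definition Cd : R := 54 / (1 - Cmod b).

Lemma Cd_ge1 : 1 <= Cd.
Proof.
unfold Cd. pose proof b_in. pose proof (Cmod_ge_0 b). apply Rmult_le_reg_r with (1 - Cmod b); [lra|].
unfold Rdiv. rewrite Rmult_assoc, Rinv_l; lra.
Qed.

Lemma ball_in (w w' : C) x : Cmod w < 1 -> Cmod (w' - w)%C <= x * (1 - Cmod w) -> (1 - x) * (1 - Cmod w) <= 1 - Cmod w'.
Proof.
intros Hw H. replace w' with (w + (w' - w))%C by ring. pose proof (Cmod_triangle w (w' - w)). lra.
Qed.

Lemma dg_ball w w' : Cmod w < 1 -> Cmod (w' - w)%C <= (1 - Cmod w) / 4 ->
  Cmod (dg w') <= Cd * Cmod (dg w) /\ Cmod (dg w) <= Cd * Cmod (dg w').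
Proof.
intros Hw Hww. pose proof b_in as Hb. pose proof (Cmod_ge_0 w).
pose proof (ball_in w w' (1 / 4) Hw ltac:(lra)) as Hw1. set (d := 1 - Cmod w) in *. assert (Hd : 0 < d) by (unfold d; lra).
assert (Hw' : Cmod w' < 1) by lra.
assert (E1 : Cmod (1 - Cconj w * w')%C <= 9 / 4 * d).
{ replace (1 - Cconj w * w')%C with (1 - Cconj w * w - Cconj w * (w' - w))%C by ring.
  eapply Rle_trans; [apply Cmod_minus_le|].
  replace (Cconj w * w)%C with (RtoC (Cmod w ^ 2)) by (rewrite Cmod2_conj; ring).
  rewrite <- RtoC_minus, Cmod_R, Rabs_pos_eq by nra. rewrite Cmod_mult, Cmod_conj. unfold d in *. nra. }
assert (E2 : Cmod (1 - Cconj w' * w)%C = Cmod (1 - Cconj w * w')%C).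
{ rewrite <- Cmod_conj. f_equal. apply C_eq; destruct w, w'; simpl; ring. }
pose proof (dg_harnack w w' Hw Hw') as H1. pose proof (dg_harnack w' w Hw' Hw) as H2. rewrite E2 in H2.
set (e := Cmod (1 - Cconj w * w')%C) in *. assert (He : 0 <= e) by apply Cmod_ge_0.
pose proof (Cmod_ge_0 (dg w)) as G1. pose proof (Cmod_ge_0 (dg w')) as G2.
assert (He2 : e ^ 2 <= 81 / 16 * d ^ 2) by nra.
assert (Hdd : 3 / 4 * d ^ 2 <= d * (1 - Cmod w')) by (simpl; nra).
fold d in H1, H2.
assert (Hgen : forall x y, 0 <= x -> 0 <= y -> (1 - Cmod b) * (d * (1 - Cmod w') * x) <= 8 * e ^ 2 * y -> x <= Cd * y).
{ intros x y Hx Hy Hxy.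
  assert ((1 - Cmod b) * (3 / 4 * d ^ 2 * x) <= 8 * (81 / 16 * d ^ 2) * y).
  { apply Rle_trans with ((1 - Cmod b) * (d * (1 - Cmod w') * x)).
    - apply Rmult_le_compat_l; [lra|]. apply Rmult_le_compat_r; auto.
    - eapply Rle_trans; [exact Hxy|]. apply Rmult_le_compat_r; auto. lra. }
  assert (Hd2 : 0 < d ^ 2) by (apply pow_lt; auto).
  assert ((1 - Cmod b) * x <= 54 * y) by (apply Rmult_le_reg_r with (3 / 4 * d ^ 2); lra).
  unfold Cd. apply Rmult_le_reg_r with (1 - Cmod b); [lra|].
  replace (54 / (1 - Cmod b) * y * (1 - Cmod b)) with (54 * y) by (field; lra). lra. }
split; apply Hgen; auto. eapply Rle_trans; [|exact H2]. apply Req_le; ring.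
Qed.

Lemma dg_pos w : Cmod w < 1 -> 0 < Cmod (dg w).
Proof. intros; apply Cmod_gt_0, dg_neq0; auto. Qed.

Lemma dg_lip w h : Cmod w < 1 -> Cmod h <= (1 - Cmod w) / 9 ->
  Cmod (dg (w + h)%C - dg w)%C <= 30 * Cd * Cmod (dg w) * (Cmod h / (1 - Cmod w)).
Proof.
intros Hw Hh. set (d := 1 - Cmod w) in *. assert (Hd : 0 < d) by (unfold d; lra). pose proof Cd_ge1. pose proof (dg_pos w Hw).
destruct (taylor_bounds dg w (d / 4 * (9 / 10)) (Cd * Cmod (dg w)) dg_hol) as [_ T]; [lra|unfold d in *; lra| |].
{ intros w' Hw'. apply (dg_ball w w'); auto. fold d. lra. }
destruct (T h ltac:(lra)) as [_ T2]. eapply Rle_trans; [exact T2|].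
pose proof (Cmod_ge_0 h).
replace (Cmod h / (d / 4 * (9 / 10))) with (40 / 9 * (Cmod h / d)) by (field; lra).
assert (0 <= Cd * Cmod (dg w) * (Cmod h / d)).
{ apply Rmult_le_pos; [apply Rmult_le_pos; lra|apply Rdiv_le_0_compat; lra]. }
lra.
Qed.

Lemma G_mod w : Cmod w < 1 -> Cmod (G w) = Cmod (w - b)%C / Cmod (dg w).
Proof. intros Hw. rewrite G_eq, Cmod_div; auto. Qed.

Lemma wb_le2 w : Cmod w < 1 -> Cmod (w - b)%C <= 2.
Proof. intros. pose proof b_in. pose proof (Cmod_minus_le w b). lra. Qed.

Lemma inv_ball x y : 0 < x -> 0 < y -> x <= Cd * y -> / y <= Cd * / x.
Proof.
intros Hx Hy H. apply Rmult_le_reg_r with (x * y); [apply Rmult_lt_0_compat; auto|].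
replace (/ y * (x * y)) with x by (field; lra). replace (Cd * / x * (x * y)) with (Cd * y) by (field; lra). auto.
Qed.

Lemma G_ball w w' : Cmod w < 1 -> Cmod (w' - w)%C <= (1 - Cmod w) / 4 -> Cmod (G w') <= 2 * Cd / Cmod (dg w).
Proof.
intros Hw Hww. pose proof (ball_in w w' (1 / 4) Hw ltac:(lra)). assert (Hw' : Cmod w' < 1) by lra.
destruct (dg_ball w w' Hw Hww) as [_ B2]. pose proof (dg_pos w Hw). pose proof (dg_pos w' Hw').
pose proof (inv_ball _ _ H0 H1 B2). rewrite G_mod by auto. pose proof (wb_le2 w' Hw'). pose proof (Cmod_ge_0 (w' - b)%C).
unfold Rdiv. rewrite Rmult_assoc. apply Rmult_le_compat; auto. left; apply Rinv_0_lt_compat; auto.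
Qed.

Definition Kg : R := Cd + 60 * Cd * Cd.

Lemma G_lip w h : Cmod w < 1 -> Cmod h <= (1 - Cmod w) / 9 ->
  Cmod (G (w + h)%C - G w)%C <= Kg / Cmod (dg w) * (Cmod h / (1 - Cmod w)).
Proof.
intros Hw Hh. set (d := 1 - Cmod w) in *. assert (Hd : 0 < d) by (unfold d; lra). pose proof Cd_ge1.
assert (Eh : (w + h - w)%C = h) by ring.
pose proof (ball_in w (w + h)%C (1 / 4) Hw ltac:(rewrite Eh; fold d; lra)) as Hin. fold d in Hin.
assert (Hw' : Cmod (w + h)%C < 1) by lra.
destruct (dg_ball w (w + h)%C Hw ltac:(rewrite Eh; fold d; lra)) as [_ B2].
pose proof (dg_pos w Hw) as P1. pose proof (dg_pos _ Hw') as P2.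
pose proof (inv_ball _ _ P1 P2 B2) as I. pose proof (dg_lip w h Hw Hh) as DL. fold d in DL.
pose proof (dg_neq0 w Hw) as N1. pose proof (dg_neq0 _ Hw') as N2.
rewrite !G_eq by auto.
replace ((w + h - b) / dg (w + h) - (w - b) / dg w)%C
  with (h / dg (w + h) - (w - b) * (dg (w + h) - dg w) / (dg w * dg (w + h)))%C by (field; auto).
eapply Rle_trans; [apply Cmod_minus_le|]. rewrite !Cmod_div, !Cmod_mult by (auto; apply Cmult_neq_0; auto).
pose proof (Cmod_ge_0 h). pose proof (wb_le2 w Hw). pose proof (Cmod_ge_0 (w - b)%C). pose proof (Cmod_ge_0 (dg (w + h) - dg w)%C).
set (x := Cmod (dg w)) in *. set (y := Cmod (dg (w + h)%C)) in *.
assert (Hhd : Cmod h <= Cmod h / d).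
{ apply Rmult_le_reg_r with d; auto. unfold Rdiv. rewrite Rmult_assoc, Rinv_l by lra. pose proof (Cmod_ge_0 w). unfold d in *. nra. }
assert (T1 : Cmod h / y <= Cmod h / d * (Cd * / x)).
{ unfold Rdiv at 1. apply Rmult_le_compat; auto. left; apply Rinv_0_lt_compat; auto. }
assert (Hxi := Rinv_0_lt_compat _ P1). assert (Hyi := Rinv_0_lt_compat _ P2).
assert (T2 : Cmod (w - b)%C * Cmod (dg (w + h) - dg w)%C / (x * y) <= 2 * (30 * Cd * x * (Cmod h / d)) * (/ x * (Cd * / x))).
{ unfold Rdiv. rewrite Rinv_mult. apply Rmult_le_compat.
  - apply Rmult_le_pos; auto.
  - apply Rmult_le_pos; lra.
  - apply Rmult_le_compat; auto.
  - apply Rmult_le_compat_l; lra. }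
eapply Rle_trans; [apply Rplus_le_compat; [exact T1|exact T2]|].
apply Req_le. unfold Kg. field. lra.
Qed.

(** The Bloch quantity of gamma read as a time: the speed |G w| is |w - b|/|gamma'(w)|, so this is
    about the time the flow takes to cover the distance 1 - |w|. *)
Definition xw (w : C) : R := (1 - Cmod w ^ 2) * Cmod (dg w).

Lemma xw_bounds w : Cmod w < 1 -> 0 < xw w <= 2 * (1 - Cmod w) * Cmod (dg w).
Proof.
intros Hw. unfold xw. pose proof (dg_pos w Hw). pose proof (Cmod_ge_0 w). split; [apply Rmult_lt_0_compat; nra|].
apply Rmult_le_compat_r; nra.
Qed.

(** [G_ball] bounds the speed near w and [stay] keeps the orbit there; 128 c Cd <= 1 limits the
    displacement to (1 - |w|)/32. *)
Lemma small_move w s c : Cmod w < 1 -> 0 <= s <= c * xw w -> 0 < c -> 128 * c * Cd <= 1 ->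
  forall u, 0 <= u <= s -> Cmod (phi u w - w)%C <= 2 * Cd / Cmod (dg w) * u /\
     2 * Cd / Cmod (dg w) * u <= 4 * c * Cd * (1 - Cmod w).
Proof.
intros Hw Hs Hc HcC. pose proof Cd_ge1. pose proof (dg_pos w Hw) as Hx. pose proof (xw_bounds w Hw).
set (B := 2 * Cd / Cmod (dg w)).
assert (HB : 0 <= B) by (apply Rdiv_le_0_compat; lra).
assert (Hmax : forall u, 0 <= u <= s -> B * u <= 4 * c * Cd * (1 - Cmod w)).
{ intros u Hu. apply Rle_trans with (B * (c * (2 * (1 - Cmod w) * Cmod (dg w)))).
  - apply Rmult_le_compat_l; auto. apply Rle_trans with (c * xw w); [lra|]. apply Rmult_le_compat_l; lra.
  - apply Req_le. unfold B. field. lra. }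
intros u Hu. split; [|auto].
apply (stay w ((1 - Cmod w) / 4) B s); auto; try lra.
- eapply Rle_lt_trans; [apply Hmax; lra|]. nra.
- intros w' Hw' Hd. apply G_ball; auto. lra.
Qed.

(** The first summand is the Taylor remainder of f at the displaced point, the second the variation
    of G along the path. *)
Definition C0 : R := 4 * 40 ^ 2 * Cd ^ 2 + 200 * Cd * Kg.

(* At the time scale c (1 - |w|^2) |gamma'(w)| the flow moves w by a fixed fraction of its distance to
   the circle, so an increment of f along the flow sees (1 - |w|^2) f'(w) up to O(c^2). *)
Lemma local_increment f w s c M : holoD f -> Cmod w < 1 -> 0 < c -> 128 * c * Cd <= 1 ->
  0 <= s <= c * xw w -> (forall w', Cmod (w' - w)%C <= (1 - Cmod w) / 8 -> Cmod (f w') <= M) ->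
  s * Cmod (G w) * Cmod (C_derive f w) <= Cmod (f (phi s w) - f w)%C + C0 * c ^ 2 * M.
Proof.
intros Hf Hw Hc HcC Hs HM. pose proof Cd_ge1 as HCd. pose proof (dg_pos w Hw) as Hx. pose proof (xw_bounds w Hw) as Hxw.
set (d := 1 - Cmod w) in *. assert (Hd : 0 < d) by (unfold d; lra).
pose proof (small_move w s c Hw Hs Hc HcC) as SM.
set (B := 2 * Cd / Cmod (dg w)) in *. fold d in SM, Hxw.
assert (HM0 : 0 <= M).
{ eapply Rle_trans; [apply Cmod_ge_0|apply (HM w)]. replace (w - w)%C with (RtoC 0) by ring. rewrite Cmod_0; lra. }
set (h := (phi s w - w)%C).
assert (Hh : Cmod h <= 4 * c * Cd * d) by (destruct (SM s ltac:(lra)); unfold h; lra).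
assert (Hh16 : Cmod h <= d / 32) by nra.
assert (HKg : 0 <= Kg) by (unfold Kg; nra).
assert (Hlin : Cmod (h - RtoC s * G w)%C <= 8 * c ^ 2 * Cd * Kg * d).
{ pose proof (flow w s (G w) (Kg / Cmod (dg w) * (4 * c * Cd)) Hw ltac:(lra)) as F.
  unfold h. eapply Rle_trans; [apply F|].
  - intros u Hu. destruct (SM u ltac:(lra)) as [S1 S2].
    replace (phi u w) with (w + (phi u w - w))%C by ring.
    eapply Rle_trans; [apply G_lip; auto; fold d; nra|]. fold d.
    apply Rmult_le_compat_l; [apply Rdiv_le_0_compat; auto|].
    apply Rmult_le_reg_r with d; auto. unfold Rdiv. rewrite Rmult_assoc, Rinv_l; lra.
  - apply Rle_trans with (Kg / Cmod (dg w) * (4 * c * Cd) * (c * (2 * d * Cmod (dg w)))).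
    + apply Rmult_le_compat_l.
      * apply Rmult_le_pos; [apply Rdiv_le_0_compat; lra|nra].
      * apply Rle_trans with (c * xw w); [lra|]. apply Rmult_le_compat_l; lra.
    + apply Req_le. field. lra. }
destruct (taylor_bounds f w (d / 8 * (19/20)) M Hf) as [T1 T2]; [lra|unfold d in *; lra| |].
{ intros w' Hw'. apply HM. fold d. lra. }
set (rr := d / 8 * (19 / 20)) in *. assert (Hrr : 0 < rr) by (unfold rr; lra).
pose proof (Cmod_ge_0 h) as Hh0.
destruct (T2 h ltac:(unfold rr; lra)) as [T3 _].
set (D := C_derive f w) in *.
assert (R1 : Cmod (f (w + h)%C - f w - h * D)%C <= 4 * 40 ^ 2 * Cd ^ 2 * c ^ 2 * M).
{ eapply Rle_trans; [exact T3|].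
  assert (Hq : Cmod h / rr <= 40 * Cd * c).
  { apply Rmult_le_reg_r with rr; auto. unfold Rdiv. rewrite Rmult_assoc, Rinv_l, Rmult_1_r by lra.
    unfold rr. assert (0 <= c * Cd * d) by (apply Rmult_le_pos; [apply Rmult_le_pos|]; lra). lra. }
  assert (Hq2 : (Cmod h / rr) ^ 2 <= (40 * Cd * c) ^ 2).
  { apply pow_incr. split; auto. apply Rdiv_le_0_compat; auto. }
  rewrite !Rpow_mult_distr in Hq2.
  apply Rle_trans with (4 * M * (40 ^ 2 * Cd ^ 2 * c ^ 2)); [apply Rmult_le_compat_l; lra|]. apply Req_le; ring. }
assert (R2 : Cmod ((h - RtoC s * G w) * D)%C <= 200 * Cd * Kg * c ^ 2 * M).
{ rewrite Cmod_mult. apply Rle_trans with (8 * c ^ 2 * Cd * Kg * d * (2 * M / rr)).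
  - apply Rmult_le_compat; auto using Cmod_ge_0.
  - assert (E : d / rr = 160 / 19) by (unfold rr; field; lra).
    replace (8 * c ^ 2 * Cd * Kg * d * (2 * M / rr)) with (16 * (Cd * Kg * c ^ 2 * M) * (d / rr)) by (field; lra).
    rewrite E. assert (0 <= Cd * Kg * c ^ 2 * M); [|lra].
    apply Rmult_le_pos; [apply Rmult_le_pos; [apply Rmult_le_pos; lra|apply pow2_ge_0]|lra]. }
assert (EE : (RtoC s * G w * D)%C = ((f (w + h) - f w) - (f (w + h) - f w - h * D) - (h - RtoC s * G w) * D)%C) by ring.
assert (EM : s * Cmod (G w) * Cmod D = Cmod (RtoC s * G w * D)%C) by (rewrite !Cmod_mult, Cmod_R, Rabs_pos_eq; lra).
rewrite EM, EE. replace (phi s w) with (w + h)%C by (unfold h; ring).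
eapply Rle_trans; [apply Cmod_minus_le|].
pose proof (Cmod_minus_le (f (w + h) - f w)%C (f (w + h) - f w - h * D)%C).
unfold C0. lra.
Qed.

Lemma b_far w : (1 + Cmod b) / 2 <= Cmod w -> (1 - Cmod b) / 2 <= Cmod (w - b)%C.
Proof. intros H. pose proof (Cmod_minus_ge w b). lra. Qed.

Definition V (f : C -> C) (w : C) : R := (1 - Cmod w ^ 2) * Cmod (C_derive f w).
(** From s >= c xw w / 2 and |w - b| >= (1 - |b|)/2, which bound s |G w| below by c (1 - |b|)/4
    times 1 - |w|^2. *)
Definition C1 : R := 4 / (1 - Cmod b).

Lemma V_increment f w s c M : holoD f -> Cmod w < 1 -> (1 + Cmod b) / 2 <= Cmod w ->
  0 < c -> 128 * c * Cd <= 1 -> c * xw w / 2 <= s <= c * xw w ->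
  (forall w', Cmod (w' - w)%C <= (1 - Cmod w) / 8 -> Cmod (f w') <= M) ->
  V f w <= C1 * (Cmod (f (phi s w) - f w)%C / c + C0 * c * M).
Proof.
intros Hf Hw Hwb Hc HcC Hs HM. pose proof (dg_pos w Hw) as Hx. pose proof (xw_bounds w Hw) as Hxw. pose proof b_in.
assert (Hcx : 0 < c * xw w) by (apply Rmult_lt_0_compat; lra).
pose proof (local_increment f w s c M Hf Hw Hc HcC ltac:(lra) HM) as L.
pose proof (b_far w Hwb) as Hbf. rewrite G_mod in L by auto.
set (D := Cmod (C_derive f w)) in *. assert (HD : 0 <= D) by apply Cmod_ge_0.
assert (K : c * (1 - Cmod b) / 4 * V f w <= s * (Cmod (w - b)%C / Cmod (dg w)) * D).
{ unfold V. fold D.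
  apply Rle_trans with (c * xw w / 2 * ((1 - Cmod b) / 2 / Cmod (dg w)) * D).
  - apply Req_le. unfold xw. field. lra.
  - apply Rmult_le_compat_r; auto. apply Rmult_le_compat; try lra.
    + apply Rdiv_le_0_compat; lra.
    + apply Rmult_le_compat_r; auto. left; apply Rinv_0_lt_compat; auto. }
apply Rmult_le_reg_l with (c * (1 - Cmod b) / 4); [apply Rdiv_lt_0_compat; [apply Rmult_lt_0_compat|]; lra|].
eapply Rle_trans; [exact K|]. eapply Rle_trans; [exact L|].
apply Req_le. unfold C1. field. lra.
Qed.

(** Along the orbit the time c xw must vary slowly for [time_change]; its rate is at most this
    Lipschitz constant times c and the speed. *)
Lemma xw_lip w h : Cmod w < 1 -> Cmod h <= (1 - Cmod w) / 9 ->
  Rabs (xw (w + h)%C - xw w) <= 80 * Cd * Cmod (dg w) * Cmod h.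
Proof.
intros Hw Hh. set (d := 1 - Cmod w) in *. assert (Hd : 0 < d) by (unfold d; lra). pose proof Cd_ge1.
assert (Eh : (w + h - w)%C = h) by ring.
pose proof (ball_in w (w + h)%C (1 / 4) Hw ltac:(rewrite Eh; fold d; lra)) as Hin. fold d in Hin.
assert (Hw' : Cmod (w + h)%C < 1) by lra.
destruct (dg_ball w (w + h)%C Hw ltac:(rewrite Eh; fold d; lra)) as [B1 _].
pose proof (dg_lip w h Hw Hh) as DL. fold d in DL.
pose proof (Cmod_ge_0 w). pose proof (Cmod_ge_0 (w + h)%C). pose proof (Cmod_ge_0 h). pose proof (dg_pos w Hw).
pose proof (dg_pos _ Hw').
assert (A1 : Rabs (Cmod (w + h)%C - Cmod w) <= Cmod h).
{ apply Rabs_le. pose proof (Cmod_triangle w h). pose proof (Cmod_minus_ge w (- h)%C).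
  replace (w - - h)%C with (w + h)%C in * by ring. rewrite Cmod_opp in *. lra. }
assert (A2 : Rabs (Cmod (dg (w + h)%C) - Cmod (dg w)) <= Cmod (dg (w + h) - dg w)%C).
{ apply Rabs_le. pose proof (Cmod_minus_ge (dg (w + h)%C) (dg w)). pose proof (Cmod_minus_ge (dg w) (dg (w + h)%C)).
  rewrite (Cmod_minus_sym (dg w)) in *. lra. }
unfold xw. set (m := Cmod w) in *. set (m' := Cmod (w + h)%C) in *. set (g := Cmod (dg w)) in *. set (g' := Cmod (dg (w + h)%C)) in *.
replace ((1 - m' ^ 2) * g' - (1 - m ^ 2) * g) with ((m - m') * (m + m') * g' + (1 - m ^ 2) * (g' - g)) by ring.
eapply Rle_trans; [apply Rabs_triang|]. rewrite !Rabs_mult.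
rewrite (Rabs_pos_eq (m + m')), (Rabs_pos_eq g'), (Rabs_pos_eq (1 - m ^ 2)) by nra.
rewrite Rabs_minus_sym in A1.
assert (U1 : Rabs (m - m') * (m + m') * g' <= Cmod h * 2 * (Cd * g)).
{ apply Rmult_le_compat; try lra; [apply Rmult_le_pos; [apply Rabs_pos|lra]|].
  apply Rmult_le_compat; try lra. apply Rabs_pos. }
assert (U2 : (1 - m ^ 2) * Rabs (g' - g) <= (2 * d) * (30 * Cd * g * (Cmod h / d))).
{ apply Rmult_le_compat; [nra|apply Rabs_pos|unfold d in *; nra|lra]. }
replace (2 * d * (30 * Cd * g * (Cmod h / d))) with (60 * (Cd * g * Cmod h)) in U2 by (field; lra).
assert (0 <= Cd * g * Cmod h) by (apply Rmult_le_pos; [apply Rmult_le_pos|]; lra).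
lra.
Qed.

Lemma polar_form w : exists s, w = polar (Cmod w) s.
Proof.
destruct (Req_dec (Cmod w) 0) as [E|E].
- exists 0. rewrite E, polar_0. apply Cmod_eq_0; auto.
- destruct (unit_angle (fst w / Cmod w) (snd w / Cmod w)) as [s [Hs1 Hs2]].
  + replace ((fst w / Cmod w) ^ 2 + (snd w / Cmod w) ^ 2) with ((fst w ^ 2 + snd w ^ 2) / Cmod w ^ 2) by (field; auto).
    change (fst w ^ 2 + snd w ^ 2) with (Re w ^ 2 + Im w ^ 2). rewrite <- Cmod2_alt. field. auto.
  + exists s. apply C_eq; simpl; [rewrite Hs1|rewrite Hs2]; field; auto.
Qed.

(** Cauchy estimates with bound 1, hence uniform in t. *)
Lemma phi_lip t z h : 0 <= t -> Cmod z < 1 -> Cmod h <= (1 - Cmod z) / 4 ->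
  Cmod (phi t (z + h)%C - phi t z)%C <= 12 * (Cmod h / (1 - Cmod z)).
Proof.
intros Ht Hz Hh. set (d := 1 - Cmod z) in *. assert (Hd : 0 < d) by (unfold d; lra).
destruct (taylor_bounds (phi t) z (d / 2) 1 (phi_hol t Ht)) as [_ T]; [lra|unfold d in *; lra| |].
{ intros w Hw. left. apply phi_in; auto. replace w with (z + (w - z))%C by ring.
  pose proof (Cmod_triangle z (w - z)). unfold d in *. lra. }
destruct (T h ltac:(lra)) as [_ T2]. eapply Rle_trans; [exact T2|]. apply Req_le. field. lra.
Qed.

(** The absolute value extends the flow to negative times, so that continuity holds on the whole
    plane, as the integral lemmas ask. *)
Lemma joint_cont r t s : 0 <= r < 1 ->
  ccont (U := prod_UniformSpace R_UniformSpace R_UniformSpace) (fun q : R * R => phi (Rabs (snd q)) (polar r (fst q))) (s, t).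
Proof.
intros Hr P [eps Hp]. simpl in Hp.
destruct (phi_tcont r Hr (eps / 2) ltac:(pose proof (cond_pos eps); lra)) as [d1 [Hd1 T1]].
set (x := Rmin ((1 - r) / 4) (eps * (1 - r) / 48)).
assert (Hx : 0 < x) by (pose proof (cond_pos eps); apply Rmin_pos; [lra|apply Rdiv_lt_0_compat; [apply Rmult_lt_0_compat|]; lra]).
assert (Hx1 : x <= (1 - r) / 4) by apply Rmin_l. assert (Hx2 : x <= eps * (1 - r) / 48) by apply Rmin_r.
pose proof (ccont_e1 r s) as C1c.
assert (Hpc : exists d2 : posreal, forall s', Rabs (s' - s) < d2 -> Cmod (polar r s' - polar r s)%C < x).
{ pose proof (rcont_Cmod (fun s' => polar r s' - polar r s)%C s
    (ccont_minus _ _ _ C1c (ccont_const _ _))) as Hc.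
  apply continuity_pt_filterlim in Hc. rewrite continuity_pt_eps in Hc.
  destruct (Hc x Hx) as [d2 [Hd2 T2]]. exists (mkposreal _ Hd2). intros s' Hs'. specialize (T2 s' Hs').
  replace (polar r s - polar r s)%C with (RtoC 0) in T2 by ring. rewrite Cmod_0, Rminus_0_r in T2.
  apply Rabs_def2 in T2. lra. }
destruct Hpc as [d2 T2].
assert (Hm : 0 < Rmin d1 d2) by (apply Rmin_pos; auto; apply cond_pos).
exists (mkposreal _ Hm). intros [s' t'] [B1 B2]. simpl in B1, B2.
unfold ball in B1, B2; simpl in B1, B2; unfold AbsRing_ball, abs, minus, plus, opp in B1, B2; simpl in B1, B2.
apply Hp. apply C_NormedModule_mixin_compat1. simpl.
pose proof (Rlt_le_trans _ _ _ B1 (Rmin_r _ _)) as S1. pose proof (Rlt_le_trans _ _ _ B2 (Rmin_l _ _)) as S2.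
specialize (T2 s' S1).
assert (Ht' : Rabs (Rabs t' - Rabs t) < d1).
{ eapply Rle_lt_trans; [apply Rabs_triang_inv2|]. exact S2. }
pose proof (Cmod_polar r s ltac:(lra)) as Hps.
specialize (T1 (Rabs t) (Rabs t') (polar r s) (Rabs_pos _) (Rabs_pos _) Ht' ltac:(lra)).
set (h := (polar r s' - polar r s)%C) in *.
pose proof (phi_lip (Rabs t') (polar r s) h (Rabs_pos _) ltac:(lra) ltac:(rewrite Hps; lra)) as T3.
rewrite Hps in T3. replace (polar r s + h)%C with (polar r s') in T3 by (unfold h; ring).
assert (T4 : 12 * (Cmod h / (1 - r)) <= eps / 4).
{ apply Rle_trans with (12 * (eps * (1 - r) / 48 / (1 - r))); [|apply Req_le; field; lra].
  apply Rmult_le_compat_l; [lra|]. apply Rmult_le_compat_r; [left; apply Rinv_0_lt_compat; lra|lra]. }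
pose proof (cond_pos eps).
change (Cmod (phi (Rabs t') (polar r s') - phi (Rabs t) (polar r s))%C < eps).
replace (phi (Rabs t') (polar r s') - phi (Rabs t) (polar r s))%C with
  ((phi (Rabs t') (polar r s') - phi (Rabs t') (polar r s)) + (phi (Rabs t') (polar r s) - phi (Rabs t) (polar r s)))%C by ring.
eapply Rle_lt_trans; [apply Cmod_triangle|]. lra.
Qed.

Lemma phi_joint (u : C -> R) r : 0 <= r < 1 ->
  (forall w, Cmod w < 1 -> continuous (T := C_UniformSpace) u w) ->
  forall s t, continuity_2d_pt (fun s t => u (phi (Rabs t) (polar r s))) s t.
Proof.
intros Hr Hu s t. apply cont2_of_continuous.
apply (continuous_comp (V := C_UniformSpace) (fun q : R * R => phi (Rabs (snd q)) (polar r (fst q))) u).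
- apply joint_cont; auto.
- apply Hu. apply phi_in; [apply Rabs_pos|]. simpl. rewrite Cmod_polar; lra.
Qed.

Lemma mn_fubini (K : R -> R -> R) a c : a <= c -> (forall s t, continuity_2d_pt K s t) ->
  mn (fun s => RInt (K s) a c) = RInt (fun t => mn (fun s => K s t)) a c.
Proof.
intros Hac HK. pose proof PI_RGT_0. unfold mn.
rewrite (RInt_fubini K 0 (2 * PI) a c) by (auto; lra).
rewrite (RInt_Rext (fun t => RInt (fun s => K s t) 0 (2 * PI) / (2 * PI)) (fun t => / (2 * PI) * RInt (fun s => K s t) 0 (2 * PI)))
  by (intros; apply Rmult_comm).
rewrite RInt_Rscal; [apply Rmult_comm|]. apply ex_RInt_cont. intros t.
apply (RInt_param_cont (fun t s => K s t)); [lra| |].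
- intros s _. apply cont2_of_continuous. specialize (HK s t). apply continuity_2d_pt_filterlim in HK.
  apply (continuous_comp (V := prod_UniformSpace R_UniformSpace R_UniformSpace) (fun q : R * R => (snd q, fst q)) (fun q : R * R => K (fst q) (snd q))); auto.
  apply ccont_pair; simpl; [apply continuous_snd'|apply continuous_fst'].
- intros t' s. apply (cont2_section_l (fun s t' => K s t')); auto.
Qed.

Lemma mn_param_cont (K : R -> R -> R) t : (forall s t, continuity_2d_pt K s t) -> continuous (fun t => mn (fun s => K s t)) t.
Proof.
intros HK. pose proof PI_RGT_0. unfold mn. apply rcont_mult; [|apply continuous_const].
apply (RInt_param_cont (fun t s => K s t)); [lra| |].
- intros s _. apply cont2_of_continuous. specialize (HK s t). apply continuity_2d_pt_filterlim in HK.
  apply (continuous_comp (V := prod_UniformSpace R_UniformSpace R_UniformSpace) (fun q : R * R => (snd q, fst q)) (fun q : R * R => K (fst q) (snd q))); auto.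
  apply ccont_pair; simpl; [apply continuous_snd'|apply continuous_fst'].
- intros t' s. apply (cont2_section_l (fun s t' => K s t')); auto.
Qed.

Lemma RInt_param_cont_l (K : R -> R -> R) a c s : a <= c -> (forall s t, continuity_2d_pt K s t) -> continuous (fun s => RInt (K s) a c) s.
Proof. intros Hac HK. apply RInt_param_cont; auto. intros; apply cont2_section; auto. Qed.

(** Means increase with the radius and the weights at [rk k] and [rk (S k)] differ by a fixed
    factor, so the radii [rk k] decide. *)
Lemma H0_of_rk p al f : Rbar_lt 0 p -> 0 < al -> Hinf p al f ->
  (forall E, 0 < E -> exists k1, forall k, (k1 <= k)%nat -> rpow (th ^ k) al * Mp p (rk k) f <= E) ->
  H0 p al f.
Proof.
intros Hp Hal Hi H. split; auto. destruct Hi as [Hf _]. intros eps He.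
assert (Hth : 0 < rpow th al) by (apply rpow_gt0; unfold th; lra).
destruct (H (eps * rpow th al / 2)) as [k1 Hk1]; [apply Rdiv_lt_0_compat; [apply Rmult_lt_0_compat; auto|lra]|].
exists (rk k1). split; [apply rk_bounds|]. intros r Hr.
destruct (rk_find k1 r ltac:(lra)) as [k [Hk Hkr]].
specialize (Hk1 (S k) ltac:(lia)). pose proof (rk_bounds k). pose proof (rk_bounds (S k)).
pose proof (Mp_mono p f r (rk (S k)) Hp Hf ltac:(lra) ltac:(lra)) as M1.
pose proof (Mp_ge0 p r f Hf ltac:(lra)) as M0.
assert (W : rpow (1 - r) al <= rpow (th ^ k) al) by (apply rpow_le; auto; unfold rk in Hkr; lra).
pose proof (th_pow k). simpl pow in Hk1. rewrite rpow_mult in Hk1 by (unfold th in *; lra).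
pose proof (rpow_ge0 (1 - r) al).
assert (X : rpow (th ^ k) al * Mp p (rk (S k)) f <= eps / 2).
{ apply Rmult_le_reg_l with (rpow th al); auto. lra. }
apply Rle_lt_trans with (rpow (th ^ k) al * Mp p (rk (S k)) f); [|lra].
apply Rmult_le_compat; auto.
Qed.

Section LittleBloch.

Hypothesis Bloch0 : forall e, 0 < e -> exists r0, 0 <= r0 < 1 /\ forall w, r0 < Cmod w < 1 -> xw w < e.

(** 128 c Cd <= 1 serves [small_move]. 320 c Cd^2 <= 1 makes c times the variation of [xw], at most
    160 c Cd^2 h, at most h / 2 as required in [time_change]. *)
Lemma c_small x : 0 < x -> exists c, 0 < c /\ 128 * c * Cd <= 1 /\ 320 * c * Cd ^ 2 <= 1 /\ c <= x.
Proof.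
intros Hx. pose proof Cd_ge1. set (y := / (320 * Cd ^ 2)).
assert (0 < Cd ^ 2) by (apply pow_lt; lra).
assert (Hy : 0 < y) by (apply Rinv_0_lt_compat; lra).
assert (Ey : 320 * y * Cd ^ 2 = 1) by (unfold y; field; lra).
exists (Rmin x y). assert (Hm : Rmin x y <= y) by apply Rmin_r. assert (0 < Rmin x y) by (apply Rmin_pos; auto).
assert (E1 : 320 * Rmin x y * Cd ^ 2 <= 1).
{ rewrite <- Ey. apply Rmult_le_compat_r; lra. }
repeat split; auto; [|apply Rmin_l]. nra.
Qed.

(** For p infinite the time c xw w may be chosen separately at each w, so the bound on f' is
    pointwise. Integrated over a radial step it contracts the weighted maxima with ratio th^al up to
    E1. *)
Lemma strong_cont_H0_inf al f : 0 < al -> strong_cont p_infty al phi f -> H0 p_infty al f.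
Proof.
intros Hal [Hi Hsc]. apply H0_of_rk; auto; [exact I|]. destruct Hi as [Hf HS].
apply Hnorm_fin in HS. destruct HS as [S0 HS0].
set (S := Rmax S0 1). assert (HS : forall r, 0 <= r < 1 -> rpow (1 - r) al * Mp p_infty r f <= S).
{ intros r Hr. eapply Rle_trans; [apply HS0; auto|apply Rmax_l]. }
assert (HS1 : 1 <= S) by apply Rmax_r.
assert (Hpt : forall g r s, holoD g -> 0 <= r < 1 -> Cmod (g (polar r s)) <= Mp p_infty r g).
{ intros g r s Hg Hr. rewrite Mp_Lp. apply (proj1 (Lp_inf_lub _ (circ_hol g r Hg Hr)) s). }
assert (Hsup : forall w, Cmod w < 1 -> rpow (1 - Cmod w) al * Cmod (f w) <= S).
{ intros w Hw. pose proof (Cmod_ge_0 w).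
  set (r := Cmod w). assert (exists s, w = polar r s) as [s Es]
  by apply polar_form.
  rewrite Es at 1. eapply Rle_trans; [|apply (HS r); unfold r in *; lra].
  apply Rmult_le_compat_l; [apply rpow_ge0|]. apply Hpt; auto. }
pose proof Cd_ge1. pose proof b_in.
assert (HC1 : 0 < C1) by (unfold C1; apply Rdiv_lt_0_compat; lra).
assert (HC0 : 0 < C0).
{ unfold C0, Kg. assert (0 < Cd ^ 2) by (apply pow_lt; lra). assert (0 <= Cd * (Cd + 60 * Cd * Cd)) by nra. lra. }
assert (H2a : 0 < rpow 2 al) by (apply rpow_gt0; lra).
intros E HE.
assert (Hq : 0 < rpow th al < 1).
{ split; [apply rpow_gt0; unfold th; lra|]. rewrite <- (rpow_one al). apply rpow_lt; auto; unfold th; lra. }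
set (E1 := E * (1 - rpow th al) / 2). assert (HE1 : 0 < E1) by (unfold E1; apply Rdiv_lt_0_compat; [apply Rmult_lt_0_compat|]; lra).
set (k := C1 * C0 * rpow 2 al * S).
assert (Hk : 0 < k) by (unfold k; apply Rmult_lt_0_compat; [apply Rmult_lt_0_compat; [apply Rmult_lt_0_compat|]|]; lra).
(* The order of choices: c makes the O(c) error at most E1/2, then [ep] makes the increment divided
   by c at most E1/2, and only then is the radius fixed beyond which c xw w < de. *)
destruct (c_small (E1 / (2 * k))) as [c [Hc [Hc1 [_ Hc2]]]]; [apply Rdiv_lt_0_compat; lra|].
set (ep := E1 * c / (2 * C1)). assert (Hep : 0 < ep) by (unfold ep; apply Rdiv_lt_0_compat; [apply Rmult_lt_0_compat|]; lra).
destruct (Hsc ep Hep) as [de [Hde Hsc2]].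
destruct (Bloch0 (de / c)) as [r0 [Hr0 HB]]; [apply Rdiv_lt_0_compat; auto|].
set (r1 := Rmax r0 ((1 + Cmod b) / 2)).
assert (Hr1 : r1 < 1) by (apply Rmax_lub_lt; lra).
assert (HV : forall w, r1 < Cmod w < 1 -> rpow (1 - Cmod w) al * V f w <= E1).
{ intros w Hw. assert (r0 <= r1) by apply Rmax_l. assert ((1 + Cmod b) / 2 <= r1) by apply Rmax_r.
  assert (Hwi : Cmod w < 1) by lra. pose proof (Cmod_ge_0 w).
  specialize (HB w ltac:(lra)). pose proof (xw_bounds w Hwi) as Hx.
  set (s := c * xw w). assert (Hs0 : 0 < s) by (apply Rmult_lt_0_compat; lra).
  assert (Hsd : s < de).
  { unfold s. apply (Rmult_lt_compat_l c) in HB; auto. replace (c * (de / c)) with de in HB by (field; lra). auto. }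
  set (d := 1 - Cmod w) in *. assert (Hd : 0 < d) by (unfold d; lra).
  assert (Hda : 0 < rpow d al) by (apply rpow_gt0; auto).
  pose proof (V_increment f w s c (rpow 2 al * S / rpow d al) Hf Hwi ltac:(lra) Hc Hc1 ltac:(fold s; lra)) as VI.
  assert (VI2 : V f w <= C1 * (Cmod (f (phi s w) - f w)%C / c + C0 * c * (rpow 2 al * S / rpow d al))).
  { apply VI. intros w' Hw'. fold d in Hw'. pose proof (ball_in w w' (1 / 8) Hwi ltac:(fold d; lra)) as Hb. fold d in Hb.
    specialize (Hsup w' ltac:(lra)).
    assert (Hdd : rpow (d / 2) al <= rpow (1 - Cmod w') al) by (apply rpow_le; lra).
    unfold Rdiv in Hdd. rewrite rpow_mult, rpow_inv in Hdd by lra.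
    assert (rpow d al * / rpow 2 al * Cmod (f w') <= S).
    { eapply Rle_trans; [|exact Hsup]. apply Rmult_le_compat_r; auto using Cmod_ge_0. }
    apply Rmult_le_reg_l with (rpow d al * / rpow 2 al); [apply Rmult_lt_0_compat; auto; apply Rinv_0_lt_compat; auto|].
    eapply Rle_trans; [eassumption|]. apply Req_le. field. lra. }
  assert (Hinc : rpow d al * Cmod (f (phi s w) - f w)%C <= ep).
  { specialize (Hsc2 s ltac:(lra)). pose proof (proj1 (Hnorm_le _ _ _ _) Hsc2) as N.
    assert (Hfd : holoD (fun z => f (phi s z) - f z)%C) by (apply holoD_minus; auto; apply holoD_phi; auto; lra).
    set (r := Cmod w). assert (exists x, w = polar r x) as [x Ex]
     by apply polar_form.
    eapply Rle_trans; [|apply (N r); unfold r in *; lra]. apply Rmult_le_compat_l; [apply rpow_ge0|].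
    rewrite Ex at 1 2. apply (Hpt (fun z => f (phi s z) - f z)%C r x); auto. }
  apply Rle_trans with (rpow d al * (C1 * (Cmod (f (phi s w) - f w)%C / c + C0 * c * (rpow 2 al * S / rpow d al)))).
  - apply Rmult_le_compat_l; lra.
  - replace (rpow d al * (C1 * (Cmod (f (phi s w) - f w)%C / c + C0 * c * (rpow 2 al * S / rpow d al))))
      with (C1 / c * (rpow d al * Cmod (f (phi s w) - f w)%C) + c * k) by (unfold k; field; lra).
    assert (C1 / c * (rpow d al * Cmod (f (phi s w) - f w)%C) <= E1 / 2).
    { apply Rle_trans with (C1 / c * ep).
      - apply Rmult_le_compat_l; auto. left; apply Rdiv_lt_0_compat; auto.
      - apply Req_le. unfold ep. field. lra. }
    assert (c * k <= E1 / 2).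
    { apply Rle_trans with (E1 / (2 * k) * k); [apply Rmult_le_compat_r; lra|]. apply Req_le; field; lra. }
    lra. }
destruct (rk_lim r1 Hr1) as [k0' Hk0'].
destruct (seq_contract (fun k => rpow (th ^ k) al * Mp p_infty (rk k) f) (rpow th al) E1 k0') as [k1 [_ Hk1]]; auto; [lra| |].
- intros j Hj. pose proof (th_pow j) as Ht. pose proof (rk_incr k0' j Hj). pose proof (rk_bounds j). pose proof (rk_bounds (Datatypes.S j)).
  set (d := th ^ j) in *.
  assert (Er : rk j = 1 - d) by reflexivity. assert (Er' : rk (Datatypes.S j) = 1 - th * d) by reflexivity.
  rewrite Er, Er' in *. simpl pow. fold d.
  assert (Hthp : 0 < th) by (unfold th; lra). assert (Hthd : 0 < th * d) by (unfold th; lra).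
  assert (Hstep : Mp p_infty (1 - th * d) f <= Mp p_infty (1 - d) f + E1 / rpow (th * d) al).
  { rewrite (Mp_Lp _ (1 - th * d)). apply Lp_inf_lub; [apply circ_hol; auto|]. intros t.
    assert (R : Cmod (f (polar (1 - th * d) t) - f (polar (1 - d) t))%C <= E1 / rpow (th * d) al / (th * d) * ((1 - th * d) - (1 - d))).
    { apply radial_mvi; auto; try (unfold th in *; lra). intros x Hx.
      pose proof (Cmod_polar x t ltac:(lra)) as Hpx.
      specialize (HV (polar x t) ltac:(lra)). unfold V in HV. rewrite Hpx in HV.
      set (D := Cmod (C_derive f (polar x t))) in *. assert (HD : 0 <= D) by apply Cmod_ge_0.
      assert (Hra : rpow (th * d) al <= rpow (1 - x) al) by (apply rpow_le; lra).
      assert (0 < rpow (th * d) al) by (apply rpow_gt0; auto).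
      assert (th * d <= 1 - x ^ 2) by nra.
      apply Rmult_le_reg_l with (rpow (th * d) al * (th * d)); [apply Rmult_lt_0_compat; auto|].
      replace (rpow (th * d) al * (th * d) * (E1 / rpow (th * d) al / (th * d))) with E1 by (field; repeat split; lra).
      eapply Rle_trans; [|exact HV]. rewrite <- (Rmult_assoc (rpow (1 - x) al)). apply Rmult_le_compat_r; auto.
      apply Rmult_le_compat; lra. }
    assert (0 < E1 / rpow (th * d) al) by (apply Rdiv_lt_0_compat; auto; apply rpow_gt0; auto).
    assert (E1 / rpow (th * d) al / (th * d) * ((1 - th * d) - (1 - d)) <= E1 / rpow (th * d) al).
    { replace (E1 / rpow (th * d) al / (th * d) * ((1 - th * d) - (1 - d))) with (E1 / rpow (th * d) al * ((1 - th) / th)).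
      - assert ((1 - th) / th <= 1) by (unfold th; lra). nra.
      - field. repeat split; try lra. apply Rgt_not_eq, rpow_gt0; auto. }
    pose proof (Hpt f (1 - d) t Hf ltac:(lra)).
    pose proof (Cmod_triangle (f (polar (1 - d) t)) (f (polar (1 - th * d) t) - f (polar (1 - d) t))) as T.
    replace (f (polar (1 - d) t) + (f (polar (1 - th * d) t) - f (polar (1 - d) t)))%C with (f (polar (1 - th * d) t)) in T by ring.
    lra. }
  assert (Hw : 0 < rpow (th * d) al) by (apply rpow_gt0; auto).
  apply Rle_trans with (rpow (th * d) al * (Mp p_infty (1 - d) f + E1 / rpow (th * d) al)); [apply Rmult_le_compat_l; lra|].
  rewrite Rmult_plus_distr_l. replace (rpow (th * d) al * (E1 / rpow (th * d) al)) with E1 by (field; lra).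
  rewrite rpow_mult by (unfold th in *; lra). lra.
- exists k1. intros j Hj. eapply Rle_trans; [apply Hk1; auto|]. apply Req_le. unfold E1. field. lra.
Qed.

(** For finite p the estimates are run on p-th powers, where integrals in time and angle commute;
    the weight exponent becomes al q. *)
Lemma Mp_pm q al r f S : 0 < q -> holoD f -> 0 <= r < 1 -> 0 <= S ->
  (rpow (1 - r) al * Mp (Finite q) r f <= S <-> rpow (1 - r) (al * q) * pm q r f <= rpow S q).
Proof.
intros Hq Hf Hr HS. rewrite Mp_fin. pose proof (pm_ge0 q r f Hq Hf Hr) as Hp.
assert (E : rpow (rpow (1 - r) al * rpow (pm q r f) (/ q)) q = rpow (1 - r) (al * q) * pm q r f).
{ rewrite rpow_mult by apply rpow_ge0. rewrite rpow_rpow by lra. rewrite rpow_inv_r by auto. auto. }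
rewrite <- E. split; intros H.
- apply rpow_le; auto.
- apply Rnot_lt_le. intros Hlt. assert (rpow S q < rpow (rpow (1 - r) al * rpow (pm q r f) (/ q)) q) by (apply rpow_lt; auto). lra.
Qed.

(** * Finite exponent: averaging over time *)

Section FiniteP.

Variables (q al : R) (f : C -> C).
Hypotheses (Hq : 0 < q) (Hal : 0 < al) (Hf : holoD f).

Let F t z := (f (phi t z) - f z)%C.
Let Vq (w : C) := rpow (V f w) q.

Lemma V_ge0 w : Cmod w < 1 -> 0 <= V f w.
Proof. intros Hw. unfold V. pose proof (Cmod_ge_0 w). apply Rmult_le_pos; [nra|apply Cmod_ge_0]. Qed.

Let Vq_cont w : Cmod w < 1 -> continuous (T := C_UniformSpace) Vq w.
Proof.
intros Hw. apply rcont_rpow; auto. unfold V. apply rcont_mult.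
- apply rcont_minus; [apply continuous_const|]. apply rcont_pow, rcont_Cmod, ccont_id.
- apply rcont_Cmod. eapply cdiff_ccont. apply holoD_cdiff; auto. apply holoD_derive; auto.
Qed.

Let Fq_cont r s t : 0 <= r < 1 -> continuity_2d_pt (fun s t => rpow (Cmod (F (Rabs t) (polar r s))) q) s t.
Proof.
intros Hr. apply cont2_of_continuous. apply rcont_rpow; auto. apply rcont_Cmod. unfold F.
assert (Hp : Cmod (polar r s) < 1) by (rewrite Cmod_polar; lra).
apply ccont_minus.
- apply (ccont_comp_hol f (fun p : R * R => phi (Rabs (snd p)) (polar r (fst p))) (s, t) (C_derive f (phi (Rabs t) (polar r s)))).
  + apply joint_cont; auto.
  + apply holoD_cdiff; auto. apply phi_in; auto. apply Rabs_pos.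
- apply (ccont_comp_hol f (fun p : R * R => polar r (fst p)) (s, t) (C_derive f (polar r s))).
  + apply ccont_polar; [apply continuous_const|apply continuous_fst'].
  + apply holoD_cdiff; auto.
Qed.

Let hm_joint r s t : 0 <= r < 1 -> continuity_2d_pt (fun s t => hm q (rad r) f (phi (Rabs t) (polar r s))) s t.
Proof.
intros Hr. destruct (rad_bounds r Hr) as [R1 _].
destruct (hm_re q (rad r) f Hq Hf R1) as [A [HA E]].
assert (Hin : forall s t, Cmod (phi (Rabs t) (polar r s)) < rad r).
{ intros. apply phi_rad; auto; [apply Rabs_pos|]. rewrite Cmod_polar; lra. }
apply (continuity_2d_pt_ext (fun s t => fst (A (phi (Rabs t) (polar r s))))); [intros; symmetry; apply E; auto|].
apply cont2_of_continuous. apply ccont_fst.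
destruct (HA (phi (Rabs t) (polar r s)) (Hin s t)) as [l Hl].
apply (ccont_comp_hol A (fun p : R * R => phi (Rabs (snd p)) (polar r (fst p))) (s, t) l); auto.
apply joint_cont; auto.
Qed.

Variables (c de rho1 Bv : R).
Hypotheses (Hc : 0 < c) (Hc1 : 128 * c * Cd <= 1) (Hc2 : 320 * c * Cd ^ 2 <= 1) (Hde : 0 < de).
Hypotheses (Hrho : (1 + Cmod b) / 2 <= rho1) (Hrx : forall w, rho1 < Cmod w < 1 -> c * xw w <= de).
Hypothesis HBv : forall w, Cmod w <= rho1 -> Cmod w < 1 -> V f w <= Bv.

(** A truncation of c y at [de]: at most both, at least c y / 2 when c y <= de, and with Lipschitz
    constant c. It is needed because in the inner disc c xw may exceed [de], while [time_change]
    allows times up to [de] only. *)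
Let eta y := c * y * de / (de + c * y).

Let eta_bounds y : 0 <= y -> 0 <= eta y <= c * y /\ eta y <= de /\ (c * y <= de -> c * y / 2 <= eta y).
Proof.
intros Hy. unfold eta. assert (0 <= c * y) by (apply Rmult_le_pos; lra).
assert (Hd : 0 < de + c * y) by lra. set (x := c * y) in *.
assert (E : forall u, 0 <= u -> x * de <= u * (de + x) -> x * de / (de + x) <= u).
{ intros u Hu H1. apply Rmult_le_reg_r with (de + x); auto. unfold Rdiv. rewrite Rmult_assoc, Rinv_l; lra. }
repeat split.
- apply Rdiv_le_0_compat; nra.
- apply E; nra.
- apply E; nra.
- intros Hx. apply Rmult_le_reg_r with (de + x); auto. unfold Rdiv at 2. rewrite (Rmult_assoc (x * de)), Rinv_l by lra. nra.
Qed.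

Let eta_lip y y' : 0 <= y -> 0 <= y' -> eta y - c * Rabs (y' - y) <= eta y'.
Proof.
intros Hy Hy'. unfold eta.
assert (0 <= c * y) by (apply Rmult_le_pos; lra). assert (0 <= c * y') by (apply Rmult_le_pos; lra).
assert (E : c * y * de / (de + c * y) - c * y' * de / (de + c * y') = c * (y - y') * (de / (de + c * y) * (de / (de + c * y')))) by (field; lra).
assert (B : forall u, 0 <= u -> 0 <= de / (de + u) <= 1).
{ intros u Hu. split; [apply Rdiv_le_0_compat; lra|]. apply Rmult_le_reg_r with (de + u); [lra|]. unfold Rdiv. rewrite Rmult_assoc, Rinv_l; lra. }
pose proof (B _ H) as B1. pose proof (B _ H0) as B2.
set (k := de / (de + c * y) * (de / (de + c * y'))) in *.
assert (0 <= k <= 1) by (unfold k; nra).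
assert (c * (y - y') * k <= c * Rabs (y' - y)); [|lra].
rewrite Rmult_assoc. apply Rmult_le_compat_l; [lra|]. rewrite Rabs_minus_sym.
pose proof (Rle_abs (y - y')). pose proof (Rabs_pos (y - y')). destruct (Rle_lt_dec 0 (y - y')); nra.
Qed.

(** Coefficients of the increments and of the Poisson majorant in [pointwise]. [D2c] is small with c
    whereas [D1c] grows as c decreases, so c is fixed before the increments are made small. *)
Definition D1c : R := rpow 2 q * (rpow (C1 / c) q * rpow 2 q).
Definition D2c : R := rpow 2 q * (rpow (C1 * C0 * c) q * 5).

Let C1_pos : 0 < C1.
Proof. unfold C1. pose proof b_in. apply Rdiv_lt_0_compat; lra. Qed.
Let C0_pos : 0 < C0.
Proof.
pose proof Cd_ge1. unfold C0, Kg. assert (0 < Cd ^ 2) by (apply pow_lt; lra).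
assert (0 <= Cd * (Cd + 60 * Cd * Cd)) by nra. lra.
Qed.

(** The increment f(phi_s w) - f(w) at w = phi_t z is the difference of the increments of f from z
    at times t + s and t. The local supremum of |f| in [V_increment] is replaced by (5 hm)^(1/q).
    Inside |w| <= rho1 the constant [Bv] suffices. *)
Let pointwise r z t : 0 <= r < 1 -> Cmod z = r -> 0 <= t ->
  Vq (phi t z) <= rpow Bv q + D1c * (rpow (Cmod (F (t + eta (xw (phi t z))) z)) q + rpow (Cmod (F t z)) q)
     + D2c * hm q (rad r) f (phi t z).
Proof.
intros Hr Hz Ht. destruct (rad_bounds r Hr) as [R1 [R2 [R3 R4]]].
assert (Hzi : Cmod z < 1) by lra. pose proof (phi_in t z Ht Hzi) as Hw.
pose proof (phi_rad t r z Ht Hr ltac:(lra)) as Hwr.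
set (w := phi t z) in *.
assert (G1 : 0 <= D1c) by (unfold D1c; apply Rmult_le_pos; [apply rpow_ge0|apply Rmult_le_pos; apply rpow_ge0]).
assert (G2 : 0 <= D2c) by (unfold D2c; apply Rmult_le_pos; [apply rpow_ge0|apply Rmult_le_pos; [apply rpow_ge0|lra]]).
pose proof (hm_ge0 q (rad r) f w Hq Hf R1 Hwr) as Hh.
pose proof (xw_bounds w Hw) as Hx. destruct (eta_bounds (xw w) ltac:(lra)) as [E1' [E2' E3']].
set (s := eta (xw w)) in *.
pose proof (rpow_ge0 (Cmod (F (t + s) z)) q) as P1. pose proof (rpow_ge0 (Cmod (F t z)) q) as P2.
pose proof (rpow_ge0 Bv q) as P3.
destruct (Rle_lt_dec (Cmod w) rho1) as [Hin|Hout].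
- assert (Vq w <= rpow Bv q) by (apply rpow_le; auto).
  assert (0 <= D1c * (rpow (Cmod (F (t + s) z)) q + rpow (Cmod (F t z)) q)) by (apply Rmult_le_pos; lra).
  assert (0 <= D2c * hm q (rad r) f w) by (apply Rmult_le_pos; lra). lra.
- specialize (Hrx w ltac:(lra)). specialize (E3' Hrx).
  set (M := rpow (5 * hm q (rad r) f w) (/ q)).
  assert (HM : 0 <= M) by apply rpow_ge0.
  assert (HMq : rpow M q = 5 * hm q (rad r) f w) by (apply rpow_inv_r; lra).
  assert (VI : V f w <= C1 * (Cmod (f (phi s w) - f w)%C / c + C0 * c * M)).
  { apply V_increment; auto; try lra. intros w' Hw'.
    rewrite <- (rpow_inv_l (Cmod (f w')) q) by (auto using Cmod_ge_0).
    apply rpow_le; [apply Rinv_0_lt_compat; auto|].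
    assert (Hrw : 7 / 8 * (1 - Cmod w) <= rad r - Cmod w).
    { pose proof (phi_boundary t z Ht Hzi) as PB. fold w in PB. rewrite Hz in PB. unfold k0 in R3. lra. }
    assert (Hw'r : Cmod w' < rad r).
    { replace w' with (w + (w' - w))%C by ring. pose proof (Cmod_triangle w (w' - w)). lra. }
    eapply Rle_trans; [apply (poisson_majorant q f (rad r)); auto|].
    apply hm_harnack; auto. lra. }
  assert (Hphi : phi s w = phi (t + s) z) by (unfold w; rewrite (Rplus_comm t s), phi_plus by (auto; lra); auto).
  set (Dl := Cmod (f (phi s w) - f w)%C) in *. assert (HDl : 0 <= Dl) by apply Cmod_ge_0.
  assert (HD : Dl <= Cmod (F (t + s) z) + Cmod (F t z)).
  { unfold Dl, F. rewrite Hphi. fold w.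
    replace (f (phi (t + s) z) - f w)%C with ((f (phi (t + s) z) - f z) - (f w - f z))%C by ring. apply Cmod_minus_le. }
  assert (HDq : rpow Dl q <= rpow 2 q * (rpow (Cmod (F (t + s) z)) q + rpow (Cmod (F t z)) q)).
  { eapply Rle_trans; [apply rpow_le; [auto|exact HD]|]. apply rpow_add; auto using Cmod_ge_0. }
  assert (Hk1 : 0 <= C1 / c) by (left; apply Rdiv_lt_0_compat; auto).
  assert (Hk2 : 0 <= C1 * C0 * c) by (left; apply Rmult_lt_0_compat; [apply Rmult_lt_0_compat|]; auto).
  assert (X : Vq w <= rpow 2 q * (rpow (C1 / c) q * rpow Dl q + rpow (C1 * C0 * c) q * (5 * hm q (rad r) f w))).
  { rewrite <- HMq, <- !rpow_mult by auto.
    eapply Rle_trans; [|apply rpow_add; auto; apply Rmult_le_pos; auto].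
    apply rpow_le; auto. eapply Rle_trans; [exact VI|]. apply Req_le. field. lra. }
  eapply Rle_trans; [exact X|].
  assert (Y : rpow 2 q * (rpow (C1 / c) q * rpow Dl q) <= D1c * (rpow (Cmod (F (t + s) z)) q + rpow (Cmod (F t z)) q)).
  { unfold D1c. rewrite !Rmult_assoc. apply Rmult_le_compat_l; [apply rpow_ge0|]. apply Rmult_le_compat_l; [apply rpow_ge0|]. exact HDq. }
  unfold D2c. lra.
Qed.

Let xw_cont w : Cmod w < 1 -> continuous (T := C_UniformSpace) xw w.
Proof.
intros Hw. unfold xw. apply rcont_mult.
- apply rcont_minus; [apply continuous_const|]. apply rcont_pow, rcont_Cmod, ccont_id.
- apply rcont_Cmod. eapply cdiff_ccont. apply (holoD_cdiff dg); auto.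
Qed.

(** The pointwise bound integrated in t. In 3 [D1c], 2 comes from [time_change] for the shifted
    increment and 1 from the unshifted one. *)
Let inner r x : 0 <= r < 1 ->
  RInt (fun t => Vq (phi (Rabs t) (polar r x))) 0 de <=
    de * rpow Bv q + 3 * D1c * RInt (fun t => rpow (Cmod (F (Rabs t) (polar r x))) q) 0 (2 * de)
    + D2c * RInt (fun t => hm q (rad r) f (phi (Rabs t) (polar r x))) 0 de.
Proof.
intros Hr. set (z := polar r x). assert (Hz : Cmod z = r) by (apply Cmod_polar; lra). assert (Hzi : Cmod z < 1) by lra.
set (psi := fun u => rpow (Cmod (F (Rabs u) z)) q).
set (s := fun t => eta (xw (phi (Rabs t) z))).
assert (Hpsi : forall t, continuous psi t).
{ intros t. apply (cont2_section (fun s t => rpow (Cmod (F (Rabs t) (polar r s))) q)). apply Fq_cont; auto. }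
assert (Hpsi0 : forall t, 0 <= psi t) by (intros; apply rpow_ge0).
assert (Hxpos : forall t, 0 < xw (phi (Rabs t) z)) by (intros; apply xw_bounds, phi_in; auto; apply Rabs_pos).
assert (Hxc : forall t, continuous (fun t => xw (phi (Rabs t) z)) t).
{ intros t. apply (cont2_section (fun s t => xw (phi (Rabs t) (polar r s)))). apply phi_joint; auto. }
assert (Hs : forall t, continuous s t).
{ intros t. unfold s, eta. specialize (Hxpos t).
  apply rcont_div.
  - apply rcont_mult; [|apply continuous_const]. apply rcont_mult; [apply continuous_const|auto].
  - apply rcont_plus; [apply continuous_const|]. apply rcont_mult; [apply continuous_const|auto].
  - assert (0 < c * xw (phi (Rabs t) z)) by (apply Rmult_lt_0_compat; auto). lra. }
assert (TC : RInt (fun t => psi (t + s t)) 0 de <= 2 * RInt psi 0 (2 * de)).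
{ apply time_change; auto.
  - intros t Ht. specialize (Hxpos t). destruct (eta_bounds (xw (phi (Rabs t) z)) ltac:(lra)). unfold s. lra.
  - intros t Ht. rewrite <- (Rabs_pos_eq t) by lra. set (w := phi (Rabs t) z).
    pose proof (phi_in (Rabs t) z (Rabs_pos _) Hzi) as Hw. fold w in Hw.
    pose proof (xw_bounds w Hw) as Hx. pose proof (dg_pos w Hw) as Hg. pose proof Cd_ge1.
    exists (c * xw w). split; [apply Rmult_lt_0_compat; lra|]. intros h Hh.
    unfold s. rewrite (Rabs_pos_eq (Rabs t)) by apply Rabs_pos.
    rewrite (Rabs_pos_eq (Rabs t + h)) by (pose proof (Rabs_pos t); lra). fold w.
    rewrite (Rplus_comm (Rabs t) h), phi_plus by (auto; try apply Rabs_pos; lra). fold w.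
    destruct (small_move w h c Hw ltac:(lra) Hc Hc1 h ltac:(lra)) as [S1 S2].
    set (k := (phi h w - w)%C) in *.
    assert (Ek : phi h w = (w + k)%C) by (unfold k; ring). rewrite Ek.
    assert (Hk9 : Cmod k <= (1 - Cmod w) / 9) by nra.
    pose proof (xw_lip w k Hw Hk9) as XL.
    assert (Hwk : Cmod (w + k)%C < 1) by (rewrite <- Ek; apply phi_in; lra).
    pose proof (xw_bounds _ Hwk).
    pose proof (eta_lip (xw w) (xw (w + k)%C) ltac:(lra) ltac:(lra)) as EL.
    assert (c * Rabs (xw (w + k)%C - xw w) <= h / 2); [|lra].
    apply Rle_trans with (c * (80 * Cd * Cmod (dg w) * (2 * Cd / Cmod (dg w) * h))).
    + apply Rmult_le_compat_l; [lra|]. eapply Rle_trans; [exact XL|]. apply Rmult_le_compat_l; auto.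
      apply Rmult_le_pos; lra.
    + replace (c * (80 * Cd * Cmod (dg w) * (2 * Cd / Cmod (dg w) * h))) with (320 * c * Cd ^ 2 * (h / 2)) by (field; lra). nra. }
assert (Hhc : forall t, continuous (fun t => hm q (rad r) f (phi (Rabs t) z)) t).
{ intros t. apply (cont2_section (fun s t => hm q (rad r) f (phi (Rabs t) (polar r s)))). apply hm_joint; auto. }
assert (HVc : forall t, continuous (fun t => Vq (phi (Rabs t) z)) t).
{ intros t. apply (cont2_section (fun s t => Vq (phi (Rabs t) (polar r s)))). apply phi_joint; auto. }
assert (Hps : forall t, continuous (fun t => psi (t + s t)) t).
{ intros t. apply (continuous_comp (fun t => t + s t) psi); auto. apply rcont_plus; auto. apply continuous_id. }
assert (Hhalf : RInt psi 0 de <= RInt psi 0 (2 * de)).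
{ rewrite <- (RInt_Rchasles psi 0 de (2 * de)) by (apply ex_RInt_cont; auto).
  assert (0 <= RInt psi de (2 * de)); [|lra]. apply RInt_ge_0; auto; [lra|apply ex_RInt_cont; auto]. }
assert (G1 : 0 <= D1c) by (unfold D1c; apply Rmult_le_pos; [apply rpow_ge0|apply Rmult_le_pos; apply rpow_ge0]).
apply Rle_trans with (RInt (fun t => rpow Bv q + D1c * (psi (t + s t) + psi t) + D2c * hm q (rad r) f (phi (Rabs t) z)) 0 de).
- apply RInt_le; [lra|apply ex_RInt_cont; auto| |].
  + apply ex_RInt_cont. intros t. apply rcont_plus; [apply rcont_plus; [apply continuous_const|]|];
    (apply rcont_mult; [apply continuous_const|]); auto. apply rcont_plus; auto.
  + intros t Ht. unfold psi, s. rewrite (Rabs_pos_eq t) by lra.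
    rewrite (Rabs_pos_eq (t + eta (xw (phi t z)))).
    * apply pointwise; auto; lra.
    * specialize (Hxpos t). rewrite (Rabs_pos_eq t) in Hxpos by lra. destruct (eta_bounds (xw (phi t z)) ltac:(lra)). lra.
- assert (E1x : ex_RInt (fun _ => rpow Bv q) 0 de) by (apply ex_RInt_cont; intros; apply continuous_const).
  assert (E2x : ex_RInt (fun t => psi (t + s t) + psi t) 0 de) by (apply ex_RInt_cont; intros; apply rcont_plus; auto).
  assert (E2y : ex_RInt (fun t => D1c * (psi (t + s t) + psi t)) 0 de)
    by (apply ex_RInt_cont; intros; apply rcont_mult; [apply continuous_const|apply rcont_plus; auto]).
  assert (E3x : ex_RInt (fun t => hm q (rad r) f (phi (Rabs t) z)) 0 de) by (apply ex_RInt_cont; auto).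
  assert (E3y : ex_RInt (fun t => D2c * hm q (rad r) f (phi (Rabs t) z)) 0 de)
    by (apply ex_RInt_cont; intros; apply rcont_mult; [apply continuous_const|auto]).
  rewrite (RInt_Rplus (fun t => rpow Bv q + D1c * (psi (t + s t) + psi t))); auto.
  2: { apply ex_RInt_cont; intros; apply rcont_plus; [apply continuous_const|]. apply rcont_mult; [apply continuous_const|apply rcont_plus; auto]. }
  rewrite (RInt_Rplus (fun _ => rpow Bv q)); auto.
  rewrite RInt_Rconst, !RInt_Rscal; auto.
  rewrite (RInt_Rplus (fun t => psi (t + s t))) by (apply ex_RInt_cont; auto).
  change (fun t => rpow (Cmod (F (Rabs t) z)) q) with psi.
  set (i1 := RInt (fun t => psi (t + s t)) 0 de) in *. set (i2 := RInt psi 0 de) in *. set (i3 := RInt psi 0 (2 * de)) in *.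
  assert (D1c * (i1 + i2) <= D1c * (3 * i3)) by (apply Rmult_le_compat_l; lra).
  rewrite Rminus_0_r. lra.
Qed.

(** Integration over the angle after exchanging integrals: strong continuity bounds the increments
    over a time interval of length 2 de, which gives 6 = 3 * 2, and subordination bounds the
    majorant at each t. *)
Lemma averaged_V r eF eS : 0 <= r < 1 ->
  (forall u, 0 < u < 2 * de -> pm q r (F u) <= eF) -> pm q (rad r) f <= eS ->
  RInt (fun t => mn (fun x => Vq (phi (Rabs t) (polar r x)))) 0 de
    <= de * (rpow Bv q + 6 * D1c * eF + D2c * (4 / cb) * eS).
Proof.
intros Hr HF HS.
assert (K1 : forall s t, continuity_2d_pt (fun s t => Vq (phi (Rabs t) (polar r s))) s t) by (apply phi_joint; auto).
assert (K2 : forall s t, continuity_2d_pt (fun s t => rpow (Cmod (F (Rabs t) (polar r s))) q) s t) by (intros; apply Fq_cont; auto).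
assert (K3 : forall s t, continuity_2d_pt (fun s t => hm q (rad r) f (phi (Rabs t) (polar r s))) s t) by (intros; apply hm_joint; auto).
assert (G1 : 0 <= D1c) by (unfold D1c; apply Rmult_le_pos; [apply rpow_ge0|apply Rmult_le_pos; apply rpow_ge0]).
assert (G2 : 0 <= D2c) by (unfold D2c; apply Rmult_le_pos; [apply rpow_ge0|apply Rmult_le_pos; [apply rpow_ge0|lra]]).
rewrite <- (mn_fubini (fun s t => Vq (phi (Rabs t) (polar r s))) 0 de) by (auto; lra).
pose proof (fun s => RInt_param_cont_l _ 0 (2 * de) s ltac:(lra) K2) as C2c.
pose proof (fun s => RInt_param_cont_l _ 0 de s ltac:(lra) K3) as C3c.
apply Rle_trans with (mn (fun x => de * rpow Bv q + 3 * D1c * RInt (fun t => rpow (Cmod (F (Rabs t) (polar r x))) q) 0 (2 * de)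
    + D2c * RInt (fun t => hm q (rad r) f (phi (Rabs t) (polar r x))) 0 de)).
- apply mn_le.
  + intros x. apply RInt_param_cont_l; auto; lra.
  + intros x. apply rcont_plus; [apply rcont_plus; [apply continuous_const|]|]; (apply rcont_mult; [apply continuous_const|]); auto.
  + intros x. apply inner; auto.
- rewrite (mn_plus (fun x => de * rpow Bv q + 3 * D1c * RInt (fun t => rpow (Cmod (F (Rabs t) (polar r x))) q) 0 (2 * de))).
  2: { intros x. apply rcont_plus; [apply continuous_const|]. apply rcont_mult; [apply continuous_const|auto]. }
  2: { intros x. apply rcont_mult; [apply continuous_const|auto]. }
  rewrite (mn_plus (fun _ => de * rpow Bv q)).
  2: { intros; apply continuous_const. }
  2: { intros x. apply rcont_mult; [apply continuous_const|auto]. }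
  rewrite mn_const, !mn_scal by auto.
  rewrite (mn_fubini (fun s t => rpow (Cmod (F (Rabs t) (polar r s))) q) 0 (2 * de)) by (auto; lra).
  rewrite (mn_fubini (fun s t => hm q (rad r) f (phi (Rabs t) (polar r s))) 0 de) by (auto; lra).
  assert (I1 : RInt (fun t => mn (fun s => rpow (Cmod (F (Rabs t) (polar r s))) q)) 0 (2 * de) <= (2 * de - 0) * eF).
  { apply RInt_ub; [lra| |].
    - apply ex_RInt_cont. intros t. apply (mn_param_cont (fun s t => rpow (Cmod (F (Rabs t) (polar r s))) q)); auto.
    - intros t Ht. rewrite (Rabs_pos_eq t) by lra. apply (HF t); lra. }
  assert (I2 : RInt (fun t => mn (fun s => hm q (rad r) f (phi (Rabs t) (polar r s)))) 0 de <= (de - 0) * (4 / cb * eS)).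
  { apply RInt_ub; [lra| |].
    - apply ex_RInt_cont. intros t. apply (mn_param_cont (fun s t => hm q (rad r) f (phi (Rabs t) (polar r s)))); auto.
    - intros t Ht. destruct (phi_littlewood q f (Rabs t) r Hq Hf (Rabs_pos t) Hr) as [_ [_ L]].
      eapply Rle_trans; [exact L|]. apply Rmult_le_compat_l; auto. left; apply Rdiv_lt_0_compat; auto; lra. }
  apply (Rmult_le_compat_l (3 * D1c)) in I1; [|lra]. apply (Rmult_le_compat_l D2c) in I2; auto. lra.
Qed.

(** Schwarz-Pick for phi_t absorbs the derivative of phi_t, so the bound depends on t through the
    point phi_t z only. *)
Lemma der_comp_bound t z : 0 <= t -> Cmod z < 1 ->
  Cmod (C_derive (fun z => f (phi t z)) z) * (1 - Cmod z) <= V f (phi t z).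
Proof.
intros Ht Hz.
assert (E : C_derive (fun z => f (phi t z)) z = (C_derive f (phi t z) * C_derive (phi t) z)%C).
{ apply is_C_derive_unique. apply (cdiff_comp f (phi t)); apply holoD_cdiff; auto. }
rewrite E, Cmod_mult. pose proof (schwarz_pick_der (phi t) z (phi_hol t Ht) (fun w => phi_in t w Ht) Hz) as SP.
pose proof (Cmod_ge_0 (C_derive f (phi t z))). pose proof (Cmod_ge_0 (C_derive (phi t) z)). pose proof (Cmod_ge_0 z).
unfold V. set (x := Cmod (C_derive (phi t) z)) in *. set (y := Cmod (C_derive f (phi t z))) in *.
assert (x * (1 - Cmod z) <= 1 - Cmod (phi t z) ^ 2).
{ eapply Rle_trans; [|exact SP]. apply Rmult_le_compat_l; auto. nra. }
rewrite Rmult_assoc, Rmult_comm. apply Rmult_le_compat_r; auto.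
Qed.

Lemma averaged_step lam K k : 0 < lam -> 0 < K ->
  (forall g d, holoD g -> 0 < d <= 1 ->
     pm q (1 - th * d) g <= (1 + lam) * pm q (1 - d) g + K * (rpow d q * pm q (1 - d / 2) (C_derive g))) ->
  RInt (fun t => pm q (rk (S k)) (fun z => f (phi (Rabs t) z))) 0 de <=
    (1 + lam) * RInt (fun t => pm q (rk k) (fun z => f (phi (Rabs t) z))) 0 de
    + K * rpow 2 q * RInt (fun t => mn (fun x => Vq (phi (Rabs t) (polar (1 - th ^ k / 2) x)))) 0 de.
Proof.
intros Hl HK Hstep. pose proof (th_pow k) as Hd. set (d := th ^ k) in *.
assert (Hthp : 0 < th < 1) by (unfold th; lra).
assert (Hr : 0 <= 1 - d / 2 < 1) by lra.
assert (fcont : forall w, Cmod w < 1 -> continuous (T := C_UniformSpace) (fun w => rpow (Cmod (f w)) q) w).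
{ intros w Hw. apply rcont_rpow; auto. apply rcont_Cmod. eapply cdiff_ccont. apply (holoD_cdiff f); auto. }
assert (Cp : forall r, 0 <= r < 1 -> forall t, continuous (fun t => pm q r (fun z => f (phi (Rabs t) z))) t).
{ intros r Hr' t. unfold pm. apply (mn_param_cont (fun s t => rpow (Cmod (f (phi (Rabs t) (polar r s)))) q)).
  apply (phi_joint (fun w => rpow (Cmod (f w)) q)); auto. }
assert (K1 : forall s t, continuity_2d_pt (fun s t => Vq (phi (Rabs t) (polar (1 - d / 2) s))) s t) by (apply phi_joint; auto).
assert (Cv : forall t, continuous (fun t => mn (fun x => Vq (phi (Rabs t) (polar (1 - d / 2) x)))) t).
{ intros t. apply (mn_param_cont (fun s t => Vq (phi (Rabs t) (polar (1 - d / 2) s)))); auto. }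
rewrite <- !RInt_Rscal by (apply ex_RInt_cont; auto; apply Cp; apply rk_bounds).
rewrite <- RInt_Rplus.
2: { apply ex_RInt_cont. intros t. apply rcont_mult; [apply continuous_const|]. apply Cp, rk_bounds. }
2: { apply ex_RInt_cont. intros t. apply rcont_mult; [apply continuous_const|auto]. }
apply RInt_le; [lra| | |].
- apply ex_RInt_cont. apply Cp, rk_bounds.
- apply ex_RInt_cont. intros t. apply rcont_plus; (apply rcont_mult; [apply continuous_const|]); auto. apply Cp, rk_bounds.
- intros t _. pose proof (Rabs_pos t) as Ht. set (g := fun z => f (phi (Rabs t) z)).
  assert (Hg : holoD g) by (apply holoD_phi; auto).
  assert (Hg' : holoD (C_derive g)) by (apply holoD_derive; auto).
  change (rk (S k)) with (1 - th * d). change (rk k) with (1 - d).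
  eapply Rle_trans; [apply (Hstep g d Hg ltac:(lra))|].
  apply Rplus_le_compat_l. rewrite Rmult_assoc. apply Rmult_le_compat_l; [lra|].
  unfold pm. rewrite <- !mn_scal.
  2: { intros x. apply (cont2_section_l (fun s t => Vq (phi (Rabs t) (polar (1 - d / 2) s)))); auto. }
  2: { apply cont_circle_pow; auto. }
  apply mn_le.
  + intros x. apply rcont_mult; [apply continuous_const|]. apply cont_circle_pow; auto.
  + intros x. apply rcont_mult; [apply continuous_const|]. apply (cont2_section_l (fun s t => Vq (phi (Rabs t) (polar (1 - d / 2) s)))); auto.
  (* On |z| = 1 - d/2 [der_comp_bound] reads |g'| d/2 <= V, so d |g'| <= 2 V; hence the factor
     [rpow 2 q]. *)
  + intros x. assert (Hz : Cmod (polar (1 - d / 2) x) < 1) by (rewrite Cmod_polar; lra).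
    pose proof (der_comp_bound (Rabs t) (polar (1 - d / 2) x) Ht Hz) as DB. fold g in DB.
    rewrite Cmod_polar in DB by lra. unfold Vq. pose proof (V_ge0 _ (phi_in (Rabs t) _ Ht Hz)).
    rewrite <- !rpow_mult; try lra; try apply Cmod_ge_0. apply rpow_le; auto. lra.
Qed.

End FiniteP.

(** The averaged derivative has three contributions, each made at most X/3: the Poisson majorant by
    the choice of c, the increments by [eF], and the inner disc by the decay of the weight. The
    contraction then bounds the time averages. *)
Lemma strong_cont_H0_fin q al f : 0 < q -> 0 < al -> strong_cont (Finite q) al phi f -> H0 (Finite q) al f.
Proof.
intros Hq Hal [Hi Hsc]. apply H0_of_rk; auto. destruct Hi as [Hf HS].
apply Hnorm_fin in HS. destruct HS as [S0 HS0].
set (S := Rmax S0 1). assert (HS1 : 1 <= S) by apply Rmax_r.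
assert (HS : forall r, 0 <= r < 1 -> rpow (1 - r) (al * q) * pm q r f <= rpow S q).
{ intros r Hr. apply Mp_pm; auto; [lra|]. eapply Rle_trans; [apply HS0; auto|apply Rmax_l]. }
set (a := al * q). fold a in HS. assert (Ha : 0 < a) by (apply Rmult_lt_0_compat; auto).
pose proof cb_pos. pose proof cb_le. pose proof Cd_ge1. pose proof b_in.
assert (Hk0 : 0 < k0) by (unfold k0; lra).
assert (HC1 : 0 < C1) by (unfold C1; apply Rdiv_lt_0_compat; lra).
assert (HC0 : 0 < C0).
{ unfold C0, Kg. assert (0 < Cd ^ 2) by (apply pow_lt; lra). assert (0 <= Cd * (Cd + 60 * Cd * Cd)) by nra. lra. }
set (tau1 := rpow th a).
assert (Htau : 0 < tau1 < 1).
{ split; [apply rpow_gt0; unfold th; lra|]. unfold tau1. rewrite <- (rpow_one a). apply rpow_lt; auto; unfold th; lra. }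
(* Small enough that the ratio tau1 (1 + lam) stays below 1. *)
set (lam := (1 - tau1) / 2). assert (Hlam : 0 < lam) by (unfold lam; lra).
destruct (radial_step q lam Hq Hlam) as [K [HK Hstep]].
set (qq := tau1 * (1 + lam)). assert (Hqq : 0 <= qq < 1) by (unfold qq, lam; nra).
assert (H2q : 0 < rpow 2 q) by (apply rpow_gt0; lra).
assert (H2a : 0 < rpow 2 a) by (apply rpow_gt0; lra).
intros E HE. assert (HEq : 0 < rpow E q) by (apply rpow_gt0; auto).
(* X is the admissible size of the averaged derivative term *)
set (X := rpow E q * (1 - qq) / (4 * rpow 2 q * (K * rpow 2 q * rpow 2 a))).
assert (HKK : 0 < K * rpow 2 q * rpow 2 a) by (apply Rmult_lt_0_compat; [apply Rmult_lt_0_compat|]; auto).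
assert (HX : 0 < X).
{ unfold X. apply Rdiv_lt_0_compat; apply Rmult_lt_0_compat; auto; try lra. }
assert (Hka : 0 < rpow k0 a) by (apply rpow_gt0; auto).
(* [D2c] is c^q times constants; [Y] is what multiplies c^q in the majorant term once the weight is
   distributed. *)
set (Y := 5 * rpow 2 q * rpow (C1 * C0) q * (4 / cb) * (rpow S q / rpow k0 a)).
assert (HSq : 0 < rpow S q) by (apply rpow_gt0; lra).
assert (HC10 : 0 < C1 * C0) by (apply Rmult_lt_0_compat; auto).
assert (H4cb : 0 < 4 / cb) by (apply Rdiv_lt_0_compat; lra).
assert (HY : 0 < Y).
{ unfold Y. apply Rmult_lt_0_compat; [apply Rmult_lt_0_compat; [apply Rmult_lt_0_compat|]|]; auto; try lra.
  - apply rpow_gt0; auto.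
  - apply Rdiv_lt_0_compat; auto. }
destruct (c_small (rpow (X / (3 * Y)) (/ q))) as [c [Hc [Hc1 [Hc2 Hc3]]]].
{ apply rpow_gt0. apply Rdiv_lt_0_compat; lra. }
assert (HcY : rpow c q * Y <= X / 3).
{ apply Rle_trans with (X / (3 * Y) * Y); [|apply Req_le; field; lra]. apply Rmult_le_compat_r; [lra|].
  rewrite <- (rpow_inv_r (X / (3 * Y)) q) by (auto; left; apply Rdiv_lt_0_compat; lra). apply rpow_le; auto. }
assert (HD1 : 0 < D1c q c).
{ unfold D1c. apply Rmult_lt_0_compat; [auto|apply Rmult_lt_0_compat; auto]. apply rpow_gt0. apply Rdiv_lt_0_compat; auto. }
(* Two requirements: the first bound makes the increments contribute at most X/3, the second pays
   for the return from f o phi_t to f at the end. *)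
set (eF := Rmin (X / (18 * D1c q c)) (rpow E q / (2 * rpow 2 q))).
assert (HeF : 0 < eF) by (apply Rmin_pos; apply Rdiv_lt_0_compat; lra).
assert (HeF1 : 6 * D1c q c * eF <= X / 3).
{ apply Rle_trans with (6 * D1c q c * (X / (18 * D1c q c))); [|apply Req_le; field; lra].
  apply Rmult_le_compat_l; [lra|apply Rmin_l]. }
assert (HeF2 : rpow 2 q * eF <= rpow E q / 2).
{ apply Rle_trans with (rpow 2 q * (rpow E q / (2 * rpow 2 q))); [|apply Req_le; field; lra].
  apply Rmult_le_compat_l; [lra|apply Rmin_r]. }
destruct (Hsc (rpow eF (/ q))) as [de0 [Hde0 Hsc2]]; [apply rpow_gt0; auto|].
set (de := de0 / 2). assert (Hde : 0 < de) by (unfold de; lra).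
assert (HF : forall u r, 0 < u < 2 * de -> 0 <= r < 1 -> rpow (1 - r) a * pm q r (fun z => f (phi u z) - f z)%C <= eF).
{ intros u r Hu Hr. specialize (Hsc2 u ltac:(unfold de in *; lra)).
  pose proof (proj1 (Hnorm_le _ _ _ _) Hsc2 r Hr) as N.
  apply Mp_pm in N; auto; [|apply holoD_minus; auto; apply holoD_phi; auto; lra|apply rpow_ge0].
  rewrite rpow_inv_r in N by lra. exact N. }
destruct (Bloch0 (de / c)) as [r0 [Hr0 HB]]; [apply Rdiv_lt_0_compat; auto|].
set (rho1 := Rmax r0 ((1 + Cmod b) / 2)).
assert (Hrho1 : rho1 < 1) by (apply Rmax_lub_lt; lra).
assert (Hrho2 : (1 + Cmod b) / 2 <= rho1) by apply Rmax_r.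
assert (Hrx : forall w, rho1 < Cmod w < 1 -> c * xw w <= de).
{ intros w Hw. assert (r0 <= rho1) by apply Rmax_l. specialize (HB w ltac:(lra)).
  apply (Rmult_lt_compat_l c) in HB; auto. replace (c * (de / c)) with de in HB by (field; lra). lra. }
pose proof (Cmod_ge_0 b) as Hb0.
destruct (disc_bound (C_derive f) rho1 (holoD_derive f Hf) ltac:(lra)) as [Bv [HBv0 HBv]].
assert (HBV : forall w, Cmod w <= rho1 -> Cmod w < 1 -> V f w <= Bv).
{ intros w Hw Hw1. unfold V. specialize (HBv w Hw). pose proof (Cmod_ge_0 w). pose proof (Cmod_ge_0 (C_derive f w)).
  assert (0 <= 1 - Cmod w ^ 2 <= 1) by nra. nra. }
(* The inner-disc term is bounded, and the weight tends to 0. *)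
assert (HW : exists k2, forall k, (k2 <= k)%nat -> rpow (th ^ k / 2) a * rpow Bv q <= X / 3).
{ set (y := rpow (X / (3 * (rpow Bv q + 1))) (/ a)). pose proof (rpow_ge0 Bv q).
  assert (Hy0 : 0 < X / (3 * (rpow Bv q + 1))) by (apply Rdiv_lt_0_compat; lra).
  assert (Hy : 0 < y) by (apply rpow_gt0; auto).
  destruct (rk_lim (1 - y) ltac:(lra)) as [k2 Hk2]. exists k2. intros k Hk.
  pose proof (rk_incr k2 k Hk). pose proof (th_pow k). unfold rk in *.
  assert (B1 : rpow (th ^ k / 2) a <= X / (3 * (rpow Bv q + 1))).
  { rewrite <- (rpow_inv_r (X / (3 * (rpow Bv q + 1))) a) by lra. apply rpow_le; auto. fold y. lra. }
  apply Rle_trans with (X / (3 * (rpow Bv q + 1)) * (rpow Bv q + 1)); [|apply Req_le; field; lra].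
  apply Rmult_le_compat; try lra. apply rpow_ge0. }
destruct HW as [k2 HW].
assert (HV : forall k, (k2 <= k)%nat ->
   rpow (th ^ k / 2) a * RInt (fun t => mn (fun x => rpow (V f (phi (Rabs t) (polar (1 - th ^ k / 2) x))) q)) 0 de <= de * X).
{ intros k Hk. pose proof (th_pow k). set (r := 1 - th ^ k / 2). assert (Hr : 0 <= r < 1) by (unfold r; lra).
  assert (Er : th ^ k / 2 = 1 - r) by (unfold r; ring). specialize (HW k Hk). rewrite Er in *.
  set (w := rpow (1 - r) a) in *. assert (Hw : 0 < w) by (apply rpow_gt0; lra).
  destruct (rad_bounds r Hr) as [R1 [R2 [R3 R4]]].
  pose proof (averaged_V q f Hq Hf c de rho1 Bv Hc Hc1 Hc2 Hde Hrho2 Hrx HBV r (eF / w) (rpow S q / (rpow k0 a * w)) Hr) as AV.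
  assert (AV2 : RInt (fun t => mn (fun x => rpow (V f (phi (Rabs t) (polar r x))) q)) 0 de <=
     de * (rpow Bv q + 6 * D1c q c * (eF / w) + D2c q c * (4 / cb) * (rpow S q / (rpow k0 a * w)))).
  { apply AV.
    - intros u Hu. apply Rmult_le_reg_l with w; auto. replace (w * (eF / w)) with eF by (field; lra). apply HF; auto.
    - assert (Hkw : 0 < rpow k0 a * w) by (apply Rmult_lt_0_compat; auto).
      apply Rmult_le_reg_l with (rpow k0 a * w); auto.
      replace (rpow k0 a * w * (rpow S q / (rpow k0 a * w))) with (rpow S q) by (field; lra).
      unfold w. rewrite <- rpow_mult by lra. rewrite <- R3. apply HS. lra. }
  apply (Rmult_le_compat_l w) in AV2; [|lra]. eapply Rle_trans; [exact AV2|].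
  replace (w * (de * (rpow Bv q + 6 * D1c q c * (eF / w) + D2c q c * (4 / cb) * (rpow S q / (rpow k0 a * w)))))
    with (de * (w * rpow Bv q + 6 * D1c q c * eF + D2c q c * (4 / cb) * (rpow S q / rpow k0 a))) by (field; lra).
  apply Rmult_le_compat_l; [lra|].
  assert (ED2 : D2c q c * (4 / cb) * (rpow S q / rpow k0 a) = rpow c q * Y).
  { unfold D2c, Y. rewrite (rpow_mult (C1 * C0) c) by lra. field. lra. }
  rewrite ED2. lra. }
set (A := fun k => RInt (fun t => pm q (rk k) (fun z => f (phi (Rabs t) z))) 0 de).
destruct (seq_contract (fun k => rpow (th ^ k) a * A k) qq (K * rpow 2 q * rpow 2 a * (de * X)) k2) as [k1 [Hk12 Hk1]]; auto.
{ apply Rmult_lt_0_compat; auto. apply Rmult_lt_0_compat; auto. }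
{ intros k Hk. pose proof (th_pow k) as Ht.
  pose proof (averaged_step q f Hq Hf de Hde lam K k Hlam HK Hstep) as AS.
  fold (A (Datatypes.S k)) (A k) in AS. specialize (HV k Hk).
  set (J := RInt (fun t => mn (fun x => rpow (V f (phi (Rabs t) (polar (1 - th ^ k / 2) x))) q)) 0 de) in *.
  change (A (Datatypes.S k) <= (1 + lam) * A k + K * rpow 2 q * J) in AS.
  simpl pow. rewrite rpow_mult by (unfold th in *; lra). fold tau1.
  unfold Rdiv in HV. rewrite rpow_mult, rpow_inv in HV by lra.
  set (w := rpow (th ^ k) a) in *. assert (Hw : 0 < w) by (apply rpow_gt0; lra).
  assert (HwJ : w * J <= rpow 2 a * (de * X)).
  { apply Rmult_le_reg_l with (/ rpow 2 a); [apply Rinv_0_lt_compat; auto|].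
    replace (/ rpow 2 a * (rpow 2 a * (de * X))) with (de * X) by (field; lra). lra. }
  apply Rle_trans with (tau1 * w * ((1 + lam) * A k + K * rpow 2 q * J)).
  - apply Rmult_le_compat_l; auto. apply Rmult_le_pos; lra.
  - replace (tau1 * w * ((1 + lam) * A k + K * rpow 2 q * J)) with (qq * (w * A k) + tau1 * (K * rpow 2 q * (w * J))) by (unfold qq; ring).
    apply Rplus_le_compat_l.
    assert (HKq : 0 < K * rpow 2 q) by (apply Rmult_lt_0_compat; auto).
    apply (Rmult_le_compat_l (K * rpow 2 q)) in HwJ; [|lra].
    assert (0 <= K * rpow 2 q * (rpow 2 a * (de * X))).
    { apply Rmult_le_pos; [lra|]. apply Rmult_le_pos; [lra|]. apply Rmult_le_pos; lra. }
    nra. }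
exists k1. intros k Hk. specialize (Hk1 k Hk). pose proof (rk_bounds k) as Hrk. pose proof (th_pow k).
assert (E1 : th ^ k = 1 - rk k) by (unfold rk; ring). rewrite E1 in *.
apply (Mp_pm q al (rk k) f E); auto; [lra|]. fold a.
set (w := rpow (1 - rk k) a) in *. assert (Hw : 0 < w) by (apply rpow_gt0; lra).
set (P := pm q (rk k) f).
assert (fcont : forall w, Cmod w < 1 -> continuous (T := C_UniformSpace) (fun w => rpow (Cmod (f w)) q) w).
{ intros v Hv. apply rcont_rpow; auto. apply rcont_Cmod. eapply cdiff_ccont. apply (holoD_cdiff f); auto. }
assert (Cp : forall t, continuous (fun t => pm q (rk k) (fun z => f (phi (Rabs t) z))) t).
{ intros t. unfold pm. apply (mn_param_cont (fun s t => rpow (Cmod (f (phi (Rabs t) (polar (rk k) s)))) q)).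
  apply (phi_joint (fun w => rpow (Cmod (f w)) q)); auto. }
(* The mean of |f|^q is at most 2^q times the sum of those of f o phi_t and of the increment, for
   each t in (0, de); averaging bounds it by [A k]. *)
assert (Hint : (de - 0) * (P / rpow 2 q - eF / w) <= A k).
{ apply RInt_lb; [lra|apply ex_RInt_cont; auto|]. intros t Ht. rewrite (Rabs_pos_eq t) by lra.
  set (g := fun z => f (phi t z)). assert (Hg : holoD g) by (apply holoD_phi; auto; lra).
  assert (HFd : holoD (fun z => g z - f z)%C) by (apply holoD_minus; auto).
  pose proof (HF t (rk k) ltac:(lra) Hrk) as HFt. fold w in HFt.
  assert (HFt2 : pm q (rk k) (fun z => g z - f z)%C <= eF / w).
  { apply Rmult_le_reg_l with w; auto. replace (w * (eF / w)) with eF by (field; lra). exact HFt. }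
  assert (HP : P <= rpow 2 q * (pm q (rk k) g + pm q (rk k) (fun z => g z - f z)%C)).
  { assert (Z1 : forall x, continuous (fun x => rpow (Cmod (f (polar (rk k) x))) q) x) by (intros x; apply cont_circle_pow; auto).
    assert (Z2 : forall x, continuous (fun x => rpow (Cmod (g (polar (rk k) x))) q) x) by (intros x; apply cont_circle_pow; auto).
    assert (Z3 : forall x, continuous (fun x => rpow (Cmod (g (polar (rk k) x) - f (polar (rk k) x))%C) q) x)
      by (intros x; apply (cont_circle_pow (fun z => g z - f z)%C); auto).
    assert (Z4 : forall x, continuous (fun x => rpow (Cmod (g (polar (rk k) x))) q + rpow (Cmod (g (polar (rk k) x) - f (polar (rk k) x))%C) q) x)
      by (intros x; apply rcont_plus; auto).
    unfold P, pm. rewrite <- mn_plus, <- mn_scal by auto. apply mn_le; auto.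
    - intros x. apply rcont_mult; [apply continuous_const|auto].
    - intros x. eapply Rle_trans; [|apply rpow_add; auto using Cmod_ge_0]. apply rpow_le; auto.
      set (u := g (polar (rk k) x)). set (v := f (polar (rk k) x)).
      pose proof (Cmod_minus_le u (u - v)%C) as Z5. replace (u - (u - v))%C with v in Z5 by ring. exact Z5. }
  apply Rmult_le_reg_l with (rpow 2 q); auto.
  replace (rpow 2 q * (P / rpow 2 q - eF / w)) with (P - rpow 2 q * (eF / w)) by (field; lra).
  apply (Rmult_le_compat_l (rpow 2 q)) in HFt2; [|lra]. lra. }
rewrite Rminus_0_r in Hint. apply (Rmult_le_compat_l w) in Hint; [|lra].
set (Z := 2 * (K * rpow 2 q * rpow 2 a * (de * X)) / (1 - qq)) in *.
assert (EZ : Z = de * (rpow E q / (2 * rpow 2 q))) by (unfold Z, X; field; repeat split; lra).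
assert (Hfin : w * (de * (P / rpow 2 q - eF / w)) <= de * (rpow E q / (2 * rpow 2 q))) by lra.
replace (w * (de * (P / rpow 2 q - eF / w))) with (de * (w * P / rpow 2 q - eF)) in Hfin by (field; lra).
apply Rmult_le_reg_l in Hfin; auto.
apply Rmult_le_reg_l with (/ rpow 2 q); [apply Rinv_0_lt_compat; auto|].
replace (/ rpow 2 q * rpow E q) with (rpow E q / (2 * rpow 2 q) + rpow E q / 2 / rpow 2 q) by (field; lra).
assert (eF <= rpow E q / 2 / rpow 2 q).
{ apply Rmult_le_reg_l with (rpow 2 q); auto. replace (rpow 2 q * (rpow E q / 2 / rpow 2 q)) with (rpow E q / 2) by (field; lra). auto. }
unfold Rdiv at 1 in Hfin. lra.
Qed.

End LittleBloch.

(** * Gliding humps *)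

(** The additive error is c / w, so that after multiplication by the weight w it becomes the
    constant c. *)
Lemma Lp_two p w A c u v : Rbar_lt 0 p -> 0 < w -> 0 <= A -> 0 <= c -> circ u -> circ v ->
  (forall t, u t <= A * v t + c / w) -> w * Lp p u <= Kp p * (A * (w * Lp p v) + c).
Proof.
intros Hp Hw HA Hc Hu Hv H. assert (Hcw : 0 <= c / w) by (apply Rdiv_le_0_compat; auto).
pose proof (Lp_plus_le p (fun t => A * v t) (fun _ => c / w) u Hp (circ_scal A v HA Hv) (circ_const _ Hcw) Hu H) as L.
rewrite Lp_scal, Lp_const in L by auto. apply (Rmult_le_compat_l w) in L; [|lra].
eapply Rle_trans; [exact L|]. apply Req_le. field. lra.
Qed.

(* [f n] is concentrated on the annulus rho n <= |z| < rho (S n), so that on this annulus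
   the sum of the x_n f_n is x_n f_n up to a small pointwise error. *)
Section Hump.

Variables (p : Rbar) (al : R) (f : nat -> C -> C) (rho ra : nat -> R) (Cu cl e0 : R).
Hypothesis Hp : Rbar_lt 0 p.
Hypothesis Hal : 0 < al.
Hypothesis f_hol : forall n, holoD (f n).
Hypothesis rho_0 : rho 0%nat = 0.
Hypothesis rho_lt : forall n, rho n < 1.
Hypothesis rho_incr : forall n, rho n <= rho (S n).
Hypothesis rho_lim : forall n, 1 - rho n <= (/ 2) ^ n.
Hypothesis cl_pos : 0 < cl.
Hypothesis Cu_pos : 0 < Cu.
Hypothesis e0_pos : 0 < e0.
Hypothesis e0_small : 8 * Kp p * e0 <= cl.
Hypothesis f_early : forall n m z, (n < m)%nat -> Cmod z < 1 ->
  rpow (1 - rho m) al * Cmod (f n z) <= e0 * ((/ 2) ^ m * (/ 2) ^ n).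
(** The disc is larger than |z| <= rho n, since the estimate must also cover phi_t z for such z. *)
Hypothesis f_late : forall n z, Cmod z <= 1 - cb * (1 - rho n) -> Cmod (f n z) <= e0 * ((/ 2) ^ n * (/ 2) ^ n).
Hypothesis f_up : forall n r, 0 <= r < 1 -> rpow (1 - r) al * Mp p r (f n) <= Cu.
Hypothesis f_low : forall n, rho n <= ra n < rho (S n) /\ cl <= rpow (1 - ra n) al * Mp p (ra n) (f n).
Hypothesis f_sc : forall e, 0 < e -> exists t0, 0 < t0 /\ forall n t r, 0 < t < t0 -> 0 <= r < 1 ->
  rpow (1 - r) al * Mp p r (fun z => f n (phi t z) - f n z)%C <= e.

Lemma rho_mono m n : (m <= n)%nat -> rho m <= rho n.
Proof. intros H. induction H; [lra|]. eapply Rle_trans; [exact IHle|apply rho_incr]. Qed.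

Lemma rho_ge0 n : 0 <= rho n.
Proof. rewrite <- rho_0. apply rho_mono; lia. Qed.

Lemma block r : 0 <= r < 1 -> exists m, rho m <= r < rho (S m).
Proof.
intros Hr. destruct (half_pow_lim (1 - r) ltac:(lra)) as [n Hn]. pose proof (rho_lim n).
assert (H1 : r < rho n) by lra. clear Hn H. induction n.
- rewrite rho_0 in H1. lra.
- destruct (Rlt_le_dec r (rho n)); auto. exists n; lra.
Qed.

(** Humps before m are killed by the weight ([f_early]), humps after m are already small pointwise
    ([f_late]). The weight is taken at r while z may go out to 1 - cb (1 - r), so that phi_t z is
    included. *)
Lemma f_rest m r n z : rho m <= r < rho (S m) -> Cmod z < 1 -> Cmod z <= 1 - cb * (1 - r) -> n <> m ->
  rpow (1 - r) al * Cmod (f n z) <= e0 * (/ 2) ^ m * (/ 2) ^ n.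
Proof.
intros Hr Hz Hz2 Hn. pose proof (Cmod_ge_0 (f n z)). pose proof cb_pos. pose proof (rho_lt (S m)).
pose proof (half_pow_bounds m). pose proof (half_pow_bounds n). pose proof (rho_ge0 m).
destruct (Nat.lt_total n m) as [L|[L|L]]; [|contradiction|].
- eapply Rle_trans; [|eapply Rle_trans; [apply (f_early n m z L Hz)|apply Req_le; ring]].
  apply Rmult_le_compat_r; auto. apply rpow_le; lra.
- assert (Hrn : r <= rho n) by (pose proof (rho_mono (S m) n L); lra).
  assert (F : Cmod (f n z) <= e0 * ((/ 2) ^ n * (/ 2) ^ n)).
  { apply f_late. assert (cb * (1 - rho n) <= cb * (1 - r)) by (apply Rmult_le_compat_l; lra). lra. }
  assert (rpow (1 - r) al <= 1) by (apply rpow_le_1; auto; lra). pose proof (rpow_ge0 (1 - r) al).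
  apply Rle_trans with (e0 * ((/ 2) ^ n * (/ 2) ^ n)); [nra|].
  rewrite Rmult_assoc. apply Rmult_le_compat_l; [lra|]. apply Rmult_le_compat_r; [lra|]. apply half_pow_decr. lia.
Qed.

Lemma f_sum s : 0 <= s < 1 -> exists a : nat -> R, ex_series a /\ forall n z, Cmod z <= s -> Cmod (f n z) <= a n.
Proof.
intros Hs. destruct (block s Hs) as [m Hm]. destruct (disc_bound (f m) s (f_hol m) Hs) as [B [HB0 HB]].
set (w := rpow (1 - s) al). assert (Hw : 0 < w) by (apply rpow_gt0; lra).
exists (fun n => (if Nat.eqb n m then B else 0) + e0 / w * (/ 2) ^ n). split.
- apply (ex_series_plus (K := R_AbsRing) (V := R_NormedModule)).
  + exists B. apply is_series_single.
  + apply (ex_series_scal (K := R_AbsRing) (V := R_NormedModule)). exists 2. apply geom_half.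
- intros n z Hz. pose proof (half_pow_bounds n). assert (0 < e0 / w) by (apply Rdiv_lt_0_compat; auto).
  assert (0 < e0 / w * (/ 2) ^ n) by (apply Rmult_lt_0_compat; lra).
  destruct (Nat.eqb_spec n m) as [->|D]; [specialize (HB z Hz); lra|].
  pose proof cb_pos. pose proof cb_le.
  pose proof (f_rest m s n z Hm ltac:(lra) ltac:(nra) D) as F. fold w in F. pose proof (half_pow_bounds m).
  apply Rmult_le_reg_l with w; auto. eapply Rle_trans; [exact F|].
  replace (w * (0 + e0 / w * (/ 2) ^ n)) with (e0 * 1 * (/ 2) ^ n) by (field; lra).
  apply Rmult_le_compat_r; [lra|]. apply Rmult_le_compat_l; lra.
Qed.

Definition hump_sum (x : nat -> C) (z : C) : C := csum (fun n => x n * f n z)%C.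

Lemma hump_majorant x X s : (forall n, Cmod (x n) <= X) -> 0 <= s < 1 -> exists a : nat -> R, ex_series a /\
  forall n z, Cmod z <= s -> Cmod (x n * f n z)%C <= a n.
Proof.
intros HX Hs. destruct (f_sum s Hs) as [a [Ha Hb]]. exists (fun n => X * a n). split.
- apply (ex_series_scal (K := R_AbsRing) (V := R_NormedModule) X a Ha).
- intros n z Hz. rewrite Cmod_mult. apply Rmult_le_compat; auto using Cmod_ge_0.
Qed.

Lemma hump_absum x X z : (forall n, Cmod (x n) <= X) -> Cmod z < 1 -> absum (fun n => x n * f n z)%C.
Proof.
intros HX Hz. destruct (hump_majorant x X (Cmod z) HX) as [a [Ha Hb]]; [split; auto using Cmod_ge_0|].
apply (absum_le _ a); auto. intros n. apply Hb; lra.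
Qed.

Lemma hump_hol x X : (forall n, Cmod (x n) <= X) -> holoD (hump_sum x).
Proof.
intros HX. apply (holoD_csum (fun n z => x n * f n z)%C).
- intros n z Hz. eexists. apply cdiff_scal. apply holoD_cdiff; auto.
- intros s Hs. apply (hump_majorant x X s HX Hs).
Qed.

Lemma hump_lin x y X Y a c z : (forall n, Cmod (x n) <= X) -> (forall n, Cmod (y n) <= Y) -> Cmod z < 1 ->
  hump_sum (fun n => a * x n + c * y n)%C z = (a * hump_sum x z + c * hump_sum y z)%C.
Proof.
intros HX HY Hz. unfold hump_sum. rewrite <- csum_lin; [|eapply hump_absum; eauto|eapply hump_absum; eauto].
apply csum_ext. intros n. ring.
Qed.

(** In the 4, one factor 2 is the geometric sum and one comes from [csum_bound]. *)
Lemma hump_split x X m r z : (forall n, Cmod (x n) <= X) -> rho m <= r < rho (S m) -> Cmod z < 1 -> Cmod z <= 1 - cb * (1 - r) ->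
  exists y, hump_sum x z = (x m * f m z + y)%C /\ Cmod y <= 4 * e0 * X * (/ 2) ^ m / rpow (1 - r) al.
Proof.
intros HX Hr Hz Hz2. pose proof (rho_lt (S m)). set (w := rpow (1 - r) al). assert (Hw : 0 < w) by (apply rpow_gt0; lra).
assert (HX0 : 0 <= X) by (eapply Rle_trans; [apply Cmod_ge_0|apply (HX 0%nat)]).
exists (csum (fun n => if Nat.eqb n m then RtoC 0 else x n * f n z)%C).
split; [apply (csum_split (fun n => x n * f n z)%C m); eapply hump_absum; eauto|].
set (c := X * (e0 * (/ 2) ^ m) / w). pose proof (half_pow_bounds m).
assert (Hc : 0 <= c).
{ apply Rdiv_le_0_compat; auto. apply Rmult_le_pos; auto. apply Rmult_le_pos; lra. }
eapply Rle_trans; [apply (csum_bound _ (fun n => c * (/ 2) ^ n))|].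
- intros n. pose proof (half_pow_bounds n). destruct (Nat.eqb_spec n m) as [->|D].
  + rewrite Cmod_0. apply Rmult_le_pos; lra.
  + pose proof (f_rest m r n z Hr Hz Hz2 D) as F. fold w in F. rewrite Cmod_mult.
    apply Rmult_le_reg_l with w; auto.
    replace (w * (c * (/ 2) ^ n)) with (X * (e0 * (/ 2) ^ m * (/ 2) ^ n)) by (unfold c; field; lra).
    replace (w * (Cmod (x n) * Cmod (f n z))) with (Cmod (x n) * (w * Cmod (f n z))) by ring.
    apply Rmult_le_compat; auto using Cmod_ge_0. apply Rmult_le_pos; [lra|apply Cmod_ge_0].
- apply (ex_series_scal (K := R_AbsRing) (V := R_NormedModule)). exists 2. apply geom_half.
- assert (E : Series (fun n => (/ 2) ^ n) = 2) by (apply is_series_unique, geom_half).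
  rewrite (Series_scal_l c (fun n => (/ 2) ^ n)), E. apply Req_le. unfold c. field. lra.
Qed.

Lemma r_cb r : 0 <= r < 1 -> r <= 1 - cb * (1 - r).
Proof. intros Hr. pose proof cb_pos. pose proof cb_le. nra. Qed.

Lemma hump_upper x X : (forall n, Cmod (x n) <= X) -> forall r, 0 <= r < 1 ->
  rpow (1 - r) al * Mp p r (hump_sum x) <= Kp p * (Cu + 4 * e0) * X.
Proof.
intros HX r Hr. destruct (block r Hr) as [m Hm]. pose proof (hump_hol x X HX) as Hh. pose proof (half_pow_bounds m).
assert (HX0 : 0 <= X) by (eapply Rle_trans; [apply Cmod_ge_0|apply (HX 0%nat)]). pose proof (Kp_ge1 p Hp).
set (w := rpow (1 - r) al). assert (Hw : 0 < w) by (apply rpow_gt0; lra).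
assert (He : 0 <= 4 * e0 * X) by (apply Rmult_le_pos; lra).
rewrite Mp_Lp. eapply Rle_trans.
- apply (Lp_two p w X (4 * e0 * X) _ (fun t => Cmod (f m (polar r t)))); auto; try (apply circ_hol; auto).
  intros t. assert (Hz : Cmod (polar r t) = r) by (apply Cmod_polar; lra).
  destruct (hump_split x X m r (polar r t) HX Hm) as [y [E Hy]]; [lra|rewrite Hz; apply r_cb; auto|].
  rewrite E. eapply Rle_trans; [apply Cmod_triangle|]. rewrite Cmod_mult. apply Rplus_le_compat.
  + apply Rmult_le_compat_r; auto using Cmod_ge_0.
  + eapply Rle_trans; [exact Hy|]. fold w. apply Rmult_le_compat_r; [left; apply Rinv_0_lt_compat; auto|].
    rewrite <- (Rmult_1_r (4 * e0 * X)) at 2. apply Rmult_le_compat_l; lra.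
- pose proof (f_up m r Hr) as U. rewrite Mp_Lp in U. fold w in U.
  replace (Kp p * (Cu + 4 * e0) * X) with (Kp p * (X * Cu + 4 * e0 * X)) by ring.
  apply Rmult_le_compat_l; [lra|]. apply Rplus_le_compat_r. apply Rmult_le_compat_l; auto.
Qed.

(** At the peak radius of hump n the other humps contribute at most 4 e0 X, which 8 Kp e0 <= cl
    turns into cl/2 X; this is absorbed when the supremum over n is taken. *)
Lemma hump_lower x X : (forall n, Cmod (x n) <= X) -> forall n,
  cl * Cmod (x n) <= Kp p * (rpow (1 - ra n) al * Mp p (ra n) (hump_sum x)) + cl / 2 * X.
Proof.
intros HX n. destruct (f_low n) as [Hm Hl]. pose proof (rho_lt (S n)). pose proof (rho_ge0 n). pose proof (half_pow_bounds n).
set (r := ra n) in *. assert (Hr : 0 <= r < 1) by lra. pose proof (hump_hol x X HX) as Hh.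
assert (HX0 : 0 <= X) by (eapply Rle_trans; [apply Cmod_ge_0|apply (HX 0%nat)]). pose proof (Kp_ge1 p Hp).
set (w := rpow (1 - r) al) in *. assert (Hw : 0 < w) by (apply rpow_gt0; lra).
assert (He : 0 <= 4 * e0 * X) by (apply Rmult_le_pos; lra).
assert (Hxf : circ (fun t => Cmod (x n) * Cmod (f n (polar r t)))) by (apply circ_scal; [apply Cmod_ge_0|apply circ_hol; auto]).
assert (L : w * Lp p (fun t => Cmod (x n) * Cmod (f n (polar r t))) <=
   Kp p * (1 * (w * Lp p (fun t => Cmod (hump_sum x (polar r t)))) + 4 * e0 * X)).
{ apply Lp_two; auto; try lra; try (apply circ_hol; auto).
  intros t. assert (Hz : Cmod (polar r t) = r) by (apply Cmod_polar; lra).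
  destruct (hump_split x X n r (polar r t) HX Hm) as [y [E Hy]]; [lra|rewrite Hz; apply r_cb; auto|].
  rewrite <- Cmod_mult. replace (x n * f n (polar r t))%C with (hump_sum x (polar r t) - y)%C by (rewrite E; ring).
  eapply Rle_trans; [apply Cmod_minus_le|]. rewrite Rmult_1_l. apply Rplus_le_compat_l.
  eapply Rle_trans; [exact Hy|]. fold w. apply Rmult_le_compat_r; [left; apply Rinv_0_lt_compat; auto|].
  rewrite <- (Rmult_1_r (4 * e0 * X)) at 2. apply Rmult_le_compat_l; lra. }
rewrite Lp_scal in L by (auto using Cmod_ge_0; apply circ_hol; auto). rewrite <- !Mp_Lp in L.
assert (L2 : cl * Cmod (x n) <= w * Mp p r (f n) * Cmod (x n)) by (apply Rmult_le_compat_r; auto using Cmod_ge_0).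
assert (L3 : 8 * Kp p * e0 * X <= cl * X) by (apply Rmult_le_compat_r; auto). lra.
Qed.

Lemma hump_Hinf x X : (forall n, Cmod (x n) <= X) -> Hinf p al (hump_sum x).
Proof.
intros HX. split; [eapply hump_hol; eauto|]. apply Hnorm_fin. eexists. apply (hump_upper x X HX).
Qed.

Lemma hump_strong_cont x X : (forall n, Cmod (x n) <= X) -> strong_cont p al phi (hump_sum x).
Proof.
intros HX. split; [eapply hump_Hinf; eauto|]. intros e He. pose proof (hump_hol x X HX) as Hh.
assert (HX0 : 0 <= X) by (eapply Rle_trans; [apply Cmod_ge_0|apply (HX 0%nat)]). pose proof (Kp_ge1 p Hp).
(* From block m0 on the other humps contribute less than e / 2. The radii up to rho m0 form a
   compact part, where uniform convergence suffices. *)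
destruct (half_pow_lim (e / (2 * (Kp p * (8 * e0 * (X + 1)))))) as [m0 Hm0].
{ apply Rdiv_lt_0_compat; auto. apply Rmult_lt_0_compat; [lra|]. apply Rmult_lt_0_compat; [lra|]. apply Rmult_lt_0_compat; lra. }
destruct (f_sc (e / (2 * (Kp p * (X + 1))))) as [t0 [Ht0 Hsc]].
{ apply Rdiv_lt_0_compat; auto. apply Rmult_lt_0_compat; [lra|]. apply Rmult_lt_0_compat; lra. }
destruct (uniform_small (hump_sum x) (rho m0) Hh (conj (rho_ge0 m0) (rho_lt m0)) e He) as [d [Hd Hd2]].
exists (Rmin t0 d). split; [apply Rmin_pos; auto|]. intros t Ht.
assert (Ht1 : 0 < t < t0) by (pose proof (Rmin_l t0 d); lra). assert (Ht2 : 0 < t < d) by (pose proof (Rmin_r t0 d); lra).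
apply Hnorm_le. intros r Hr.
assert (Hhp : holoD (fun z => hump_sum x (phi t z) - hump_sum x z)%C) by (apply holoD_minus; auto; apply holoD_phi; auto; lra).
destruct (Rle_lt_dec r (rho m0)) as [Hrr|Hrr].
- rewrite Mp_Lp.
  assert (Hle : Lp p (fun s => Cmod (hump_sum x (phi t (polar r s)) - hump_sum x (polar r s))%C) <= e).
  { apply Lp_le_const; auto; [apply (circ_hol (fun z => hump_sum x (phi t z) - hump_sum x z)%C); auto|].
    intros s. apply Hd2; auto. rewrite Cmod_polar; lra. }
  pose proof (rpow_le_1 (1 - r) al Hal ltac:(lra)). pose proof (rpow_ge0 (1 - r) al). nra.
- destruct (block r Hr) as [m Hm].
  assert (Hmm : (m0 <= m)%nat).
  { destruct (Nat.le_gt_cases m0 m) as [|L]; auto. pose proof (rho_mono (S m) m0 L). lra. }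
  pose proof (half_pow_decr m0 m Hmm). pose proof (half_pow_bounds m).
  set (w := rpow (1 - r) al). assert (Hw : 0 < w) by (apply rpow_gt0; lra).
  set (c := 8 * e0 * X * (/ 2) ^ m). assert (Hc : 0 <= c).
  { unfold c. apply Rmult_le_pos; [|lra]. apply Rmult_le_pos; lra. }
  assert (Hfm : holoD (fun z => f m (phi t z) - f m z)%C) by (apply holoD_minus; auto; apply holoD_phi; auto; lra).
  rewrite Mp_Lp. eapply Rle_trans.
  + apply (Lp_two p w X c _ (fun s => Cmod (f m (phi t (polar r s)) - f m (polar r s))%C)); auto.
    * apply (circ_hol (fun z => hump_sum x (phi t z) - hump_sum x z)%C); auto.
    * apply (circ_hol (fun z => f m (phi t z) - f m z)%C); auto.
    * intros s. assert (Hz : Cmod (polar r s) = r) by (apply Cmod_polar; lra).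
      assert (Hz1 : Cmod (polar r s) < 1) by lra.
      destruct (hump_split x X m r (polar r s) HX Hm Hz1) as [y [E Hy]]; [rewrite Hz; apply r_cb; auto|].
      pose proof (phi_boundary t (polar r s) ltac:(lra) Hz1) as PB. rewrite Hz in PB.
      (* The same index m and radius r are used at phi_t z, even if it lies in another annulus; only
         the bound on its modulus matters. *)
      destruct (hump_split x X m r (phi t (polar r s)) HX Hm) as [y' [E' Hy']]; [apply phi_in; auto; lra|lra|].
      rewrite E, E'. set (u := f m (phi t (polar r s))). set (v := f m (polar r s)). fold w in Hy, Hy'.
      replace (x m * u + y' - (x m * v + y))%C with (x m * (u - v) + (y' - y))%C by ring.
      eapply Rle_trans; [apply Cmod_triangle|]. rewrite Cmod_mult. apply Rplus_le_compat.
      -- apply Rmult_le_compat_r; auto using Cmod_ge_0.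
      -- eapply Rle_trans; [apply Cmod_minus_le|]. apply Rle_trans with (4 * e0 * X * (/ 2) ^ m / w + 4 * e0 * X * (/ 2) ^ m / w); [lra|].
         apply Req_le. unfold c. field. lra.
  + pose proof (Hsc m t r Ht1 Hr) as U. rewrite Mp_Lp in U. fold w in U.
    set (L := w * Lp p (fun s => Cmod (f m (phi t (polar r s)) - f m (polar r s))%C)) in *.
    assert (HL0 : 0 <= L) by (apply Rmult_le_pos; [lra|]; apply Lp_ge0; apply (circ_hol (fun z => f m (phi t z) - f m z)%C); auto).
    assert (U1 : Kp p * (X * L) <= e / 2).
    { apply Rle_trans with (Kp p * ((X + 1) * (e / (2 * (Kp p * (X + 1)))))); [|apply Req_le; field; lra].
      apply Rmult_le_compat_l; [lra|]. apply Rmult_le_compat; lra. }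
    assert (U2 : Kp p * c <= e / 2).
    { apply Rle_trans with (Kp p * (8 * e0 * (X + 1) * (e / (2 * (Kp p * (8 * e0 * (X + 1))))))); [|apply Req_le; field; lra].
      apply Rmult_le_compat_l; [lra|]. unfold c. apply Rmult_le_compat; try lra.
      apply Rmult_le_pos; lra. }
    lra.
Qed.

(** With all coefficients 1 the weighted means at the peak radii, which tend to 1, stay above cl /
    (2 Kp). *)
Lemma hump_not_H0 : ~ H0 p al (hump_sum (fun _ => 1%C)).
Proof.
intros [_ H]. pose proof (Kp_ge1 p Hp).
destruct (H (cl / (2 * Kp p))) as [r0 [Hr0 Hlim]]; [apply Rdiv_lt_0_compat; lra|].
destruct (block r0 Hr0) as [m Hm]. pose proof (f_low (S m)) as [[L1 L2] _]. pose proof (rho_lt (S (S m))).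
specialize (Hlim (ra (S m)) ltac:(lra)).
assert (Hb1 : forall n : nat, Cmod ((fun _ => 1%C) n) <= 1) by (intros; simpl; rewrite Cmod_1; lra).
pose proof (hump_lower (fun _ => 1%C) 1 Hb1 (S m)) as HL. cbv beta in HL.
rewrite Cmod_1 in HL. apply (Rmult_lt_compat_l (Kp p)) in Hlim; [|lra].
replace (Kp p * (cl / (2 * Kp p))) with (cl / 2) in Hlim by (field; lra). lra.
Qed.

Lemma linf_norm_spec x : linf_seq x -> exists X, linf_norm x = Finite X /\ (forall n, Cmod (x n) <= X) /\
  forall M, (forall n, Cmod (x n) <= M) -> X <= M.
Proof.
intros [M0 HM0]. unfold linf_norm. set (E := fun v => exists n, v = Cmod (x n)).
destruct (Lub_Rbar_correct E) as [H1 H2].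
assert (Hfin : is_finite (Lub_Rbar E)).
{ assert (B1 : Rbar_le (Cmod (x 0%nat)) (Lub_Rbar E)) by (apply H1; exists 0%nat; auto).
  assert (B2 : Rbar_le (Lub_Rbar E) M0) by (apply H2; intros v [n ->]; simpl; auto).
  destruct (Lub_Rbar E); simpl in *; try contradiction. reflexivity. }
exists (real (Lub_Rbar E)). split; [symmetry; exact Hfin|]. rewrite <- Hfin in H1, H2. split.
- intros n. apply (H1 (Cmod (x n))). exists n; auto.
- intros M HM. apply (H2 M). intros v [n ->]. simpl. auto.
Qed.

Lemma hump_norm_lower x X N : (forall n, Cmod (x n) <= X) -> (forall M, (forall n, Cmod (x n) <= M) -> X <= M) ->
  (forall r, 0 <= r < 1 -> rpow (1 - r) al * Mp p r (hump_sum x) <= N) -> cl / (2 * Kp p) * X <= N.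
Proof.
intros HX HX2 HN. pose proof (Kp_ge1 p Hp).
assert (L : X <= (Kp p * N + cl / 2 * X) / cl).
{ apply HX2. intros n. pose proof (hump_lower x X HX n) as HL. destruct (f_low n) as [[L1 L2] _].
  pose proof (rho_lt (S n)). pose proof (rho_ge0 n). specialize (HN (ra n) ltac:(lra)).
  apply (Rmult_le_compat_l (Kp p)) in HN; [|lra].
  apply Rmult_le_reg_l with cl; auto. replace (cl * ((Kp p * N + cl / 2 * X) / cl)) with (Kp p * N + cl / 2 * X) by (field; lra). lra. }
apply (Rmult_le_compat_l cl) in L; [|lra].
replace (cl * ((Kp p * N + cl / 2 * X) / cl)) with (Kp p * N + cl / 2 * X) in L by (field; lra).
apply Rmult_le_reg_l with (2 * Kp p); [lra|]. replace (2 * Kp p * (cl / (2 * Kp p) * X)) with (cl * X) by (field; lra). lra.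
Qed.

Lemma C_cauchy_limit (x : nat -> C) (N : nat -> R) : (forall e, 0 < e -> exists k, forall j, (k <= j)%nat -> N j < e) ->
  (forall i j, Cmod (x i - x j)%C <= N i + N j) -> exists l, forall j, Cmod (x j - l)%C <= 2 * N j.
Proof.
intros HN Hx.
assert (Hpart : forall g : C -> R, (forall u v, Rabs (g u - g v) <= Cmod (u - v)%C) ->
   exists l, forall j, Rabs (g (x j) - l) <= N j).
{ intros g Hg. assert (Hc : Cauchy_crit (fun j => g (x j))).
  - intros e He. destruct (HN (e / 2) ltac:(lra)) as [k Hk]. exists k. intros i j Hi Hj. unfold Rdist.
    eapply Rle_lt_trans; [apply Hg|]. eapply Rle_lt_trans; [apply Hx|]. pose proof (Hk i Hi). pose proof (Hk j Hj). lra.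
  - destruct (Rcomplete.R_complete _ Hc) as [l Hl]. exists l. intros j. apply le_epsilon. intros e He. destruct (Hl (e / 2) ltac:(lra)) as [k1 Hk1].
    destruct (HN (e / 2) ltac:(lra)) as [k2 Hk2]. set (i := Nat.max k1 k2).
    specialize (Hk1 i ltac:(unfold i; lia)). specialize (Hk2 i ltac:(unfold i; lia)). unfold Rdist in Hk1.
    pose proof (Hg (x j) (x i)). pose proof (Hx j i).
    replace (g (x j) - l) with ((g (x j) - g (x i)) + (g (x i) - l)) by ring.
    eapply Rle_trans; [apply Rabs_triang|]. lra. }
destruct (Hpart fst) as [l1 H1].
{ intros u v. replace (fst u - fst v) with (fst (u - v)%C) by reflexivity. apply Cmod_fst_le. }
destruct (Hpart snd) as [l2 H2].
{ intros u v. replace (snd u - snd v) with (snd (u - v)%C) by reflexivity. apply Cmod_snd_le. }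
exists (l1, l2). intros j. eapply Rle_trans; [apply Cmod_le_abs|]. simpl. specialize (H1 j). specialize (H2 j).
unfold Rminus in H1, H2. lra.
Qed.

(** By the lower norm bound the coefficient sequences of approximants are uniformly Cauchy. Their
    limit l gives g because point evaluations are continuous both for the sum and, by [point_bound],
    for the norm. *)
Lemma hump_closed g : Hinf p al g ->
  (forall eps, 0 < eps -> exists x, linf_seq x /\ Rbar_lt (Hnorm p al (fun z => hump_sum x z - g z)%C) (Finite eps)) ->
  exists x, linf_seq x /\ forall z, inD z -> g z = hump_sum x z.
Proof.
intros [Hg _] H. pose proof (Kp_ge1 p Hp) as HK.
set (e := fun j => (/ 2) ^ j).
assert (He : forall j, 0 < e j) by (intros j; apply half_pow_bounds).
set (x := fun j => proj1_sig (constructive_indefinite_description _ (H (e j) (He j)))).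
assert (Hx : forall j, linf_seq (x j) /\ forall r, 0 <= r < 1 -> rpow (1 - r) al * Mp p r (fun z => hump_sum (x j) z - g z)%C <= e j).
{ intros j. destruct (proj2_sig (constructive_indefinite_description _ (H (e j) (He j)))) as [B1 B2]. fold (x j) in B1, B2.
  split; auto. apply Hnorm_le. apply Rbar_lt_le. exact B2. }
assert (Hxh : forall j, holoD (hump_sum (x j))).
{ intros j. destruct (Hx j) as [[X HX] _]. eapply hump_hol; eauto. }
set (k := 2 * Kp p / cl * Kp p). assert (Hk : 0 < k).
{ unfold k. apply Rmult_lt_0_compat; [apply Rdiv_lt_0_compat|]; lra. }
assert (Hdiff : forall i j n, Cmod (x i n - x j n)%C <= k * e i + k * e j).
{ intros i j n. destruct (Hx i) as [[Xi HXi] Ni]. destruct (Hx j) as [[Xj HXj] Nj].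
  set (y := fun n => (1 * x i n + (- (1)) * x j n)%C).
  destruct (linf_norm_spec y) as [Y [_ [HY1 HY2]]].
  { exists (Xi + Xj). intros m. unfold y. replace (1 * x i m + (- (1)) * x j m)%C with (x i m - x j m)%C by ring.
    eapply Rle_trans; [apply Cmod_minus_le|]. specialize (HXi m). specialize (HXj m). lra. }
  replace (x i n - x j n)%C with (y n) by (unfold y; ring). eapply Rle_trans; [apply HY1|].
  assert (L : cl / (2 * Kp p) * Y <= Kp p * (e i + e j)).
  { apply (hump_norm_lower y); auto. intros r Hr. specialize (Ni r Hr). specialize (Nj r Hr).
    pose proof (rpow_ge0 (1 - r) al).
    pose proof (Mp_minus p r (fun z => hump_sum (x i) z - g z)%C (fun z => hump_sum (x j) z - g z)%C Hp
      (holoD_minus _ _ (Hxh i) Hg) (holoD_minus _ _ (Hxh j) Hg) Hr) as M.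
    assert (E : Mp p r (hump_sum y) = Mp p r (fun z => (hump_sum (x i) z - g z) - (hump_sum (x j) z - g z))%C).
    { rewrite !Mp_Lp. f_equal. apply FunctionalExtensionality.functional_extensionality. intros t. f_equal. unfold y.
      rewrite (hump_lin _ _ Xi Xj) by (auto; rewrite Cmod_polar; lra). ring. }
    rewrite E. apply (Rmult_le_compat_l (rpow (1 - r) al)) in M; auto. eapply Rle_trans; [exact M|].
    rewrite (Rmult_comm (Kp p)), <- Rmult_assoc, (Rmult_comm _ (Kp p)).
    apply Rmult_le_compat_l; lra. }
  apply (Rmult_le_compat_l (2 * Kp p / cl)) in L; [|apply Rdiv_le_0_compat; lra].
  replace (2 * Kp p / cl * (cl / (2 * Kp p) * Y)) with Y in L by (field; lra).
  eapply Rle_trans; [exact L|]. apply Req_le. unfold k. ring. }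
assert (Hlim : forall n, exists l, forall j, Cmod (x j n - l)%C <= 2 * (k * e j)).
{ intros n. apply (C_cauchy_limit (fun j => x j n) (fun j => k * e j)); auto.
  intros d Hd. destruct (half_pow_lim (d / k)) as [m Hm]; [apply Rdiv_lt_0_compat; auto|]. exists m. intros j Hj.
  unfold e. pose proof (half_pow_decr m j Hj).
  apply Rle_lt_trans with (k * (/ 2) ^ m); [apply Rmult_le_compat_l; lra|].
  apply (Rmult_lt_compat_l k) in Hm; auto. replace (k * (d / k)) with d in Hm by (field; lra). auto. }
set (l := fun n => proj1_sig (constructive_indefinite_description _ (Hlim n))).
assert (Hl : forall n j, Cmod (x j n - l n)%C <= 2 * (k * e j)).
{ intros n. exact (proj2_sig (constructive_indefinite_description _ (Hlim n))). }
destruct (Hx 0%nat) as [[X0 HX0] _].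
set (L := X0 + 2 * (k * e 0%nat)).
assert (HL : forall n, Cmod (l n) <= L).
{ intros n. specialize (Hl n 0%nat). specialize (HX0 n). pose proof (Cmod_minus_le (x 0%nat n) (x 0%nat n - l n)%C) as M.
  replace (x 0%nat n - (x 0%nat n - l n))%C with (l n) in M by ring. unfold L. lra. }
exists l. split; [exists L; auto|]. intros z Hz. unfold inD in Hz. pose proof (Cmod_ge_0 z).
destruct (f_sum (Cmod z)) as [a [Ha Hb]]; [lra|].
set (r := (1 + Cmod z) / 2). assert (Hr : 0 <= r < 1) by (unfold r; lra).
set (w := rpow (1 - r) al). assert (Hw : 0 < w) by (apply rpow_gt0; lra).
set (dz := dp p ((1 - Cmod z) / 4)). assert (Hdz : 0 < dz) by (apply dp_pos; lra).
assert (Ha0 : 0 <= Series a).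
{ pose proof (csum_bound (fun _ => RtoC 0) a) as B. assert (Cmod (csum (fun _ => RtoC 0)) <= 2 * Series a).
  - apply B; auto. intros n. rewrite Cmod_0. eapply Rle_trans; [apply Cmod_ge_0|apply (Hb n z); lra].
  - pose proof (Cmod_ge_0 (csum (fun _ => RtoC 0))). lra. }
set (Q := 4 * k * Series a + / (w * dz)).
assert (HQ : 0 < Q).
{ unfold Q. assert (0 < / (w * dz)) by (apply Rinv_0_lt_compat, Rmult_lt_0_compat; auto).
  assert (0 <= 4 * k * Series a) by (apply Rmult_le_pos; lra). lra. }
assert (Hclose : forall j, Cmod (g z - hump_sum l z)%C <= Q * e j).
{ intros j. destruct (Hx j) as [[Xj HXj] Nj].
  assert (B1 : Cmod (hump_sum (x j) z - hump_sum l z)%C <= 4 * k * Series a * e j).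
  { pose proof (hump_lin (x j) l Xj L 1%C (- (1))%C z HXj HL Hz) as E.
    replace (hump_sum (x j) z - hump_sum l z)%C with (1 * hump_sum (x j) z + (- (1)) * hump_sum l z)%C by ring. rewrite <- E.
    eapply Rle_trans; [apply (csum_bound _ (fun n => 2 * (k * e j) * a n))|].
    - intros n. rewrite Cmod_mult. replace (1 * x j n + (- (1)) * l n)%C with (x j n - l n)%C by ring.
      apply Rmult_le_compat; auto using Cmod_ge_0. apply Hb; lra.
    - apply (ex_series_scal (K := R_AbsRing) (V := R_NormedModule) _ a Ha).
    - rewrite (Series_scal_l (2 * (k * e j)) a). apply Req_le. ring. }
  assert (B2 : Cmod (hump_sum (x j) z - g z)%C <= / (w * dz) * e j).
  { specialize (Nj r Hr). fold w in Nj.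
    pose proof (point_bound p (fun z => hump_sum (x j) z - g z)%C z Hp (holoD_minus _ _ (Hxh j) Hg) Hz) as PB.
    fold dz r in PB. apply (Rmult_le_compat_l w) in PB; [|lra].
    apply Rmult_le_reg_l with (w * dz); [apply Rmult_lt_0_compat; auto|].
    replace (w * dz * (/ (w * dz) * e j)) with (e j) by (field; lra). cbv beta in PB. lra. }
  replace (g z - hump_sum l z)%C with ((hump_sum (x j) z - hump_sum l z) - (hump_sum (x j) z - g z))%C by ring.
  eapply Rle_trans; [apply Cmod_minus_le|]. unfold Q. lra. }
assert (E0 : Cmod (g z - hump_sum l z)%C = 0).
{ apply Rle_antisym; [|apply Cmod_ge_0]. apply le_epsilon. intros d Hd.
  destruct (half_pow_lim (d / Q)) as [m Hm]; [apply Rdiv_lt_0_compat; auto|].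
  eapply Rle_trans; [apply (Hclose m)|]. unfold e. apply (Rmult_lt_compat_l Q) in Hm; auto.
  replace (Q * (d / Q)) with d in Hm by (field; lra). lra. }
apply Cmod_eq_0 in E0. replace (g z) with ((g z - hump_sum l z) + hump_sum l z)%C by ring. rewrite E0. ring.
Qed.

Lemma hump_embedding : contains_closed_linf p al (strong_cont p al phi).
Proof.
pose proof (Kp_ge1 p Hp) as HK. exists hump_sum. split; [|split; [|split]].
- intros x y a c [X HX] [Y HY] z Hz. eapply hump_lin; eauto.
- exists (cl / (2 * Kp p)), (Kp p * (Cu + 4 * e0)).
  split; [apply Rdiv_lt_0_compat; lra|]. split; [apply Rmult_lt_0_compat; lra|]. intros x Hx.
  destruct (linf_norm_spec x Hx) as [X [E [HX1 HX2]]]. rewrite E. simpl. split.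
  + destruct (Hnorm p al (hump_sum x)) as [N| |] eqn:EN; simpl; auto.
    * apply (hump_norm_lower x X); auto. apply Hnorm_le. rewrite EN. simpl; lra.
    * assert (B : Rbar_le (Hnorm p al (hump_sum x)) (Finite (-1))) by (rewrite EN; exact I).
      pose proof (proj1 (Hnorm_le _ _ _ _) B 0 ltac:(lra)) as B0.
      pose proof (Mp_ge0 p 0 (hump_sum x) (hump_hol x X HX1) ltac:(lra)). pose proof (rpow_ge0 (1 - 0) al). nra.
  + apply Hnorm_le. apply hump_upper; auto.
- intros x [X HX]. eapply hump_strong_cont; eauto.
- apply hump_closed.
Qed.

End Hump.

(** * Kernel functions along a sequence where gamma is not little Bloch *)

Section Kernel.

Variables (p : Rbar) (al : R) (N0 M : nat) (eta : R).
Hypothesis Hp : Rbar_lt 0 p.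
Hypothesis Hal : 0 < al.
Hypothesis HN0 : match p with Finite q => 2 < INR N0 * q | _ => True end.
Hypothesis HM : al <= INR M.
Hypothesis Heta : 0 < eta.

(** The factor (1 - |a|)^(- al - 1/p) that makes the weighted norm of the kernel power comparable to
    1. *)
Definition amp (a : C) : R := / (rpow (1 - Cmod a) al * dp p (1 - Cmod a)).
Definition Fk (n : nat) (a z : C) : C := (RtoC (amp a) * Cpow (kf a z) n)%C.

Lemma amp_pos a : Cmod a < 1 -> 0 < amp a.
Proof.
intros Ha. apply Rinv_0_lt_compat. apply Rmult_lt_0_compat; [apply rpow_gt0|apply dp_pos]; lra.
Qed.

Lemma Fk_hol n a : Cmod a < 1 -> holoD (Fk n a).
Proof.
intros Ha z Hz. unfold inD in Hz. eexists. apply cdiff_scal. apply (holoD_cdiff (fun z => Cpow (kf a z) n)); auto.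
apply holoD_pow, holoD_kf; auto.
Qed.

Lemma Fk_mod n a z : Cmod a < 1 -> Cmod (Fk n a z) = amp a * Cmod (kf a z) ^ n.
Proof.
intros Ha. unfold Fk. rewrite Cmod_mult, Cmod_R, Cmod_pow, Rabs_pos_eq; auto. left; apply amp_pos; auto.
Qed.

Lemma pow_decr01 x m n : 0 <= x <= 1 -> (m <= n)%nat -> x ^ n <= x ^ m.
Proof.
intros Hx H. induction H; [lra|]. simpl. assert (0 <= x ^ m0) by (apply pow_le; lra). nra.
Qed.

(** [N0] of the factors [kf a] are spent on integrability through [Mp_kernel]; the others are
    estimated pointwise. *)
Lemma Mp_Fk n a r c : Cmod a < 1 -> 0 <= r < 1 -> 0 <= c ->
  (forall z, Cmod z = r -> Cmod (Fk n a z) <= c / dp p (1 - Cmod a) * Cmod (kf a z) ^ N0) -> Mp p r (Fk n a) <= c.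
Proof.
intros Ha Hr Hc H. assert (Hd : 0 < dp p (1 - Cmod a)) by (apply dp_pos; lra).
pose proof (holoD_pow _ N0 (holoD_kf a Ha)) as Hk.
assert (Hcd : 0 <= c / dp p (1 - Cmod a)) by (apply Rdiv_le_0_compat; auto).
rewrite Mp_Lp. apply Rle_trans with (Lp p (fun t => c / dp p (1 - Cmod a) * Cmod (Cpow (kf a (polar r t)) N0))).
- apply Lp_mono; auto; [apply circ_hol; auto; apply Fk_hol; auto|apply circ_scal; auto; apply (circ_hol (fun z => Cpow (kf a z) N0)); auto|].
  intros t. rewrite Cmod_pow. apply H. apply Cmod_polar; lra.
- rewrite Lp_scal; auto; [|apply (circ_hol (fun z => Cpow (kf a z) N0)); auto].
  pose proof (Mp_kernel p a N0 r Hp HN0 Ha Hr) as K. rewrite Mp_Lp in K.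
  apply Rle_trans with (c / dp p (1 - Cmod a) * dp p (1 - Cmod a)); [|apply Req_le; field; lra].
  apply Rmult_le_compat_l; auto.
Qed.

Lemma Fk_crude n a r : (N0 <= n)%nat -> Cmod a < 1 -> 0 <= r < 1 -> Mp p r (Fk n a) <= / rpow (1 - Cmod a) al.
Proof.
intros Hn Ha Hr. assert (Hw : 0 < rpow (1 - Cmod a) al) by (apply rpow_gt0; lra).
assert (Hd : 0 < dp p (1 - Cmod a)) by (apply dp_pos; lra).
apply Mp_Fk; auto; [left; apply Rinv_0_lt_compat; auto|]. intros z Hz. rewrite Fk_mod by auto.
replace (/ rpow (1 - Cmod a) al / dp p (1 - Cmod a)) with (amp a) by (unfold amp; field; lra).
apply Rmult_le_compat_l; [left; apply amp_pos; auto|]. apply pow_decr01; auto. split; [apply Cmod_ge_0|apply kf_bounds; lra].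
Qed.

(** [M] further factors pay for the weight: |kf a| is at most 1 and at most (1 - |a|)/(1 - r), and M
    >= al. *)
Lemma Fk_norm n a r : (N0 + M <= n)%nat -> Cmod a < 1 -> 0 <= r < 1 -> rpow (1 - r) al * Mp p r (Fk n a) <= 1.
Proof.
intros Hn Ha Hr. set (w := rpow (1 - r) al). assert (Hw : 0 < w) by (apply rpow_gt0; lra).
set (d := 1 - Cmod a). assert (Hd0 : 0 < d) by (unfold d; lra).
set (wd := rpow d al). assert (Hwd : 0 < wd) by (apply rpow_gt0; lra).
assert (Hd : 0 < dp p d) by (apply dp_pos; lra).
apply Rmult_le_reg_l with (/ w); [apply Rinv_0_lt_compat; auto|].
replace (/ w * (w * Mp p r (Fk n a))) with (Mp p r (Fk n a)) by (field; lra). rewrite Rmult_1_r.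
apply Mp_Fk; auto; [left; apply Rinv_0_lt_compat; auto|]. intros z Hz. rewrite Fk_mod by auto.
destruct (kf_bounds a z Ha ltac:(lra)) as [K1 K2]. set (k := Cmod (kf a z)) in *. assert (Hk : 0 <= k) by apply Cmod_ge_0.
rewrite Hz in K2. fold d in K2 |- *. unfold amp. fold d wd.
assert (Hkk : w * k ^ M <= wd).
{ assert (HkM : 0 <= k ^ M <= 1).
  { split; [apply pow_le; auto|]. rewrite <- (pow1 M). apply pow_incr; lra. }
  destruct (Rle_lt_dec (1 - r) d) as [L|L].
  - assert (w <= wd) by (apply rpow_le; auto). nra.
  - set (x := d / (1 - r)). assert (Hx : 0 < x < 1).
    { unfold x. split; [apply Rdiv_lt_0_compat; lra|apply Rdiv_lt_1; lra]. }
    assert (Hkx : k <= x).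
    { unfold x. apply Rmult_le_reg_r with (1 - r); [lra|]. replace (d / (1 - r) * (1 - r)) with d by (field; lra). auto. }
    assert (E : wd = w * rpow x al).
    { unfold w, wd. rewrite <- rpow_mult by lra. f_equal. unfold x. field. lra. }
    rewrite E. apply Rmult_le_compat_l; [lra|]. apply Rle_trans with (x ^ M); [apply pow_incr; lra|].
    rewrite <- Rpower_pow by lra. rewrite <- rpow_pos by lra.
    destruct HM as [HM1|<-]; [|lra].
    replace (INR M) with (al + (INR M - al)) by ring. rewrite rpow_plus by lra.
    assert (rpow x (INR M - al) <= 1) by (apply rpow_le_1; lra). pose proof (rpow_ge0 x al). nra. }
assert (HkN : k ^ n <= k ^ N0 * k ^ M) by (rewrite <- pow_add; apply pow_decr01; auto; lra).
assert (0 <= k ^ N0) by (apply pow_le; auto).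
apply Rmult_le_reg_l with (w * (wd * dp p d)); [apply Rmult_lt_0_compat; auto; apply Rmult_lt_0_compat; auto|].
replace (w * (wd * dp p d) * (/ (wd * dp p d) * k ^ n)) with (w * k ^ n) by (field; lra).
replace (w * (wd * dp p d) * (/ w / dp p d * k ^ N0)) with (wd * k ^ N0) by (field; lra).
apply Rle_trans with (w * (k ^ N0 * k ^ M)); [apply Rmult_le_compat_l; lra|].
replace (w * (k ^ N0 * k ^ M)) with (w * k ^ M * k ^ N0) by ring. apply Rmult_le_compat_r; auto.
Qed.

Lemma Fk_phi_norm n a r t : (N0 + M <= n)%nat -> Cmod a < 1 -> 0 <= r < 1 -> 0 <= t ->
  rpow (1 - r) al * Mp p r (fun z => Fk n a (phi t z)) <= CL p / rpow k0 al.
Proof.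
intros Hn Ha Hr Ht. destruct (rad_bounds r Hr) as [R1 [R2 [R3 R4]]]. pose proof cb_pos.
assert (Hk0 : 0 < k0) by (unfold k0; lra). assert (Hka : 0 < rpow k0 al) by (apply rpow_gt0; auto).
pose proof (Mp_phi p (Fk n a) t r Hp (Fk_hol n a Ha) Ht Hr) as M1. pose proof (CL_pos p).
pose proof (Fk_norm n a (rad r) Hn Ha ltac:(lra)) as M2. rewrite R3, rpow_mult in M2 by lra.
pose proof (rpow_ge0 (1 - r) al) as Hw. apply (Rmult_le_compat_l _ _ _ Hw) in M1. eapply Rle_trans; [exact M1|].
apply Rmult_le_reg_l with (rpow k0 al); auto. replace (rpow k0 al * (CL p / rpow k0 al)) with (CL p * 1) by (field; lra).
replace (rpow k0 al * (rpow (1 - r) al * (CL p * Mp p (rad r) (Fk n a))))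
  with (CL p * (rpow k0 al * rpow (1 - r) al * Mp p (rad r) (Fk n a))) by ring.
apply Rmult_le_compat_l; lra.
Qed.

(** The kernel is at least 1/2 in modulus at a itself, and [point_bound] passes this to the circle
    of radius (1 + |a|)/2. *)
Lemma Fk_low n a : Cmod a < 1 ->
  rpow (/ 2) al * dp p (/ 4) * (/ 2) ^ n <= rpow (1 - (1 + Cmod a) / 2) al * Mp p ((1 + Cmod a) / 2) (Fk n a).
Proof.
intros Ha. pose proof (Cmod_ge_0 a). set (d := 1 - Cmod a). assert (Hd0 : 0 < d) by (unfold d; lra).
set (wd := rpow d al). assert (Hwd : 0 < wd) by (apply rpow_gt0; lra).
assert (Hd : 0 < dp p d) by (apply dp_pos; lra).
assert (H2 : 0 < rpow (/ 2) al) by (apply rpow_gt0; lra). assert (H4 : 0 < dp p (/ 4)) by (apply dp_pos; lra).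
replace (1 - (1 + Cmod a) / 2) with (/ 2 * d) by (unfold d; field). rewrite rpow_mult by lra. fold wd.
pose proof (point_bound p (Fk n a) a Hp (Fk_hol n a Ha) Ha) as PB.
replace ((1 - Cmod a) / 4) with (/ 4 * d) in PB by (unfold d; field). rewrite dp_mult in PB by lra.
rewrite Fk_mod in PB by auto. unfold amp in PB. fold d wd in PB.
assert (Hk : / 2 <= Cmod (kf a a)).
{ rewrite kf_mod by auto. fold d. replace (Cconj a * a)%C with (RtoC (Cmod a ^ 2)) by (rewrite Cmod2_conj; ring).
  rewrite <- RtoC_minus, Cmod_R, Rabs_pos_eq by nra. apply Rmult_le_reg_r with (1 - Cmod a ^ 2); [nra|].
  replace (d / (1 - Cmod a ^ 2) * (1 - Cmod a ^ 2)) with d by (field; nra). unfold d. nra. }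
assert (Hk2 : (/ 2) ^ n <= Cmod (kf a a) ^ n) by (apply pow_incr; lra).
eapply Rle_trans; [|apply Rmult_le_compat_l; [|exact PB]].
- replace (rpow (/ 2) al * wd * (dp p (/ 4) * dp p d * (/ (wd * dp p d) * Cmod (kf a a) ^ n)))
    with (rpow (/ 2) al * dp p (/ 4) * Cmod (kf a a) ^ n) by (field; lra).
  apply Rmult_le_compat_l; auto. left; apply Rmult_lt_0_compat; auto.
- left; apply Rmult_lt_0_compat; auto.
Qed.

(** 2 * 8 * 2: the bound |w - b| <= 2, the constant of [dg_harnack], and (1 - |a|) |gamma'(a)| >=
    eta/2. *)
Definition Ceta : R := 32 / ((1 - Cmod b) * eta).

Lemma Ceta_pos : 0 < Ceta.
Proof. pose proof b_in. apply Rdiv_lt_0_compat; [lra|]. apply Rmult_lt_0_compat; lra. Qed.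

Definition good (a : C) : Prop := Cmod a < 1 /\ eta <= xw a.

Lemma G_kernel a w : good a -> Cmod w < 1 -> Cmod (G w) <= Ceta * Cmod (1 - Cconj a * w)%C ^ 2 / (1 - Cmod w).
Proof.
intros [Ha Hx] Hw. pose proof b_in. pose proof (xw_bounds a Ha) as X. pose proof (dg_pos w Hw) as Dw.
pose proof (dg_harnack w a Hw Ha) as H1.
assert (E2 : Cmod (1 - Cconj w * a)%C = Cmod (1 - Cconj a * w)%C).
{ rewrite <- Cmod_conj. f_equal. apply C_eq; destruct w, a; simpl; ring. }
rewrite E2 in H1. set (D := Cmod (1 - Cconj a * w)%C) in *.
rewrite G_mod by auto. pose proof (wb_le2 w Hw).
assert (H2 : (1 - Cmod b) * ((1 - Cmod w) * (eta / 2)) <= 8 * D ^ 2 * Cmod (dg w)).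
{ eapply Rle_trans; [|exact H1]. apply Rmult_le_compat_l; [lra|]. rewrite Rmult_assoc. apply Rmult_le_compat_l; lra. }
apply Rmult_le_reg_r with (Cmod (dg w)); auto.
replace (Cmod (w - b)%C / Cmod (dg w) * Cmod (dg w)) with (Cmod (w - b)%C) by (field; lra).
apply Rle_trans with 2; auto. unfold Ceta.
apply Rmult_le_reg_l with ((1 - Cmod b) * ((1 - Cmod w) * (eta / 2)) / 2).
- apply Rdiv_lt_0_compat; [|lra]. apply Rmult_lt_0_compat; [lra|]. apply Rmult_lt_0_compat; lra.
- match goal with |- _ <= ?x => replace x with (8 * D ^ 2 * Cmod (dg w)) by (field; lra) end. lra.
Qed.

(** Where |1 - conj a z| = O(1 - |a|) and z is not much closer to the circle than a, [G_kernel]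
    gives speed O(1 - |a|), so the displacement relative to 1 - |a| is O(u) uniformly in a. *)
Lemma kernel_near a z L kap u : good a -> Cmod z < 1 -> 0 <= L -> 0 < kap <= 1 ->
  Cmod (1 - Cconj a * z)%C <= L * (1 - Cmod a) -> kap * (1 - Cmod a) <= 1 - Cmod z ->
  0 <= u -> 2 * Ceta * (L + 1) ^ 2 / kap * u < kap / 2 ->
  Cmod (phi u z - z)%C <= 2 * Ceta * (L + 1) ^ 2 / kap * u * (1 - Cmod a).
Proof.
intros Ha Hz HL Hk Hy Hz2 Hu HB. pose proof Ceta_pos. set (d := 1 - Cmod a) in *. assert (Hd : 0 < d) by (unfold d; destruct Ha; lra).
set (B := 2 * Ceta * (L + 1) ^ 2 / kap) in *.
assert (HL2 : 0 < (L + 1) ^ 2) by (apply pow_lt; lra).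
assert (HB0 : 0 < B) by (unfold B; apply Rdiv_lt_0_compat; [apply Rmult_lt_0_compat|]; lra).
replace (B * u * d) with (B * d * u) by ring.
apply (stay z (kap / 2 * d) (B * d) u); auto; try lra.
- left; apply Rmult_lt_0_compat; auto.
- replace (B * d * u) with (B * u * d) by ring. apply Rmult_lt_compat_r; auto.
- intros w Hw Hwz. eapply Rle_trans; [apply (G_kernel a w Ha Hw)|].
  assert (H1 : kap / 2 * d <= 1 - Cmod w).
  { replace w with (z + (w - z))%C by ring. pose proof (Cmod_triangle z (w - z)). lra. }
  assert (H2 : Cmod (1 - Cconj a * w)%C <= (L + 1) * d).
  { replace (1 - Cconj a * w)%C with ((1 - Cconj a * z) - Cconj a * (w - z))%C by ring.
    eapply Rle_trans; [apply Cmod_minus_le|]. rewrite conj_mult_mod. destruct Ha as [Ha _]. pose proof (Cmod_ge_0 a).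
    pose proof (Cmod_ge_0 (w - z)%C). nra. }
  assert (H3 : Cmod (1 - Cconj a * w)%C ^ 2 <= ((L + 1) * d) ^ 2) by (apply pow_incr; split; [apply Cmod_ge_0|auto]).
  assert (Hkd : 0 < kap / 2 * d) by (apply Rmult_lt_0_compat; lra).
  apply Rle_trans with (Ceta * ((L + 1) * d) ^ 2 / (kap / 2 * d)).
  + unfold Rdiv. apply Rmult_le_compat.
    * apply Rmult_le_pos; [lra|apply pow2_ge_0].
    * left; apply Rinv_0_lt_compat; lra.
    * apply Rmult_le_compat_l; lra.
    * apply Rinv_le_contravar; auto.
  + apply Req_le. unfold B. field. lra.
Qed.

Lemma phi_path_cont z : Cmod z < 1 -> forall u, ccont (fun u => phi (Rabs u) z) u.
Proof.
intros Hz u. pose proof (Cmod_ge_0 z).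
assert (H1 : forall (g : C -> R), (forall v w, Rabs (g v - g w) <= Cmod (v - w)%C) -> continuous (fun u => g (phi (Rabs u) z)) u).
{ intros g Hg. apply continuity_pt_filterlim. apply continuity_pt_eps. intros e He.
  destruct (phi_tcont (Cmod z) ltac:(lra) e He) as [d [Hd Hd2]]. exists d. split; auto. intros y Hy.
  eapply Rle_lt_trans; [apply Hg|]. apply Hd2; try apply Rabs_pos; [|lra].
  eapply Rle_lt_trans; [apply Rabs_triang_inv2|auto]. }
apply ccont_pair; apply H1; intros v w.
- replace (fst v - fst w) with (fst (v - w)%C) by reflexivity. apply Cmod_fst_le.
- replace (snd v - snd w) with (snd (v - w)%C) by reflexivity. apply Cmod_snd_le.
Qed.

(* A trajectory coming close to [a] must cross the level |1 - conj a z| = 2 K (1 - |a|), after which it is slow. *)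
Lemma kernel_far a z K kap t : good a -> Cmod z < 1 -> 1 <= K -> 0 < kap <= 1 ->
  2 * K * (1 - Cmod a) <= Cmod (1 - Cconj a * z)%C -> kap * (1 - Cmod a) <= 1 - Cmod z -> 0 <= t ->
  2 * Ceta * (2 * K + 1) ^ 2 / (cb * kap) * t < cb * kap / 2 ->
  K * (1 - Cmod a) <= Cmod (1 - Cconj a * phi t z)%C.
Proof.
intros Ha Hz HK Hk Hy Hz2 Ht HB. apply Rnot_lt_le. intros Hlt. pose proof cb_pos. pose proof cb_le. pose proof Ceta_pos.
set (d := 1 - Cmod a) in *. assert (Hd : 0 < d) by (unfold d; destruct Ha; lra).
assert (HKd : d <= K * d) by nra.
destruct (IVT_cor (fun u => Cmod (1 - Cconj a * phi (Rabs u) z)%C - 2 * K * d) 0 t) as [s [Hs Es]]; auto.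
{ intros u. apply continuity_pt_filterlim. apply (rcont_minus (fun u => Cmod (1 - Cconj a * phi (Rabs u) z)%C) (fun _ => 2 * K * d)); [|apply continuous_const].
  apply rcont_Cmod.
  apply ccont_minus; [apply ccont_const|]. apply ccont_mult; [apply ccont_const|]. apply phi_path_cont; auto. }
{ rewrite Rabs_R0, (Rabs_pos_eq t), phi_0 by auto. rewrite Rmult_comm. apply Rmult_le_0_r; lra. }
rewrite Rabs_pos_eq in Es by lra. set (z' := phi s z) in *.
assert (Hz' : Cmod z' < 1) by (apply phi_in; auto; lra).
assert (Hz'2 : cb * kap * d <= 1 - Cmod z').
{ eapply Rle_trans; [|apply phi_boundary; auto; lra]. rewrite Rmult_assoc. apply Rmult_le_compat_l; lra. }
set (B := 2 * Ceta * (2 * K + 1) ^ 2 / (cb * kap)) in *.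
assert (Hck : 0 < cb * kap <= 1) by (split; [apply Rmult_lt_0_compat; lra|nra]).
assert (HB0 : 0 < B).
{ unfold B. apply Rdiv_lt_0_compat; [|lra]. apply Rmult_lt_0_compat; [lra|apply pow_lt; lra]. }
assert (HBt : B * (t - s) < cb * kap / 2) by (eapply Rle_lt_trans; [|exact HB]; apply Rmult_le_compat_l; lra).
pose proof (kernel_near a z' (2 * K) (cb * kap) (t - s) Ha Hz' ltac:(lra) Hck) as KN. fold d B in KN.
specialize (KN ltac:(unfold z' in *; lra) Hz'2 ltac:(lra) HBt).
unfold z' in KN at 1. rewrite <- phi_plus in KN by (auto; lra). replace (t - s + s) with t in KN by ring.
set (w := phi t z) in *.
assert (HBd : B * (t - s) * d <= d / 2).
{ apply Rle_trans with (cb * kap / 2 * d); [apply Rmult_le_compat_r; lra|]. nra. }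
assert (E : (1 - Cconj a * z')%C = ((1 - Cconj a * w) + Cconj a * (w - z'))%C) by ring.
assert (Cmod (1 - Cconj a * z')%C <= Cmod (1 - Cconj a * w)%C + Cmod (w - z')%C).
{ rewrite E. eapply Rle_trans; [apply Cmod_triangle|]. rewrite conj_mult_mod. destruct Ha as [Ha _].
  pose proof (Cmod_ge_0 (w - z')%C). pose proof (Cmod_ge_0 a). nra. }
lra.
Qed.

Lemma Cpow_diff u v m n : Cmod u <= m -> Cmod v <= m ->
  Cmod (Cpow v (S n) - Cpow u (S n))%C <= INR (S n) * m ^ n * Cmod (v - u)%C.
Proof.
intros Hu Hv. assert (Hm : 0 <= m) by (eapply Rle_trans; [apply Cmod_ge_0|exact Hu]).
induction n.
- simpl. apply Req_le. replace (v * 1 - u * 1)%C with (v - u)%C by ring. ring.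
- set (k := S n) in *. rewrite S_INR.
  replace (Cpow v (S k) - Cpow u (S k))%C with (v * (Cpow v k - Cpow u k) + (v - u) * Cpow u k)%C by (simpl; ring).
  eapply Rle_trans; [apply Cmod_triangle|]. rewrite !Cmod_mult, Cmod_pow.
  assert (H1 : Cmod v * Cmod (Cpow v k - Cpow u k)%C <= m * (INR k * m ^ n * Cmod (v - u)%C))
    by (apply Rmult_le_compat; auto using Cmod_ge_0).
  assert (H2 : Cmod u ^ k <= m ^ k) by (apply pow_incr; split; [apply Cmod_ge_0|auto]).
  assert (H3 : Cmod (v - u)%C * Cmod u ^ k <= Cmod (v - u)%C * m ^ k) by (apply Rmult_le_compat_l; auto using Cmod_ge_0).
  replace ((INR k + 1) * m ^ k * Cmod (v - u)%C) with (m * (INR k * m ^ n * Cmod (v - u)%C) + Cmod (v - u)%C * m ^ k)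
    by (unfold k; simpl pow; ring).
  lra.
Qed.

(** Near a the relative change of [kf a] is at most e. Far from a both kernel values are at most
    1/K, so one factor out of S n is traded for 1/K; this is why the lower power n appears on the
    right. *)
Lemma Fk_diff n a z t K kap e : good a -> Cmod z < 1 -> 1 <= K -> 0 < kap <= 1 -> 0 < e <= 1 -> kap * (1 - Cmod a) <= 1 - Cmod z ->
  0 <= t -> 2 * Ceta * (2 * K + 1) ^ 2 / (cb * kap) * t < cb * kap / 2 ->
  2 * Ceta * (2 * K + 1) ^ 2 / (cb * kap) * t <= e ->
  Cmod (Fk (S n) a (phi t z) - Fk (S n) a z)%C <=
    INR (S n) * 2 ^ n * e * Cmod (Fk (S n) a z) + / K * (Cmod (Fk n a (phi t z)) + Cmod (Fk n a z)).
Proof.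
intros Hga Hz HK Hk He Hz2 Ht HB HBe. pose proof cb_pos. pose proof cb_le. pose proof Ceta_pos.
pose proof Hga as [Ha _]. pose proof (amp_pos a Ha) as HA.
set (w := phi t z). assert (Hw : Cmod w < 1) by (apply phi_in; auto).
set (u := kf a z). set (v := kf a w).
assert (HKi : 0 < / K) by (apply Rinv_0_lt_compat; lra).
assert (Hn : 0 <= INR (S n) * 2 ^ n * e).
{ apply Rmult_le_pos; [|lra]. apply Rmult_le_pos; [apply pos_INR|apply pow_le; lra]. }
rewrite !Fk_mod by auto. fold u v.
replace (Fk (S n) a w - Fk (S n) a z)%C with (RtoC (amp a) * (Cpow v (S n) - Cpow u (S n)))%C by (unfold Fk; fold u v; ring).
rewrite Cmod_mult, Cmod_R, Rabs_pos_eq by lra.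
replace (INR (S n) * 2 ^ n * e * (amp a * Cmod u ^ S n) + / K * (amp a * Cmod v ^ n + amp a * Cmod u ^ n))
  with (amp a * (INR (S n) * 2 ^ n * e * Cmod u ^ S n + / K * (Cmod v ^ n + Cmod u ^ n))) by ring.
apply Rmult_le_compat_l; [lra|].
assert (Un : 0 <= Cmod u ^ n) by (apply pow_le, Cmod_ge_0). assert (Vn : 0 <= Cmod v ^ n) by (apply pow_le, Cmod_ge_0).
set (d := 1 - Cmod a) in *. assert (Hd : 0 < d) by (unfold d; lra).
assert (Hfar : forall x, Cmod x < 1 -> K * d <= Cmod (1 - Cconj a * x)%C -> Cmod (kf a x) <= / K).
{ intros x Hx HKd. rewrite kf_mod by auto. fold d. set (D := Cmod (1 - Cconj a * x)%C) in *.
  assert (0 < D) by nra. apply Rmult_le_reg_r with (K * D); [apply Rmult_lt_0_compat; lra|].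
  replace (d / D * (K * D)) with (K * d) by (field; lra). replace (/ K * (K * D)) with D by (field; lra). auto. }
destruct (Rle_lt_dec (2 * K * d) (Cmod (1 - Cconj a * z)%C)) as [Lf|Ln].
- assert (Hv : Cmod v <= / K) by (apply Hfar; auto; apply (kernel_far a z K kap t); auto).
  assert (Hu : Cmod u <= / K) by (apply Hfar; auto; nra).
  eapply Rle_trans; [apply Cmod_minus_le|]. rewrite !Cmod_pow. simpl pow.
  assert (Cmod v * Cmod v ^ n <= / K * Cmod v ^ n) by (apply Rmult_le_compat_r; auto).
  assert (Cmod u * Cmod u ^ n <= / K * Cmod u ^ n) by (apply Rmult_le_compat_r; auto).
  assert (0 <= INR (S n) * 2 ^ n * e * (Cmod u * Cmod u ^ n)).
  { apply Rmult_le_pos; auto. apply Rmult_le_pos; auto using Cmod_ge_0. }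
  lra.
- assert (Hck : 0 < cb * kap <= 1) by (split; [apply Rmult_lt_0_compat; lra|nra]).
  assert (Hck2 : cb * kap * d <= 1 - Cmod z).
  { eapply Rle_trans; [|exact Hz2]. apply Rmult_le_compat_r; [lra|]. nra. }
  pose proof (kernel_near a z (2 * K) (cb * kap) t Hga Hz ltac:(lra) Hck ltac:(fold d; lra) Hck2 Ht HB) as KN. fold d w in KN.
  assert (Hwz : Cmod (w - z)%C <= e * d).
  { eapply Rle_trans; [exact KN|]. apply Rmult_le_compat_r; lra. }
  (* The difference of two kernels contains their product, so smallness of w - z against 1 - |a|
     becomes a relative estimate. *)
  assert (Euv : (v - u)%C = (u * v * (Cconj a * (w - z)) / RtoC d)%C).
  { unfold u, v, kf. fold d. field. repeat split; try (apply kden_neq0; auto). intros Q. apply RtoC_inj in Q. lra. }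
  assert (Huv : Cmod (v - u)%C <= e * (Cmod u * Cmod v)).
  { rewrite Euv. rewrite Cmod_div_R by auto. rewrite !Cmod_mult, Cmod_conj.
    apply Rmult_le_reg_r with d; auto. unfold Rdiv. rewrite Rmult_assoc, Rinv_l, Rmult_1_r by lra.
    pose proof (Cmod_ge_0 u). pose proof (Cmod_ge_0 v). pose proof (Cmod_ge_0 (w - z)%C). pose proof (Cmod_ge_0 a).
    replace (e * (Cmod u * Cmod v) * d) with (Cmod u * Cmod v * (e * d)) by ring.
    apply Rmult_le_compat_l; [apply Rmult_le_pos; auto|]. nra. }
  assert (Hu1 : Cmod u <= 1) by (apply kf_bounds; auto). assert (Hv1 : Cmod v <= 1) by (apply kf_bounds; auto).
  pose proof (Cmod_ge_0 u) as Gu. pose proof (Cmod_ge_0 v) as Gv.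
  assert (Huv2 : Cmod (v - u)%C <= e * Cmod u).
  { eapply Rle_trans; [exact Huv|]. apply Rmult_le_compat_l; [lra|]. nra. }
  assert (Hv2 : Cmod v <= 2 * Cmod u).
  { replace v with ((v - u) + u)%C by ring. eapply Rle_trans; [apply Cmod_triangle|]. nra. }
  eapply Rle_trans; [apply (Cpow_diff u v (2 * Cmod u) n); lra|].
  assert (H2n : 0 <= INR (S n) * (2 * Cmod u) ^ n).
  { apply Rmult_le_pos; [apply pos_INR|apply pow_le; lra]. }
  apply Rle_trans with (INR (S n) * (2 * Cmod u) ^ n * (e * Cmod u)); [apply Rmult_le_compat_l; auto|].
  rewrite Rpow_mult_distr. simpl pow.
  assert (0 <= / K * (Cmod v ^ n + Cmod u ^ n)) by (apply Rmult_le_pos; lra).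
  replace (INR (S n) * (2 ^ n * Cmod u ^ n) * (e * Cmod u)) with (INR (S n) * 2 ^ n * e * (Cmod u * Cmod u ^ n)) by ring. lra.
Qed.

Lemma rpow_small x y e : 0 < y -> 0 < e -> x <= rpow e (/ y) -> rpow x y <= e.
Proof.
intros Hy He H. rewrite <- (rpow_inv_r e y) by lra. apply rpow_le; auto.
Qed.

Lemma Fk_uniform_sc n : (N0 + M <= n)%nat -> forall e, 0 < e -> exists t0, 0 < t0 /\ forall a t r, good a -> 0 < t < t0 -> 0 <= r < 1 ->
  rpow (1 - r) al * Mp p r (fun z => Fk (S n) a (phi t z) - Fk (S n) a z)%C <= e.
Proof.
intros Hn e He. pose proof (Kp_ge1 p Hp) as HK. pose proof (CL_pos p) as HC. pose proof cb_pos. pose proof cb_le. pose proof Ceta_pos.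
assert (Hk0 : 0 < k0) by (unfold k0; lra). assert (Hka : 0 < rpow k0 al) by (apply rpow_gt0; auto).
assert (HCk : 0 < CL p / rpow k0 al) by (apply Rdiv_lt_0_compat; auto).
set (q := e / (Kp p * (CL p + 1))). assert (Hq : 0 < q) by (apply Rdiv_lt_0_compat; [auto|apply Rmult_lt_0_compat; lra]).
(* Separates the radii: for 1 - r < kap (1 - |a|) the weight is at most q times (1 - |a|)^al and
   [Fk_crude] suffices; otherwise [Fk_diff] applies. *)
set (kap := Rmin 1 (rpow q (/ al))). assert (Hkap : 0 < kap <= 1).
{ split; [apply Rmin_pos; [lra|apply rpow_gt0; auto]|apply Rmin_l]. }
(* Large enough that the traded factor 1/K brings the kernel terms below e/2. *)
set (K := 1 + 2 * (Kp p * Kp p * (CL p / rpow k0 al + 1)) / e).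
assert (HKK : 0 < Kp p * Kp p * (CL p / rpow k0 al + 1)).
{ apply Rmult_lt_0_compat; [apply Rmult_lt_0_compat|]; lra. }
assert (HK1 : 1 <= K).
{ unfold K. assert (0 < 2 * (Kp p * Kp p * (CL p / rpow k0 al + 1)) / e) by (apply Rdiv_lt_0_compat; lra). lra. }
assert (Hn2 : 0 < INR (S n) * 2 ^ n) by (apply Rmult_lt_0_compat; [apply lt_0_INR; lia|apply pow_lt; lra]).
set (e1 := Rmin 1 (e / (2 * (Kp p * (INR (S n) * 2 ^ n))))).
assert (He1 : 0 < e1 <= 1).
{ split; [apply Rmin_pos; [lra|]|apply Rmin_l]. apply Rdiv_lt_0_compat; auto. apply Rmult_lt_0_compat; [lra|]. apply Rmult_lt_0_compat; lra. }
set (B := 2 * Ceta * (2 * K + 1) ^ 2 / (cb * kap)).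
assert (Hck : 0 < cb * kap) by (apply Rmult_lt_0_compat; lra).
assert (HB : 0 < B).
{ unfold B. apply Rdiv_lt_0_compat; auto. apply Rmult_lt_0_compat; [lra|apply pow_lt; lra]. }
exists (Rmin (cb * kap / 2) e1 / B). split; [apply Rdiv_lt_0_compat; auto; apply Rmin_pos; lra|].
intros a t r Hga Ht Hr. pose proof Hga as [Ha _].
assert (HBt : B * t < Rmin (cb * kap / 2) e1).
{ destruct Ht as [_ Ht]. apply (Rmult_lt_compat_l B) in Ht; auto.
  replace (B * (Rmin (cb * kap / 2) e1 / B)) with (Rmin (cb * kap / 2) e1) in Ht by (field; lra). auto. }
assert (HBt1 : B * t < cb * kap / 2) by (eapply Rlt_le_trans; [exact HBt|apply Rmin_l]).
assert (HBt2 : B * t <= e1) by (left; eapply Rlt_le_trans; [exact HBt|apply Rmin_r]).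
set (w := rpow (1 - r) al). assert (Hw : 0 < w) by (apply rpow_gt0; lra).
set (d := 1 - Cmod a) in *. assert (Hd : 0 < d) by (unfold d; lra).
assert (HhS : holoD (Fk (S n) a)) by (apply Fk_hol; auto). assert (Hhn : holoD (Fk n a)) by (apply Fk_hol; auto).
assert (HhSp : holoD (fun z => Fk (S n) a (phi t z))) by (apply holoD_phi; auto; lra).
assert (Hhnp : holoD (fun z => Fk n a (phi t z))) by (apply holoD_phi; auto; lra).
destruct (Rle_lt_dec (kap * d) (1 - r)) as [Lb|Lb].
- set (c1 := INR (S n) * 2 ^ n * e1). assert (Hc1 : 0 < c1) by (apply Rmult_lt_0_compat; lra).
  assert (HKi : 0 < / K) by (apply Rinv_0_lt_compat; lra).
  set (u1 := fun s => Cmod (Fk n a (phi t (polar r s)))). set (u2 := fun s => Cmod (Fk n a (polar r s))).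
  set (u3 := fun s => Cmod (Fk (S n) a (polar r s))).
  assert (U1 : circ u1) by (apply (circ_hol (fun z => Fk n a (phi t z))); auto).
  assert (U2 : circ u2) by (apply circ_hol; auto). assert (U3 : circ u3) by (apply circ_hol; auto).
  assert (U12 : circ (fun s => u1 s + u2 s)) by (apply circ_plus; auto).
  assert (L1 : Mp p r (fun z => Fk (S n) a (phi t z) - Fk (S n) a z)%C <=
     Kp p * (Lp p (fun s => c1 * u3 s) + Lp p (fun s => / K * (u1 s + u2 s)))).
  { rewrite Mp_Lp. apply Lp_plus_le; auto.
    - apply circ_scal; auto; lra.
    - apply (circ_scal (/ K) (fun s => u1 s + u2 s)); auto; lra.
    - apply (circ_hol (fun z => Fk (S n) a (phi t z) - Fk (S n) a z)%C); auto. apply holoD_minus; auto.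
    - intros s. assert (Hz : Cmod (polar r s) = r) by (apply Cmod_polar; lra).
      apply (Fk_diff n a (polar r s) t K kap e1); auto; try lra. fold d. rewrite Hz. lra. }
  rewrite Lp_scal in L1 by (auto; lra). rewrite (Lp_scal p (/ K) (fun s => u1 s + u2 s)) in L1 by (auto; lra).
  pose proof (Lp_plus p u1 u2 Hp U1 U2) as L2.
  pose proof (Fk_norm (S n) a r ltac:(lia) Ha Hr) as N1. pose proof (Fk_norm n a r Hn Ha Hr) as N2.
  pose proof (Fk_phi_norm n a r t Hn Ha Hr ltac:(lra)) as N3. rewrite Mp_Lp in N1, N2, N3. fold w in N1, N2, N3.
  fold u3 in N1. fold u2 in N2. fold u1 in N3.
  set (l1 := Lp p u1) in *. set (l2 := Lp p u2) in *. set (l3 := Lp p u3) in *.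
  set (l12 := Lp p (fun s => u1 s + u2 s)) in *.
  assert (B1 : Kp p * (c1 * (w * l3)) <= e / 2).
  { apply Rle_trans with (Kp p * (INR (S n) * 2 ^ n * (e / (2 * (Kp p * (INR (S n) * 2 ^ n))))) * 1).
    - rewrite Rmult_assoc. apply Rmult_le_compat_l; [lra|]. apply Rmult_le_compat; try lra.
      + apply Rmult_le_pos; [lra|]. apply Lp_ge0; auto.
      + unfold c1. apply Rmult_le_compat_l; [lra|apply Rmin_r].
    - set (Q := INR (S n) * 2 ^ n) in *. apply Req_le. field. lra. }
  assert (B2 : Kp p * (/ K * (w * l12)) <= e / 2).
  { apply Rle_trans with (/ K * (Kp p * Kp p * (CL p / rpow k0 al + 1))).
    - replace (Kp p * (/ K * (w * l12))) with (/ K * (Kp p * (w * l12))) by ring.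
      apply Rmult_le_compat_l; [lra|]. rewrite (Rmult_assoc (Kp p)). apply Rmult_le_compat_l; [lra|].
      apply Rle_trans with (w * (Kp p * (l1 + l2))); [apply Rmult_le_compat_l; lra|].
      replace (w * (Kp p * (l1 + l2))) with (Kp p * (w * l1 + w * l2)) by ring. apply Rmult_le_compat_l; lra.
    - apply Rmult_le_reg_l with K; [lra|]. rewrite <- Rmult_assoc, Rinv_r, Rmult_1_l by lra.
      unfold K. set (Q := Kp p * Kp p * (CL p / rpow k0 al + 1)) in *.
      replace ((1 + 2 * Q / e) * (e / 2)) with (e / 2 + Q) by (field; lra). lra. }
  apply (Rmult_le_compat_l w) in L1; [|lra]. eapply Rle_trans; [exact L1|].
  replace (w * (Kp p * (c1 * l3 + / K * l12))) with (Kp p * (c1 * (w * l3)) + Kp p * (/ K * (w * l12))) by ring. lra.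
- pose proof (Mp_minus p r (fun z => Fk (S n) a (phi t z)) (Fk (S n) a) Hp HhSp HhS Hr) as M1.
  pose proof (Mp_phi p (Fk (S n) a) t r Hp HhS ltac:(lra) Hr) as M2. destruct (rad_bounds r Hr) as [R1 _].
  pose proof (Fk_crude (S n) a r ltac:(lia) Ha Hr) as C1'. pose proof (Fk_crude (S n) a (rad r) ltac:(lia) Ha ltac:(lra)) as C2'.
  fold d in C1', C2'. set (wd := rpow d al) in *. assert (Hwd : 0 < wd) by (apply rpow_gt0; lra).
  assert (Hww : w <= q * wd).
  { apply Rle_trans with (rpow (kap * d) al); [apply rpow_le; auto; lra|]. rewrite rpow_mult by lra. fold wd.
    apply Rmult_le_compat_r; [lra|]. apply rpow_small; auto. apply Rmin_r. }
  assert (M3 : Mp p r (fun z => Fk (S n) a (phi t z) - Fk (S n) a z)%C <= Kp p * (CL p + 1) / wd).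
  { eapply Rle_trans; [exact M1|]. unfold Rdiv. rewrite Rmult_assoc. apply Rmult_le_compat_l; [lra|].
    apply (Rmult_le_compat_l (CL p)) in C2'; lra. }
  apply Rle_trans with (q * wd * (Kp p * (CL p + 1) / wd)).
  + apply Rmult_le_compat; auto; try lra. apply Mp_ge0; auto. apply holoD_minus; auto.
  + apply Req_le. unfold q. field. lra.
Qed.

End Kernel.

(** The exponent 1/p, with value 0 for p infinite, which turns [dp] into a single power. *)
Definition inv_exp (p : Rbar) : R := match p with Finite q => / q | _ => 0 end.

Lemma dp_rpow p x : 0 < x -> dp p x = rpow x (inv_exp p).
Proof. intros Hx. destruct p; simpl; auto; rewrite rpow_pos, Rpower_O; auto. Qed.

(** On |z| <= s the kernel is O(1 - |a|), so amplitude times N-th power is O((1 - |a|)^g) with g = N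
    - al - 1/p > 0. *)
Lemma Fk_late p al N s e : 0 < al -> al + inv_exp p < INR N -> 0 <= s < 1 -> 0 < e ->
  exists d0, 0 < d0 /\ forall a, Cmod a < 1 -> 1 - Cmod a < d0 -> forall z, Cmod z <= s -> Cmod (Fk p al N a z) <= e.
Proof.
intros Hal HN Hs He. set (g := INR N - (al + inv_exp p)). assert (Hg : 0 < g) by (unfold g; lra).
assert (HsN : 0 < (1 - s) ^ N) by (apply pow_lt; lra).
assert (HE : 0 < e * (1 - s) ^ N) by (apply Rmult_lt_0_compat; auto).
exists (rpow (e * (1 - s) ^ N) (/ g)). split; [apply rpow_gt0; auto|]. intros a Ha Hd z Hz.
set (d := 1 - Cmod a) in *. assert (Hd0 : 0 < d) by (unfold d; lra).
rewrite Fk_mod by auto. destruct (kf_bounds a z Ha ltac:(lra)) as [_ K2]. fold d in K2.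
set (k := Cmod (kf a z)) in *. assert (Hk : 0 <= k) by apply Cmod_ge_0.
assert (Hk2 : k * (1 - s) <= d) by nra.
assert (Hk3 : k ^ N * (1 - s) ^ N <= d ^ N).
{ rewrite <- Rpow_mult_distr. apply pow_incr. split; auto. apply Rmult_le_pos; lra. }
pose proof (amp_pos p al a Ha) as HA.
assert (E : amp p al a * d ^ N = rpow d g).
{ unfold amp. fold d. rewrite dp_rpow, <- rpow_plus by auto. rewrite <- Rpower_pow, <- rpow_pos by auto.
  assert (0 < rpow d (al + inv_exp p)) by (apply rpow_gt0; auto).
  apply Rmult_eq_reg_l with (rpow d (al + inv_exp p)); [|lra]. rewrite <- rpow_plus by auto.
  replace (al + inv_exp p + g) with (INR N) by (unfold g; ring). field. lra. }
assert (S1 : rpow d g <= e * (1 - s) ^ N) by (apply rpow_small; auto; lra).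
apply Rmult_le_reg_r with ((1 - s) ^ N); auto. eapply Rle_trans; [|exact S1]. rewrite <- E, Rmult_assoc.
apply Rmult_le_compat_l; lra.
Qed.

Lemma amp_le p al a a' : Rbar_lt 0 p -> 0 < al -> Cmod a <= Cmod a' -> Cmod a' < 1 -> amp p al a <= amp p al a'.
Proof.
intros Hp Hal H Ha. unfold amp.
assert (0 < rpow (1 - Cmod a') al) by (apply rpow_gt0; lra). assert (0 < dp p (1 - Cmod a')) by (apply dp_pos; lra).
apply Rinv_le_contravar; [apply Rmult_lt_0_compat; auto|]. apply Rmult_le_compat; try lra.
- apply rpow_le; lra.
- destruct p; simpl; try lra. apply rpow_le; [apply Rinv_0_lt_compat; auto|lra].
Qed.

Lemma exists_exponent (p : Rbar) : Rbar_lt 0 p ->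
  exists n : nat, match p with Finite q => 2 < INR n * q | _ => True end /\ inv_exp p <= INR n.
Proof.
intros Hp. destruct p as [q| |]; simpl in Hp; [| |contradiction].
- destruct (INR_unbounded (2 / q)) as [n Hn]. exists n. apply (Rmult_lt_compat_r q) in Hn; auto.
  replace (2 / q * q) with 2 in Hn by (field; lra). split; auto. simpl.
  apply Rmult_le_reg_r with q; auto. rewrite Rinv_l; lra.
- exists 0%nat. simpl. split; auto; lra.
Qed.

Lemma hump_family p al eta : Rbar_lt 0 p -> 0 < al -> 0 < eta ->
  (forall r0, 0 <= r0 < 1 -> exists a, r0 < Cmod a < 1 /\ eta <= xw a) ->
  contains_closed_linf p al (strong_cont p al phi) /\ exists g, strong_cont p al phi g /\ ~ H0 p al g.
Proof.
intros Hp Hal Heta Hbad. pose proof (Kp_ge1 p Hp) as HK. pose proof cb_pos. pose proof cb_le.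
destruct (exists_exponent p Hp) as [N0 [HN0 HN1]]. destruct (INR_unbounded al) as [M HM].
(* [N0] for integrability, [M] for the weight, and one factor for the trade in [Fk_diff]. *)
set (N := S (N0 + M)).
assert (HN : al + inv_exp p < INR N) by (unfold N; rewrite S_INR, plus_INR; lra).
set (cl := rpow (/ 2) al * dp p (/ 4) * (/ 2) ^ N).
assert (Hcl : 0 < cl).
{ unfold cl. apply Rmult_lt_0_compat; [apply Rmult_lt_0_compat; [apply rpow_gt0|apply dp_pos]; lra|apply pow_lt; lra]. }
set (e0 := cl / (8 * Kp p)). assert (He0 : 0 < e0) by (apply Rdiv_lt_0_compat; lra).
(* A state is a kernel point a with the inner radius of its annulus. [P] asks in particular that the
   hump be negligible on the disc that the flow can reach from within that radius. [Q] starts the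
   next annulus beyond the peak radius (1 + |a|)/2 and so near the circle that the weight kills the
   current hump. *)
set (P := fun (n : nat) (s : C * R) => good eta (fst s) /\ 0 <= snd s < 1 /\ (n = 0%nat -> snd s = 0) /\ 1 - snd s <= (/ 2) ^ n /\
   snd s <= Cmod (fst s) /\ forall z, Cmod z <= 1 - cb * (1 - snd s) -> Cmod (Fk p al N (fst s) z) <= e0 * ((/ 2) ^ n * (/ 2) ^ n)).
set (Q := fun (n : nat) (s s' : C * R) => (1 + Cmod (fst s)) / 2 < snd s' /\
   rpow (1 - snd s') al * amp p al (fst s) <= e0 * ((/ 2) ^ S n * (/ 2) ^ S n)).
assert (Hnext : forall n rho, 0 <= rho < 1 -> (n = 0%nat -> rho = 0) -> 1 - rho <= (/ 2) ^ n -> exists a, P n (a, rho)).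
{ intros n rho Hrho Hn0 Hrn. pose proof (half_pow_bounds n).
  destruct (Fk_late p al N (1 - cb * (1 - rho)) (e0 * ((/ 2) ^ n * (/ 2) ^ n)) Hal HN) as [d0 [Hd0 Hlate]].
  - nra.
  - apply Rmult_lt_0_compat; auto. apply Rmult_lt_0_compat; lra.
  - destruct (Hbad (Rmax rho (1 - d0))) as [a [Ha Hxa]].
    + split; [eapply Rle_trans; [|apply Rmax_l]; lra|apply Rmax_lub_lt; lra].
    + pose proof (Rmax_l rho (1 - d0)). pose proof (Rmax_r rho (1 - d0)).
      exists a. unfold P, good; simpl. repeat split; auto; try lra. apply Hlate; lra. }
destruct (dependent_choice P Q) as [s Hs].
{ destruct (Hnext 0%nat 0) as [a Ha]; auto; [lra|simpl; lra|]. exists (a, 0). auto. }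
{ intros n [a rho] [Hga [Hrho _]]. simpl in Hga, Hrho. pose proof Hga as [Ha _].
  pose proof (amp_pos p al a Ha) as HA. pose proof (half_pow_bounds (S n)).
  set (y := e0 * ((/ 2) ^ S n * (/ 2) ^ S n)).
  assert (Hy : 0 < y) by (apply Rmult_lt_0_compat; auto; apply Rmult_lt_0_compat; lra).
  assert (Hya : 0 < y / amp p al a) by (apply Rdiv_lt_0_compat; auto).
  (* The three bounds give convergence of the radii to 1, a start beyond the peak of the current
     hump, and smallness of the weight against its amplitude. *)
  set (x := Rmin ((/ 2) ^ S n) (Rmin ((1 - Cmod a) / 4) (rpow (y / amp p al a) (/ al)))).
  assert (Hx : 0 < x) by (apply Rmin_pos; [lra|]; apply Rmin_pos; [lra|apply rpow_gt0; auto]).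
  assert (X1 : x <= (/ 2) ^ S n) by apply Rmin_l.
  assert (X2 : x <= (1 - Cmod a) / 4) by (eapply Rle_trans; [apply Rmin_r|apply Rmin_l]).
  assert (X3 : x <= rpow (y / amp p al a) (/ al)) by (eapply Rle_trans; [apply Rmin_r|apply Rmin_r]).
  destruct (Hnext (S n) (1 - x)) as [a' Ha']; [lra|discriminate|lra|].
  exists (a', 1 - x). split; auto. unfold Q; simpl fst; simpl snd. split; [lra|]. fold y.
  replace (1 - (1 - x)) with x by ring.
  apply Rle_trans with (y / amp p al a * amp p al a); [|apply Req_le; field; lra].
  apply Rmult_le_compat_r; [lra|]. apply rpow_small; auto. }
set (a := fun n => fst (s n)). set (rho := fun n => snd (s n)).
assert (Pa : forall n, good eta (a n)) by (intros n; apply (Hs n)).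
assert (Pa1 : forall n, Cmod (a n) < 1) by (intros n; apply (Pa n)).
assert (Pr : forall n, 0 <= rho n < 1) by (intros n; apply (Hs n)).
assert (Pra : forall n, rho n <= Cmod (a n)) by (intros n; apply (Hs n)).
assert (Pq : forall n, (1 + Cmod (a n)) / 2 < rho (S n)) by (intros n; apply (Hs n)).
assert (Hmono : forall m n, (m <= n)%nat -> Cmod (a m) <= Cmod (a n)).
{ intros m n H1. induction H1; [lra|]. eapply Rle_trans; [exact IHle|]. pose proof (Pq m0). pose proof (Pra (S m0)).
  pose proof (Pa1 m0). lra. }
set (f := fun n => Fk p al N (a n)). set (ra := fun n => (1 + Cmod (a n)) / 2).
assert (A1 : forall n, holoD (f n)) by (intros n; apply Fk_hol; auto).
assert (A2 : rho 0%nat = 0) by (apply (Hs 0%nat); auto).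
assert (A3 : forall n, rho n <= rho (S n)).
{ intros n. pose proof (Pq n). pose proof (Pra n). pose proof (Pa1 n). lra. }
assert (A4 : forall n, 1 - rho n <= (/ 2) ^ n) by (intros n; apply (Hs n)).
assert (A5 : 8 * Kp p * e0 <= cl) by (apply Req_le; unfold e0; field; lra).
(* [Q] controls only hump m - 1 on annulus m; older humps have smaller amplitude because |a n|
   increases. *)
assert (A6 : forall n m z, (n < m)%nat -> Cmod z < 1 -> rpow (1 - rho m) al * Cmod (f n z) <= e0 * ((/ 2) ^ m * (/ 2) ^ n)).
{ intros n m z Hnm Hz. destruct m as [|m]; [lia|]. destruct (Hs m) as [_ [_ Hq]]. fold (a m) (rho (S m)) in Hq.
  pose proof (half_pow_bounds (S m)).
  apply Rle_trans with (e0 * ((/ 2) ^ S m * (/ 2) ^ S m)).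
  - eapply Rle_trans; [|exact Hq]. apply Rmult_le_compat_l; [apply rpow_ge0|].
    unfold f. rewrite Fk_mod by auto. pose proof (amp_pos p al (a n) (Pa1 n)).
    pose proof (amp_le p al (a n) (a m) Hp Hal (Hmono n m ltac:(lia)) (Pa1 m)).
    assert (Cmod (kf (a n) z) ^ N <= 1).
    { rewrite <- (pow1 N). apply pow_incr. split; [apply Cmod_ge_0|apply kf_bounds; auto]. }
    assert (0 <= Cmod (kf (a n) z) ^ N) by (apply pow_le, Cmod_ge_0). nra.
  - apply Rmult_le_compat_l; [lra|]. apply Rmult_le_compat_l; [lra|]. apply half_pow_decr. lia. }
assert (A7 : forall n z, Cmod z <= 1 - cb * (1 - rho n) -> Cmod (f n z) <= e0 * ((/ 2) ^ n * (/ 2) ^ n)).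
{ intros n. apply (Hs n). }
assert (A8 : forall n r, 0 <= r < 1 -> rpow (1 - r) al * Mp p r (f n) <= 1).
{ intros n r Hr. apply (Fk_norm p al N0 M); auto; [lra|unfold N; lia]. }
assert (A9 : forall n, rho n <= ra n < rho (S n) /\ cl <= rpow (1 - ra n) al * Mp p (ra n) (f n)).
{ intros n. split.
  - pose proof (Pq n). pose proof (Pra n). pose proof (Pa1 n). unfold ra. lra.
  - apply Fk_low; auto. }
assert (A10 : forall e, 0 < e -> exists t0, 0 < t0 /\ forall n t r, 0 < t < t0 -> 0 <= r < 1 ->
  rpow (1 - r) al * Mp p r (fun z => f n (phi t z) - f n z)%C <= e).
{ intros e He. destruct (Fk_uniform_sc p al N0 M eta Hp Hal HN0 ltac:(lra) Heta (N0 + M) (Nat.le_refl _) e He) as [t0 [Ht0 Hsc]].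
  exists t0. split; auto. intros n t r Ht Hr. apply Hsc; auto. }
assert (Pr1 : forall n, rho n < 1) by (intros n; apply Pr).
split.
- apply (hump_embedding p al f rho ra 1 cl e0); auto; lra.
- exists (hump_sum f (fun _ => 1%C)). split.
  + apply (hump_strong_cont p al f rho 1 e0) with (X := 1); auto; try lra. intros n. rewrite Cmod_1. lra.
  + apply (hump_not_H0 p al f rho ra cl e0); auto; lra.
Qed.

(** * Little Bloch characterization *)

Lemma little_Bloch_xw : little_Bloch gamma ->
  forall e, 0 < e -> exists r0, 0 <= r0 < 1 /\ forall w, r0 < Cmod w < 1 -> xw w < e.
Proof.
intros [_ H] e He. destruct (H e He) as [r0 [Hr0 Hl]]. exists r0. split; auto. intros w Hw.
apply (Hl w (dg w) Hw). apply (holoD_cdiff gamma); [apply gamma_hol|lra].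
Qed.

Lemma not_little_Bloch_xw : ~ little_Bloch gamma ->
  exists eta, 0 < eta /\ forall r0, 0 <= r0 < 1 -> exists a, r0 < Cmod a < 1 /\ eta <= xw a.
Proof.
intros H. apply NNPP. intros Hn. apply H. split; [apply gamma_hol|]. intros e He. apply NNPP. intros Hr. apply Hn.
exists e. split; auto. intros r0 Hr0. apply NNPP. intros Ha. apply Hr. exists r0. split; auto. intros z l Hz Hl.
apply Rnot_le_lt. intros Hle. apply Ha. exists z. split; auto.
unfold xw. replace (dg z) with l; auto. apply (cdiff_unique gamma z); auto.
apply holoD_cdiff; [apply gamma_hol|lra].
Qed.

Lemma H0_iff_strong_cont p al : Rbar_lt 0 p -> 0 < al ->
  ((forall f, H0 p al f <-> strong_cont p al phi f) <-> little_Bloch gamma).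
Proof.
intros Hp Hal. split.
- intros H. apply NNPP. intros Hn. destruct (not_little_Bloch_xw Hn) as [eta [Heta Hbad]].
  destruct (hump_family p al eta Hp Hal Heta Hbad) as [_ [g [Hg1 Hg2]]]. apply Hg2, H; auto.
- intros HB f. split; [apply H0_strong_cont; auto|]. pose proof (little_Bloch_xw HB) as HX.
  destruct p as [q| |]; [| |contradiction].
  + apply strong_cont_H0_fin; auto.
  + apply strong_cont_H0_inf; auto.
Qed.

Lemma linf_in_strong_cont p al : Rbar_lt 0 p -> 0 < al -> ~ little_Bloch gamma ->
  contains_closed_linf p al (strong_cont p al phi).
Proof.
intros Hp Hal Hn. destruct (not_little_Bloch_xw Hn) as [eta [Heta Hbad]].
apply (hump_family p al eta Hp Hal Heta Hbad).
Qed.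

End Semigroup.

Theorem theorem6p4 (p : Rbar) (alpha : R) (phi : R -> C -> C) (b : C)
    (G gamma : C -> C) :
  Rbar_lt (Finite 0) p -> 0 < alpha ->
  semigroup phi -> nontrivial phi -> DW_point_in_D phi b ->
  generator phi G -> g_symbol b G gamma ->
  ((forall f, H0 p alpha f <-> strong_cont p alpha phi f) <-> little_Bloch gamma) /\
  (~ little_Bloch gamma -> contains_closed_linf p alpha (strong_cont p alpha phi)).
Proof.
intros Hp Hal Hsg Hnt Hdw Hgen Hgs. split.
- apply (H0_iff_strong_cont phi b G gamma); auto.
- apply (linf_in_strong_cont phi b G gamma); auto.
Qed.
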